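(* Let $R$ be a commutative ring, $A$ a commutative $R$-algebra and $\mathcal X$ a quasi-compact fibered category over $R$ such that $\mathrm{QCoh}_{\mathrm{fp}}(\mathcal X)$ generates $\mathrm{QCoh}(\mathcal X)$. Then $\mathrm{Lex}_R(\mathrm{QCoh}_{\mathrm{fp}}(\mathcal X),A)$ is the category of contravariant, $R$-linear functors $\mathrm{QCoh}_{\mathrm{fp}}(\mathcal X)\to\mathrm{Mod}\,A$ which are left exact on right exact sequences (i.e. send every right exact sequence $\mathcal E''\to\mathcal E'\to\mathcal E\to0$ in $\mathrm{QCoh}_{\mathrm{fp}}(\mathcal X)$ to an exact sequence $0\to\Gamma_{\mathcal E}\to\Gamma_{\mathcal E'}\to\Gamma_{\mathcal E''}$). Moreover the functors $$\Omega^{*}\colon\mathrm{QCoh}_A(\mathcal X)\to\mathrm{Lex}_R(\mathrm{QCoh}_{\mathrm{fp}}(\mathcal X),A),\qquad \mathcal F_{*,\mathrm{QCoh}_{\mathrm{fp}}(\mathcal X)}\colon\mathrm{Lex}_R(\mathrm{QCoh}_{\mathrm{fp}}(\mathcal X),A)\to\mathrm{QCoh}_A(\mathcal X)$$ are quasi-inverses of each other.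
   Context: A fibered category over $R$ is a category fibered in groupoids $\mathcal X\to\mathrm{Aff}/R$ over the category of affine $R$-schemes; its objects over $\operatorname{Spec}B$ are identified with maps $\operatorname{Spec}B\to\mathcal X$. A quasi-coherent sheaf $\mathcal F$ on $\mathcal X$ consists of a $B$-module $\mathcal F(\xi)$ for every object $\xi\colon\operatorname{Spec}B\to\mathcal X$ and, functorially, for every morphism $\xi\to\eta$ of $\mathcal X$ lying over $\operatorname{Spec}B\to\operatorname{Spec}B'$, a $B'$-linear map $\mathcal F(\eta)\to\mathcal F(\xi)$ such that the induced map $\mathcal F(\eta)\otimes_{B'}B\to\mathcal F(\xi)$ is an isomorphism. $\mathrm{QCoh}(\mathcal X)$ is the category of these, and $\mathrm{QCoh}_{\mathrm{fp}}(\mathcal X)$ the full subcategory of those of finite presentation (every $\mathcal F(\xi)$ is a finitely presented $B$-module). An fpqc atlas of $\mathcal X$ is a map $X\to\mathcal X$ from a scheme which is representable (every base change along a map $T\to\mathcal X$ from an affine scheme is an algebraic space) and an fpqc covering. $\mathcal X$ is quasi-compact if it has an fpqc atlas from an affine scheme; then $\mathrm{QCoh}(\mathcal X)$ is an $R$-linear abelian category (a sequence $\mathcal F\to\mathcal G\to\mathcal H\to0$ is exact iff it is exact after evaluation on every object). Exact sequences of sheaves in a subcategory are always meant to be exact in $\mathrm{QCoh}(\mathcal X)$. A subcategory generates $\mathrm{QCoh}(\mathcal X)$ if every quasi-coherent sheaf on $\mathcal X$ is a quotient of a (possibly infinite) direct sum of sheaves in it. $\mathrm{QCoh}_A(\mathcal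 X)$ is the category of quasi-coherent sheaves $\mathcal F$ on $\mathcal X$ together with an $R$-algebra map $A\to\mathrm{End}_{\mathcal X}(\mathcal F)$ (equivalent to $\mathrm{QCoh}(\mathcal X\times_R\operatorname{Spec}A)$). For a full subcategory $\mathcal D\subseteq\mathrm{QCoh}(\mathcal X)$, $\mathrm{L}_R(\mathcal D,A)$ is the category of contravariant $R$-linear functors $\Gamma\colon\mathcal D\to\mathrm{Mod}\,A$ (value at $\mathcal E$ denoted $\Gamma_{\mathcal E}$); for $\mathcal F\in\mathrm{QCoh}_A(\mathcal X)$, $\Omega^{\mathcal F}=\mathrm{Hom}_{\mathcal X}(-,\mathcal F)\colon\mathcal D\to\mathrm{Mod}\,A$. If $\mathcal D$ is essentially small, $\mathcal F_{*,\mathcal D}$ denotes the left adjoint of $\Omega^*\colon\mathrm{QCoh}_A(\mathcal X)\to\mathrm{L}_R(\mathcal D,A)$ (and its restriction to $\mathrm{Lex}_R(\mathcal D,A)$). A test sequence in $\mathcal D$ is an exact sequence $\bigoplus_{k\in K}\mathcal E_k\to\bigoplus_{j\in J}\mathcal E_j\to\mathcal E\to0$ in $\mathrm{QCoh}(\mathcal X)$ with $\mathcal E,\mathcal E_j,\mathcal E_k\in\mathcal D$ and $J,K$ sets, such that every $\mathcal E_k\to\bigoplus_j\mathcal E_j$ factors through a finite subsum. With components $u_j\colon\mathcal E_j\to\mathcal E$, $u_{kj}\colon\mathcal E_k\to\mathcal E_j$, a functor $\Gamma\in\mathrm{L}_R(\mathcal D,A)$ is exact on it if $$0\to\Gamma_{\mathcal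 E}\xrightarrow{x\mapsto(\Gamma_{u_j}(x))_j}\prod_{j}\Gamma_{\mathcal E_j}\xrightarrow{(x_j)_j\mapsto(\sum_j\Gamma_{u_{kj}}(x_j))_k}\prod_k\Gamma_{\mathcal E_k}$$ is exact. $\mathrm{Lex}_R(\mathcal D,A)$ is the full subcategory of $\mathrm{L}_R(\mathcal D,A)$ of functors exact on all test sequences in $\mathcal D$. *)

(* Defs.v *)
From HB Require Import structures.
From mathcomp Require Import all_boot all_algebra.
From mathcomp Require Import boolp classical_sets functions cardinality fsbigop.

Set Implicit Arguments.
Unset Strict Implicit.
Unset Printing Implicit Defensive.

Import GRing.Theory.
Local Open Scope classical_set_scope.
Local Open Scope ring_scope.
Local Open Scope quotient_scope.

(* Size convention.  In MathComp all rings and modules have their carrier in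
   one universe u.  The rings of the site Aff/R have their carrier in a
   strictly smaller universe (the one of [carrier] below), and the fibered
   categories considered have their objects and morphisms in u.  So Aff/R is small with
   respect to the modules, and the morphisms between two quasi-coherent
   sheaves form a module of the universe u. *)

(* Commutative rings, possibly zero. *)
Record cring := CRing {
  carrier : Type;
  cring_class : GRing.ComPzRing.axioms_ carrier }.

Coercion cring_ring (B : cring) : comPzRingType :=
  GRing.ComPzRing.Pack (cring_class B).

Record calg (R : cring) := CAlg {
  calg_ring :> cring;
  calg_str : {rmorphism R -> calg_ring} }.

(* A morphism A -> B of R-algebras, i.e. a morphism Spec B -> Spec A of affine
   R-schemes: Aff/R is the opposite of the category of R-algebras. *)
Record calg_hom (R : cring) (A B : calg R) := CAlgHom {
  calg_fun :> {rmorphism A -> B};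
  calg_funP : forall r, calg_fun (calg_str A r) = calg_str B r }.

Lemma rmorphism_ext (A B : pzSemiRingType) (f g : {rmorphism A -> B}) :
  f =1 g -> f = g.
Proof.
case: f g => f [[f1] [f2] ] [g [[g1] [g2] ]] /= fg.
have efg : f = g by apply/funext.
case: g / efg g1 g2 {fg} => g1 g2.
by rewrite (Prop_irrelevance f1 g1) (Prop_irrelevance f2 g2).
Qed.

Lemma linear_ext (A : pzSemiRingType) (U : lSemiModType A) (V : nmodType)
    (s : A -> V -> V) (f g : {linear U -> V | s}) : f =1 g -> f = g.
Proof.
case: f g => f [[f1] [f2] ] [g [[g1] [g2] ]] /= fg.
have efg : f = g by apply/funext.
case: g / efg g1 g2 {fg} => g1 g2.
by rewrite (Prop_irrelevance f1 g1) (Prop_irrelevance f2 g2).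
Qed.

Section CAlg.
Variable R : cring.

Lemma calg_hom_ext (A B : calg R) (f g : calg_hom A B) : f =1 g -> f = g.
Proof.
case: f g => f fP [g gP] /= fg.
have efg : f = g by apply: rmorphism_ext.
by case: g / efg gP {fg} => gP; rewrite (Prop_irrelevance fP gP).
Qed.

Lemma calg_idP (A : calg R) r :
  (idfun : {rmorphism A -> A}) (calg_str A r) = calg_str A r.
Proof. by []. Qed.
Definition calg_id (A : calg R) : calg_hom A A := CAlgHom (@calg_idP A).

Lemma calg_compP (A B C : calg R) (g : calg_hom B C) (f : calg_hom A B) r :
  (g \o f : {rmorphism A -> C}) (calg_str A r) = calg_str C r.
Proof. by rewrite /= !calg_funP. Qed.
Definition calg_comp (A B C : calg R) (g : calg_hom B C) (f : calg_hom A B) :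
  calg_hom A C := CAlgHom (calg_compP g f).

End CAlg.

(* Extension of scalars B ⊗_A M along f : A -> B: formal sums of symbols b ⊗ m
   modulo the congruence generated by the bilinearity relations. *)
Section ExtensionOfScalars.
Variables (A B : comPzRingType) (f : {rmorphism A -> B}) (M : lmodType A).

Inductive ext_rel : seq (B * M) -> seq (B * M) -> Prop :=
| ext_refl s : ext_rel s s
| ext_sym s t : ext_rel s t -> ext_rel t s
| ext_trans s t v : ext_rel s t -> ext_rel t v -> ext_rel s v
| ext_cat s s' t t' : ext_rel s s' -> ext_rel t t' -> ext_rel (s ++ t) (s' ++ t')
| ext_catC s t : ext_rel (s ++ t) (t ++ s)
| ext_0 m : ext_rel [:: (0, m)] [::]
| ext_Dl b b' m : ext_rel [:: (b + b', m)] [:: (b, m); (b', m)]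
| ext_Dr b m m' : ext_rel [:: (b, m + m')] [:: (b, m); (b, m')]
| ext_Z b a m : ext_rel [:: (b * f a, m)] [:: (b, a *: m)].

Definition ext_relb s t := `[< ext_rel s t >].

Lemma ext_relb_refl : reflexive ext_relb.
Proof. by move=> s; apply/asboolP; apply: ext_refl. Qed.
Lemma ext_relb_sym : symmetric ext_relb.
Proof.
by move=> s t; apply/idP/idP => /asboolP h; apply/asboolP; apply: ext_sym.
Qed.
Lemma ext_relb_trans : transitive ext_relb.
Proof.
by move=> t s v /asboolP h /asboolP k; apply/asboolP; apply: ext_trans h k.
Qed.

Canonical ext_equiv :=
  EquivRel ext_relb ext_relb_refl ext_relb_sym ext_relb_trans.

Definition ext := {eq_quot ext_equiv}.
HB.instance Definition _ := Choice.on ext.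
HB.instance Definition _ := Quotient.on ext.

Definition ext_scale_seq (c : B) (s : seq (B * M)) :=
  [seq (c * p.1, p.2) | p <- s].

Lemma ext_piP s t : \pi_ext s = \pi_ext t <-> ext_rel s t.
Proof.
by split=> [/eqquotP /asboolP //|h]; apply/eqquotP; apply/asboolP.
Qed.

Lemma ext_repr s : ext_rel (repr (\pi_ext s)) s.
Proof. by apply/ext_piP; rewrite reprK. Qed.

Lemma ext_scale_rel c s t :
  ext_rel s t -> ext_rel (ext_scale_seq c s) (ext_scale_seq c t).
Proof.
elim=> {s t} [s|s t _ h|s t v _ h _ k|s s' t t' _ h _ k|s t|m|b b' m|b m m'|b a m].
- exact: ext_refl.
- exact: ext_sym.
- exact: ext_trans h k.
- by rewrite /ext_scale_seq !map_cat; exact: ext_cat.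
- by rewrite /ext_scale_seq !map_cat; exact: ext_catC.
- by rewrite /= mulr0; exact: ext_0.
- by rewrite /= mulrDr; exact: ext_Dl.
- exact: ext_Dr.
- by rewrite /= mulrA; exact: ext_Z.
Qed.

Definition ext_add (x y : ext) : ext := \pi_ext (repr x ++ repr y).
Definition ext_zero : ext := \pi_ext [::].
Definition ext_scale (c : B) (x : ext) : ext := \pi_ext (ext_scale_seq c (repr x)).
Definition ext_opp (x : ext) : ext := ext_scale (-1) x.

Lemma ext_addE s t : ext_add (\pi_ext s) (\pi_ext t) = \pi_ext (s ++ t).
Proof. by apply/ext_piP; apply: ext_cat; apply: ext_repr. Qed.

Lemma ext_scaleE c s : ext_scale c (\pi_ext s) = \pi_ext (ext_scale_seq c s).
Proof. by apply/ext_piP; apply: ext_scale_rel; apply: ext_repr. Qed.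

Lemma ext_addA : associative ext_add.
Proof.
move=> x y z; rewrite -[x]reprK -[y]reprK -[z]reprK.
rewrite (ext_addE (repr y) (repr z)) (ext_addE (repr x) (repr y)).
by rewrite (ext_addE (repr x)) (ext_addE (_ ++ _)) catA.
Qed.

Lemma ext_addC : commutative ext_add.
Proof.
move=> x y; rewrite -[x]reprK -[y]reprK !ext_addE.
by apply/ext_piP; exact: ext_catC.
Qed.

Lemma ext_add0 : left_id ext_zero ext_add.
Proof. by move=> x; rewrite -[x]reprK ext_addE. Qed.

Lemma ext_scaleDl (x : ext) (b c : B) :
  ext_scale (b + c) x = ext_add (ext_scale b x) (ext_scale c x).
Proof.
rewrite -[x]reprK !(ext_scaleE _ (repr x)) (ext_addE (ext_scale_seq _ _)).
apply/ext_piP; elim: (repr x) => [|[d m] s ih]; first exact: ext_refl.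
rewrite /= mulrDl.
have h := ext_cat (ext_Dl (b * d) (c * d) m) ih.
apply: ext_trans h _ => /=.
apply: (@ext_cat [:: _] [:: _]); first exact: ext_refl.
rewrite -!/(ext_scale_seq _ _) -cat1s catA.
rewrite -[X in ext_rel _ (_ ++ X)]cat1s catA.
by apply: ext_cat; [exact: ext_catC|exact: ext_refl].
Qed.

Lemma ext_scale0 (x : ext) : ext_scale 0 x = ext_zero.
Proof.
rewrite -[x]reprK (ext_scaleE _ (repr x)); apply/ext_piP.
elim: (repr x) => [|[d m] s ih]; first exact: ext_refl.
by rewrite /= mul0r; apply: (ext_cat (ext_0 m) ih).
Qed.

Lemma ext_scale1 : left_id 1 ext_scale.
Proof.
move=> x; rewrite -[x]reprK ext_scaleE /ext_scale_seq; congr (\pi_ext _).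
by rewrite -[RHS]map_id; apply: eq_map => -[b m] /=; rewrite mul1r.
Qed.

Lemma ext_addN : left_inverse ext_zero ext_opp ext_add.
Proof.
move=> x; rewrite -[X in ext_add _ X]ext_scale1 /ext_opp -ext_scaleDl.
by rewrite addNr ext_scale0.
Qed.

HB.instance Definition _ :=
  GRing.isZmodule.Build ext ext_addA ext_addC ext_add0 ext_addN.

Lemma ext_scaleA b c (x : ext) : ext_scale b (ext_scale c x) = ext_scale (b * c) x.
Proof.
rewrite -[x]reprK (ext_scaleE c (repr x)) (ext_scaleE _ (repr x)) (ext_scaleE b).
rewrite /ext_scale_seq -map_comp; congr (\pi_ext _).
by apply: eq_map => p /=; rewrite mulrA.
Qed.

Lemma ext_scaleDr : right_distributive ext_scale +%R.
Proof.
move=> b x y; rewrite -[x]reprK -[y]reprK /GRing.add /=.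
rewrite (ext_addE (repr x) (repr y)) (ext_scaleE b (repr x ++ repr y)).
rewrite (ext_scaleE b (repr x)) (ext_scaleE b (repr y)).
by rewrite (ext_addE (ext_scale_seq _ _)) /ext_scale_seq map_cat.
Qed.

HB.instance Definition _ :=
  GRing.Zmodule_isLmodule.Build B ext ext_scaleA ext_scale1 ext_scaleDr ext_scaleDl.

Definition ext_pure (b : B) (m : M) : ext := \pi_ext [:: (b, m)].

(* The B-linear map B ⊗_A M -> P, b ⊗ m |-> b v(m), induced by a map
   v : M -> P which is linear along f; see ext_liftE. *)
Definition ext_lift (P : lmodType B) (v : {linear M -> P | f \; *:%R}) (x : ext) : P :=
  \sum_(p <- repr x) p.1 *: v p.2.

Lemma ext_lift_rel (P : lmodType B) (v : {linear M -> P | f \; *:%R}) s t :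
  ext_rel s t -> \sum_(p <- s) p.1 *: v p.2 = \sum_(p <- t) p.1 *: v p.2.
Proof.
elim=> {s t} [//|s t _ -> //|s t w _ -> _ -> //|s s' t t' _ h _ k|s t|m|b b' m|b m m'|b a m].
- by rewrite !big_cat h k.
- by rewrite !big_cat /= addrC.
- by rewrite big_seq1 big_nil scale0r.
- by rewrite !big_cons !big_nil /= scalerDl !addr0.
- by rewrite !big_cons !big_nil /= linearD scalerDr !addr0.
- by rewrite !big_seq1 /= linearZ_LR /= scalerA.
Qed.

Lemma ext_liftE (P : lmodType B) (v : {linear M -> P | f \; *:%R}) s :
  ext_lift v (\pi_ext s) = \sum_(p <- s) p.1 *: v p.2.
Proof. exact/ext_lift_rel/ext_repr. Qed.

End ExtensionOfScalars.

(* B ⊗_A i : B ⊗_A M -> B ⊗_A N; see ext_mapE. *)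
Definition ext_map (A B : comPzRingType) (f : {rmorphism A -> B})
    (M N : lmodType A) (i : {linear M -> N}) (x : ext f M) : ext f N :=
  \pi_(ext f N) [seq (p.1, i p.2) | p <- repr x].

Lemma ext_map_rel (A B : comPzRingType) (f : {rmorphism A -> B})
    (M N : lmodType A) (i : {linear M -> N}) (s t : seq (B * M)) :
  ext_rel f s t -> ext_rel f [seq (p.1, i p.2) | p <- s] [seq (p.1, i p.2) | p <- t].
Proof.
elim=> {s t} [s|s t _ h|s t v _ h _ k|s s' t t' _ h _ k|s t|m|b b' m|b m m'|b a m] /=.
- exact: ext_refl.
- exact: ext_sym.
- exact: ext_trans h k.
- by rewrite !map_cat; exact: ext_cat.
- by rewrite !map_cat; exact: ext_catC.
- exact: ext_0.
- exact: ext_Dl.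
- by rewrite linearD; exact: ext_Dr.
- by rewrite linearZ; exact: ext_Z.
Qed.

Lemma ext_mapE (A B : comPzRingType) (f : {rmorphism A -> B})
    (M N : lmodType A) (i : {linear M -> N}) (s : seq (B * M)) :
  ext_map i (\pi_(ext f M) s) = \pi_(ext f N) [seq (p.1, i p.2) | p <- s].
Proof. by apply/ext_piP/ext_map_rel/ext_repr. Qed.

Definition flat (A B : comPzRingType) (f : {rmorphism A -> B}) : Prop :=
  forall (M N : lmodType A) (i : {linear M -> N}),
    injective i -> injective (@ext_map A B f M N i).

(* Exactness of B^m -> B^n -> M -> 0 for some m, n and some maps. *)
Definition fin_pres_mod (B : comPzRingType) (M : lmodType B) : Prop :=
  exists (m n : nat) (q : {linear 'rV[B]_m -> 'rV[B]_n}) (p : {linear 'rV[B]_n -> M}),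
    (forall x, exists y, p y = x) /\
    (forall y, p y = 0 <-> exists z, q z = y).

Section AffineGeometry.
Variable R : cring.
Implicit Types A B C D K : calg R.

Record prime_ideal A (p : A -> Prop) : Prop := PrimeIdeal {
  prime0 : p 0;
  primeD : forall x y, p x -> p y -> p (x + y);
  primeMl : forall a x, p x -> p (a * x);
  prime1 : ~ p 1;
  primeM : forall x y, p (x * y) -> p x \/ p y }.

Definition jointly_surjective A (I : Type) (B : I -> calg R)
    (f : forall i, calg_hom A (B i)) : Prop :=
  forall p : A -> Prop, prime_ideal p ->
  exists (i : I) (q : B i -> Prop), prime_ideal q /\ forall a, p a <-> q (f i a).

Definition is_field K : Prop :=
  (1 : K) <> 0 /\ forall x : K, x <> 0 -> exists y, y * x = 1.

Definition is_localization A B (a : A) (f : calg_hom A B) : Prop :=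
  (exists b, b * f a = 1) /\
  forall C (g : calg_hom A C), (exists c, c * g a = 1) ->
    exists! h : calg_hom B C, calg_comp h f = g.

(* Polynomials in n variables, as formal sums of (coefficient, exponents). *)
Definition polynomial A n := seq (A * ('I_n -> nat)).

Definition poly_eval A C n (g : calg_hom A C) (c : 'I_n -> C)
    (P : polynomial A n) : C :=
  \sum_(t <- P) g t.1 * \prod_(i < n) c i ^+ t.2 i.

(* B = A[x_1, ..., x_n]/(P_1, ..., P_m), with x_i |-> b_i, stated by the
   universal property of this quotient. *)
Definition is_presentation A B (f : calg_hom A B) n m (P : 'I_m -> polynomial A n)
    (b : 'I_n -> B) : Prop :=
  (forall j, poly_eval f b (P j) = 0) /\
  forall C (g : calg_hom A C) (c : 'I_n -> C),
    (forall j, poly_eval g c (P j) = 0) ->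
    exists! h : calg_hom B C, calg_comp h f = g /\ forall i, h (b i) = c i.

Definition fin_pres_alg A B (f : calg_hom A B) : Prop :=
  exists n m (P : 'I_m -> polynomial A n) (b : 'I_n -> B), is_presentation f P b.

Definition formally_etale A B (f : calg_hom A B) : Prop :=
  forall C D (s : calg_hom C D),
    (forall d, exists c, s c = d) ->
    (forall x y, s x = 0 -> s y = 0 -> x * y = 0) ->
  forall (g : calg_hom A C) (h : calg_hom B D), calg_comp s g = calg_comp h f ->
    exists! k : calg_hom B C, calg_comp s k = h /\ calg_comp k f = g.

Definition etale A B (f : calg_hom A B) : Prop :=
  fin_pres_alg f /\ formally_etale f.

End AffineGeometry.

(* Schemes and algebraic spaces over R, through their functors of points:
   presheaves of sets on Aff/R. *)
Record presheaf (R : cring) := Presheaf {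
  psec :> calg R -> Type;
  pres : forall A B : calg R, calg_hom A B -> psec A -> psec B;
  pres_id : forall (A : calg R) (x : psec A), pres (calg_id A) x = x;
  pres_comp : forall (A B C : calg R) (g : calg_hom B C) (f : calg_hom A B)
    (x : psec A), pres (calg_comp g f) x = pres g (pres f x) }.

Section AlgebraicSpaces.
Variable R : cring.
Implicit Types (A B C K T : calg R) (P Q U : presheaf R).

Record psh_map P Q := PshMap {
  psh_fun :> forall A, P A -> Q A;
  psh_nat : forall A B (f : calg_hom A B) (x : P A),
    psh_fun (pres f x) = pres f (psh_fun x) }.

Lemma calg_compA A B C D (h : calg_hom C D) (g : calg_hom B C) (f : calg_hom A B) :
  calg_comp h (calg_comp g f) = calg_comp (calg_comp h g) f.
Proof. exact: calg_hom_ext. Qed.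
Lemma calg_comp1f A B (f : calg_hom A B) : calg_comp (calg_id B) f = f.
Proof. exact: calg_hom_ext. Qed.
Lemma calg_compf1 A B (f : calg_hom A B) : calg_comp f (calg_id A) = f.
Proof. exact: calg_hom_ext. Qed.

Definition Spec T : presheaf R :=
  @Presheaf R (calg_hom T) (fun A B f g => calg_comp f g)
    (fun A g => calg_comp1f g) (fun A B C g f h => esym (calg_compA g f h)).

(* The functor of points of the fibre product of x, y : Spec T -> P and the
   diagonal of P, i.e. the equalizer of x and y. *)
Section Equalizer.
Variables (P : presheaf R) (T : calg R) (x y : P T).

Record eq_sec A := EqSec {
  eq_val : calg_hom T A;
  eq_valP : pres eq_val x = pres eq_val y }.

Lemma eq_sec_ext A (s t : eq_sec A) : eq_val s = eq_val t -> s = t.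
Proof.
case: s t => f fP [g gP] /= e; case: g / e gP => gP.
by rewrite (Prop_irrelevance fP gP).
Qed.

Lemma eq_resP A B (f : calg_hom A B) (s : eq_sec A) :
  pres (calg_comp f (eq_val s)) x = pres (calg_comp f (eq_val s)) y.
Proof. by rewrite !pres_comp eq_valP. Qed.

Definition eq_res A B (f : calg_hom A B) (s : eq_sec A) : eq_sec B :=
  EqSec (eq_resP f s).

Lemma eq_res_id A (s : eq_sec A) : eq_res (calg_id A) s = s.
Proof. by apply: eq_sec_ext; rewrite /= calg_comp1f. Qed.
Lemma eq_res_comp A B C (g : calg_hom B C) (f : calg_hom A B) (s : eq_sec A) :
  eq_res (calg_comp g f) s = eq_res g (eq_res f s).
Proof. by apply: eq_sec_ext; rewrite /= calg_compA. Qed.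

Definition equalizer : presheaf R := Presheaf eq_res_id eq_res_comp.

End Equalizer.

Section Pullback.
Variables (U P : presheaf R) (a : psh_map U P) (T : calg R) (t : P T).

Record pb_sec A := PbSec {
  pb_fst : U A;
  pb_snd : calg_hom T A;
  pb_secP : a A pb_fst = pres pb_snd t }.

Lemma pb_sec_ext A (s s' : pb_sec A) :
  pb_fst s = pb_fst s' -> pb_snd s = pb_snd s' -> s = s'.
Proof.
case: s s' => u f h [u' f' h'] /= e e'.
case: u' / e h' => h'; case: f' / e' h' => h'.
by rewrite (Prop_irrelevance h h').
Qed.

Lemma pb_resP A B (f : calg_hom A B) (s : pb_sec A) :
  a B (pres f (pb_fst s)) = pres (calg_comp f (pb_snd s)) t.
Proof. by rewrite psh_nat pb_secP pres_comp. Qed.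

Definition pb_res A B (f : calg_hom A B) (s : pb_sec A) : pb_sec B :=
  PbSec (pb_resP f s).

Lemma pb_res_id A (s : pb_sec A) : pb_res (calg_id A) s = s.
Proof. by apply: pb_sec_ext; rewrite /= ?pres_id ?calg_comp1f. Qed.
Lemma pb_res_comp A B C (g : calg_hom B C) (f : calg_hom A B) (s : pb_sec A) :
  pb_res (calg_comp g f) s = pb_res g (pb_res f s).
Proof. by apply: pb_sec_ext; rewrite /= ?pres_comp ?calg_compA. Qed.

Definition pullback : presheaf R := Presheaf pb_res_id pb_res_comp.

End Pullback.

(* Sheaf condition for the family Spec (B i) -> Spec A; matching is tested on
   all Spec C mapping to two members of the family over Spec A. *)
Definition sheaf_for P A n (B : 'I_n -> calg R) (f : forall i, calg_hom A (B i)) : Prop :=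
  forall x : (forall i, P (B i)),
    (forall i j C (g : calg_hom (B i) C) (h : calg_hom (B j) C),
       calg_comp g (f i) = calg_comp h (f j) -> pres g (x i) = pres h (x j)) ->
    exists! y : P A, forall i, pres (f i) y = x i.

Definition zariski_sheaf P : Prop :=
  forall A n (a c : 'I_n -> A) (B : 'I_n -> calg R) (f : forall i, calg_hom A (B i)),
    \sum_(i < n) c i * a i = 1 ->
    (forall i, is_localization (a i) (f i)) ->
    sheaf_for P f.

Definition fppf_sheaf P : Prop :=
  forall A n (B : 'I_n -> calg R) (f : forall i, calg_hom A (B i)),
    (forall i, flat (f i) /\ fin_pres_alg (f i)) ->
    jointly_surjective f ->
    sheaf_for P f.

(* u : Spec A -> P is an open immersion: it is a monomorphism and, for every
   x : Spec B -> P, its inverse image in Spec B is the open subscheme on which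
   some subset I of B generates the unit ideal. *)
Definition affine_open P A (u : P A) : Prop :=
  (forall B, injective (fun f : calg_hom A B => pres f u)) /\
  forall B (x : P B), exists I : set B,
    forall C (g : calg_hom B C),
      (exists f : calg_hom A C, pres f u = pres g x) <->
      (exists s : seq (C * B), (forall p, p \in s -> I p.2) /\
                               \sum_(p <- s) p.1 * g p.2 = 1).

(* Every field-valued point lies in an affine open. *)
Definition scheme P : Prop :=
  zariski_sheaf P /\
  forall K (x : P K), is_field K ->
    exists A (u : P A), affine_open u /\ exists f : calg_hom A K, pres f u = x.

(* The fibre products pullback a t are schemes when the diagonal of P is
   representable, so that the definition is the usual one for their
   projections to Spec T. *)
Definition etale_surjective U P (a : psh_map U P) : Prop :=
  forall T (t : P T),
    (forall B (v : pullback a t B), affine_open v -> etale (pb_snd v)) /\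
    (forall p : T -> Prop, prime_ideal p ->
       exists B (v : pullback a t B) (q : B -> Prop),
         [/\ affine_open v, prime_ideal q & forall x, p x <-> q (pb_snd v x)]).

Definition etale_atlas U P (a : psh_map U P) : Prop :=
  scheme U /\ etale_surjective a.

Definition algebraic_space P : Prop :=
  [/\ fppf_sheaf P,
      forall T (x y : P T), scheme (equalizer x y)
    & exists U (a : psh_map U P), etale_atlas a].

(* q : P -> Spec T is flat, and Spec T is the image of a quasi-compact open of
   P; both are read off an étale atlas of P. *)
Definition fpqc_covering P T (q : psh_map P (Spec T)) : Prop :=
  exists U (a : psh_map U P),
    [/\ etale_atlas a,
        forall B (u : U B), affine_open u -> flat (q B (a B u) : calg_hom T B)
      & exists n (B : 'I_n -> calg R) (u : forall i, U (B i)),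
          (forall i, affine_open (u i)) /\
          jointly_surjective (fun i => q (B i) (a (B i) (u i)) : calg_hom T (B i))].

End AlgebraicSpaces.

(* Categories fibered in groupoids over Aff/R.  [X B] is the class of objects
   over Spec B, i.e. of maps Spec B -> X; a morphism from x over Spec A to y
   over Spec B lies over a morphism Spec A -> Spec B, i.e. B -> A. *)
Record fibcat (R : cring) := FibCat {
  fob :> calg R -> Type;
  fhom : forall A B : calg R, fob A -> fob B -> Type;
  fover : forall (A B : calg R) (x : fob A) (y : fob B), fhom x y -> calg_hom B A;
  fid : forall (A : calg R) (x : fob A), fhom x x;
  fcomp : forall (A B C : calg R) (x : fob A) (y : fob B) (z : fob C),
    fhom y z -> fhom x y -> fhom x z;
  fcomp1f : forall A B (x : fob A) (y : fob B) (f : fhom x y), fcomp (fid y) f = f;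
  fcompf1 : forall A B (x : fob A) (y : fob B) (f : fhom x y), fcomp f (fid x) = f;
  fcompA : forall A B C D (x : fob A) (y : fob B) (z : fob C) (t : fob D)
    (h : fhom z t) (g : fhom y z) (f : fhom x y),
    fcomp h (fcomp g f) = fcomp (fcomp h g) f;
  fover_id : forall A (x : fob A), fover (fid x) = calg_id A;
  fover_comp : forall A B C (x : fob A) (y : fob B) (z : fob C)
    (g : fhom y z) (f : fhom x y),
    fover (fcomp g f) = calg_comp (fover f) (fover g);
  flift : forall A B (y : fob B) (f : calg_hom B A),
    exists (x : fob A) (phi : fhom x y), fover phi = f;
  fcartesian : forall A B C (x : fob A) (y : fob B) (z : fob C)
    (phi : fhom x y) (psi : fhom z y) (h : calg_hom A C),
    calg_comp h (fover phi) = fover psi ->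
    exists! chi : fhom z x, fcomp phi chi = psi /\ fover chi = h }.

Arguments fid {R f A} x : rename.
Arguments fcomp {R f A B C x y z} _ _ : rename.

Section FpqcAtlas.
Variables (R : cring) (X : fibcat R).

(* For x : Spec C -> X and t : Spec T -> X, an A-point of the fibre product
   Spec C x_X Spec T is given by an object over Spec A with maps to x and t,
   up to isomorphism over Spec A. *)
Record span (C T : calg R) (x : X C) (t : X T) (A : calg R) := Span {
  apex : X A;
  span_fst : fhom apex x;
  span_snd : fhom apex t }.

(* s' is the restriction of s along f : Spec B -> Spec A; for f = id this
   says that s and s' are isomorphic. *)
Definition span_restr C T (x : X C) (t : X T) A B (f : calg_hom A B)
    (s' : span x t B) (s : span x t A) : Prop :=
  exists phi : fhom (apex s') (apex s),
    [/\ fover phi = f,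
        fcomp (span_fst s) phi = span_fst s'
      & fcomp (span_snd s) phi = span_snd s'].

Definition is_fibre_product C T (x : X C) (t : X T) (P : presheaf R)
    (cl : forall A, span x t A -> P A) : Prop :=
  [/\ forall A (p : P A), exists s, cl A s = p,
      forall A (s s' : span x t A), cl A s' = cl A s <-> span_restr (calg_id A) s' s
    & forall A B (f : calg_hom A B) (s' : span x t B) (s : span x t A),
        span_restr f s' s -> cl B s' = pres f (cl A s)].

Definition fpqc_atlas C (x : X C) : Prop :=
  forall T (t : X T), exists (P : presheaf R) (cl : forall A, span x t A -> P A)
      (q : psh_map P (Spec T)),
    [/\ is_fibre_product cl,
        forall A (s : span x t A), q A (cl A s) = fover (span_snd s),
        algebraic_space P
      & fpqc_covering q].

Definition quasi_compact : Prop := exists C (x : X C), fpqc_atlas x.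

End FpqcAtlas.

Section QCoh.
Variables (R : cring) (X : fibcat R).

Record qcoh := QCoh {
  qmod :> forall B : calg R, X B -> lmodType B;
  qres : forall (A B : calg R) (x : X A) (y : X B) (phi : fhom x y),
    {linear qmod y -> qmod x | fover phi \; *:%R};
  qres_id : forall A (x : X A) (m : qmod x), qres (fid x) m = m;
  qres_comp : forall A B C (x : X A) (y : X B) (z : X C)
    (g : fhom y z) (f : fhom x y) (m : qmod z),
    qres (fcomp g f) m = qres f (qres g m);
  (* The induced map A ⊗_B F(y) -> F(x) is an isomorphism. *)
  qres_iso : forall A B (x : X A) (y : X B) (phi : fhom x y),
    bijective (ext_lift (qres phi)) }.

Record qhom (F G : qcoh) := QHom {
  qfun :> forall (B : calg R) (x : X B), {linear F B x -> G B x};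
  qfun_nat : forall A B (x : X A) (y : X B) (phi : fhom x y) (m : F B y),
    qfun x (qres F phi m) = qres G phi (qfun y m) }.

Lemma qhom_ext (F G : qcoh) (u v : qhom F G) :
  (forall B (x : X B), u B x =1 v B x) -> u = v.
Proof.
case: u v => u uP [v vP] /= uv.
have e : u = v.
  by apply/functional_extensionality_dep => B;
     apply/functional_extensionality_dep => x; apply: linear_ext; apply: uv.
by case: v / e vP {uv} => vP; rewrite (Prop_irrelevance uP vP).
Qed.

Definition qid (F : qcoh) : qhom F F :=
  @QHom F F (fun B x => idfun) (fun A B x y phi m => erefl).

Lemma qcomp_nat (F G H : qcoh) (v : qhom G H) (u : qhom F G)
    A B (x : X A) (y : X B) (phi : fhom x y) (m : F B y) :
  (v A x \o u A x) (qres F phi m) = qres H phi ((v B y \o u B y) m).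
Proof. by rewrite /= !qfun_nat. Qed.
Definition qcomp (F G H : qcoh) (v : qhom G H) (u : qhom F G) : qhom F H :=
  @QHom F H (fun B x => v B x \o u B x) (qcomp_nat v u).

Section HomModule.
Variables F G : qcoh.
Implicit Types u v w : qhom F G.

HB.instance Definition _ := gen_eqMixin (qhom F G).
HB.instance Definition _ := gen_choiceMixin (qhom F G).

Lemma qadd_nat u v A B (x : X A) (y : X B) (phi : fhom x y) (m : F B y) :
  (u A x \+ v A x) (qres F phi m) = qres G phi ((u B y \+ v B y) m).
Proof. by rewrite /= linearD !qfun_nat. Qed.
Definition qadd u v : qhom F G :=
  @QHom F G (fun B x => u B x \+ v B x) (qadd_nat u v).

Lemma qopp_nat u A B (x : X A) (y : X B) (phi : fhom x y) (m : F B y) :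
  (\- u A x) (qres F phi m) = qres G phi ((\- u B y) m).
Proof. by rewrite /= linearN !qfun_nat. Qed.
Definition qopp u : qhom F G := @QHom F G (fun B x => \- u B x) (qopp_nat u).

Lemma qzero_nat A B (x : X A) (y : X B) (phi : fhom x y) (m : F B y) :
  (\0 : F A x -> G A x) (qres F phi m) = qres G phi ((\0 : F B y -> G B y) m).
Proof. by rewrite /= linear0. Qed.
Definition qzero : qhom F G := @QHom F G (fun B x => \0) qzero_nat.

Lemma qscale_nat (r : R) u A B (x : X A) (y : X B) (phi : fhom x y) (m : F B y) :
  (calg_str A r \*: u A x) (qres F phi m) =
  qres G phi ((calg_str B r \*: u B y) m).
Proof. by rewrite /= linearZ_LR /= calg_funP qfun_nat. Qed.
Definition qscale (r : R) u : qhom F G :=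
  @QHom F G (fun B x => calg_str B r \*: u B x) (qscale_nat r u).

Lemma qaddA : associative qadd.
Proof. by move=> u v w; apply: qhom_ext => B x m /=; rewrite addrA. Qed.
Lemma qaddC : commutative qadd.
Proof. by move=> u v; apply: qhom_ext => B x m /=; rewrite addrC. Qed.
Lemma qadd0 : left_id qzero qadd.
Proof. by move=> u; apply: qhom_ext => B x m /=; rewrite add0r. Qed.
Lemma qaddN : left_inverse qzero qopp qadd.
Proof. by move=> u; apply: qhom_ext => B x m /=; rewrite addNr. Qed.

HB.instance Definition _ := GRing.isZmodule.Build (qhom F G) qaddA qaddC qadd0 qaddN.

Lemma qscaleA a b u : qscale a (qscale b u) = qscale (a * b) u.
Proof. by apply: qhom_ext => B x m /=; rewrite scalerA rmorphM. Qed.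
Lemma qscale1 : left_id 1 qscale.
Proof. by move=> u; apply: qhom_ext => B x m /=; rewrite rmorph1 scale1r. Qed.
Lemma qscaleDr : right_distributive qscale +%R.
Proof. by move=> a u v; apply: qhom_ext => B x m /=; rewrite scalerDr. Qed.
Lemma qscaleDl u : {morph qscale^~ u : a b / a + b}.
Proof. by move=> a b; apply: qhom_ext => B x m /=; rewrite rmorphD scalerDl. Qed.

HB.instance Definition _ :=
  GRing.Zmodule_isLmodule.Build R (qhom F G) qscaleA qscale1 qscaleDr qscaleDl.

End HomModule.
End QCoh.

Section Subcategories.
Variables (R : cring) (X : fibcat R).

Definition is_fp (F : qcoh X) : Prop :=
  forall (B : calg R) (x : X B), fin_pres_mod (F B x).

(* Objects of the full subcategory of QCoh(X) given by a predicate. *)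
Record sub_qcoh (D : qcoh X -> Prop) := SubQCoh {
  sub_val :> qcoh X;
  sub_valP : D sub_val }.

(* E'' -> E' -> E -> 0 is exact. *)
Definition right_exact (E'' E' E : qcoh X) (v : qhom E'' E') (u : qhom E' E) : Prop :=
  forall (B : calg R) (x : X B),
    (forall y, exists z, u B x z = y) /\
    (forall z, u B x z = 0 <-> exists w, v B x w = z).

Definition finitely_supported (B : comPzRingType) (J : choiceType) (M : J -> lmodType B)
    (z : forall j, M j) : Prop :=
  finite_set [set j | z j != 0].

(* Every sheaf is a quotient of a direct sum of objects of D.  The elements of
   a direct sum of modules are the finitely supported families, and the map
   (+)_j E_j -> F with components u_j sends (z_j)_j to the sum of the u_j(z_j).
   Index sets are choiceTypes only for the sake of the big operators: every type
   is one, by gen_eqMixin and gen_choiceMixin. *)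
Definition generates (D : qcoh X -> Prop) : Prop :=
  forall F : qcoh X,
  exists (J : choiceType) (E : J -> sub_qcoh D) (u : forall j, qhom (E j) F),
  forall (B : calg R) (x : X B) (y : F B x),
  exists z : forall j, E j B x,
    finitely_supported z /\ y = \sum_(j \in [set: J]) u j B x (z j).

(* Exact sequences (+)_k E_k -> (+)_j E_j -> E -> 0 in which every
   E_k -> (+)_j E_j factors through a finite subsum, i.e. is given by a family
   (v k j)_j with finitely many nonzero members. *)
Record test_sequence (D : qcoh X -> Prop) := TestSequence {
  ts_J : choiceType;
  ts_K : choiceType;
  ts_E : sub_qcoh D;
  ts_EJ : ts_J -> sub_qcoh D;
  ts_EK : ts_K -> sub_qcoh D;
  ts_u : forall j, qhom (ts_EJ j) ts_E;
  ts_v : forall k j, qhom (ts_EK k) (ts_EJ j);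
  ts_fin : forall k, finite_set [set j | ts_v k j != 0];
  ts_surj : forall (B : calg R) (x : X B) (y : ts_E B x),
    exists z : forall j, ts_EJ j B x,
      finitely_supported z /\ y = \sum_(j \in [set: ts_J]) ts_u j B x (z j);
  ts_exact : forall (B : calg R) (x : X B) (z : forall j, ts_EJ j B x),
    finitely_supported z ->
    (\sum_(j \in [set: ts_J]) ts_u j B x (z j) = 0 <->
     exists w : forall k, ts_EK k B x, finitely_supported w /\
       forall j, z j = \sum_(k \in [set: ts_K]) ts_v k j B x (w k)) }.

End Subcategories.

Arguments is_fp {R} X F.

Record category := Category {
  cob :> Type;
  chom : cob -> cob -> Type;
  cid : forall a, chom a a;
  ccomp : forall a b c, chom b c -> chom a b -> chom a c;
  ccomp1f : forall a b (f : chom a b), ccomp (cid b) f = f;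
  ccompf1 : forall a b (f : chom a b), ccomp f (cid a) = f;
  ccompA : forall a b c d (h : chom c d) (g : chom b c) (f : chom a b),
    ccomp h (ccomp g f) = ccomp (ccomp h g) f }.

Arguments cid {c} a : rename.
Arguments ccomp {c a b c0} _ _ : rename.

Record functor (C D : category) := Functor {
  fun_ob :> C -> D;
  fun_hom : forall a b, chom a b -> chom (fun_ob a) (fun_ob b);
  fun_id : forall a, fun_hom (cid a) = cid (fun_ob a);
  fun_comp : forall a b c (g : chom b c) (f : chom a b),
    fun_hom (ccomp g f) = ccomp (fun_hom g) (fun_hom f) }.

Section Functors.

Definition functor_id (C : category) : functor C C :=
  @Functor C C id (fun a b f => f) (fun a => erefl) (fun a b c g f => erefl).

Lemma functor_comp_id (C D E : category) (G : functor D E) (F : functor C D) a :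
  fun_hom G (fun_hom F (cid a)) = cid (G (F a)).
Proof. by rewrite !fun_id. Qed.
Lemma functor_comp_comp (C D E : category) (G : functor D E) (F : functor C D)
    a b c (g : chom b c) (f : chom a b) :
  fun_hom G (fun_hom F (ccomp g f)) =
  ccomp (fun_hom G (fun_hom F g)) (fun_hom G (fun_hom F f)).
Proof. by rewrite !fun_comp. Qed.
Definition functor_comp (C D E : category) (G : functor D E) (F : functor C D) :
  functor C E :=
  @Functor C E (fun a => G (F a)) (fun a b f => fun_hom G (fun_hom F f))
    (functor_comp_id G F) (functor_comp_comp G F).

End Functors.

Record nat_trans (C D : category) (F G : functor C D) := NatTrans {
  nt_fun :> forall a, chom (F a) (G a);
  nt_nat : forall a b (f : chom a b),
    ccomp (nt_fun b) (fun_hom F f) = ccomp (fun_hom G f) (nt_fun a) }.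

Definition is_iso (C : category) (a b : C) (f : chom a b) : Prop :=
  exists g : chom b a, ccomp g f = cid a /\ ccomp f g = cid b.

Definition nat_isomorphic (C D : category) (F G : functor C D) : Prop :=
  exists t : nat_trans F G, forall a, is_iso (t a).

Definition quasi_inverses (C D : category) (F : functor C D) (G : functor D C) : Prop :=
  nat_isomorphic (functor_comp G F) (functor_id C) /\
  nat_isomorphic (functor_comp F G) (functor_id D).

Record left_adjoint (C D : category) (G : functor C D) := LeftAdjoint {
  la_fun :> functor D C;
  la_unit : nat_trans (functor_id D) (functor_comp G la_fun);
  la_counit : nat_trans (functor_comp la_fun G) (functor_id C);
  la_triangle1 : forall d, ccomp (la_counit (la_fun d)) (fun_hom la_fun (la_unit d)) =
    cid (la_fun d);
  la_triangle2 : forall c, ccomp (fun_hom G (la_counit c)) (la_unit (G c)) = cid (G c) }.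

Section FullSubcategory.
Variables (C : category) (P : C -> Prop).

Record full_ob := FullOb { full_val :> C; full_valP : P full_val }.

Definition full_subcategory : category :=
  @Category full_ob (fun a b => @chom C a b) (fun a => cid (full_val a))
    (fun a b c g f => ccomp g f)
    (fun a b f => ccomp1f f) (fun a b f => ccompf1 f)
    (fun a b c d h g f => ccompA h g f).

Definition functor_restrict (D : category) (F : functor C D) : functor full_subcategory D :=
  @Functor full_subcategory D (fun a => F (full_val a)) (fun a b f => fun_hom F f)
    (fun a => fun_id F (full_val a)) (fun a b c g f => fun_comp F g f).

Definition functor_corestrict (D : category) (F : functor D C) (hF : forall d, P (F d)) :
  functor D full_subcategory :=
  @Functor D full_subcategory (fun d => FullOb (hF d)) (fun a b f => fun_hom F f)
    (fun a => fun_id F a) (fun a b c g f => fun_comp F g f).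

End FullSubcategory.

Section QCohA.
Variables (R : cring) (A : calg R) (X : fibcat R).

(* Quasi-coherent sheaves with an R-algebra map A -> End(F). *)
Record qcohA := QCohA {
  qA_val :> qcoh X;
  qA_act : A -> qhom qA_val qA_val;
  qA_actD : forall a b, qA_act (a + b) = qA_act a + qA_act b;
  qA_actM : forall a b, qA_act (a * b) = qcomp (qA_act a) (qA_act b);
  qA_act1 : qA_act 1 = qid qA_val;
  qA_act_str : forall r, qA_act (calg_str A r) = r *: qid qA_val }.

Record qAhom (F G : qcohA) := QAHom {
  qAh_val :> qhom F G;
  qAh_act : forall a, qcomp qAh_val (qA_act F a) = qcomp (qA_act G a) qAh_val }.

Lemma qAhom_ext (F G : qcohA) (u v : qAhom F G) :
  (forall B (x : X B), u B x =1 v B x) -> u = v.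
Proof.
case: u v => u uP [v vP] /= uv.
have e : u = v by exact: qhom_ext.
by case: v / e vP {uv} => vP; rewrite (Prop_irrelevance uP vP).
Qed.

Lemma qAid_act (F : qcohA) a : qcomp (qid F) (qA_act F a) = qcomp (qA_act F a) (qid F).
Proof. exact: qhom_ext. Qed.
Definition qAid (F : qcohA) : qAhom F F := QAHom (@qAid_act F).

Lemma qcompA (F G H K : qcoh X) (w : qhom H K) (v : qhom G H) (u : qhom F G) :
  qcomp w (qcomp v u) = qcomp (qcomp w v) u.
Proof. exact: qhom_ext. Qed.

Lemma qAcomp_act (F G H : qcohA) (v : qAhom G H) (u : qAhom F G) a :
  qcomp (qcomp v u) (qA_act F a) = qcomp (qA_act H a) (qcomp v u).
Proof. by rewrite -qcompA qAh_act !qcompA qAh_act. Qed.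
Definition qAcomp (F G H : qcohA) (v : qAhom G H) (u : qAhom F G) : qAhom F H :=
  QAHom (qAcomp_act v u).

Lemma qAcomp1f F G (u : qAhom F G) : qAcomp (qAid G) u = u.
Proof. exact: qAhom_ext. Qed.
Lemma qAcompf1 F G (u : qAhom F G) : qAcomp u (qAid F) = u.
Proof. exact: qAhom_ext. Qed.
Lemma qAcompA F G H K (w : qAhom H K) (v : qAhom G H) (u : qAhom F G) :
  qAcomp w (qAcomp v u) = qAcomp (qAcomp w v) u.
Proof. exact: qAhom_ext. Qed.

Definition QCoh_A : category := Category qAcomp1f qAcompf1 qAcompA.

(* Hom_X(E, F) as an A-module. *)
Definition homA (E : qcoh X) (F : qcohA) : Type := qhom E F.
HB.instance Definition _ E F := GRing.Zmodule.on (homA E F).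

Section HomA.
Variables (E : qcoh X) (F : qcohA).
Implicit Types u v : homA E F.

Definition homA_scale (a : A) u : homA E F := qcomp (qA_act F a) u.

Lemma homA_scaleA a b u : homA_scale a (homA_scale b u) = homA_scale (a * b) u.
Proof. by rewrite /homA_scale qA_actM qcompA. Qed.
Lemma homA_scale1 : left_id 1 homA_scale.
Proof. by move=> u; rewrite /homA_scale qA_act1; apply: qhom_ext. Qed.
Lemma homA_scaleDr : right_distributive homA_scale +%R.
Proof. by move=> a u v; apply: qhom_ext => B x m /=; rewrite linearD. Qed.
Lemma homA_scaleDl u : {morph homA_scale^~ u : a b / a + b}.
Proof. by move=> a b; rewrite /homA_scale qA_actD; apply: qhom_ext. Qed.

HB.instance Definition _ :=
  GRing.Zmodule_isLmodule.Build A (homA E F)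
    homA_scaleA homA_scale1 homA_scaleDr homA_scaleDl.

End HomA.

Section LinearFunctors.
Variable D : qcoh X -> Prop.

Record lfun := LFun {
  lval :> sub_qcoh D -> lmodType A;
  lmap : forall E E' : sub_qcoh D, qhom E E' -> {linear lval E' -> lval E};
  lmap_id : forall (E : sub_qcoh D) (x : lval E), lmap (qid E) x = x;
  lmap_comp : forall (E E' E'' : sub_qcoh D) (v : qhom E' E'') (u : qhom E E')
    (x : lval E''), lmap (qcomp v u) x = lmap u (lmap v x);
  lmapD : forall (E E' : sub_qcoh D) (u v : qhom E E') (x : lval E'),
    lmap (u + v) x = lmap u x + lmap v x;
  lmapZ : forall (E E' : sub_qcoh D) (r : R) (u : qhom E E') (x : lval E'),
    lmap (r *: u) x = calg_str A r *: lmap u x }.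

Record lfun_hom (G H : lfun) := LFunHom {
  lf_fun :> forall E, {linear G E -> H E};
  lf_nat : forall (E E' : sub_qcoh D) (u : qhom E E') (x : G E'),
    lf_fun E (lmap G u x) = lmap H u (lf_fun E' x) }.

Lemma lfun_hom_ext G H (s t : lfun_hom G H) : (forall E, s E =1 t E) -> s = t.
Proof.
case: s t => s sP [t tP] /= st.
have e : s = t.
  by apply/functional_extensionality_dep => E; apply: linear_ext; apply: st.
by case: t / e tP {st} => tP; rewrite (Prop_irrelevance sP tP).
Qed.

Definition lfun_id G : lfun_hom G G :=
  @LFunHom G G (fun E => idfun) (fun E E' u x => erefl).

Lemma lfun_comp_nat G H K (t : lfun_hom H K) (s : lfun_hom G H)
    (E E' : sub_qcoh D) (u : qhom E E') (x : G E') :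
  (t E \o s E) (lmap G u x) = lmap K u ((t E' \o s E') x).
Proof. by rewrite /= !lf_nat. Qed.
Definition lfun_comp G H K (t : lfun_hom H K) (s : lfun_hom G H) : lfun_hom G K :=
  @LFunHom G K (fun E => t E \o s E) (lfun_comp_nat t s).

Lemma lfun_comp1f G H (s : lfun_hom G H) : lfun_comp (lfun_id H) s = s.
Proof. exact: lfun_hom_ext. Qed.
Lemma lfun_compf1 G H (s : lfun_hom G H) : lfun_comp s (lfun_id G) = s.
Proof. exact: lfun_hom_ext. Qed.
Lemma lfun_compA G H K L (w : lfun_hom K L) (t : lfun_hom H K) (s : lfun_hom G H) :
  lfun_comp w (lfun_comp t s) = lfun_comp (lfun_comp w t) s.
Proof. exact: lfun_hom_ext. Qed.

Definition L_R : category := Category lfun_comp1f lfun_compf1 lfun_compA.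

Definition exact_on_test (G : lfun) (S : test_sequence D) : Prop :=
  (forall x : G (ts_E S), (forall j : ts_J S, lmap G (ts_u j) x = 0) -> x = 0) /\
  (forall x : (forall j : ts_J S, G (ts_EJ j)),
     (forall k : ts_K S, \sum_(j \in [set: ts_J S]) lmap G (ts_v k j) (x j) = 0) <->
     exists y : G (ts_E S), forall j : ts_J S, lmap G (ts_u j) y = x j).

Definition is_lex (G : lfun) : Prop := forall S, exact_on_test G S.

Definition Lex_R : category := @full_subcategory L_R is_lex.

Definition left_exact (G : lfun) : Prop :=
  forall (E'' E' E : sub_qcoh D) (v : qhom E'' E') (u : qhom E' E),
    right_exact v u ->
    (forall x : G E, lmap G u x = 0 -> x = 0) /\
    (forall x : G E', lmap G v x = 0 <-> exists y : G E, lmap G u y = x).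

Section OmegaObject.
Variable F : qcohA.

Definition omega_map (E E' : qcoh X) (u : qhom E E') (h : homA E' F) : homA E F :=
  qcomp h u.

Lemma omega_map_linear (E E' : qcoh X) (u : qhom E E') : linear (omega_map u).
Proof. by move=> a h k; apply: qhom_ext. Qed.
HB.instance Definition _ (E E' : qcoh X) (u : qhom E E') :=
  GRing.isLinear.Build A (homA E' F) (homA E F) _ (omega_map u) (omega_map_linear u).

Lemma omega_id (E : sub_qcoh D) (h : homA E F) : omega_map (qid E) h = h.
Proof. exact: qhom_ext. Qed.
Lemma omega_comp (E E' E'' : sub_qcoh D) (v : qhom E' E'') (u : qhom E E')
    (h : homA E'' F) : omega_map (qcomp v u) h = omega_map u (omega_map v h).
Proof. exact: qcompA. Qed.
Lemma omegaD (E E' : sub_qcoh D) (u v : qhom E E') (h : homA E' F) :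
  omega_map (u + v) h = omega_map u h + omega_map v h.
Proof. by apply: qhom_ext => B x m /=; rewrite linearD. Qed.
Lemma omegaZ (E E' : sub_qcoh D) (r : R) (u : qhom E E') (h : homA E' F) :
  omega_map (r *: u) h = calg_str A r *: omega_map u h.
Proof.
apply: qhom_ext => B x m; rewrite /= linearZ_LR /= /GRing.scale /= qA_act_str /=.
by [].
Qed.

Definition omega : lfun :=
  @LFun (fun E => homA E F) (fun E E' u => omega_map u) omega_id omega_comp omegaD omegaZ.

End OmegaObject.

Definition omega_hom_fun (F F' : qcohA) (t : qAhom F F') (E : sub_qcoh D)
    (h : homA E F) : homA E F' := qcomp t h.

Lemma omega_hom_linear (F F' : qcohA) (t : qAhom F F') (E : sub_qcoh D) :
  linear (@omega_hom_fun F F' t E).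
Proof.
move=> a h k; rewrite /omega_hom_fun.
apply: qhom_ext => B x m /=; rewrite linearD; congr (_ + _).
have /(congr1 (fun w : qhom F F' => w B x (h B x m))) := qAh_act t a.
by [].
Qed.
HB.instance Definition _ (F F' : qcohA) (t : qAhom F F') (E : sub_qcoh D) :=
  GRing.isLinear.Build A (homA E F) (homA E F') _ (@omega_hom_fun F F' t E)
    (@omega_hom_linear F F' t E).

Lemma omega_hom_nat (F F' : qcohA) (t : qAhom F F') (E E' : sub_qcoh D)
    (u : qhom E E') (h : homA E' F) :
  omega_hom_fun t (omega_map u h) = omega_map u (omega_hom_fun t h).
Proof. exact: qcompA. Qed.
Definition omega_hom (F F' : qcohA) (t : qAhom F F') : lfun_hom (omega F) (omega F') :=
  @LFunHom (omega F) (omega F') (fun E => @omega_hom_fun F F' t E) (omega_hom_nat t).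

Lemma omega_hom_id F : omega_hom (qAid F) = lfun_id (omega F).
Proof. by apply: lfun_hom_ext => E h; apply: qhom_ext. Qed.
Lemma omega_hom_comp F G H (v : qAhom G H) (u : qAhom F G) :
  omega_hom (qAcomp v u) = lfun_comp (omega_hom v) (omega_hom u).
Proof. by apply: lfun_hom_ext => E h; apply: qhom_ext. Qed.

Definition Omega : functor QCoh_A L_R :=
  @Functor QCoh_A L_R omega omega_hom omega_hom_id omega_hom_comp.

Definition Omega_Lex (hO : forall F, is_lex (Omega F)) : functor QCoh_A Lex_R :=
  @functor_corestrict L_R is_lex QCoh_A Omega hO.

Definition Lex_restrict (C : category) (L : functor L_R C) : functor Lex_R C :=
  @functor_restrict L_R is_lex C L.

End LinearFunctors.
End QCohA.

Arguments Omega {R} A {X} D.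
Arguments is_lex {R A X} D G.

(* Main.v *)
From HB Require Import structures.
From mathcomp Require Import all_boot all_algebra.
From mathcomp Require Import boolp classical_sets functions cardinality fsbigop filter.
From Stdlib Require List.
From Stdlib Require Import Ring.
Require Import Defs.

(** The functor Omega sends F to Hom(-, F). Its left adjoint sends a functor G to the coend LG,
    whose value at an object y is generated by symbols c ⊗ e with c in G(E) and e in E(y), for E of
    finite presentation, subject to bilinearity and to u^*c ⊗ e = c ⊗ u(e); to stay inside one
    universe, E runs through a small skeleton. The theorem amounts to three facts: the counit
    LΩF -> F is invertible, the unit G -> ΩLG is invertible for every left exact G, and ΩF is exact
    on all test sequences. Indeed a functor which is exact on test sequences is left exact, because
    a right exact sequence is a test sequence with index sets of one element; conversely a left
    exact G is isomorphic to ΩLG. As left adjoints are unique, the result holds for every left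
    adjoint of Omega (adjoint_quasi_inverses).

    The key is that kernels exist in QCoh and are computed at an atlas x : Spec C -> X
    (kernel_sheaf). With generation it gives ker_hit: if h : F -> F' kills an element z of F(x), then
    z is in the image of some E -> F with E of finite presentation and E -> F -> F' zero.

    Counit (counit_bij): every element of LΩF(x) is a single symbol h ⊗ e, since direct sums of
    sheaves of finite presentation are of finite presentation. If it maps to h(e) = 0, then e = g(e')
    for some g with h g = 0, and h ⊗ e = h g ⊗ e' = 0. Surjectivity is generation.

    Unit (eta_bij): for left exact G the pairs (E, c) with c in G(E) form a filtered category,
    thanks to direct sums and cokernels, and LG(y) is the colimit of the E(y). So c ⊗ e = 0 only if e
    dies along some u with c in the image of u^* (bk_zero). As E(x) is finitely generated, an element
    c all of whose symbols vanish is zero. For surjectivity, given h : E -> LG, write the images of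
    generators of E(x) as symbols of a single c0 in G(E0). By ker_hit there is a right exact sequence
    E3 -> E2 -> E -> 0 and a map E2 -> E0 such that h becomes c0 on E2. The pullback of c0 to E2
    vanishes on E3, so by left exactness it comes from an element of G(E), which the unit maps to h.

    Kernels are obtained by flat descent. Any map to X is covered by flat ones which factor through
    x, and the kernel K of h at x must be shown to descend. Two maps al, be to x from the same object
    factor locally through an affine étale chart of the algebraic space Spec C ×_X Spec C; there be
    is flat, so that the extension of K along be is the kernel of h, and it receives the extension
    along al. These comparisons agree and compose, which yields the descent datum theta. The kernel
    at an arbitrary object t is then the limit of the values at the objects over t which map to x,
    and flatness of a covering makes this limit commute with extension of scalars (proj_flat).

    The commutative algebra behind it is that étale algebras are flat and that étale covers descend.
    Flatness (formally_etale_flat): if B = S/I with S a polynomial algebra over A, a section of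
    S/I² -> B lifts to an endomorphism phi of S with phi = id modulo I and phi(I) in I²; iterating it
    makes an element that dies after an extension of scalars divisible by all powers of I, and Krull's
    lemma over a finitely generated subring applies (smooth_flat). Descent: algebras of finite
    presentation induce open maps for the constructible topology, by Chevalley's theorem, and this
    topology is quasi-compact; so a jointly surjective family of flat maps of finite presentation
    contains a finite one which kills no nonzero element of any module (flat_cover_pure). Such pure
    families suffice for descent of sections of quasi-coherent sheaves (qglue). *)

Set Implicit Arguments.
Unset Strict Implicit.
Unset Printing Implicit Defensive.

Import GRing.Theory.
Local Open Scope quotient_scope.
Local Open Scope classical_set_scope.
Local Open Scope ring_scope.

(** * Algebras by generators and relations *)

Lemma sval_inj (T : Type) (P : T -> Prop) : injective (@sval T P).
Proof.
move=> [x p] [y q] /= e; case: y / e q => q.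
by rewrite (Prop_irrelevance p q).
Qed.

Inductive tm (T I : Type) : Type :=
  Cst (c : T) | Gen (i : I) | Add (s t : tm T I) | Mul (s t : tm T I).
Arguments Gen {T I} i.
Arguments Cst {T I} c.
Arguments Add {T I} s t.
Arguments Mul {T I} s t.

Section PresentedRing.
Variables (R : cring) (T : calg R) (I : Type) (rel : tm (carrier T) I -> tm (carrier T) I -> Prop).
Notation tm := (tm (carrier T) I).
Implicit Types s t u : tm.

Inductive teq : tm -> tm -> Prop :=
| teq_refl s : teq s s
| teq_sym s t : teq s t -> teq t s
| teq_trans s t u : teq s t -> teq t u -> teq s u
| teq_add s s' t t' : teq s s' -> teq t t' -> teq (Add s t) (Add s' t')
| teq_mul s s' t t' : teq s s' -> teq t t' -> teq (Mul s t) (Mul s' t')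
| teq_addA s t u : teq (Add s (Add t u)) (Add (Add s t) u)
| teq_addC s t : teq (Add s t) (Add t s)
| teq_add0 s : teq (Add (Cst (0 : T)) s) s
| teq_mulA s t u : teq (Mul s (Mul t u)) (Mul (Mul s t) u)
| teq_mulC s t : teq (Mul s t) (Mul t s)
| teq_mul0 s : teq (Mul (Cst (0 : T)) s) (Cst (0 : T))
| teq_mul1 s : teq (Mul (Cst (1 : T)) s) s
| teq_mulDl s t u : teq (Mul (Add s t) u) (Add (Mul s u) (Mul t u))
| teq_cstD (a b : T) : teq (Cst (a + b)) (Add (Cst a) (Cst b))
| teq_cstM (a b : T) : teq (Cst (a * b)) (Mul (Cst a) (Cst b))
| teq_rel s t : rel s t -> teq s t.

(** Congruence classes are encoded as predicates on terms: so the presented ring has its carrier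
    in the small universe of T and I, as the objects of the site must. *)
Definition pring := {S : tm -> Prop | exists t, S = teq t}.

Definition pcl (t : tm) : pring := exist _ (teq t) (ex_intro _ t erefl).

Lemma pcl_eq s t : pcl s = pcl t <-> teq s t.
Proof.
split=> [/(congr1 sval)/= e|st].
  by rewrite e; exact: teq_refl.
apply: sval_inj => /=; apply/funext => u; apply/propext; split=> h.
  exact: teq_trans (teq_sym st) h.
exact: teq_trans st h.
Qed.

Definition prep (x : pring) : tm := projT1 (boolp.cid (svalP x)).
Lemma prepK x : pcl (prep x) = x.
Proof. by apply: sval_inj; rewrite /= /prep; case: boolp.cid => t /= <-. Qed.

HB.instance Definition _ := gen_eqMixin pring.
HB.instance Definition _ := gen_choiceMixin pring.

Definition padd x y := pcl (Add (prep x) (prep y)).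
Definition pmul x y := pcl (Mul (prep x) (prep y)).
Definition popp x := pcl (Mul (Cst (- 1 : T)) (prep x)).

Lemma prep_pcl s : teq (prep (pcl s)) s.
Proof. by apply/pcl_eq; rewrite prepK. Qed.
Lemma paddE s t : padd (pcl s) (pcl t) = pcl (Add s t).
Proof. by apply/pcl_eq; apply: teq_add; apply: prep_pcl. Qed.
Lemma pmulE s t : pmul (pcl s) (pcl t) = pcl (Mul s t).
Proof. by apply/pcl_eq; apply: teq_mul; apply: prep_pcl. Qed.
Lemma pind (P : pring -> Prop) : (forall t, P (pcl t)) -> forall x, P x.
Proof. by move=> h x; rewrite -[x]prepK. Qed.

Lemma paddA : associative padd.
Proof.
elim/pind=> s; elim/pind=> t; elim/pind=> u; rewrite !paddE.
by apply/pcl_eq; exact: teq_addA.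
Qed.
Lemma paddC : commutative padd.
Proof. by elim/pind=> s; elim/pind=> t; rewrite !paddE; apply/pcl_eq; exact: teq_addC. Qed.
Lemma padd0 : left_id (pcl (Cst (0 : T))) padd.
Proof. by elim/pind=> s; rewrite !paddE; apply/pcl_eq; exact: teq_add0. Qed.
Lemma pmulA : associative pmul.
Proof.
elim/pind=> s; elim/pind=> t; elim/pind=> u; rewrite !pmulE.
by apply/pcl_eq; exact: teq_mulA.
Qed.
Lemma pmulC : commutative pmul.
Proof. by elim/pind=> s; elim/pind=> t; rewrite !pmulE; apply/pcl_eq; exact: teq_mulC. Qed.
Lemma pmul1 : left_id (pcl (Cst (1 : T))) pmul.
Proof. by elim/pind=> s; rewrite !pmulE; apply/pcl_eq; exact: teq_mul1. Qed.
Lemma pmulDl : left_distributive pmul padd.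
Proof.
elim/pind=> s; elim/pind=> t; elim/pind=> u; rewrite paddE !pmulE paddE.
by apply/pcl_eq; exact: teq_mulDl.
Qed.
Lemma paddN : left_inverse (pcl (Cst (0 : T))) popp padd.
Proof.
elim/pind=> s.
have -> : popp (pcl s) = pmul (pcl (Cst (- 1 : T))) (pcl s).
  rewrite pmulE; apply/pcl_eq; apply: teq_mul; [exact: teq_refl|exact: prep_pcl].
have := pmulDl (pcl (Cst (- 1 : T))) (pcl (Cst (1 : T))) (pcl s).
rewrite pmul1 => <-; rewrite paddE pmulE.
apply/pcl_eq; apply: teq_trans (teq_mul0 s).
apply: teq_mul; last exact: teq_refl.
by apply: teq_trans (teq_sym (teq_cstD _ _)) _; rewrite addNr; exact: teq_refl.
Qed.

HB.instance Definition _ := GRing.isZmodule.Build pring paddA paddC padd0 paddN.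
HB.instance Definition _ :=
  GRing.Zmodule_isComPzRing.Build pring pmulA pmulC pmul1 pmulDl.

Lemma pclD s t : pcl (Add s t) = pcl s + pcl t.
Proof. by rewrite -paddE. Qed.
Lemma pclM s t : pcl (Mul s t) = pcl s * pcl t.
Proof. by rewrite -pmulE. Qed.

Definition pcring : cring := @CRing pring (GRing.ComPzRing.class pring).

Lemma pcst_is_zmod : zmod_morphism (fun a : T => pcl (Cst a)).
Proof.
move=> a b; apply: (@addIr _ (pcl (Cst b))); rewrite subrK -pclD.
by apply/pcl_eq; apply: teq_trans (teq_sym (teq_cstD _ _)) _; rewrite subrK; exact: teq_refl.
Qed.
Lemma pcst_is_monoid : monoid_morphism (fun a : T => pcl (Cst a)).
Proof. by split=> // a b; rewrite -pclM; apply/pcl_eq; exact: teq_cstM. Qed.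

Definition pcst : T -> pcring := fun a => pcl (Cst a).
HB.instance Definition _ := GRing.isZmodMorphism.Build T pcring pcst pcst_is_zmod.
HB.instance Definition _ := GRing.isMonoidMorphism.Build T pcring pcst pcst_is_monoid.

Definition pcalg : calg R := CAlg (pcst \o calg_str T : {rmorphism R -> pcring}).
Lemma pincP r : (pcst : {rmorphism T -> pcalg}) (calg_str T r) = calg_str pcalg r.
Proof. by []. Qed.
Definition pinc : calg_hom T pcalg := CAlgHom pincP.
Definition pgen (i : I) : pcalg := pcl (Gen i).
Definition ptm (t : tm) : pcalg := pcl t.

Lemma ptm_ind (P : pcalg -> Prop) : (forall t, P (ptm t)) -> forall x, P x.
Proof. by move=> h x; rewrite -[x]prepK; apply: h. Qed.
Lemma ptm_eq s t : ptm s = ptm t <-> teq s t.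
Proof. exact: pcl_eq. Qed.
Lemma ptmD s t : ptm (Add s t) = ptm s + ptm t. Proof. exact: pclD. Qed.
Lemma ptmM s t : ptm (Mul s t) = ptm s * ptm t. Proof. exact: pclM. Qed.
Lemma ptmC (a : T) : ptm (Cst a) = pinc a. Proof. by []. Qed.
Lemma ptmG i : ptm (Gen i) = pgen i. Proof. by []. Qed.

Lemma pcalg_ind (P : pcalg -> Prop) : (forall a : T, P (pinc a)) ->
  (forall i, P (pgen i)) -> (forall x y, P x -> P y -> P (x + y)) ->
  (forall x y, P x -> P y -> P (x * y)) -> forall x, P x.
Proof.
move=> hc hg hD hM x; elim/ptm_ind: x; elim=> [a|i|s hs t ht|s hs t ht].
- exact: hc.
- exact: hg.
- by rewrite ptmD; apply: hD.
- by rewrite ptmM; apply: hM.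
Qed.

End PresentedRing.

Record ideal (E : comPzRingType) (J : E -> Prop) : Prop := Ideal {
  ideal0 : J 0;
  idealD : forall x y, J x -> J y -> J (x + y);
  idealM : forall a x, J x -> J (a * x) }.

Lemma idealN (E : comPzRingType) (J : E -> Prop) (hJ : ideal J) x : J x -> J (- x).
Proof. by move=> hx; rewrite -mulN1r; apply: idealM. Qed.
Lemma idealB (E : comPzRingType) (J : E -> Prop) (hJ : ideal J) x y : J x -> J y -> J (x - y).
Proof. by move=> hx hy; apply: idealD => //; apply: idealN. Qed.

Section Evaluation.
Variables (T I : Type) (E : comPzRingType) (g : T -> E) (c : I -> E).
Fixpoint tev (t : tm T I) : E :=
  match t with
  | Cst a => g a | Gen i => c i
  | Add s t => tev s + tev t | Mul s t => tev s * tev t end.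
End Evaluation.

(** The axioms of a commutative ring hold modulo every ideal. The ideal 0 gives the morphisms
    out of a presented ring; the ideal generated by the relations gives the kernel of the map to
    it from the free algebra. *)
Lemma tev_sound (R : cring) (T : calg R) I (rel : tm (carrier T) I -> tm (carrier T) I -> Prop)
    (E : comPzRingType) (g : {rmorphism T -> E}) (c : I -> E) (J : E -> Prop) (hJ : ideal J) :
  (forall s t, rel s t -> J (tev g c s - tev g c t)) ->
  forall s t, teq rel s t -> J (tev g c s - tev g c t).
Proof.
move=> hr s t; elim=> {s t} /=.
- by move=> s; rewrite subrr; apply: ideal0.
- by move=> s t _ h; rewrite -opprB; apply: idealN.
- by move=> s t u _ h _ k; rewrite -[X in X - _](subrK (tev g c t)) -addrA; apply: idealD.
- by move=> s s' t t' _ h _ k; rewrite opprD addrACA; apply: idealD.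
- move=> s s' t t' _ h _ k.
  have -> : tev g c s * tev g c t - tev g c s' * tev g c t' =
    tev g c t * (tev g c s - tev g c s') + tev g c s' * (tev g c t - tev g c t').
    rewrite !mulrBr [tev g c t * _]mulrC [tev g c t * _]mulrC.
    by rewrite addrA subrK.
  by apply: idealD => //; apply: idealM.
- by move=> s t u; rewrite addrA subrr; apply: ideal0.
- by move=> s t; rewrite [X in X - _]addrC subrr; apply: ideal0.
- by move=> s; rewrite rmorph0 add0r subrr; apply: ideal0.
- by move=> s t u; rewrite mulrA subrr; apply: ideal0.
- by move=> s t; rewrite mulrC subrr; apply: ideal0.
- by move=> s; rewrite rmorph0 mul0r subrr; apply: ideal0.
- by move=> s; rewrite rmorph1 mul1r subrr; apply: ideal0.
- by move=> s t u; rewrite mulrDl subrr; apply: ideal0.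
- by move=> a b; rewrite rmorphD subrr; apply: ideal0.
- by move=> a b; rewrite rmorphM subrr; apply: ideal0.
- by move=> s t; apply: hr.
Qed.

Lemma zero_ideal (E : comPzRingType) : ideal (fun x : E => x = 0).
Proof. by split=> // [x y -> ->|a x ->]; rewrite ?addr0 ?mulr0. Qed.

Section Universal.
Variables (R : cring) (T : calg R) (I : Type) (rel : tm (carrier T) I -> tm (carrier T) I -> Prop).
Notation S := (pcalg rel).

Lemma tev_ptm t : tev (pinc rel) (pgen rel) t = ptm rel t.
Proof. by elim: t => //= [s -> t ->|s -> t ->]; rewrite ?ptmD ?ptmM. Qed.

Lemma rmorph_tev (E : comPzRingType) (h : {rmorphism S -> E}) (g : T -> E) (c : I -> E) t :
  (forall a, h (pinc rel a) = g a) -> (forall i, h (pgen rel i) = c i) ->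
  h (ptm rel t) = tev g c t.
Proof.
move=> hg hc; elim: t => [a|i|s hs t ht|s hs t ht] //=.
- exact: hg.
- exact: hc.
- by rewrite ptmD rmorphD hs ht.
- by rewrite ptmM rmorphM hs ht.
Qed.

Lemma pcalg_hom_eq (E : comPzRingType) (h k : {rmorphism S -> E}) :
  (forall a, h (pinc rel a) = k (pinc rel a)) -> (forall i, h (pgen rel i) = k (pgen rel i)) ->
  h =1 k.
Proof.
move=> hc hg; elim/ptm_ind=> t.
rewrite (@rmorph_tev _ h (fun a => k (pinc rel a)) (fun i => k (pgen rel i))) //.
by rewrite -(@rmorph_tev _ k (fun a => k (pinc rel a)) (fun i => k (pgen rel i))).
Qed.

Section Morphism.
Variables (E : comPzRingType) (g : {rmorphism T -> E}) (c : I -> E).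
Hypothesis hrel : forall s t, rel s t -> tev g c s = tev g c t.

Definition pmor (x : S) : E := tev g c (prep x).
Lemma pmor_ptm t : pmor (ptm rel t) = tev g c t.
Proof.
apply/subr0_eq; apply: (@tev_sound _ _ _ rel _ g c _ (zero_ideal E)) => [s u h|].
  by rewrite (hrel h) subrr.
exact: prep_pcl.
Qed.
Lemma pmor_zmod : zmod_morphism pmor.
Proof.
move=> x y; apply: (@addIr _ (pmor y)); rewrite subrK -{2}[x](subrK y).
elim/ptm_ind: (x - y) => s; elim/ptm_ind: y => t.
by rewrite -ptmD !pmor_ptm.
Qed.
Lemma pmor_monoid : monoid_morphism pmor.
Proof.
split; first by rewrite -[1]/(ptm rel (Cst (1 : T))) pmor_ptm /= rmorph1.
by elim/ptm_ind=> s; elim/ptm_ind=> t; rewrite -ptmM !pmor_ptm.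
Qed.
HB.instance Definition _ := GRing.isZmodMorphism.Build S E pmor pmor_zmod.
HB.instance Definition _ := GRing.isMonoidMorphism.Build S E pmor pmor_monoid.
Definition pmorR : {rmorphism S -> E} := pmor.
Lemma pmorR_inc a : pmorR (pinc rel a) = g a. Proof. exact: (pmor_ptm (Cst a)). Qed.
Lemma pmorR_gen i : pmorR (pgen rel i) = c i. Proof. exact: (pmor_ptm (Gen i)). Qed.
End Morphism.

Variables (C : calg R) (g : calg_hom T C) (c : I -> C).
Hypothesis hrel : forall s t, rel s t -> tev g c s = tev g c t.
Lemma pextP r : pmorR hrel (calg_str S r) = calg_str C r.
Proof. by rewrite -(calg_funP g); apply: (pmor_ptm hrel). Qed.
Definition pext : calg_hom S C := CAlgHom pextP.
Lemma pext_ptm t : pext (ptm rel t) = tev g c t. Proof. exact: (pmor_ptm hrel). Qed.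
Lemma pext_inc a : pext (pinc rel a) = g a. Proof. exact: (pext_ptm (Cst a)). Qed.
Lemma pext_gen i : pext (pgen rel i) = c i. Proof. exact: (pext_ptm (Gen i)). Qed.

End Universal.

(** Commuting endomorphisms of a T-module which satisfy the relations turn it into a module over
    the presented algebra. *)
Section Action.
Variables (R : cring) (T : calg R) (I : Type) (rel : tm (carrier T) I -> tm (carrier T) I -> Prop).
Variables (G : lmodType T) (c : I -> {linear G -> G}).
Hypothesis hcomm : forall i j v, c i (c j v) = c j (c i v).
Fixpoint tact (t : tm (carrier T) I) (v : G) : G :=
  match t with
  | Cst a => (a : T) *: v | Gen i => c i v
  | Add s t => tact s v + tact t v | Mul s t => tact s (tact t v) end.
Hypothesis hrel : forall s t, rel s t -> forall v, tact s v = tact t v.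

Lemma tactD t u v : tact t (u + v) = tact t u + tact t v.
Proof.
elim: t u v => [a|i|s hs t ht|s hs t ht] u v /=; rewrite ?scalerDr ?linearD //.
- by rewrite hs ht addrACA.
- by rewrite ht hs.
Qed.
Lemma tactZ t (a : T) v : tact t (a *: v) = a *: tact t v.
Proof.
elim: t v => [b|i|s hs t ht|s hs t ht] v /=.
- by rewrite !scalerA mulrC.
- by rewrite linearZ.
- by rewrite hs ht scalerDr.
- by rewrite ht hs.
Qed.
Lemma tactG t i v : tact t (c i v) = c i (tact t v).
Proof.
elim: t v => [b|j|s hs t ht|s hs t ht] v /=.
- by rewrite linearZ.
- by rewrite hcomm.
- by rewrite hs ht linearD.
- by rewrite ht hs.
Qed.
Lemma tact_comm s t v : tact s (tact t v) = tact t (tact s v).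
Proof.
elim: t v => [b|j|t ht u hu|t ht u hu] v /=.
- by rewrite tactZ.
- by rewrite tactG.
- by rewrite tactD ht hu.
- by rewrite ht hu.
Qed.
Lemma tact_sound s t : teq rel s t -> forall v, tact s v = tact t v.
Proof.
elim=> {s t} /=.
- by [].
- by move=> s t _ h v; rewrite h.
- by move=> s t u _ h _ k v; rewrite h k.
- by move=> s s' t t' _ h _ k v; rewrite h k.
- by move=> s s' t t' _ h _ k v; rewrite h k.
- by move=> s t u v; rewrite addrA.
- by move=> s t v; rewrite addrC.
- by move=> s v; rewrite scale0r add0r.
- by [].
- by move=> s t v; rewrite tact_comm.
- by move=> s v; rewrite !scale0r.
- by move=> s v; rewrite scale1r.
- by [].
- by move=> a b v; rewrite scalerDl.
- by move=> a b v; rewrite scalerA.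
- by move=> s t h v; apply: hrel.
Qed.

Definition pact : Type := G.
HB.instance Definition _ := GRing.Zmodule.on pact.
Definition pscale (x : pcalg rel) (v : pact) : pact := tact (prep x) v.
Lemma pscale_ptm t v : pscale (ptm rel t) v = tact t v.
Proof. by apply: tact_sound; exact: prep_pcl. Qed.
Lemma pscaleA x y v : pscale x (pscale y v) = pscale (x * y) v.
Proof. by elim/ptm_ind: x => s; elim/ptm_ind: y => t; rewrite -ptmM !pscale_ptm. Qed.
Lemma pscale1 : left_id 1 pscale.
Proof. by move=> v; rewrite (pscale_ptm (Cst (1 : T))) /= scale1r. Qed.
Lemma pscaleDr : right_distributive pscale +%R.
Proof. by elim/ptm_ind=> s u v; rewrite !pscale_ptm; apply: tactD. Qed.
Lemma pscaleDl v : {morph pscale^~ v : a b / a + b}.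
Proof. by elim/ptm_ind=> s; elim/ptm_ind=> t; rewrite -ptmD !pscale_ptm. Qed.
HB.instance Definition _ :=
  GRing.Zmodule_isLmodule.Build (pcalg rel) pact pscaleA pscale1 pscaleDr pscaleDl.
Definition pact_mod : lmodType (pcalg rel) := pact.
Lemma pact_ptm t (v : pact_mod) : ptm rel t *: v = tact t v.
Proof. exact: pscale_ptm. Qed.
Lemma pact_inc (a : T) (v : pact_mod) : pinc rel a *: v = (a *: (v : G) : G).
Proof. exact: (pact_ptm (Cst a)). Qed.
Lemma pact_gen i (v : pact_mod) : pgen rel i *: v = c i v.
Proof. exact: (pact_ptm (Gen i)). Qed.
End Action.

(** * Extension of scalars *)

Section ExtTheory.
Variables (A B : comPzRingType) (f : {rmorphism A -> B}).

Section OneModule.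
Variable M : lmodType A.
Notation "b ⊗ m" := (ext_pure f b m) (at level 40).

Lemma ext_cons (p : B * M) s : \pi_(ext f M) (p :: s) = p.1 ⊗ p.2 + \pi_(ext f M) s.
Proof. by rewrite /GRing.add /= /ext_pure ext_addE; case: p. Qed.

Lemma ext_ind (P : ext f M -> Prop) : P 0 -> (forall b m, P (b ⊗ m)) ->
  (forall x y, P x -> P y -> P (x + y)) -> forall x, P x.
Proof.
move=> h0 h1 hD x; rewrite -[x]reprK; elim: (repr x) => [|p s ih] //.
by rewrite ext_cons; apply: hD.
Qed.

Lemma ext_pureDl b c (m : M) : (b + c) ⊗ m = b ⊗ m + c ⊗ m.
Proof. by rewrite /GRing.add /= /ext_pure ext_addE; apply/ext_piP/ext_Dl. Qed.
Lemma ext_pureDr b (m n : M) : b ⊗ (m + n) = b ⊗ m + b ⊗ n.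
Proof. by rewrite /GRing.add /= /ext_pure ext_addE; apply/ext_piP/ext_Dr. Qed.
Lemma ext_pureZ b a (m : M) : b ⊗ (a *: m) = (b * f a) ⊗ m.
Proof. by apply/ext_piP/ext_sym/ext_Z. Qed.
Lemma ext_scale_pure c b (m : M) : c *: (b ⊗ m) = (c * b) ⊗ m.
Proof. by rewrite /GRing.scale /= /ext_pure ext_scaleE. Qed.
Lemma ext_pure1 b (m : M) : b ⊗ m = b *: (1 ⊗ m).
Proof. by rewrite ext_scale_pure mulr1. Qed.
Lemma ext_pure0l (m : M) : 0 ⊗ m = 0.
Proof. by rewrite ext_pure1 scale0r. Qed.
Lemma ext_pure0r b : b ⊗ (0 : M) = 0.
Proof. by rewrite -(scale0r (0 : M)) ext_pureZ rmorph0 mulr0 ext_pure0l. Qed.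

(** Additive maps out of an extension of scalars which are not assumed to be
    linear, e.g. into another extension of scalars. *)
Definition ext_fold (G : zmodType) (beta : B -> M -> G) (x : ext f M) : G :=
  \sum_(p <- repr x) beta p.1 p.2.
Section Fold.
Variables (G : zmodType) (beta : B -> M -> G).
Hypotheses (bDl : forall b c m, beta (b + c) m = beta b m + beta c m)
  (bDr : forall b m n, beta b (m + n) = beta b m + beta b n)
  (bZ : forall b a m, beta b (a *: m) = beta (b * f a) m).
Lemma ext_fold_rel s t : ext_rel f s t ->
  \sum_(p <- s) beta p.1 p.2 = \sum_(p <- t) beta p.1 p.2.
Proof.
have b0 m : beta 0 m = 0.
  by apply: (@addrI _ (beta 0 m)); rewrite -bDl !addr0.
elim=> {s t} [//|s t _ -> //|s t w _ -> _ -> //|s s' t t' _ h _ k|s t|m|b b' m|b m m'|b a m].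
- by rewrite !big_cat h k.
- by rewrite !big_cat /= addrC.
- by rewrite big_seq1 big_nil b0.
- by rewrite !big_cons !big_nil /= bDl !addr0.
- by rewrite !big_cons !big_nil /= bDr !addr0.
- by rewrite !big_seq1 /= bZ.
Qed.
Lemma ext_foldE s : ext_fold beta (\pi_(ext f M) s) = \sum_(p <- s) beta p.1 p.2.
Proof. exact/ext_fold_rel/ext_repr. Qed.
Lemma ext_fold_pure b m : ext_fold beta (b ⊗ m) = beta b m.
Proof. by rewrite ext_foldE big_seq1. Qed.
Lemma ext_foldD x y : ext_fold beta (x + y) = ext_fold beta x + ext_fold beta y.
Proof.
rewrite -[x]reprK -[y]reprK /GRing.add /= [X in ext_fold beta X]ext_addE.
by rewrite !ext_foldE big_cat.
Qed.
End Fold.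

Lemma ext_lift_is_linear (P : lmodType B) (v : {linear M -> P | f \; *:%R}) :
  linear (ext_lift v : ext f M -> P).
Proof.
have hD x y : ext_lift v (x + y) = ext_lift v x + ext_lift v y.
  apply: (@ext_foldD _ (fun b m => b *: v m)) => [b c m|b m n|b a m]; rewrite ?scalerDl //.
    by rewrite linearD scalerDr.
  by rewrite linearZ_LR /= scalerA.
move=> a x y; rewrite hD; congr (_ + _).
elim/ext_ind: x => [|b m|x y' hx hy].
- by rewrite scaler0 /ext_lift -/(ext_lift v 0) (ext_liftE v [::]) big_nil scaler0.
- by rewrite ext_scale_pure !(ext_liftE v [:: _]) !big_seq1 scalerA.
- by rewrite scalerDr !hD hx hy scalerDr.
Qed.
HB.instance Definition _ (P : lmodType B) (v : {linear M -> P | f \; *:%R}) :=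
  GRing.isLinear.Build B (ext f M) P _ (ext_lift v) (ext_lift_is_linear v).
Lemma ext_lift_pure (P : lmodType B) (v : {linear M -> P | f \; *:%R}) b m :
  ext_lift v (b ⊗ m) = b *: v m.
Proof. by rewrite (ext_liftE v [:: _]) big_seq1. Qed.

Lemma ext_pure1_linear : linear_for (f \; *:%R) (ext_pure f 1 : M -> ext f M).
Proof. by move=> a x y; rewrite ext_pureDr ext_pureZ mul1r [LHS]addrC addrC ext_pure1. Qed.
HB.instance Definition _ := GRing.isLinear.Build A M (ext f M) (f \; *:%R)
  (ext_pure f 1) ext_pure1_linear.
Definition ext_in : {linear M -> ext f M | f \; *:%R} := ext_pure f 1.

Lemma ext_eq (P : lmodType B) (u v : {linear ext f M -> P}) :
  (forall m, u (1 ⊗ m) = v (1 ⊗ m)) -> u =1 v.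
Proof.
move=> h; elim/ext_ind => [|b m|x y hx hy]; rewrite ?linear0 //.
  by rewrite ext_pure1 !linearZ h.
by rewrite !linearD hx hy.
Qed.

End OneModule.

Lemma ext_map_pure (M N : lmodType A) (i : {linear M -> N}) b m :
  ext_map i (ext_pure f b m) = ext_pure f b (i m).
Proof. by rewrite /ext_pure ext_mapE. Qed.
Lemma ext_map_is_linear (M N : lmodType A) (i : {linear M -> N}) :
  linear (ext_map i : ext f M -> ext f N).
Proof.
have hD x y : ext_map i (x + y) = ext_map i x + ext_map i y :> ext f N.
  rewrite -[x]reprK -[y]reprK /GRing.add /= [X in ext_map i X]ext_addE !ext_mapE.
  by rewrite [RHS]ext_addE map_cat.
move=> a x y; rewrite hD; congr (_ + _).
elim/ext_ind: x => [|b m|x y' hx hy].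
- have e0 : ext_map i (0 : ext f M) = 0 := ext_mapE f i [::].
  by rewrite scaler0 e0 scaler0.
- by rewrite ext_scale_pure !ext_map_pure ext_scale_pure.
- by rewrite scalerDr !hD hx hy scalerDr.
Qed.
HB.instance Definition _ (M N : lmodType A) (i : {linear M -> N}) :=
  GRing.isLinear.Build B (ext f M) (ext f N) _ (ext_map i) (ext_map_is_linear i).

Lemma ext_map_id (M : lmodType A) (i : {linear M -> M}) : i =1 id ->
  (ext_map i : ext f M -> ext f M) =1 id.
Proof. by move=> h; apply: (@ext_eq _ _ (ext_map i) idfun) => m; rewrite /= ext_map_pure h. Qed.
Lemma ext_map_comp (M N P : lmodType A) (j : {linear N -> P}) (i : {linear M -> N})
    (x : ext f M) : ext_map j (ext_map i x) = ext_map (j \o i) x.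
Proof.
by move: x; apply: (@ext_eq _ _ (ext_map j \o ext_map i) (ext_map (j \o i))) => m; rewrite /= !ext_map_pure.
Qed.
Lemma ext_map_eq (M N : lmodType A) (i j : {linear M -> N}) : i =1 j ->
  (ext_map i : ext f M -> ext f N) =1 ext_map j.
Proof. by move=> h; apply: (@ext_eq _ _ (ext_map i) (ext_map j)) => m; rewrite /= !ext_map_pure h. Qed.
Lemma ext_map0 (M N : lmodType A) (i : {linear M -> N}) : (forall m, i m = 0) ->
  forall x : ext f M, ext_map i x = 0.
Proof.
move=> h; apply: (@ext_eq _ _ (ext_map i) (\0)) => m.
by rewrite /= ext_map_pure h ext_pure0r.
Qed.

Lemma ext_lift_map (M N : lmodType A) (P : lmodType B) (i : {linear M -> N})
    (v : {linear N -> P | f \; *:%R}) (w : {linear M -> P | f \; *:%R}) :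
  (forall m, v (i m) = w m) -> forall x : ext f M, ext_lift v (ext_map i x) = ext_lift w x.
Proof.
move=> h; apply: (@ext_eq _ _ (ext_lift v \o ext_map i) (ext_lift w)) => m /=.
by rewrite ext_map_pure !ext_lift_pure h.
Qed.

End ExtTheory.

(** * Quotients, submodules and products of modules *)

Section Quotient.
Variables (A : comPzRingType) (M : lmodType A).

Record submod (S : M -> Prop) : Prop := Submod {
  sm0 : S 0; smD : forall x y, S x -> S y -> S (x + y);
  smZ : forall a x, S x -> S (a *: x) }.
Lemma smN (S : M -> Prop) (hS : submod S) x : S x -> S (- x).
Proof. by move=> h; rewrite -scaleN1r; apply: smZ. Qed.
Lemma smB (S : M -> Prop) (hS : submod S) x y : S x -> S y -> S (x - y).
Proof. by move=> h k; apply: smD => //; apply: smN. Qed.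

Variables (S : M -> Prop) (hS : submod S).

Definition quo_rel (m : M) : M -> Prop := fun x => S (x - m).
Definition quo := {C : M -> Prop | exists m, C = quo_rel m}.
Definition qcl (m : M) : quo := exist _ (quo_rel m) (ex_intro _ m erefl).
Lemma qcl_eq m n : qcl m = qcl n <-> S (m - n).
Proof.
split=> [/(congr1 sval)/(congr1 (fun C => C m))/= e|h].
  by move: e; rewrite /quo_rel subrr => <-; apply: sm0.
apply: sval_inj => /=; apply/funext => x; apply/propext; rewrite /quo_rel; split=> k.
  by rewrite -[x](subrK m) -addrA; apply: smD.
by rewrite -[x](subrK n) -addrA -[n - m]opprB; apply: smB.
Qed.
Definition qrep (x : quo) : M := projT1 (boolp.cid (svalP x)).
Lemma qrepK x : qcl (qrep x) = x.
Proof. by apply: sval_inj; rewrite /= /qrep; case: boolp.cid => t /= <-. Qed.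
Lemma qrep_cl m : S (qrep (qcl m) - m).
Proof. by apply/qcl_eq; rewrite qrepK. Qed.
Lemma qcl_ind (P : quo -> Prop) : (forall m, P (qcl m)) -> forall x, P x.
Proof. by move=> h x; rewrite -[x]qrepK. Qed.

HB.instance Definition _ := gen_eqMixin quo.
HB.instance Definition _ := gen_choiceMixin quo.

Definition quo_add x y := qcl (qrep x + qrep y).
Definition quo_opp x := qcl (- qrep x).
Definition quo_scale a x := qcl (a *: qrep x).
Lemma quo_addE m n : quo_add (qcl m) (qcl n) = qcl (m + n).
Proof. by apply/qcl_eq; rewrite opprD addrACA; apply: smD => //; apply: qrep_cl. Qed.
Lemma quo_oppE m : quo_opp (qcl m) = qcl (- m).
Proof. by apply/qcl_eq; rewrite -opprD; apply: smN => //; apply: qrep_cl. Qed.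
Lemma quo_scaleE a m : quo_scale a (qcl m) = qcl (a *: m).
Proof. by apply/qcl_eq; rewrite -scalerBr; apply: smZ => //; apply: qrep_cl. Qed.
Lemma quo_addA : associative quo_add.
Proof. by do 3!elim/qcl_ind=> ?; rewrite !quo_addE addrA. Qed.
Lemma quo_addC : commutative quo_add.
Proof. by do 2!elim/qcl_ind=> ?; rewrite !quo_addE addrC. Qed.
Lemma quo_add0 : left_id (qcl 0) quo_add.
Proof. by elim/qcl_ind=> ?; rewrite quo_addE add0r. Qed.
Lemma quo_addN : left_inverse (qcl 0) quo_opp quo_add.
Proof. by elim/qcl_ind=> ?; rewrite quo_oppE quo_addE addNr. Qed.
HB.instance Definition _ := GRing.isZmodule.Build quo quo_addA quo_addC quo_add0 quo_addN.
Lemma quo_scaleA a b x : quo_scale a (quo_scale b x) = quo_scale (a * b) x.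
Proof. by elim/qcl_ind: x => ?; rewrite !quo_scaleE scalerA. Qed.
Lemma quo_scale1 : left_id 1 quo_scale.
Proof. by elim/qcl_ind=> ?; rewrite quo_scaleE scale1r. Qed.
Lemma quo_scaleDr : right_distributive quo_scale +%R.
Proof.
move=> a; elim/qcl_ind=> m; elim/qcl_ind=> n.
rewrite -[qcl m + _]/(quo_add (qcl m) (qcl n)) -[RHS]/(quo_add _ _).
by rewrite quo_addE !quo_scaleE quo_addE scalerDr.
Qed.
Lemma quo_scaleDl x : {morph quo_scale^~ x : a b / a + b}.
Proof.
elim/qcl_ind: x => m a b.
by rewrite -[RHS]/(quo_add _ _) !quo_scaleE quo_addE scalerDl.
Qed.
HB.instance Definition _ := GRing.Zmodule_isLmodule.Build A quo
  quo_scaleA quo_scale1 quo_scaleDr quo_scaleDl.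
Definition quomod : lmodType A := quo.

Lemma qcl_linear : linear (qcl : M -> quomod).
Proof. by move=> a x y; rewrite -quo_addE -quo_scaleE. Qed.
HB.instance Definition _ := GRing.isLinear.Build A M quomod _ qcl qcl_linear.
Definition qproj : {linear M -> quomod} := qcl.
Lemma qproj0 m : qproj m = 0 <-> S m.
Proof. by rewrite -[0]/(qcl 0) qcl_eq subr0. Qed.
Lemma qproj_surj x : exists m, qproj m = x.
Proof. by exists (qrep x); apply: qrepK. Qed.

Section Lift.
Variables (P : zmodType) (s : GRing.Scale.law A P) (v : {linear M -> P | s}).
Hypothesis hv : forall m, S m -> v m = 0.
Definition qlift (x : quomod) : P := v (qrep x).
Lemma qlift_proj m : qlift (qproj m) = v m.
Proof. by apply/subr0_eq; rewrite -linearB; apply/hv/qrep_cl. Qed.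
Lemma qlift_linear : linear_for s qlift.
Proof.
move=> a x y; have [m <-] := qproj_surj x; have [n <-] := qproj_surj y.
by rewrite -linearP !qlift_proj linearP.
Qed.
HB.instance Definition _ := GRing.isLinear.Build A quomod P s qlift qlift_linear.
Definition qliftL : {linear quomod -> P | s} := qlift.
End Lift.

End Quotient.

Section Submodule.
Variables (A : comPzRingType) (M : lmodType A) (S : M -> Prop) (hS : submod S).
Definition subm := {m : M | S m}.
HB.instance Definition _ := gen_eqMixin subm.
HB.instance Definition _ := gen_choiceMixin subm.
Implicit Types x y : subm.
Definition sub_add x y : subm := exist _ _ (smD hS (svalP x) (svalP y)).
Definition sub_opp x : subm := exist _ _ (smN hS (svalP x)).
Definition sub_zero : subm := exist _ _ (sm0 hS).
Definition sub_scale a x : subm := exist _ _ (smZ hS a (svalP x)).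
Lemma sub_addA : associative sub_add. Proof. by move=> *; apply: sval_inj; apply: addrA. Qed.
Lemma sub_addC : commutative sub_add. Proof. by move=> *; apply: sval_inj; apply: addrC. Qed.
Lemma sub_add0 : left_id sub_zero sub_add. Proof. by move=> *; apply: sval_inj; apply: add0r. Qed.
Lemma sub_addN : left_inverse sub_zero sub_opp sub_add.
Proof. by move=> *; apply: sval_inj; apply: addNr. Qed.
HB.instance Definition _ := GRing.isZmodule.Build subm sub_addA sub_addC sub_add0 sub_addN.
Lemma sub_scaleA a b x : sub_scale a (sub_scale b x) = sub_scale (a * b) x.
Proof. by apply: sval_inj; apply: scalerA. Qed.
Lemma sub_scale1 : left_id 1 sub_scale. Proof. by move=> x; apply: sval_inj; apply: scale1r. Qed.
Lemma sub_scaleDr : right_distributive sub_scale +%R.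
Proof. by move=> a x y; apply: sval_inj; apply: scalerDr. Qed.
Lemma sub_scaleDl x : {morph sub_scale^~ x : a b / a + b}.
Proof. by move=> a b; apply: sval_inj; apply: scalerDl. Qed.
HB.instance Definition _ := GRing.Zmodule_isLmodule.Build A subm
  sub_scaleA sub_scale1 sub_scaleDr sub_scaleDl.
Definition submodm : lmodType A := subm.
Definition smval (x : submodm) : M := sval x.
Lemma smval_linear : linear smval. Proof. by []. Qed.
HB.instance Definition _ := GRing.isLinear.Build A submodm M _ smval smval_linear.
Lemma smvalP x : S (smval x). Proof. exact: svalP. Qed.
Lemma smval_inj : injective smval. Proof. exact: sval_inj. Qed.
Lemma smval_ex m : S m -> exists x, smval x = m.
Proof. by move=> h; exists (exist _ m h). Qed.
End Submodule.

Section RestrictionOfScalars.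
Variables (A B : comPzRingType) (f : {rmorphism A -> B}) (N : lmodType B).
Definition rst : Type := N.
HB.instance Definition _ := GRing.Zmodule.on rst.
Definition rst_scale (a : A) (n : rst) : rst := f a *: (n : N).
Lemma rst_scaleA a b x : rst_scale a (rst_scale b x) = rst_scale (a * b) x.
Proof. by rewrite /rst_scale scalerA rmorphM. Qed.
Lemma rst_scale1 : left_id 1 rst_scale.
Proof. by move=> x; rewrite /rst_scale rmorph1 scale1r. Qed.
Lemma rst_scaleDr : right_distributive rst_scale +%R.
Proof. by move=> a x y; apply: scalerDr. Qed.
Lemma rst_scaleDl x : {morph rst_scale^~ x : a b / a + b}.
Proof. by move=> a b; rewrite /rst_scale rmorphD scalerDl. Qed.
HB.instance Definition _ := GRing.Zmodule_isLmodule.Build A rst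
  rst_scaleA rst_scale1 rst_scaleDr rst_scaleDl.
Definition rstmod : lmodType A := rst.
Lemma rstE (a : A) (n : rstmod) : a *: n = f a *: (n : N). Proof. by []. Qed.
End RestrictionOfScalars.

Section DependentProduct.
Variables (A : comPzRingType) (I : Type) (N : I -> lmodType A).
Definition dprod := forall i, N i.
HB.instance Definition _ := gen_eqMixin dprod.
HB.instance Definition _ := gen_choiceMixin dprod.
Implicit Types x y : dprod.
Definition dp_add x y : dprod := fun i => x i + y i.
Definition dp_opp x : dprod := fun i => - x i.
Definition dp_zero : dprod := fun i => 0.
Definition dp_scale a x : dprod := fun i => a *: x i.
Lemma dprod_eq x y : (forall i, x i = y i) -> x = y.
Proof. by move=> h; apply/functional_extensionality_dep. Qed.
Lemma dp_addA : associative dp_add. Proof. by move=> *; apply: dprod_eq => i; apply: addrA. Qed.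
Lemma dp_addC : commutative dp_add. Proof. by move=> *; apply: dprod_eq => i; apply: addrC. Qed.
Lemma dp_add0 : left_id dp_zero dp_add. Proof. by move=> *; apply: dprod_eq => i; apply: add0r. Qed.
Lemma dp_addN : left_inverse dp_zero dp_opp dp_add.
Proof. by move=> *; apply: dprod_eq => i; apply: addNr. Qed.
HB.instance Definition _ := GRing.isZmodule.Build dprod dp_addA dp_addC dp_add0 dp_addN.
Lemma dp_scaleA a b x : dp_scale a (dp_scale b x) = dp_scale (a * b) x.
Proof. by apply: dprod_eq => i; apply: scalerA. Qed.
Lemma dp_scale1 : left_id 1 dp_scale. Proof. by move=> x; apply: dprod_eq => i; apply: scale1r. Qed.
Lemma dp_scaleDr : right_distributive dp_scale +%R.
Proof. by move=> a x y; apply: dprod_eq => i; apply: scalerDr. Qed.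
Lemma dp_scaleDl x : {morph dp_scale^~ x : a b / a + b}.
Proof. by move=> a b; apply: dprod_eq => i; apply: scalerDl. Qed.
HB.instance Definition _ := GRing.Zmodule_isLmodule.Build A dprod
  dp_scaleA dp_scale1 dp_scaleDr dp_scaleDl.
Definition dprodmod : lmodType A := dprod.
Definition dpr i (x : dprodmod) : N i := x i.
Lemma dpr_linear i : linear (dpr i). Proof. by []. Qed.
HB.instance Definition _ i := GRing.isLinear.Build A dprodmod (N i) _ (dpr i) (dpr_linear i).
End DependentProduct.

(** The linearity of the maps out of an extension of scalars, in a form where all the implicit
    structures are determined by the statement. *)
Section ExtRewriting.
Variables (A B : comPzRingType) (f : {rmorphism A -> B}) (M N : lmodType A) (P : lmodType B)
  (v : {linear M -> P | f \; *:%R}) (i : {linear M -> N}).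
Implicit Types (x y : ext f M) (b : B).
Lemma ext_lift0 : ext_lift v (0 : ext f M) = 0. Proof. exact: linear0. Qed.
Lemma ext_liftD x y : ext_lift v (x + y) = ext_lift v x + ext_lift v y.
Proof. exact: linearD. Qed.
Lemma ext_liftB x y : ext_lift v (x - y) = ext_lift v x - ext_lift v y.
Proof. exact: linearB. Qed.
Lemma ext_liftZ b x : ext_lift v (b *: x) = b *: ext_lift v x.
Proof. exact: linearZ. Qed.
Lemma ext_mapZero : ext_map i (0 : ext f M) = 0. Proof. exact: linear0. Qed.
Lemma ext_mapD x y : ext_map i (x + y) = ext_map i x + ext_map i y.
Proof. exact: linearD. Qed.
Lemma ext_mapB x y : ext_map i (x - y) = ext_map i x - ext_map i y.
Proof. exact: linearB. Qed.
Lemma ext_mapZ b x : ext_map i (b *: x) = b *: ext_map i x.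
Proof. exact: linearZ. Qed.
End ExtRewriting.

(** * Base change, exactness and pure families *)

Definition mkL (A : pzRingType) (U : lmodType A) (V : zmodType) (s : GRing.Scale.law A V)
    (v : U -> V) (h : linear_for s v) : {linear U -> V | s} :=
  HB.pack v (GRing.isLinear.Build A U V s v h).
Lemma mkLE (A : pzRingType) (U : lmodType A) (V : zmodType) (s : GRing.Scale.law A V)
    (v : U -> V) (h : linear_for s v) x : mkL h x = v x.
Proof. by []. Qed.

Section BaseChange.
Variables (A B C : comPzRingType) (f : {rmorphism A -> B}) (g : {rmorphism B -> C})
  (k : {rmorphism A -> C}) (H : forall a, k a = g (f a)).

Section OneModule.
Variable M : lmodType A.
Definition bc_fun : ext f M -> ext k M := ext_fold (fun b m => ext_pure k (g b) m).
Lemma bc_fun_pure b m : bc_fun (ext_pure f b m) = ext_pure k (g b) m.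
Proof.
apply: (@ext_fold_pure _ _ f M _ (fun b m => ext_pure k (g b) m)) => [b1 b2 m'|b' m1 m2|b' a m'].
- by rewrite rmorphD ext_pureDl.
- by rewrite ext_pureDr.
- by rewrite ext_pureZ H rmorphM.
Qed.
Lemma bc_funD x y : bc_fun (x + y) = bc_fun x + bc_fun y.
Proof.
apply: (@ext_foldD _ _ f M _ (fun b m => ext_pure k (g b) m)) => [b1 b2 m'|b' m1 m2|b' a m'].
- by rewrite rmorphD ext_pureDl.
- by rewrite ext_pureDr.
- by rewrite ext_pureZ H rmorphM.
Qed.
Lemma bc_fun0 : bc_fun 0 = 0.
Proof. by apply: (@addrI _ (bc_fun 0)); rewrite -bc_funD !addr0. Qed.
Lemma bc_fun_linear : linear_for (g \; *:%R) bc_fun.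
Proof.
move=> b x y; rewrite bc_funD; congr (_ + _) => /=.
elim/ext_ind: x => [|c m|x x' hx hx'].
- by rewrite scaler0 bc_fun0 scaler0.
- by rewrite ext_scale_pure !bc_fun_pure ext_scale_pure rmorphM.
- by rewrite scalerDr !bc_funD hx hx' scalerDr.
Qed.
Definition ext_bc : {linear ext f M -> ext k M | g \; *:%R} := mkL bc_fun_linear.
Lemma ext_bc_pure b m : ext_bc (ext_pure f b m) = ext_pure k (g b) m.
Proof. exact: bc_fun_pure. Qed.
Lemma ext_bc0 : ext_bc 0 = 0. Proof. exact: linear0. Qed.
Lemma ext_bcD x y : ext_bc (x + y) = ext_bc x + ext_bc y. Proof. exact: linearD. Qed.
Lemma ext_bcB x y : ext_bc (x - y) = ext_bc x - ext_bc y. Proof. exact: linearB. Qed.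
Lemma ext_bcZ b x : ext_bc (b *: x) = g b *: ext_bc x. Proof. exact: linearZ_LR. Qed.

Lemma tower_in_linear : linear_for (k \; *:%R) (fun m : M => ext_pure g 1 (ext_pure f 1 m)).
Proof.
move=> a x y; rewrite ext_pureDr ext_pureZ mul1r ext_pureDr; congr (_ + _) => /=.
by rewrite [ext_pure f _ _]ext_pure1 ext_pureZ mul1r -H ext_pure1.
Qed.

(** Transitivity of extension of scalars; the inverse sends c ⊗ m to c ⊗ (1 ⊗ m). *)
Lemma ext_tower : bijective (ext_lift ext_bc : ext g (ext f M) -> ext k M).
Proof.
exists (ext_lift (mkL tower_in_linear)) => x.
- elim/ext_ind: x => [|c m|x y hx hy]; first by rewrite !ext_lift0.
  + rewrite ext_lift_pure; elim/ext_ind: m => [|b m|m n hm hn].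
    * by rewrite ext_bc0 scaler0 ext_pure0r ext_lift0.
    * rewrite ext_bc_pure ext_liftZ ext_lift_pure mkLE scalerA ext_scale_pure mulr1.
      by rewrite [ext_pure f b m]ext_pure1 ext_pureZ.
    * by rewrite ext_bcD scalerDr ext_liftD hm hn ext_pureDr.
  + by rewrite !ext_liftD hx hy.
- elim/ext_ind: x => [|c m|x y hx hy]; first by rewrite !ext_lift0.
  + rewrite ext_lift_pure mkLE ext_liftZ ext_lift_pure scale1r ext_bc_pure rmorph1.
    by rewrite ext_scale_pure mulr1.
  + by rewrite !ext_liftD hx hy.
Qed.
End OneModule.

Lemma ext_bc_map (M N : lmodType A) (i : {linear M -> N}) x :
  ext_bc N (ext_map i x) = ext_map i (ext_bc M x).
Proof.
elim/ext_ind: x => [|b m|x y hx hy]; first by rewrite ext_bc0 !ext_mapZero ext_bc0.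
- by rewrite ext_map_pure !ext_bc_pure ext_map_pure.
- by rewrite ext_bcD !ext_mapD ext_bcD hx hy.
Qed.

Lemma ext_tower_map (M N : lmodType A) (i : {linear M -> N}) x :
  ext_lift (ext_bc N) (ext_map (ext_map i) x) = ext_map i (ext_lift (ext_bc M) x).
Proof.
elim/ext_ind: x => [|b m|x y hx hy]; first by rewrite ext_lift0 !ext_mapZero ext_lift0.
- by rewrite ext_map_pure !ext_lift_pure ext_bc_map ext_mapZ.
- by rewrite ext_liftD !ext_mapD ext_liftD hx hy.
Qed.

Lemma flat_comp : flat f -> flat g -> flat k.
Proof.
move=> hf hg M N i inj x y.
have [u _ ux] := ext_tower M; have [w wy _] := ext_tower N.
rewrite -[x]ux -[y]ux -!ext_tower_map => /(bij_inj (ext_tower N)) /hg h.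
by congr ext_lift; apply: h; apply: hf.
Qed.
End BaseChange.

Section FlatExactness.
Variables (A B : comPzRingType) (f : {rmorphism A -> B}).

Lemma im_submod (R : comPzRingType) (M N : lmodType R) (u : {linear M -> N}) :
  submod (fun n => exists m, u m = n).
Proof.
split; first by exists 0; rewrite linear0.
- by move=> x y [m <-] [n <-]; exists (m + n); rewrite linearD.
- by move=> a x [m <-]; exists (a *: m); rewrite linearZ.
Qed.
Lemma ker_submod (R : comPzRingType) (M N : lmodType R) (u : {linear M -> N}) :
  submod (fun m => u m = 0).
Proof.
split; first by rewrite linear0.
- by move=> x y; rewrite linearD => -> ->; rewrite addr0.
- by move=> a x h; rewrite linearZ /= h scaler0.
Qed.

Lemma ext_map_surj (M N : lmodType A) (v : {linear M -> N}) :
  (forall n, exists m, v m = n) -> forall y : ext f N, exists x, ext_map v x = y.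
Proof.
move=> hv; elim/ext_ind => [|b n|x y [x' <-] [y' <-]].
- by exists 0; rewrite ext_mapZero.
- by have [m <-] := hv n; exists (ext_pure f b m); rewrite ext_map_pure.
- by exists (x' + y'); rewrite ext_mapD.
Qed.

(** Right exactness: the quotient of B ⊗ M by the image of B ⊗ M' receives a map
    from B ⊗ N, defined with the help of preimages in M. *)
Lemma ext_rexact (M' M N : lmodType A) (u : {linear M' -> M}) (v : {linear M -> N}) :
  (forall n, exists m, v m = n) -> (forall m, v m = 0 -> exists m', u m' = m) ->
  forall x : ext f M, ext_map v x = 0 -> exists y, ext_map u y = x.
Proof.
move=> hv hu x hx.
pose hS := im_submod (ext_map u : {linear ext f M' -> ext f M}).
pose s (n : N) : M := projT1 (boolp.cid (hv n)).
have vs n : v (s n) = n by rewrite /s; case: boolp.cid.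
pose w (n : N) : quomod hS := qproj hS (ext_pure f 1 (s n)).
have wv m : w (v m) = qproj hS (ext_pure f 1 m).
  apply/subr0_eq; rewrite /w -linearB; apply/qproj0.
  have [|m' e] := hu (s (v m) - m); first by rewrite linearB vs subrr.
  by exists (ext_pure f 1 m'); rewrite /= ext_map_pure e linearB.
have wl : linear_for (f \; *:%R) w.
  move=> a n1 n2; have [m1 <-] := hv n1; have [m2 <-] := hv n2.
  rewrite -linearP !wv ext_pureDr ext_pureZ mul1r ext_pure1 linearP /=.
  by [].
have e y : ext_lift (mkL wl) (ext_map v y) = qproj hS y.
  elim/ext_ind: y => [|b m|y z hy hz]; first by rewrite ext_mapZero ext_lift0 linear0.
  - by rewrite ext_map_pure ext_lift_pure mkLE wv [ext_pure f b m]ext_pure1 linearZ.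
  - by rewrite ext_mapD ext_liftD hy hz linearD.
by apply/(qproj0 hS); rewrite -e hx ext_lift0.
Qed.

(** Factor v through its image: the surjection onto the image is dealt with by right exactness,
    the inclusion of the image by flatness. *)
Lemma flat_exact (M' M N : lmodType A) (u : {linear M' -> M}) (v : {linear M -> N}) :
  flat f -> (forall m, v m = 0 -> exists m', u m' = m) ->
  forall x : ext f M, ext_map v x = 0 -> exists y, ext_map u y = x.
Proof.
move=> hf hu x hx.
pose hS := im_submod v; pose i : {linear submodm hS -> N} := @smval _ _ _ hS.
have vS m : exists y, i y = v m by apply: smval_ex; exists m.
pose v' m := projT1 (boolp.cid (vS m)).
have iv m : i (v' m) = v m by rewrite /v'; case: boolp.cid.
have ii : injective i by exact: smval_inj.
have v'l : linear v'.
  by move=> a m n; apply: ii; rewrite linearP !iv linearP.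
apply: (@ext_rexact _ _ _ u (mkL v'l)).
- move=> n; have [m e] := svalP n; exists m; apply: ii; rewrite mkLE iv //.
- by move=> m; rewrite mkLE => e; apply: hu; rewrite -iv e linear0.
- apply: (hf _ _ i ii); rewrite ext_mapZero ext_map_comp -hx; apply: ext_map_eq => m.
  exact: iv.
Qed.

End FlatExactness.

(** Universal injectivity. Faithfully flat families have this property, and it passes to every
    family through which a pure family factors, whether or not that family is flat. *)
Definition pure (T : comPzRingType) (I : Type) (B : I -> comPzRingType)
    (g : forall i, {rmorphism T -> B i}) : Prop :=
  forall (Q : lmodType T) (q : Q), (forall i, ext_pure (g i) 1 q = 0) -> q = 0.

Section Pure.
Variables (T : comPzRingType) (I : Type) (B : I -> comPzRingType)
  (g : forall i, {rmorphism T -> B i}) (gP : pure g).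

Lemma pure_eq (Q : lmodType T) (q q' : Q) :
  (forall i, ext_pure (g i) 1 q = ext_pure (g i) 1 q') -> q = q'.
Proof.
move=> h; apply/subr0_eq; apply: gP => i.
have := linearB (ext_in (g i) Q) q q'; rewrite /= h => ->; exact: subrr.
Qed.

(** Apply purity to the class of n in the cokernel of u. *)
Lemma pure_mem (M N : lmodType T) (u : {linear M -> N}) (n : N) :
  (forall i, exists z : ext (g i) M, ext_map u z = ext_pure (g i) 1 n) -> exists m, u m = n.
Proof.
move=> h; apply/(qproj0 (im_submod u)); apply: gP => i.
have [z e] := h i.
rewrite -ext_map_pure -e ext_map_comp; apply: ext_map0 => m /=.
by apply/qproj0; exists m.
Qed.
End Pure.

Section FiniteProduct.
Variables (T : comPzRingType) (n : nat) (N : 'I_n -> lmodType T).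
Definition dinj_fun (j : 'I_n) (y : N j) : dprodmod N :=
  fun i => match eqP with ReflectT e => eq_rect j N y i e | ReflectF _ => 0 end.
Arguments dinj_fun j y : clear implicits.
Lemma dinj_funE j y : dinj_fun j y j = y.
Proof. by rewrite /dinj_fun; case: eqP => // e; rewrite (Prop_irrelevance e erefl). Qed.
Lemma dinj_fun0 j y i : j != i -> dinj_fun j y i = 0.
Proof. by rewrite /dinj_fun; case: eqP. Qed.
Lemma dinj_linear j : linear (dinj_fun j).
Proof.
move=> a x y; apply: dprod_eq => i.
rewrite -[RHS]/(a *: dinj_fun j x i + dinj_fun j y i).
case: (eqVneq j i) => [e|ne]; last by rewrite !dinj_fun0 // scaler0 addr0.
by case: i / e; rewrite !dinj_funE.
Qed.
Definition dinj j : {linear N j -> dprodmod N} := mkL (@dinj_linear j).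

Lemma dprod_sumE (x : dprodmod N) : x = \sum_j dinj j (dpr j x).
Proof.
apply: dprod_eq => i; rewrite -[RHS]/(dpr i _) linear_sum (bigD1 i) //= big1 ?addr0.
  by rewrite [RHS]dinj_funE.
by move=> j ji; apply: dinj_fun0.
Qed.

(** A finite product is a sum of its factors, so extension of scalars commutes with it. *)
Lemma ext_dprod_eq0 (B : comPzRingType) (g : {rmorphism T -> B}) (x : ext g (dprodmod N)) :
  (forall j, ext_map (dpr j : {linear dprodmod N -> N j}) x = 0) -> x = 0.
Proof.
move=> h.
have -> : x = \sum_j ext_map (dinj j) (ext_map (dpr j : {linear dprodmod N -> N j}) x).
  elim/ext_ind: x {h} => [|b m|x y hx hy].
  - by rewrite big1 // => j _; rewrite !ext_mapZero.
  - under eq_bigr do rewrite !ext_map_pure ext_pure1.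
    rewrite -scaler_sumr -(linear_sum (ext_in g (dprodmod N))) /= -dprod_sumE.
    by rewrite -ext_pure1.
  - by rewrite {1}hx {1}hy -big_split; apply: eq_bigr => j _; rewrite !ext_mapD.
by rewrite big1 // => j _; rewrite h ext_mapZero.
Qed.
End FiniteProduct.

(** Descent of elements. The x j form an element of the product of the B j ⊗ N; after extension
    of scalars to B i it is, by the compatibility, the image of x i, so that it comes from N by
    purity. Finiteness is used because only finite products commute with B i ⊗ -. *)
Lemma pure_glue (T : comPzRingType) (n : nat) (B : 'I_n -> comPzRingType)
    (g : forall i, {rmorphism T -> B i}) (gP : pure g) (N : lmodType T)
    (v : forall j, {linear N -> rstmod (g j) (ext (g j) N)})
    (x : forall j, ext (g j) N) :
  (forall j m, v j m = ext_pure (g j) 1 m) ->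
  (forall i j, ext_map (v j) (x i) = ext_pure (g i) 1 (x j : rstmod (g j) (ext (g j) N))) ->
  exists m, forall j, x j = ext_pure (g j) 1 m.
Proof.
move=> vE h; pose Q := dprodmod (fun j => rstmod (g j) (ext (g j) N)).
pose u0 (m : N) : Q := fun j => v j m.
have ul : linear u0 by move=> a m m'; apply: dprod_eq => j; rewrite /u0 linearP.
pose q : Q := x.
have [|m e] := @pure_mem _ _ _ _ gP N Q (mkL ul) q.
  move=> i; exists (x i); apply/subr0_eq; apply: ext_dprod_eq0 => j.
  by rewrite ext_mapB ext_map_comp ext_map_pure -h (ext_map_eq (j := v j)) ?subrr.
by exists m => j; rewrite -vE -[x j]/(q j) -e.
Qed.

(** * Pushouts of algebras *)

Section Pushout.
Variables (R : cring) (T B B' : calg R) (f : calg_hom T B) (f' : calg_hom T B').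

Inductive porel : tm (carrier B) (carrier B') -> tm (carrier B) (carrier B') -> Prop :=
| porelD (b c : B') : porel (Gen (b + c)) (Add (Gen b) (Gen c))
| porelM (b c : B') : porel (Gen (b * c)) (Mul (Gen b) (Gen c))
| porel1 : porel (Gen (1 : B')) (Cst (1 : B))
| porelT (t : T) : porel (Gen (f' t)) (Cst (f t)).

(** The ring B ⊗_T B', as the B-algebra generated by the elements of B': unlike the module
    quotient ext, a presented ring is small, hence again an R-algebra of the site. *)
Definition push : calg R := pcalg porel.
Definition poL : calg_hom B push := pinc porel.

Lemma pogenD (b c : B') : pgen porel (b + c) = pgen porel b + pgen porel c.
Proof. by rewrite -!ptmG -ptmD; apply/ptm_eq/teq_rel/porelD. Qed.
Lemma pogenM (b c : B') : pgen porel (b * c) = pgen porel b * pgen porel c.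
Proof. by rewrite -!ptmG -ptmM; apply/ptm_eq/teq_rel/porelM. Qed.
Lemma pogen1 : pgen porel (1 : B') = 1.
Proof. by rewrite -[RHS](rmorph1 poL) -ptmG -ptmC; apply/ptm_eq/teq_rel/porel1. Qed.
Lemma pogenT t : pgen porel (f' t) = poL (f t).
Proof. by rewrite -ptmG -ptmC; apply/ptm_eq/teq_rel/porelT. Qed.

Definition pogen (b : B') : push := pgen porel b.
Lemma pogen_zmod : zmod_morphism pogen.
Proof. by move=> b c; apply: (@addIr _ (pogen c)); rewrite subrK /pogen -pogenD subrK. Qed.
Lemma pogen_monoid : monoid_morphism pogen.
Proof. by split; [exact: pogen1|exact: pogenM]. Qed.
HB.instance Definition _ := GRing.isZmodMorphism.Build B' push pogen pogen_zmod.
HB.instance Definition _ := GRing.isMonoidMorphism.Build B' push pogen pogen_monoid.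
Lemma poRP r : (pogen : {rmorphism B' -> push}) (calg_str B' r) = calg_str push r.
Proof. by rewrite -(calg_funP f') -(calg_funP poL) -(calg_funP f) [LHS]pogenT. Qed.
Definition poR : calg_hom B' push := CAlgHom poRP.

Lemma po_comm t : poR (f' t) = poL (f t). Proof. exact: pogenT. Qed.
Lemma po_commE : calg_comp poR f' = calg_comp poL f.
Proof. by apply: calg_hom_ext => t; apply: po_comm. Qed.

Lemma push_ind (P : push -> Prop) : (forall b, P (poL b)) -> (forall b, P (poR b)) ->
  (forall x y, P x -> P y -> P (x + y)) -> (forall x y, P x -> P y -> P (x * y)) -> forall x, P x.
Proof. by move=> h1 h2 h3 h4; apply: (@pcalg_ind R B _ porel P) => // i; apply: h2. Qed.

Lemma push_hom_eq (E : comPzRingType) (h k : {rmorphism push -> E}) :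
  (forall b, h (poL b) = k (poL b)) -> (forall b, h (poR b) = k (poR b)) -> h =1 k.
Proof. by move=> h1 h2; apply: pcalg_hom_eq => // i; apply: h2. Qed.

Section Copair.
Variables (C : calg R) (g : calg_hom B C) (g' : calg_hom B' C).
Hypothesis hg : forall t, g (f t) = g' (f' t).
Lemma copair_rel s t : porel s t -> tev g g' s = tev g g' t.
Proof.
by case=> [b c|b c||u] /=; rewrite ?rmorphD ?rmorphM ?rmorph1 ?hg.
Qed.
Definition copair : calg_hom push C := pext copair_rel.
Lemma copairL b : copair (poL b) = g b. Proof. exact: pext_inc. Qed.
Lemma copairR b : copair (poR b) = g' b. Proof. exact: pext_gen. Qed.
End Copair.

Section PushoutBaseChange.
Variable N : lmodType B'.
Let G : lmodType B := ext f (rstmod f' N).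

Lemma rst_act_linear (b : B') : linear (fun n : rstmod f' N => b *: (n : N) : rstmod f' N).
Proof. by move=> t x y; rewrite !rstE scalerDr !scalerA mulrC. Qed.
Definition rst_act b : {linear rstmod f' N -> rstmod f' N} := mkL (rst_act_linear b).
Definition po_act (b : carrier B') : {linear G -> G} := ext_map (rst_act b).
Lemma po_act_pure b c n : po_act b (ext_pure f c n) = ext_pure f c ((b : B') *: (n : N) : rstmod f' N).
Proof. by rewrite /po_act /= ext_map_pure. Qed.
Lemma po_act_comm b c v : po_act b (po_act c v) = po_act c (po_act b v).
Proof.
rewrite /po_act /= !ext_map_comp; apply: ext_map_eq => n /=.
by rewrite ?mkLE !scalerA mulrC.
Qed.
Lemma po_act_rel s t : porel s t -> forall v,
  @tact R B (carrier B') G po_act s v = @tact R B (carrier B') G po_act t v.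
Proof.
case=> [b c|b c||u] v /=; elim/ext_ind: v => [|d n|x y hx hy].
all: rewrite ?ext_mapZero ?addr0 ?scaler0 ?ext_mapD ?hx ?hy ?scalerDr //.
- rewrite !ext_map_pure -ext_pureDr; congr (ext_pure f d _); exact: (scalerDl (n : N) (b : B') (c : B')).
- by rewrite addrACA.
- rewrite !ext_map_pure; congr (ext_pure f d _); exact: (esym (scalerA (b : B') (c : B') (n : N))).
- rewrite ext_map_pure scale1r; congr (ext_pure f d _); exact: (scale1r (n : N)).
- by rewrite ext_map_pure ext_scale_pure mulrC -ext_pureZ.
Qed.

(** B ⊗_T N is a module over B ⊗_T B', through the action of B' on N; the inverse of po_fwd
    below is linear for this structure. *)
Definition po_mod : lmodType push :=
  @pact_mod R B (carrier B') porel G po_act po_act_comm po_act_rel.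

Lemma po_inv_linear : linear_for (poR \; *:%R) (fun n : N => ext_pure f 1 (n : rstmod f' N) : po_mod).
Proof.
move=> b x y; rewrite [LHS](@ext_pureDr _ _ _ (rstmod f' N)); congr (_ + _).
by rewrite [RHS](@pact_gen _ _ _ _ _ _ po_act_comm po_act_rel) po_act_pure.
Qed.
Definition po_inv : ext poR N -> po_mod := ext_lift (mkL po_inv_linear).

Lemma po_fwd0_linear : linear_for (f \; *:%R)
  (fun n : rstmod f' N => ext_pure poR 1 (n : N) : rstmod poL (ext poR N)).
Proof.
move=> t x y; rewrite /= !rstE ext_pureDr ext_pureZ mul1r; congr (_ + _).
by rewrite po_comm ext_pure1.
Qed.
(** The isomorphism B ⊗_T N -> (B ⊗_T B') ⊗_B' N. *)
Definition po_fwd : {linear G -> rstmod poL (ext poR N)} := ext_lift (mkL po_fwd0_linear).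
Lemma po_fwd_pure b n : po_fwd (ext_pure f b n) = ext_pure poR (poL b) (n : N) :> ext poR N.
Proof. by rewrite /po_fwd /= ext_lift_pure ?mkLE rstE -ext_pure1. Qed.

Lemma po_fwd_act (s : push) (v : G) : po_fwd (s *: (v : po_mod)) = s *: (po_fwd v : ext poR N).
Proof.
elim/push_ind: s v => [b|b|s t hs ht|s t hs ht] v.
- by rewrite (@pact_inc _ _ _ _ _ _ po_act_comm po_act_rel) linearZ.
- rewrite [_ *: (v : po_mod)](@pact_gen _ _ _ _ _ _ po_act_comm po_act_rel).
  elim/ext_ind: v => [|d n|x y hx hy].
  + by rewrite !linear0.
  + rewrite po_act_pure !po_fwd_pure ext_scale_pure.
    by rewrite ext_pureZ mulrC.
  + by rewrite !linearD; congr (_ + _).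
- by rewrite !scalerDl linearD hs ht.
- by rewrite -!scalerA hs ht.
Qed.

Lemma po_fwd_bij : bijective po_fwd.
Proof.
exists po_inv => x.
- elim/ext_ind: x => [|b n|x y hx hy].
  + by rewrite linear0; exact: ext_lift0.
  + rewrite po_fwd_pure /po_inv ext_lift_pure ?mkLE.
    rewrite (@pact_inc _ _ _ _ _ _ po_act_comm po_act_rel).
    by rewrite ext_scale_pure mulr1.
  + by rewrite linearD [LHS]ext_liftD; congr (_ + _).
- elim/ext_ind: x => [|b n|x y hx hy].
  + by rewrite /po_inv ext_lift0 linear0.
  + rewrite /po_inv ext_lift_pure ?mkLE po_fwd_act po_fwd_pure rmorph1.
    by rewrite ext_scale_pure mulr1.
  + by rewrite /po_inv ext_liftD linearD; congr (_ + _).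
Qed.

End PushoutBaseChange.

Lemma rst_map_linear (N P : lmodType B') (i : {linear N -> P}) :
  linear (i : rstmod f' N -> rstmod f' P).
Proof. by move=> t x y; rewrite !rstE linearP. Qed.
Definition rst_map (N P : lmodType B') (i : {linear N -> P}) :
  {linear rstmod f' N -> rstmod f' P} := mkL (rst_map_linear i).

Lemma po_fwd_map (N P : lmodType B') (i : {linear N -> P}) v :
  po_fwd P (ext_map (rst_map i) v) = ext_map i (po_fwd N v : ext poR N).
Proof.
elim/ext_ind: v => [|b n|x y hx hy].
- by rewrite ext_mapZero !linear0.
- by rewrite ext_map_pure !po_fwd_pure ext_map_pure ?mkLE.
- by rewrite ext_mapD !linearD; congr (_ + _).
Qed.

(** By po_fwd the base change of f has the exactness properties of f. *)
Lemma flat_push : flat f -> flat poR.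
Proof.
move=> hf N P i ii x y.
have [u _ ux] := po_fwd_bij N.
rewrite -[x]ux -[y]ux -!po_fwd_map => /(bij_inj (po_fwd_bij P)) h.
by congr (po_fwd N _); apply: (hf _ _ (rst_map i) ii).
Qed.

End Pushout.

(** By po_fwd an element which dies in the base change dies in every B i ⊗_T N. *)
Lemma pure_push (R : cring) (T B' : calg R) (I : Type) (B : I -> calg R)
    (f : forall i, calg_hom T (B i)) (f' : calg_hom T B') :
  pure (fun i => f i : {rmorphism T -> B i}) ->
  pure (fun i => poR (f i) f' : {rmorphism B' -> push (f i) f'}).
Proof.
move=> hp Q q h; apply: (hp (rstmod f' Q)) => i.
apply: (bij_inj (po_fwd_bij (f i) f' Q)); rewrite po_fwd_pure linear0 rmorph1.
exact: h.
Qed.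

(** Purity is transitive; the composite family may be replaced by a coarser one. *)
Lemma pure_comp (T : comPzRingType) (I : Type) (J : I -> Type) (B : I -> comPzRingType)
    (C : forall i, J i -> comPzRingType) (g : forall i, {rmorphism T -> B i})
    (h : forall i j, {rmorphism B i -> C i j})
    (K : Type) (D : K -> comPzRingType) (k : forall x, {rmorphism T -> D x}) :
  pure g -> (forall i, pure (h i)) ->
  (forall i j, exists (x : K) (e : {rmorphism D x -> C i j}), forall t, e (k x t) = h i j (g i t)) ->
  pure k.
Proof.
move=> hg hh hk Q q hq; apply: hg => i; apply: hh => j.
have [x [e he]] := hk i j.
pose w : {rmorphism T -> C i j} := h i j \o g i.
have h1 : forall a, w a = h i j (g i a) by [].
have h2 : forall a, w a = e (k x a) by move=> a; rewrite he.
apply: (bij_inj (ext_tower h1 Q)); rewrite ext_lift0 ext_lift_pure scale1r ext_bc_pure rmorph1.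
rewrite -(rmorph1 e) -(ext_bc_pure h2) hq; exact: ext_bc0.
Qed.

(** * Prime ideals *)

Section Primes.
Local Open Scope classical_set_scope.
Variable E : comPzRingType.

(** The notion of prime_ideal for rings without algebra structure. *)
Record prime (P : E -> Prop) : Prop := Prime {
  prime_idl : ideal P; prime_n1 : ~ P 1;
  prime_mul : forall x y, P (x * y) -> P x \/ P y }.

(** Krull: an ideal which is maximal among those missing a multiplicative set is prime. *)
Lemma prime_exists (J S : E -> Prop) : ideal J -> S 1 ->
  (forall x y, S x -> S y -> S (x * y)) -> (forall x, J x -> ~ S x) ->
  exists P, [/\ prime P, forall x, J x -> P x & forall x, P x -> ~ S x].
Proof.
move=> hJ S1 SM JS.
(* J is adjoined to X so that the union of the empty chain is an ideal as well *)
pose good (X : set E) := ideal (fun x => X x \/ J x) /\ forall x, X x -> ~ S x.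
have [F FP Ftot|P [[Pid PS] Pmax]] := @Zorn_bigcup E good.
  split; last by move=> x [X FX Xx]; apply: (FP X FX).2.
  split.
  - by right; apply: ideal0.
  - move=> x y [[X FX Xx]|Jx] [[Y FY Yy]|Jy].
    + have [XY|YX] := Ftot X Y FX FY.
        have [|h] := idealD (FP Y FY).1 (x := x) (y := y) (or_introl (XY _ Xx)) (or_introl Yy); last by right.
        by left; exists Y.
      have [|h] := idealD (FP X FX).1 (x := x) (y := y) (or_introl Xx) (or_introl (YX _ Yy)); last by right.
      by left; exists X.
    + have [|h] := idealD (FP X FX).1 (x := x) (y := y) (or_introl Xx) (or_intror Jy); last by right.
      by left; exists X.
    + have [|h] := idealD (FP Y FY).1 (x := x) (y := y) (or_intror Jx) (or_introl Yy); last by right.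
      by left; exists Y.
    + by right; apply: idealD.
  - move=> a x [[X FX Xx]|Jx]; last by right; apply: idealM.
    have [|h] := idealM (FP X FX).1 a (x := x) (or_introl Xx); last by right.
    by left; exists X.
pose Q x := P x \/ J x.
have QS x : Q x -> ~ S x by case=> [hx|hx]; [exact: PS|exact: JS].
have QI : ideal Q by [].
pose add a y := exists q b, Q q /\ y = q + b * a.
have addI a : ideal (add a).
  split; first by exists 0, 0; rewrite mul0r addr0; split=> //; apply: ideal0.
  - move=> x y [q [b [hq ->]]] [q' [b' [hq' ->]]]; exists (q + q'), (b + b').
    by rewrite mulrDl addrACA; split=> //; apply: idealD.
  - move=> c x [q [b [hq ->]]]; exists (c * q), (c * b).
    by rewrite mulrDr mulrA; split=> //; apply: idealM.
have Qadd a x : Q x -> add a x by move=> hx; exists x, 0; rewrite mul0r addr0.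
have hit a : ~ Q a -> exists s, S s /\ add a s.
  move=> nQ; apply: contrapT => /forallNP hs; apply: (@Pmax (add a)).
    split; first by move=> x Px; apply: Qadd; left.
    move=> h; apply: nQ; left; apply: h; exists 0, 1.
    by rewrite add0r mul1r; split=> //; apply: ideal0.
  split; last by move=> x hx sx; apply: (hs x).
  have -> : (fun x => add a x \/ J x) = add a; last exact: addI.
  apply/funext => x; apply/propext; split=> [[//|Jx]|]; last by left.
  by apply: Qadd; right.
exists Q; split=> //; last by move=> x Jx; right.
split=> // [Q1|x y Qxy]; first exact: (QS _ Q1).
apply: contrapT => /not_orP[/hit [s [Ss [q [b [hq es]]]]] /hit [t [St [r [c [hr et]]]]]].
apply: (QS (s * t)); last exact: SM.
have -> : s * t = (c * y + r) * q + (b * x) * r + (b * c) * (x * y).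
  rewrite es et !mulrDl !mulrDr -!addrA.
  rewrite [b * x * (c * y)]mulrACA [q * r]mulrC [q * (c * y)]mulrC.
  by rewrite addrCA.
by apply: idealD => //; [apply: idealD => //; apply: idealM|apply: idealM].
Qed.

Lemma maximal_exists (J : E -> Prop) : ideal J -> ~ J 1 ->
  exists P, prime P /\ forall x, J x -> P x.
Proof.
move=> hJ J1; have [||x y -> ->|x Jx e|P [hP h _]] := @prime_exists J (fun x => x = 1) => //.
- by rewrite mulr1.
- by apply: J1; rewrite -e.
- by exists P.
Qed.
End Primes.

Lemma primeE (R : cring) (A : calg R) (p : A -> Prop) : prime_ideal p <-> prime p.
Proof.
split=> [[h0 hD hM h1 h]|[[h0 hD hM] h1 h]]; last by split.
by split=> //; split.
Qed.

Lemma prime_pre (A B : comPzRingType) (f : {rmorphism A -> B}) (q : B -> Prop) :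
  prime q -> prime (fun a => q (f a)).
Proof.
move=> [[h0 hD hM] h1 h]; split; last by move=> x y; rewrite rmorphM => /h.
  split; first by rewrite rmorph0.
  - by move=> x y; rewrite rmorphD; apply: hD.
  - by move=> a x; rewrite rmorphM; apply: hM.
by rewrite rmorph1.
Qed.

(** * Noetherian modules and Krull's lemma *)

Section Noetherian.
Variables (S : comPzRingType) (V : lmodType S).
Implicit Types (Y : seq S) (L : V -> Prop) (l v : seq V).

(** The additive subgroups stable under a finite set Y of scalars are the modules over the
    subring Z[Y]. This ring is Noetherian; speaking of stable subgroups of one S-module avoids
    forming Z[Y] and the modules over it. *)
Record stable Y L : Prop := Stable {
  st0 : L 0; stB : forall x y, L x -> L y -> L (x - y);
  stZ : forall y x, y \in Y -> L x -> L (y *: x) }.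

Lemma stN Y L (hL : stable Y L) x : L x -> L (- x).
Proof. by move=> h; rewrite -sub0r; apply: (stB hL) => //; apply: st0 hL. Qed.
Lemma stD Y L (hL : stable Y L) x y : L x -> L y -> L (x + y).
Proof. by move=> h k; rewrite -[y]opprK; apply: (stB hL) => //; apply: (stN hL). Qed.
Lemma stX Y L (hL : stable Y L) y k x : y \in Y -> L x -> L (y ^+ k *: x).
Proof.
by move=> yY Lx; elim: k => [|k ih]; rewrite ?expr0 ?scale1r // exprS -scalerA; apply: (stZ hL).
Qed.
Lemma st_sum Y L (hL : stable Y L) (I : finType) (x : I -> V) :
  (forall i, L (x i)) -> L (\sum_i x i).
Proof. by move=> h; elim/big_ind: _ => // [|u w]; [exact: st0 hL|exact: (stD hL)]. Qed.

Inductive span Y l : V -> Prop :=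
| span_in x : x \in l -> span Y l x
| span_0 : span Y l 0
| span_B x y : span Y l x -> span Y l y -> span Y l (x - y)
| span_Z y x : y \in Y -> span Y l x -> span Y l (y *: x).

Lemma span_stable Y l : stable Y (span Y l).
Proof. by split; [exact: span_0|exact: span_B|exact: span_Z]. Qed.
Lemma span_min Y l L : stable Y L -> (forall x, x \in l -> L x) -> forall x, span Y l x -> L x.
Proof.
move=> hL h x; elim=> {x} [x /h //||x y _ k _ k'|y x yY _ k].
- exact: st0 hL.
- exact: (stB hL).
- exact: (stZ hL).
Qed.
Lemma span_sub Y l Y' l' : {subset Y <= Y'} -> {subset l <= l'} ->
  forall x, span Y l x -> span Y' l' x.
Proof.
move=> YY ll; apply: span_min => [|x /ll]; last exact: span_in.
by split; [exact: span_0|exact: span_B|move=> y x /YY; exact: span_Z].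
Qed.

Lemma span_nil Y x : span Y [::] x -> x = 0.
Proof.
apply: (span_min (L := fun x => x = 0)) => //; split=> // [x' y -> ->|y x' _ ->].
  by rewrite subrr.
by rewrite scaler0.
Qed.

Definition noeth Y v := forall L, stable Y L -> (forall x, L x -> span Y v x) ->
  exists l, (forall x, x \in l -> L x) /\ forall x, L x -> span Y l x.

Lemma st_mulrz Y L (hL : stable Y L) x (k : int) : L x -> L (x *~ k).
Proof.
move=> h; have hn n : L (x *+ n).
  by elim: n => [|n ih]; rewrite ?mulr0n ?mulrS; [exact: (st0 hL)|exact: (stD hL)].
by case: k => n; rewrite ?NegzE ?mulrNz ?pmulrn; [exact: hn|apply: (stN hL); exact: hn].
Qed.

Lemma span_cons0 (v0 : V) v x : span [::] (v0 :: v) x ->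
  exists (k : int) w, span [::] v w /\ x = v0 *~ k + w.
Proof.
elim=> {x} [x||x y _ [k [w [hw ->]]] _ [k' [w' [hw' ->]]]|//].
- rewrite inE => /orP[/eqP ->|xv]; first by exists 1, 0; rewrite mulr1z addr0; split=> //; exact: span_0.
  by exists 0, x; rewrite mulr0z add0r; split=> //; exact: span_in.
- by exists 0, 0; rewrite mulr0z add0r; split=> //; exact: span_0.
- exists (k - k'), (w - w'); rewrite mulrzBr opprD addrACA; split=> //; exact: span_B.
Qed.

(** Subgroups of a finitely generated abelian group are finitely generated: divide with
    remainder by the smallest positive coefficient of v0 which occurs in L. *)
Lemma noeth_nil v : noeth [::] v.
Proof.
elim: v => [|v0 v ih] L hL Lv.
  by exists [::]; split=> // x /Lv /span_nil ->; exact: span_0.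
have hL' : stable [::] (fun x => L x /\ span [::] v x).
  split=> //; first by split; [exact: st0 hL|exact: span_0].
  by move=> x y [h h'] [k k']; split; [exact: (stB hL)|exact: span_B].
have [l' [l'L l'S]] := ih _ hL' (fun x h => h.2).
pose P n := `[< (0 < n)%N /\ exists w, span [::] v w /\ L (v0 *+ n + w) >].
have [eP|nP] := pselect (exists n, P n); last first.
  exists l'; split=> [x /l'L[]//|x Lx]; apply: l'S; split=> //.
  have [k [w [hw ex]]] := span_cons0 (Lv _ Lx).
  have [k0|] := eqVneq k 0; first by rewrite ex k0 mulr0z add0r.
  case: k ex => n ex n0; exfalso; apply: nP.
    exists n; apply/asboolP; split; first by rewrite lt0n; move: n0; apply: contra => /eqP ->.
    by exists w; split=> //; rewrite -[v0 *+ n]/(v0 *~ n%:Z) -ex.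
  exists n.+1; apply/asboolP; split=> //; exists (- w); split; first exact: (stN (span_stable _ _)).
  by rewrite -[v0 *+ n.+1]opprK -opprD; apply: (stN hL); move: Lx; rewrite ex NegzE mulrNz.
have [n0 /asboolP[n0_gt0 [w0 [hw0 Lx0]]] nmin] := ex_minnP eP.
set x0 := v0 *+ n0 + w0 in Lx0.
exists (x0 :: l'); split=> [x|x Lx].
  by rewrite inE => /orP[/eqP ->//|/l'L[]].
have [k [w [hw ex]]] := span_cons0 (Lv _ Lx).
have sp : stable [::] (span [::] (x0 :: l')) := span_stable _ _.
pose q := (k %/ n0)%Z.
have Lx' : L (x - x0 *~ q) by apply: (stB hL) => //; exact: (st_mulrz hL).
have e' : x - x0 *~ q = v0 *~ (k %% n0)%Z + (w - w0 *~ q).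
  rewrite ex {1}(divz_eq k n0) /x0 mulrzDl opprD.
  rewrite [v0 *~ (_ + _)]mulrzDr [q * _]mulrC mulrzA -pmulrn.
  by rewrite -[X in X + _]addrA addrACA subrr add0r addrA.
have [r er] : exists r : nat, (k %% n0)%Z = r.
  by exists `|(k %% n0)%Z|%N; rewrite gez0_abs // modz_ge0 // lt0n_neq0.
have r0 : r = 0%N.
  apply/eqP; rewrite -leqn0 leqNgt; apply/negP => r_gt0.
  have : (n0 <= r)%N.
    apply: nmin; apply/asboolP; split=> //; exists (w - w0 *~ q); split.
      by apply: span_B => //; exact: (st_mulrz (span_stable _ _)).
    by rewrite -[v0 *+ r]/(v0 *~ r%:Z) -er -e'.
  by rewrite leqNgt -ltz_nat -er ltz_pmod // ltz_nat.
rewrite -[x](subrK (x0 *~ q)); apply: (stD sp).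
  apply: (@span_sub [::] l') => [z //|z zl|]; first by rewrite inE zl orbT.
  apply: l'S; split=> //; rewrite e' er r0 mulr0z add0r.
  by apply: span_B => //; exact: (st_mulrz (span_stable _ _)).
by apply: (st_mulrz sp); apply: span_in; rewrite inE eqxx.
Qed.

(** Hilbert's basis theorem, by comparison of leading coefficients. *)
Lemma noeth_cons y Y v : noeth Y v -> noeth (y :: Y) v.
Proof.
move=> nY L hL Lv.
pose W := span Y v.
have hW : stable Y W := span_stable _ _.
(* D d consists of the polynomials in y of degree less than d with coefficients in W *)
pose D := fix D d x := if d is d'.+1 then exists w x', [/\ W w, D d' x' & x = y ^+ d' *: w + x'] else x = 0.
have DB d : forall x x', D d x -> D d x' -> D d (x - x').
  elim: d => [|d ih] x x' /=; first by move=> -> ->; rewrite subrr.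
  move=> [w [u [hw hu ->]]] [w' [u' [hw' hu' ->]]]; exists (w - w'), (u - u'); split.
  - exact: (stB hW).
  - exact: ih.
  - by rewrite opprD addrACA scalerBr.
have D0 d : D d 0 by elim: d => [//|d ih]; exists 0, 0; split=> //; [exact: st0 hW|rewrite scaler0 addr0].
have DS d x : D d x -> D d.+1 x by move=> h; exists 0, x; split=> //; [exact: st0 hW|rewrite scaler0 add0r].
have Dle d d' x : (d <= d')%N -> D d x -> D d' x.
  by move=> /subnK <-; elim: (d' - d)%N => [//|k ih] /ih; rewrite addSn; apply: DS.
have Dy d : forall x, D d x -> D d.+1 (y *: x).
  elim: d => [x ->|d ih x [w [u [hw /ih hu ->]]]]; first by rewrite scaler0; exact: D0.
  by exists w, (y *: u); split=> //; rewrite scalerDr scalerA -exprS.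
have DYk d k x : D d x -> D (k + d)%N (y ^+ k *: x).
  move=> h; elim: k => [|k ih]; first by rewrite expr0 scale1r.
  by rewrite exprS -scalerA addSn; apply: Dy.
have DZ d z : z \in Y -> forall x, D d x -> D d (z *: x).
  move=> zY; elim: d => [x ->|d ih x [w [u [hw /ih hu ->]]]]; first by rewrite scaler0.
  by exists (z *: w), (z *: u); split=> //; [exact: (stZ hW)|rewrite scalerDr !scalerA mulrC].
have Dspan x : span (y :: Y) v x -> exists d, D d x.
  elim=> {x} [x xv||x x' _ [d h] _ [d' h']|z x zY _ [d h]].
  - by exists 1%N, x, 0; split=> //; [exact: span_in|rewrite expr0 scale1r addr0].
  - by exists 0%N.
  - by exists (maxn d d'); apply: DB; [exact: (Dle _ _ _ (leq_maxl d d'))|exact: (Dle _ _ _ (leq_maxr d d'))].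
  - move: zY; rewrite inE => /orP[/eqP ->|zY]; first by exists d.+1; apply: Dy.
    by exists d; apply: DZ.
(* Ld d consists of the leading coefficients of the polynomials of degree d in L *)
pose Ld d w := W w /\ exists x, L x /\ D d (x - y ^+ d *: w).
have hLd d : stable Y (Ld d).
  split.
  - by split; [exact: st0 hW|exists 0; rewrite scaler0 subrr; split; [exact: st0 hL|exact: D0]].
  - move=> w w' [hw [x [hx dx]]] [hw' [x' [hx' dx']]]; split; first exact: (stB hW).
    exists (x - x'); split; first exact: (stB hL).
    have -> : x - x' - y ^+ d *: (w - w') = (x - y ^+ d *: w) - (x' - y ^+ d *: w'); last exact: DB.
    by rewrite scalerBr !opprD !opprK addrACA.
  - move=> z w zY [hw [x [hx dx]]]; split; first exact: (stZ hW).
    exists (z *: x); split; first by apply: (stZ hL) => //; rewrite inE zY orbT.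
    have -> : z *: x - y ^+ d *: (z *: w) = z *: (x - y ^+ d *: w); last exact: DZ.
    by rewrite scalerBr !scalerA mulrC.
have LdS d w : Ld d w -> Ld d.+1 w.
  move=> [hw [x [hx dx]]]; split=> //; exists (y *: x); split; first by apply: (stZ hL) => //; rewrite inE eqxx.
  by rewrite exprS -scalerA -scalerBr; apply: Dy.
have Ldle d d' w : (d <= d')%N -> Ld d w -> Ld d' w.
  by move=> /subnK <-; elim: (d' - d)%N => [//|k ih] /ih; rewrite addSn; apply: LdS.
have hLi : stable Y (fun w => exists d, Ld d w).
  split.
  - by exists 0%N; exact: st0 (hLd 0%N).
  - move=> w w' [d h] [d' h']; exists (maxn d d'); apply: (stB (hLd _)).
      exact: (Ldle _ _ _ (leq_maxl d d')).
    exact: (Ldle _ _ _ (leq_maxr d d')).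
  - by move=> z w zY [d h]; exists d; apply: (stZ (hLd d)).
have [li [liL liS]] := nY _ hLi (fun w h => let: ex_intro d h' := h in h'.1).
have [d0 hd0] : exists d0, forall w, w \in li -> Ld d0 w.
  elim: li liL {liS} => [|w li ih] h; first by exists 0%N.
  have [|d hd] := ih; first by move=> x xl; apply: h; rewrite inE xl orbT.
  have [|d' hd'] := h w; first by rewrite inE eqxx.
  exists (maxn d d') => x; rewrite inE => /orP[/eqP ->|/hd]; first exact: (Ldle _ _ _ (leq_maxr d d')).
  exact: (Ldle _ _ _ (leq_maxl d d')).
have Ld0 d w : Ld d w -> Ld d0 w.
  by move=> h; apply: (span_min (hLd d0) hd0); apply: liS; exists d.
(* elements of L whose leading coefficients generate Ld d *)
have lift d : exists m : seq V, (forall x, x \in m -> L x) /\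
    forall w, Ld d w -> exists z, span (y :: Y) m z /\ D d (z - y ^+ d *: w).
  have [l [lL lS]] := nY _ (hLd d) (fun w h => h.1).
  have [m [mL mS]] : exists m : seq V, (forall x, x \in m -> L x) /\
      forall w, w \in l -> exists z, z \in m /\ D d (z - y ^+ d *: w).
    elim: l lL {lS} => [|w l ih] h; first by exists [::].
    have [|m [mL mS]] := ih; first by move=> x xl; apply: h; rewrite inE xl orbT.
    have [|_ [x [Lx dx]]] := h w; first by rewrite inE eqxx.
    exists (x :: m); split=> [x'|w']; first by rewrite inE => /orP[/eqP ->|/mL].
    rewrite inE => /orP[/eqP ->|/mS [z [zm dz]]]; first by exists x; rewrite inE eqxx.
    by exists z; rewrite inE zm orbT.
  exists m; split=> // w /lS; apply: (span_min (L := fun w => exists z, span (y :: Y) m z /\ D d (z - y ^+ d *: w))) => [|w' /mS [z [zm dz]]]; last by exists z; split=> //; exact: span_in.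
  split.
  - by exists 0; split; [exact: span_0|rewrite scaler0 subrr].
  - move=> w1 w2 [z1 [h1 d1]] [z2 [h2 d2]]; exists (z1 - z2); split; first exact: span_B.
    have -> : z1 - z2 - y ^+ d *: (w1 - w2) = (z1 - y ^+ d *: w1) - (z2 - y ^+ d *: w2); last exact: DB.
    by rewrite scalerBr !opprD !opprK addrACA.
  - move=> z w1 zY [z1 [h1 d1]]; exists (z *: z1); split; first by apply: span_Z => //; rewrite inE zY orbT.
    have -> : z *: z1 - y ^+ d *: (z *: w1) = z *: (z1 - y ^+ d *: w1); last exact: DZ.
    by rewrite scalerBr !scalerA mulrC.
(* degrees above d0 bring no new leading coefficients *)
have [M [ML MS]] : exists M : seq V, (forall x, x \in M -> L x) /\ forall d, (d <= d0)%N ->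
    forall w, Ld d w -> exists z, span (y :: Y) M z /\ D d (z - y ^+ d *: w).
  elim: d0 {hd0 Ld0} => [|d0 [M [ML MS]]].
    by have [m [mL mS]] := lift 0%N; exists m; split=> // d; rewrite leqn0 => /eqP ->.
  have [m [mL mS]] := lift d0.+1; exists (M ++ m); split=> [x|d].
    by rewrite mem_cat => /orP[/ML|/mL].
  rewrite leq_eqVlt => /orP[/eqP ->|dd] w.
    by move=> /mS [z [hz dz]]; exists z; split=> //; apply: span_sub hz => // x; rewrite mem_cat orbC => ->.
  by move=> /(MS _ dd) [z [hz dz]]; exists z; split=> //; apply: span_sub hz => // x; rewrite mem_cat => ->.
exists M; split=> // x Lx; have [d dx] := Dspan _ (Lv _ Lx).
have hM : stable (y :: Y) (span (y :: Y) M) := span_stable _ _.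
have hML z : span (y :: Y) M z -> L z by apply: span_min.
elim: d x Lx dx => [x _ ->|d ih x Lx [w [u [hw hu ex]]]]; first exact: span_0.
have Lw : Ld d w by split=> //; exists x; split=> //; rewrite ex addrAC subrr add0r.
have [z [hz dz]] : exists z, span (y :: Y) M z /\ D d (z - y ^+ d *: w).
  have [dd|dd] := leqP d d0; first exact: MS.
  have [z [hz dz]] := MS _ (leqnn d0) _ (Ld0 _ _ Lw).
  exists (y ^+ (d - d0) *: z); split; first by apply: (stX hM) => //; rewrite inE eqxx.
  have e : y ^+ d = y ^+ (d - d0) * y ^+ d0 by rewrite -exprD subnK // ltnW.
  by have := DYk _ (d - d0)%N _ dz; rewrite subnK ?(ltnW dd) // scalerBr scalerA -e.
rewrite -[x](subrK z); apply: (stD hM) => //; apply: ih; first by apply: (stB hL) => //; apply: hML.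
have -> : x - z = u - (z - y ^+ d *: w); last exact: DB.
by rewrite ex opprB addrA [u + _]addrC.
Qed.

Lemma noetherian Y v : noeth Y v.
Proof. by elim: Y => [|y Y ih]; [exact: noeth_nil|exact: noeth_cons]. Qed.

End Noetherian.

Section SubringAction.
Variables (S : comPzRingType).

Inductive rgen (Y : seq S) : S -> Prop :=
| rgen_in y : y \in Y -> rgen Y y
| rgen_1 : rgen Y 1
| rgen_B x y : rgen Y x -> rgen Y y -> rgen Y (x - y)
| rgen_M x y : rgen Y x -> rgen Y y -> rgen Y (x * y).

Lemma rgen_0 Y : rgen Y 0.
Proof. by rewrite -(subrr 1); apply: rgen_B; exact: rgen_1. Qed.
Lemma rgen_D Y x y : rgen Y x -> rgen Y y -> rgen Y (x + y).
Proof. by move=> h k; rewrite -[y]opprK -[- y]add0r; apply: rgen_B => //; apply: rgen_B => //; exact: rgen_0. Qed.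
Lemma rgen_sub Y Y' : {subset Y <= Y'} -> forall x, rgen Y x -> rgen Y' x.
Proof.
move=> YY x; elim=> {x} [y /YY|| x y _ h _ k|x y _ h _ k]; first exact: rgen_in.
- exact: rgen_1.
- exact: rgen_B.
- exact: rgen_M.
Qed.
Lemma rgen_act (V : lmodType S) Y (L : V -> Prop) (hL : stable Y L) s :
  rgen Y s -> forall x, L x -> L (s *: x).
Proof.
elim=> {s} [y yY|| s t _ h _ k|s t _ h _ k] x Lx.
- exact: (stZ hL).
- by rewrite scale1r.
- by rewrite scalerBl; apply: (stB hL); [exact: h|exact: k].
- by rewrite -scalerA; apply: h; apply: k.
Qed.
End SubringAction.

Section Krull.
Local Open Scope classical_set_scope.
Variables (S : comPzRingType) (V : lmodType S) (Y : seq S).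
Implicit Types (F : seq S) (N : V -> Prop).

(** The product I N, when N is stable under Y and I is the ideal of Z[Y] generated by a family F
    in Z[Y]. *)
Inductive Isub F N : V -> Prop :=
| Isub_0 : Isub F N 0
| Isub_B x y : Isub F N x -> Isub F N y -> Isub F N (x - y)
| Isub_in f u : f \in F -> N u -> Isub F N (f *: u).

Lemma Isub_stable F N : stable Y N -> stable Y (Isub F N).
Proof.
move=> hN; split; [exact: Isub_0|exact: Isub_B|].
move=> y x yY; elim=> {x} [|x x' _ h _ k|f u fF Nu]; first by rewrite scaler0; exact: Isub_0.
- by rewrite scalerBr; apply: Isub_B.
- by rewrite scalerA mulrC -scalerA; apply: Isub_in => //; apply: (stZ hN).
Qed.
Lemma Isub_mono F N N' : (forall x, N x -> N' x) -> forall x, Isub F N x -> Isub F N' x.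
Proof.
move=> h x; elim=> {x} [|x y _ h1 _ h2|f u fF /h]; [exact: Isub_0|exact: Isub_B|exact: Isub_in].
Qed.
Lemma Isub_le F N : stable Y N -> (forall f, f \in F -> rgen Y f) -> forall x, Isub F N x -> N x.
Proof.
move=> hN hF x; elim=> {x} [|x y _ h _ k|f u /hF fF Nu]; first exact: st0 hN.
- exact: (stB hN).
- exact: (rgen_act hN).
Qed.

Fixpoint Ipow F k N := if k is k'.+1 then Isub F (Ipow F k' N) else N.

Lemma Ipow_prod F k N (L : V -> Prop) : stable [::] L ->
  (forall s u, size s = k -> {subset s <= F} -> N u -> L ((\prod_(f <- s) f) *: u)) ->
  forall x, Ipow F k N x -> L x.
Proof.
move=> hL; elim: k L hL => [|k ih] L hL h x /=.
  by move=> Nx; have := h [::] x erefl; rewrite big_nil scale1r; apply.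
elim=> {x} [|x y _ h1 _ h2|f u fF]; first exact: st0 hL.
- exact: (stB hL).
- apply: (ih (fun u => L (f *: u))) => [|s w sk sF Nw].
    split=> //; first by rewrite scaler0; exact: st0 hL.
    by move=> a b; rewrite scalerBr; exact: (stB hL).
  have := h (f :: s) w; rewrite big_cons scalerA /= sk; apply=> // z.
  by rewrite inE => /orP[/eqP ->|/sF].
Qed.

(** A long product of members of F contains a high power of one of them. *)
Lemma prod_pigeonhole F (M L : V -> Prop) : stable [::] L ->
  (forall f u, f \in F -> M u -> M (f *: u)) ->
  (forall f u, f \in F -> L u -> L (f *: u)) ->
  (forall f, f \in F -> exists m, forall u, M u -> L (f ^+ m *: u)) ->
  exists K, forall s u, (K <= size s)%N -> {subset s <= F} -> M u -> L ((\prod_(f <- s) f) *: u).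
Proof.
move=> hL hM hLF.
have hMs s u : {subset s <= F} -> M u -> M ((\prod_(f <- s) f) *: u).
  elim: s => [|f s ih] sF Mu; first by rewrite big_nil scale1r.
  rewrite big_cons -scalerA; apply: hM; first by apply: sF; rewrite inE eqxx.
  by apply: ih => // z zs; apply: sF; rewrite inE zs orbT.
have hLs s u : {subset s <= F} -> L u -> L ((\prod_(f <- s) f) *: u).
  elim: s => [|f s ih] sF Lu; first by rewrite big_nil scale1r.
  rewrite big_cons -scalerA; apply: hLF; first by apply: sF; rewrite inE eqxx.
  by apply: ih => // z zs; apply: sF; rewrite inE zs orbT.
move=> hm; suff : forall F', {subset F' <= F} -> exists K, forall s u, (K <= size s)%N ->
    {subset s <= F'} -> M u -> L ((\prod_(f <- s) f) *: u).
  by move=> /(_ F); apply.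
elim=> [|f F' ih] sF; first by exists 1%N; case=> // f s u _ /(_ f); rewrite inE eqxx => /(_ isT).
have [|K hK] := ih; first by move=> z zF; apply: sF; rewrite inE zF orbT.
have fF : f \in F by apply: sF; rewrite inE eqxx.
have [m hfm] := hm f fF.
exists (m + K)%N => s u sz sub Mu.
pose s1 := [seq x <- s | pred1 f x]; pose s2 := [seq x <- s | predC (pred1 f) x].
have sF' z : z \in s -> z \in F by move=> /sub /sF.
have s1F : {subset s1 <= F} by move=> z; rewrite mem_filter => /andP[_ /sF'].
have s2F : {subset s2 <= F} by move=> z; rewrite mem_filter => /andP[_ /sF'].
have -> : \prod_(g <- s) g = \prod_(g <- s1) g * \prod_(g <- s2) g.
  by rewrite (bigID (pred1 f)) /= !big_filter.
have e1 : \prod_(g <- s1) g = f ^+ size s1.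
  rewrite /s1; elim: (s) => [|g t it]; first by rewrite big_nil expr0.
  by rewrite /=; case: eqP => // ->; rewrite big_cons it exprS.
have [m1|m1] := leqP m (size s1).
  rewrite e1 -(subnK m1) addnC exprD -mulrA -scalerA; apply: hfm.
  rewrite -scalerA; elim: (size s1 - m)%N => [|k ik]; first by rewrite scale1r; apply: hMs.
  by rewrite exprS -scalerA; apply: hM.
rewrite -scalerA; apply: hLs => //; apply: hK => //.
  have : (size s1 + size s2)%N = size s by rewrite !size_filter count_predC.
  by move=> e; rewrite -(leq_add2l m); apply: (leq_trans sz); rewrite -e leq_add2r ltnW.
move=> z; rewrite mem_filter => /andP[/= zf /sub]; rewrite inE => /orP[/eqP e|//].
by rewrite e eqxx in zf.
Qed.

(** Krull: choose L maximal among the submodules of M with L ∩ N = IN; every f in F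
    satisfies f^m M ⊆ L for some m, because the submodules (L : f^m) stabilize. *)
Lemma krull F (v n : seq V) : (forall f, f \in F -> rgen Y f) ->
  (forall x, x \in n -> span Y v x) ->
  exists K, forall x, span Y n x -> Ipow F K (span Y v) x -> Isub F (span Y n) x.
Proof.
move=> hF nv.
set M := span Y v; set N := span Y n; set IN := Isub F N.
have hM : stable Y M := span_stable _ _.
have hN : stable Y N := span_stable _ _.
have hIN : stable Y IN by apply: Isub_stable.
have NM x : N x -> M x by apply: span_min.
have INN x : IN x -> N x by apply: Isub_le.
(* IN is adjoined to X so that the union of the empty chain is good as well *)
pose good (X : set V) := let L x := X x \/ IN x in
  [/\ stable Y L, forall x, L x -> M x & forall x, L x -> N x -> IN x].
have [C Cgood Ctot|X [[hL LM LN] Xmax]] := @Zorn_bigcup V good.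
  have pair X1 X2 : C X1 -> C X2 -> exists X, [/\ C X, X1 `<=` X & X2 `<=` X].
    by move=> h1 h2; have [h|h] := Ctot _ _ h1 h2; [exists X2|exists X1]; split=> //; exact: subset_refl.
  split; last first.
  - move=> x [[X CX Xx]|//]; have [_ _ h] := Cgood X CX; apply: h; by left.
  - move=> x [[X CX Xx]|/INN/NM//]; have [_ h _] := Cgood X CX; apply: h; by left.
  split; first by right; exact: st0 hIN.
  - have sub1 X x y : C X -> (X x \/ IN x) -> (X y \/ IN y) -> (\bigcup_(X in C) X) (x - y) \/ IN (x - y).
      move=> CX hx hy; have [h _ _] := Cgood X CX.
      by have [h'|] := stB h hx hy; [left; exists X|right].
    move=> x y [[X1 C1 X1x]|Ix] [[X2 C2 X2y]|Iy].
    + have [X [CX s1 s2]] := pair _ _ C1 C2; apply: (sub1 X) => //; left; [exact: s1|exact: s2].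
    + by apply: (sub1 X1) => //; [left|right].
    + by apply: (sub1 X2) => //; [right|left].
    + by right; apply: (stB hIN).
  - move=> y x yY [[X CX Xx]|Ix]; last by right; apply: (stZ hIN).
    have [h _ _] := Cgood X CX.
    by have [h'|] := stZ h yY (or_introl Xx); [left; exists X|right].
pose L x := X x \/ IN x.
have hfm f : f \in F -> exists m, forall u, M u -> L (f ^+ m *: u).
  move=> fF.
  (* Cm m is the submodule (L : f^m) of M; these submodules form a chain *)
  pose Cm m u := M u /\ L (f ^+ m *: u).
  have fL u : L u -> L (f *: u) by apply: (rgen_act hL); apply: hF.
  have hCm m : stable Y (Cm m).
    split.
    - by split; rewrite ?scaler0; [exact: st0 hM|exact: st0 hL].
    - by move=> a b [h1 h2] [k1 k2]; split; rewrite ?scalerBr; [exact: (stB hM)|exact: (stB hL)].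
    - move=> y a yY [h1 h2]; split; first exact: (stZ hM).
      by rewrite scalerA mulrC -scalerA; apply: (stZ hL).
  have Cle m m' u : (m <= m')%N -> Cm m u -> Cm m' u.
    move=> /subnK <- [h1 h2]; split=> //; elim: (m' - m)%N => [//|k ik].
    by rewrite addSn exprS -scalerA; apply: fL.
  have hC : stable Y (fun u => exists m, Cm m u).
    split.
    - by exists 0%N; exact: st0 (hCm 0%N).
    - move=> x y [a ha] [b hb]; exists (maxn a b); apply: (stB (hCm _)).
        exact: (Cle _ _ _ (leq_maxl a b)).
      exact: (Cle _ _ _ (leq_maxr a b)).
    - by move=> y x yY [a ha]; exists a; apply: (stZ (hCm a)).
  have [l [lC lS]] := @noetherian _ _ Y v _ hC (fun x hx => let: ex_intro _ h := hx in h.1).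
  have [m0 hm0] : exists m0, forall u, u \in l -> Cm m0 u.
    elim: l lC {lS} => [|w l ih] h; first by exists 0%N.
    have [|d hd] := ih; first by move=> x xl; apply: h; rewrite inE xl orbT.
    have [|d' hd'] := h w; first by rewrite inE eqxx.
    exists (maxn d d') => x; rewrite inE => /orP[/eqP ->|/hd]; first exact: (Cle _ _ _ (leq_maxr d d')).
    exact: (Cle _ _ _ (leq_maxl d d')).
  have C0 m u : Cm m u -> Cm m0 u.
    by move=> h; apply: (span_min (hCm m0) hm0); apply: lS; exists m.
  exists m0 => u Mu.
  pose L' x := exists a w, [/\ L a, M w & x = a + f ^+ m0 *: w].
  have hL' : stable Y L'.
    split.
    - by exists 0, 0; rewrite scaler0 addr0; split=> //; [exact: st0 hL|exact: st0 hM].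
    - move=> x y [a [w [ha hw ->]]] [b [z [hb hz ->]]]; exists (a - b), (w - z); split.
      + exact: (stB hL).
      + exact: (stB hM).
      + by rewrite scalerBr opprD addrACA.
    - move=> y x yY [a [w [ha hw ->]]]; exists (y *: a), (y *: w); split.
      + exact: (stZ hL).
      + exact: (stZ hM).
      + by rewrite scalerDr !scalerA mulrC.
  have LL' x : L x -> L' x.
    by exists x, 0; rewrite scaler0 addr0; split=> //; exact: st0 hM.
  have XL x : X x -> L x by left.
  (* otherwise L' = L + f^m0 M would be larger than L *)
  apply: contrapT => nL; apply: (@Xmax L').
    split; first by move=> x /XL /LL'.
    move=> h; apply: nL; left; apply: h; exists 0, u; rewrite add0r; split=> //; exact: st0 hL.
  have eL : (fun x => L' x \/ IN x) = L'.
    by apply/funext => x; apply/propext; split=> [[//|Ix]|]; [apply: LL'; right|left].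
  have eLx x : L' x \/ IN x -> L' x by case=> // Ix; apply: LL'; right.
  rewrite /good eL; split=> // x /eLx.
    move=> [a [w [/LM ha hw ->]]]; apply: (stD hM) => //.
    elim: (m0) => [|k ik]; first by rewrite scale1r.
    by rewrite exprS -scalerA; apply: (rgen_act hM) => //; apply: hF.
  move=> [a [w [ha hw ex]]] Nx; apply: LN => //.
  have h1 : L (f *: x) by right; apply: Isub_in.
  have h2 : L (f ^+ m0.+1 *: w).
    have -> : f ^+ m0.+1 *: w = f *: x - f *: a; last by apply: (stB hL) => //; apply: fL.
    by rewrite ex scalerDr addrAC subrr add0r exprS scalerA.
  have [_ h3] : Cm m0 w by apply: (C0 m0.+1).
  by rewrite ex; apply: (stD hL).
have hL0 : stable [::] L by split=> //; [exact: st0 hL|exact: stB hL].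
have [||K hK] := @prod_pigeonhole F M L hL0 _ _ hfm.
- by move=> f u /hF fY; apply: (rgen_act hM).
- by move=> f u /hF fY; apply: (rgen_act hL).
exists K => x Nx Px; apply: (LN x) => //.
by apply: (Ipow_prod hL0 _ Px) => s u sK; apply: hK; rewrite sK.
Qed.
End Krull.

(** * Flatness of polynomial algebras *)

(** Without relations the presented algebra is the polynomial algebra. *)
Definition norel (T I : Type) : tm T I -> tm T I -> Prop := fun _ _ => False.

(** The index type of the generators lives in a small universe, unlike 'I_n. *)
Definition ix (n : nat) := {k : nat | (k < n)%N}.
Definition s2o n (i : ix n) : 'I_n := Ordinal (svalP i).
Definition o2s n (i : 'I_n) : ix n := exist _ (val i) (ltn_ord i).
Lemma o2sK n (i : ix n) : o2s (s2o i) = i. Proof. exact: sval_inj. Qed.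
Lemma s2oK n (i : 'I_n) : s2o (o2s i) = i. Proof. exact: val_inj. Qed.

Section FreeAlgebra.
Variables (R : cring) (A : calg R) (n : nat).
Notation S := (pcalg (@norel (carrier A) (ix n))).
Notation inc := (pinc (@norel (carrier A) (ix n))).
Notation gX i := (pgen (@norel (carrier A) (ix n)) (o2s i)).
Notation E := {ffun 'I_n -> nat}.

Definition einc (i : 'I_n) (e : E) : E := [ffun j => ((j == i) + e j)%N].
Definition edec (i : 'I_n) (e : E) : E := [ffun j => (e j - (j == i))%N].
Lemma eincK i : cancel (einc i) (edec i).
Proof. by move=> e; apply/ffunP => j; rewrite !ffunE addKn. Qed.
Definition mon (e : E) : S := \prod_i gX i ^+ e i.
Lemma monX i e : gX i * mon e = mon (einc i e).
Proof.
rewrite /mon [in LHS](bigD1 i) //= [in RHS](bigD1 i) //= mulrA ffunE eqxx -exprS.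
by congr (_ * _); apply: eq_bigr => j /negPf ji; rewrite ffunE ji.
Qed.

Section PowerSeries.
Variable M : lmodType A.

(** The polynomial algebra S acts on the families of elements of M indexed by exponents, that is
    on power series over M, the variables by shifts. The S-linear map S ⊗ M -> PS reads off
    coefficients; it is injective because every element of S ⊗ M is the sum of its monomials. *)
Definition PS : lmodType A := dprodmod (fun _ : E => M).
Definition shift_fun (i : 'I_n) (v : PS) : PS := fun e => if e i == 0%N then 0 else v (edec i e).
Lemma shift_linear i : linear (shift_fun i).
Proof.
move=> a u v; apply: dprod_eq => e.
rewrite -[RHS]/(a *: shift_fun i u e + shift_fun i v e) /shift_fun.
by case: (e i == 0%N) => //; rewrite scaler0 addr0.
Qed.
Definition shift i : {linear PS -> PS} := mkL (@shift_linear i).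
Lemma shift_comm i j v : shift i (shift j v) = shift j (shift i v).
Proof.
case: (eqVneq i j) => [->//|ij]; apply: dprod_eq => e.
rewrite /= /shift_fun !ffunE ![j == i]eq_sym !(negPf ij) !subn0.
case: (e i == 0%N) (e j == 0%N) => [] [] //; congr v.
by apply/ffunP => k; rewrite !ffunE subnAC.
Qed.
Definition shifts (i : ix n) : {linear PS -> PS} := shift (s2o i).
Lemma shifts_comm i j v : shifts i (shifts j v) = shifts j (shifts i v).
Proof. exact: shift_comm. Qed.
Definition PSmod : lmodType S := pact_mod shifts_comm (fun s t (h : norel s t) => match h with end).
Definition PS0 (m : M) : PSmod := fun e : E => if e == [ffun=> 0%N] then m else 0.
Lemma PS0_linear : linear_for (inc \; *:%R) PS0.
Proof.
move=> a u v; rewrite [X in _ = X + _](@pact_inc _ _ _ _ _ _ shifts_comm).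
apply: dprod_eq => e; rewrite /PS0 -[RHS]/(a *: PS0 u e + PS0 v e) /PS0.
by case: ifP => // _; rewrite scaler0 addr0.
Qed.
Definition coefs : ext inc M -> PSmod := ext_lift (mkL PS0_linear).
Lemma coefsX (i : 'I_n) z e : coefs (gX i *: z) e = if e i == 0%N then 0 else coefs z (edec i e).
Proof. by rewrite /coefs ext_liftZ (@pact_gen _ _ _ _ _ _ shifts_comm) /shifts s2oK. Qed.
Lemma coefsC (a : A) z e : coefs (inc a *: z) e = a *: coefs z e.
Proof. by rewrite /coefs ext_liftZ (@pact_inc _ _ _ _ _ _ shifts_comm). Qed.
Lemma coefsD x y e : coefs (x + y) e = coefs x e + coefs y e.
Proof. by rewrite /coefs ext_liftD. Qed.

Definition has_exp (z : ext inc M) := exists l : seq E, [/\ uniq l,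
  forall e, e \notin l -> coefs z e = 0 & z = \sum_(e <- l) ext_pure inc (mon e) (coefs z e)].

Lemma big_widen (F : E -> ext inc M) (l l' : seq E) : uniq l -> uniq l' -> {subset l <= l'} ->
  (forall e, e \notin l -> F e = 0) -> \sum_(e <- l) F e = \sum_(e <- l') F e.
Proof.
move=> ul ul' ll' hF.
rewrite [RHS](bigID (mem l)) /= [X in _ + X]big1 ?addr0; last by move=> e /hF.
rewrite -[RHS]big_filter; apply: perm_big; apply: uniq_perm => //; first exact: filter_uniq.
by move=> e; rewrite mem_filter /=; case: (boolP (e \in l)) => // /ll' ->.
Qed.

Lemma has_expD x y : has_exp x -> has_exp y -> has_exp (x + y).
Proof.
move=> [l [ul hl el]] [l' [ul' hl' el']]; exists (undup (l ++ l')); split.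
- exact: undup_uniq.
- move=> e; rewrite mem_undup mem_cat negb_or => /andP[/hl h /hl' h'].
  by rewrite coefsD h h' addr0.
- under eq_bigr do rewrite coefsD ext_pureDr.
  rewrite big_split /= {1}el {1}el'; congr (_ + _); apply: big_widen => //; rewrite ?undup_uniq //.
  + by move=> e h; rewrite mem_undup mem_cat h.
  + by move=> e /hl ->; rewrite ext_pure0r.
  + by move=> e h; rewrite mem_undup mem_cat h orbT.
  + by move=> e /hl' ->; rewrite ext_pure0r.
Qed.
Lemma has_expS s z : has_exp z -> has_exp (s *: z).
Proof.
elim/pcalg_ind: s z => [a|i|s t hs ht|s t hs ht] z hz.
- have [l [ul hl el]] := hz; exists l; split=> // [e /hl h|]; first by rewrite coefsC h scaler0.
  rewrite {1}el scaler_sumr; apply: eq_bigr => e _.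
  by rewrite coefsC ext_pureZ ext_scale_pure mulrC.
- rewrite -[i]o2sK; move: (s2o i) => {}i; have [l [ul hl el]] := hz; exists (map (einc i) l); split.
  + by rewrite map_inj_uniq //; exact: can_inj (eincK i).
  + move=> e; rewrite coefsX; case: eqP => // ei ne; apply: hl; apply: contra ne => /(map_f (einc i)).
    have -> : einc i (edec i e) = e; last by [].
    apply/ffunP => j; rewrite !ffunE; case: eqP => [->|_]; last by rewrite subn0.
    by rewrite subnKC // lt0n; apply/eqP.
  + rewrite {1}el scaler_sumr big_map; apply: eq_bigr => e _.
    by rewrite coefsX ffunE eqxx /= eincK ext_scale_pure monX.
- by rewrite scalerDl; apply: has_expD; [exact: hs|exact: ht].
- by rewrite -scalerA; apply: hs; apply: ht.
Qed.
Lemma has_exp_all z : has_exp z.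
Proof.
elim/ext_ind: z => [|s m|x y hx hy]; last exact: has_expD.
  by exists [::]; split=> // [e _|]; rewrite ?big_nil // /coefs ext_lift0.
rewrite ext_pure1; apply: has_expS; exists [:: [ffun=> 0%N]].
have ec e : coefs (ext_pure inc 1 m) e = if e == [ffun=> 0%N] then m else 0.
  by rewrite /coefs ext_lift_pure scale1r.
split=> // [e|]; first by rewrite inE ec => /negPf ->.
rewrite big_seq1 ec eqxx; congr ext_pure.
by rewrite /mon big1 // => i _; rewrite ffunE expr0.
Qed.
Lemma coefs_eq0 z : (forall e, coefs z e = 0) -> z = 0.
Proof.
by move=> h; have [l [_ _ ->]] := has_exp_all z; rewrite big1 // => e _; rewrite h ext_pure0r.
Qed.
End PowerSeries.

Lemma coefs_map (M N : lmodType A) (i : {linear M -> N}) z e :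
  coefs (ext_map i z) e = i (coefs z e).
Proof.
elim/ext_ind: z e => [|s m|x y hx hy] e.
- by rewrite ext_mapZero /coefs !ext_lift0 linear0.
- rewrite ext_pure1 ext_mapZ ext_map_pure; set z0 := ext_pure inc 1 (i m); set z1 := ext_pure inc 1 m.
  have h0 e' : coefs z0 e' = i (coefs z1 e').
    rewrite /coefs !ext_lift_pure !scale1r /= /PS0.
    by case: ifP; rewrite ?linear0.
  elim/pcalg_ind: s z0 z1 h0 e => [a|j|s t hs ht|s t hs ht] z0 z1 h0 e.
  + by rewrite !coefsC h0 linearZ.
  + by rewrite -[j]o2sK !coefsX h0; case: ifP; rewrite ?linear0.
  + by rewrite !scalerDl !coefsD linearD (hs _ _ h0) (ht _ _ h0).
  + by rewrite -!scalerA; apply: hs; apply: ht.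
- by rewrite ext_mapD !coefsD linearD hx hy.
Qed.

(** The coefficients of the image of z under S ⊗ i are the images under i of the coefficients of
    z. *)
Lemma flat_free : flat inc.
Proof.
move=> M N i ii x y h; apply/subr0_eq; apply: coefs_eq0 => e; apply: ii.
rewrite -coefs_map ext_mapB h subrr linear0.
by rewrite /coefs ext_lift0.
Qed.
End FreeAlgebra.

(** * Flatness of smooth algebras *)

Lemma mem_imf (T : finType) (U : eqType) (f : T -> U) (j : T) : f j \in [seq f j | j : T].
Proof. by apply: map_f; rewrite mem_enum. Qed.

Lemma flat_of_ker (A B : comPzRingType) (f : {rmorphism A -> B}) :
  (forall (M N : lmodType A) (i : {linear M -> N}), injective i ->
    forall x : ext f M, ext_map i x = 0 -> x = 0) -> flat f.
Proof.
move=> h M N i ii x y e; apply/subr0_eq; apply: (h _ _ i ii).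
by rewrite ext_mapB e subrr.
Qed.

Lemma ext_sumE (A B : comPzRingType) (f : {rmorphism A -> B}) (M : lmodType A) (x : ext f M) :
  x = \sum_(p <- repr x) ext_pure f p.1 p.2.
Proof.
rewrite -[LHS]reprK; elim: (repr x) => [|p s ih]; first by rewrite big_nil.
by rewrite big_cons ext_cons ih.
Qed.

Lemma ext_bc_surj (A B C : comPzRingType) (f : {rmorphism A -> B}) (g : {rmorphism B -> C})
  (k : {rmorphism A -> C}) (H : forall a, k a = g (f a)) (M : lmodType A) :
  (forall c, exists b, g b = c) -> forall y, exists x, ext_bc H M x = y.
Proof.
move=> gs; elim/ext_ind => [|c m|x y [x' <-] [y' <-]]; first by exists 0; rewrite ext_bc0.
- by have [b <-] := gs c; exists (ext_pure f b m); rewrite ext_bc_pure.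
- by exists (x' + y'); rewrite ext_bcD.
Qed.

Lemma sum_rgen_consts (R : cring) (A : calg R) (n : nat) (s : pcalg (@norel (carrier A) (ix n))) :
  exists C : seq A, rgen ([seq pinc _ a | a <- C] ++ [seq pgen _ (o2s i) | i : 'I_n]) s.
Proof.
have cat (C C' : seq A) : let Y D := [seq pinc (@norel (carrier A) (ix n)) a | a <- D] ++
    [seq pgen _ (o2s i) | i : 'I_n] in
    {subset Y C <= Y (C ++ C')} /\ {subset Y C' <= Y (C ++ C')}.
  by move=> Y; split=> z; rewrite /Y !mem_cat map_cat mem_cat => /orP[->|->]; rewrite ?orbT.
elim/pcalg_ind: s => [a|i|x y [C h] [C' h']|x y [C h] [C' h']].
- by exists [:: a]; apply: rgen_in; rewrite mem_cat inE eqxx.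
- exists [::]; apply: rgen_in; rewrite /= -[i]o2sK.
  exact: (mem_imf (fun i : 'I_n => pgen (@norel (carrier A) (ix n)) (o2s i))).
- have [c c'] := cat C C'; exists (C ++ C').
  by apply: rgen_D; [exact: rgen_sub h|exact: rgen_sub h'].
- have [c c'] := cat C C'; exists (C ++ C').
  by apply: rgen_M; [exact: rgen_sub h|exact: rgen_sub h'].
Qed.

(** B is the quotient of the polynomial algebra S by the ideal I = (F_1, ..., F_m), and phi is
    an endomorphism of the A-algebra S which is the identity modulo I and maps I into I². Such a
    phi comes from a section of S/I² -> S/I = B, as provided by formal smoothness. *)
Section Smooth.
Variables (R : cring) (A B : calg R) (n : nat).
Notation S := (pcalg (@norel (carrier A) (ix n))).
Notation inc := (pinc (@norel (carrier A) (ix n))).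
Notation gX i := (pgen (@norel (carrier A) (ix n)) (o2s i)).
Variables (m : nat) (F : 'I_m -> S) (p : calg_hom S B) (k : calg_hom A B) (phi : {rmorphism S -> S}).
Definition inI (s : S) := exists c : 'I_m -> S, s = \sum_j c j * F j.
Hypotheses (kE : forall a, k a = p (inc a)) (p_surj : forall b, exists s, p s = b)
  (p_ker : forall s, p s = 0 <-> inI s) (phiC : forall a, inc a = phi (inc a))
  (phiF : forall j, exists h : 'I_m -> 'I_m -> S, phi (F j) = \sum_a \sum_b h a b * (F a * F b))
  (phi1 : forall s, inI (phi s - s)).

(** S/I ⊗ V is V/IV. *)
Lemma ext_quot_ker (V : lmodType S) (x : V) : ext_pure p 1 x = 0 ->
  exists w : 'I_m -> V, x = \sum_j F j *: w j.
Proof.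
pose IV (x : V) := exists w : 'I_m -> V, x = \sum_j F j *: w j.
have hIV : submod IV.
  split; first by exists (fun=> 0); rewrite big1 // => j _; rewrite scaler0.
  - move=> u v [w ->] [w' ->]; exists (fun j => w j + w' j).
    by rewrite -big_split; apply: eq_bigr => j _; rewrite scalerDr.
  - move=> a u [w ->]; exists (fun j => a *: w j).
    by rewrite scaler_sumr; apply: eq_bigr => j _; rewrite !scalerA mulrC.
pose s b := projT1 (boolp.cid (p_surj b)).
have ps b : p (s b) = b by rewrite /s; case: boolp.cid.
have eqI a b v : p a = p b -> qproj hIV (a *: v) = qproj hIV (b *: v).
  move=> e; apply/subr0_eq; rewrite -linearB; apply/qproj0; rewrite -scalerBl.
  have /p_ker[c ->] : p (a - b) = 0 by rewrite rmorphB e subrr.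
  by exists (fun j => c j *: v); rewrite scaler_suml; apply: eq_bigr => j _; rewrite scalerA mulrC.
pose beta b (v : V) := qproj hIV (s b *: v).
have b1 b c v : beta (b + c) v = beta b v + beta c v.
  by rewrite /beta -linearD -scalerDl; apply: eqI; rewrite rmorphD !ps.
have b2 b u v : beta b (u + v) = beta b u + beta b v by rewrite /beta scalerDr linearD.
have b3 b a v : beta b (a *: v) = beta (b * p a) v.
  by rewrite /beta scalerA; apply: eqI; rewrite rmorphM !ps.
move=> h; apply/(qproj0 hIV); rewrite -[x]scale1r (@eqI _ (s 1)) ?ps ?rmorph1 //.
rewrite -[LHS](ext_fold_pure b1 b2 b3 1 x) h.
exact: etrans (ext_foldE b1 b2 b3 [::]) (big_nil _ _ _ _).
Qed.

(** Let z in B ⊗ N die in B ⊗ M, and lift it to an element of S ⊗ N, with image w in S ⊗ M. Then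
    w lies in I(S ⊗ M), and phi^k(w) lies in its I-adic filtration at order k + 1, while w -
    phi^k(w) is in I times the image of S ⊗ N. All this takes place in finitely generated
    modules over a finitely generated subring of S, where Krull's lemma applies: w itself is in
    I times the image of S ⊗ N. As S is flat over A, the lift of z is then in I(S ⊗ N), so that
    z = 0. *)
Lemma smooth_flat : flat k.
Proof.
apply: flat_of_ker => N M i ii z hz.
have [z' ez] := @ext_bc_surj _ _ _ _ _ _ kE N p_surj z.
pose w := ext_map i z' : ext inc M.
have [W hW] : exists W : 'I_m -> ext inc M, w = \sum_j F j *: W j.
  apply: ext_quot_ker; apply: (bij_inj (ext_tower kE M)).
  by rewrite ext_lift0 ext_lift_pure scale1r ext_bc_map ez hz.
(* coefficients of phi(s) - s in I, and of phi(F_j) in I² *)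
pose c s := projT1 (boolp.cid (phi1 s)).
have cE s : phi s - s = \sum_j c s j * F j by rewrite /c; case: boolp.cid.
pose h j := projT1 (boolp.cid (phiF j)).
have hE j : phi (F j) = \sum_a \sum_b h j a b * (F a * F b) by rewrite /h; case: boolp.cid.
pose Y C := [seq inc a | a <- C] ++ [seq gX i | i : 'I_n].
have consts (l : seq S) : exists C, forall s, s \in l -> rgen (Y C) s.
  elim: l => [|s l [C hC]]; first by exists [::].
  have [C' hC'] := sum_rgen_consts s; exists (C' ++ C) => t.
  have sC : {subset Y C' <= Y (C' ++ C)}.
    by move=> u; rewrite /Y !mem_cat map_cat mem_cat => /orP[->|->]; rewrite ?orbT.
  have sC' : {subset Y C <= Y (C' ++ C)}.
    by move=> u; rewrite /Y !mem_cat map_cat mem_cat => /orP[->|->]; rewrite ?orbT.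
  by rewrite inE => /orP[/eqP ->|/hC hs]; [apply: (rgen_sub sC)|apply: (rgen_sub sC')].
(* Z[Y] contains all the scalars which occur below and is stable under phi *)
have [C hC] := consts ([seq q.1 | q <- repr z'] ++ flatten [seq [seq q.1 | q <- repr (W j)] | j : 'I_m]
  ++ [seq F j | j : 'I_m] ++ flatten [seq [seq h j a.1 a.2 | a : 'I_m * 'I_m] | j : 'I_m]
  ++ flatten [seq [seq c q.1 j | j : 'I_m] | q <- repr z'] ++ [seq phi (gX i) | i : 'I_n]).
have memY y : (y \in Y C) = (y \in [seq inc a | a <- C]) || (y \in [seq gX i | i : 'I_n]).
  by rewrite mem_cat.
move: {consts}(Y C) hC memY => {}Y hC memY.
have Yz q : q \in repr z' -> rgen Y q.1 by move=> hq; apply: hC; rewrite mem_cat; apply/orP; left; exact: (map_f fst).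
have YW j q : q \in repr (W j) -> rgen Y q.1.
  move=> hq; apply: hC; rewrite !mem_cat; apply/orP; right; apply/orP; left.
  by apply/flattenP; exists [seq q.1 | q <- repr (W j)]; [exact: (mem_imf (fun j => [seq q.1 | q <- repr (W j)]))|exact: map_f].
have YF j : rgen Y (F j) by apply: hC; rewrite !mem_cat (mem_imf F) ?orbT.
have Yh j a b : rgen Y (h j a b).
  apply: hC; rewrite !mem_cat; do 3!(apply/orP; right); apply/orP; left.
  apply/flattenP; exists [seq h j a.1 a.2 | a : 'I_m * 'I_m]; first exact: (mem_imf (fun j => [seq h j a.1 a.2 | a : 'I_m * 'I_m])).
  exact: (mem_imf (fun a : 'I_m * 'I_m => h j a.1 a.2) (a, b)).
have Yc q j : q \in repr z' -> rgen Y (c q.1 j).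
  move=> hq; apply: hC; rewrite !mem_cat; do 4!(apply/orP; right); apply/orP; left.
  by apply/flattenP; exists [seq c q.1 j | j : 'I_m]; [exact: (map_f (fun q : S * N => [seq c q.1 j | j : 'I_m]))|exact: (mem_imf (c q.1))].
have YX i' : rgen Y (phi (gX i')) by apply: hC; rewrite !mem_cat (mem_imf (fun i => phi (gX i))) ?orbT.
have Yphi y : y \in Y -> rgen Y (phi y).
  rewrite memY => /orP[/mapP[a aC ->]|/mapP[i' _ ->]]; last exact: YX.
  by rewrite -phiC; apply: rgen_in; rewrite memY map_f.
pose Fs := [seq F j | j : 'I_m].
have FY f : f \in Fs -> rgen Y f by move=> /mapP[j _ ->].
have FFs j : F j \in Fs by exact: (mem_imf F).
(* N2 and M2 contain the image of the lift of z, and the witnesses of its divisibility by I *)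
pose gl := [seq ext_pure inc 1 (i q.2) | q <- repr z'].
pose gv := gl ++ flatten [seq [seq ext_pure inc 1 q.2 | q <- repr (W j)] | j : 'I_m].
pose M2 := span Y gv; pose N2 := span Y gl.
have hM2 : stable Y M2 := span_stable _ _.
have hN2 : stable Y N2 := span_stable _ _.
pose phiV := ext_bc phiC M.
have phiB x y : phiV (x - y) = phiV x - phiV y by exact: linearB.
have phiZ s x : phiV (s *: x) = phi s *: phiV x by exact: ext_bcZ.
have phi0 : phiV 0 = 0 by exact: ext_bc0.
have phi_span l : (forall x, x \in l -> exists u, x = ext_pure inc 1 u) ->
    forall x, span Y l x -> span Y l (phiV x).
  move=> hl x; have hs := span_stable Y l; elim=> {x} [x xl||x y _ h1 _ h2|y x yY _ h1].
  - have [u eu] := hl x xl; rewrite eu /phiV ext_bc_pure rmorph1 -eu; exact: span_in.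
  - by rewrite phi0; exact: span_0.
  - by rewrite phiB; apply: span_B.
  - by rewrite phiZ; apply: (rgen_act hs) => //; apply: Yphi.
have glP x : x \in gl -> exists u, x = ext_pure inc 1 u by move=> /mapP[q _ ->]; exists (i q.2).
have gvP x : x \in gv -> exists u, x = ext_pure inc 1 u.
  rewrite mem_cat => /orP[/glP//|/flattenP[t /mapP[j _ ->] /mapP[q _ ->]]]; by exists q.2.
have phiN2 := phi_span gl glP; have phiM2 := phi_span gv gvP.
have [|K hK] := @krull _ _ Y Fs gv gl FY.
  by move=> x xl; apply: span_in; rewrite mem_cat xl.
have ipst k' : stable Y (Ipow Fs k' M2) by elim: k' => [//|k' ih]; apply: Isub_stable.
have wE : w = \sum_(q <- repr z') q.1 *: ext_pure inc 1 (i q.2).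
  rewrite /w {1}(ext_sumE z'); elim: (repr z') => [|q s ih]; first by rewrite !big_nil ext_mapZero.
  by rewrite !big_cons ext_mapD ih ext_map_pure -ext_pure1.
have sumN2 (L : ext inc M -> Prop) (f : S * N -> ext inc M) : stable Y L ->
    (forall q, q \in repr z' -> L (f q)) -> L (\sum_(q <- repr z') f q).
  move=> hL hf; rewrite big_seq; elim/big_ind: _ => //; first exact: st0 hL.
  exact: (stD hL).
have glz q : q \in repr z' -> N2 (ext_pure inc 1 (i q.2)).
  by move=> hq; apply: span_in; exact: (map_f (fun q : S * N => ext_pure inc 1 (i q.2))).
have N2w : N2 w by rewrite wE; apply: sumN2 => // q hq; apply: (rgen_act hN2 (Yz _ hq)); exact: glz.
have hIN2 := Isub_stable Fs hN2.
have Iw : Isub Fs N2 (phiV w - w).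
  have -> : phiV w - w = \sum_(q <- repr z') (phi q.1 - q.1) *: ext_pure inc 1 (i q.2).
    rewrite wE; elim: (repr z') => [|q s ih]; first by rewrite !big_nil phi0 subrr.
    rewrite !big_cons -ih opprD /phiV ext_bcD addrACA; congr (_ + _).
    by rewrite ext_bcZ ext_bc_pure rmorph1 scalerBl.
  apply: sumN2 => // q hq; rewrite cE scaler_suml.
  apply: (st_sum hIN2) => j; rewrite mulrC -scalerA; apply: Isub_in => //.
  by apply: (rgen_act hN2 (Yc _ _ hq)); exact: glz.
(* phi maps I N into I N and raises the order of divisibility by I *)
have phiFin L f u : stable Y L -> f \in Fs -> L (phiV u) -> Isub Fs (Isub Fs L) (phiV (f *: u)).
  move=> hL /mapP[j _ ->] Lu; rewrite phiZ hE scaler_suml.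
  have h1 := Isub_stable Fs hL; have h2 := Isub_stable Fs h1.
  apply: (st_sum h2) => a; rewrite scaler_suml; apply: (st_sum h2) => b.
  rewrite -scalerA; apply: (rgen_act h2 (Yh j a b)); rewrite -scalerA.
  by apply: Isub_in => //; apply: Isub_in.
have Iphi x : Isub Fs N2 x -> Isub Fs N2 (phiV x).
  elim=> {x} [|x y _ h1 _ h2|f u fF Nu]; first by rewrite phi0; exact: Isub_0.
  - by rewrite phiB; apply: Isub_B.
  - by apply: (Isub_mono (Isub_le hN2 FY)); apply: phiFin => //; apply: phiN2.
have hk k' : N2 (iter k' phiV w) /\ Isub Fs N2 (iter k' phiV w - w).
  elim: k' => [|k' [h1 h2]] /=; first by rewrite subrr; split=> //; exact: Isub_0.
  split; first exact: phiN2.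
  have -> : phiV (iter k' phiV w) - w = phiV (iter k' phiV w - w) + (phiV w - w).
    by rewrite phiB addrA subrK.
  by apply: (stD hIN2) => //; apply: Iphi.
have ipphi k' : (forall x, Ipow Fs k' M2 x -> Ipow Fs k' M2 (phiV x)) /\
    (forall x, Ipow Fs k'.+1 M2 x -> Ipow Fs k'.+2 M2 (phiV x)).
  elim: k' => [|k' [ih1 ih2]].
    split=> [x|x]; first exact: phiM2.
    elim=> {x} [|x y _ h1 _ h2|f u fF Nu]; first exact: (eq_ind_r (fun t => Ipow Fs 2 M2 t) (Isub_0 Fs (Isub Fs M2)) phi0).
    - by rewrite phiB; apply: Isub_B.
    - by apply: phiFin => //; apply: phiM2.
  have h3 x : Ipow Fs k'.+1 M2 x -> Ipow Fs k'.+1 M2 (phiV x).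
    move=> /ih2; exact: (Isub_le (ipst k'.+1) FY).
  split=> // x.
  elim=> {x} [|x y _ h1 _ h2|f u fF Nu]; first exact: (eq_ind_r (fun t => Ipow Fs k'.+3 M2 t) (Isub_0 Fs (Ipow Fs k'.+2 M2)) phi0).
  - by rewrite phiB; apply: Isub_B.
  - by apply: (phiFin (Ipow Fs k'.+1 M2)) => //; exact: h3.
have ipw k' : Ipow Fs k'.+1 M2 (iter k' phiV w).
  elim: k' => [|k' ih] /=; last exact: (ipphi k').2.
  rewrite hW; apply: (st_sum (ipst 1%N)) => j; apply: Isub_in => //.
  rewrite (ext_sumE (W j)) big_seq; elim/big_ind: _ => [||q hq]; first exact: st0 hM2.
    exact: (stD hM2).
  rewrite ext_pure1; apply: (rgen_act hM2 (YW _ _ hq)); apply: span_in.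
  rewrite mem_cat; apply/orP; right; apply/flattenP.
  exists [seq ext_pure inc 1 q.2 | q <- repr (W j)]; last exact: (map_f (fun q : S * M => ext_pure inc 1 q.2)).
  exact: (mem_imf (fun j => [seq ext_pure inc 1 q.2 | q <- repr (W j)])).
(* phi^K(w) - w is in I N2 and phi^K(w) in I^(K+1) M2, so Krull gives that w is in I N2 *)
have Isw : Isub Fs N2 w.
  have [h1 h2] := hk K.
  have -> : w = iter K phiV w - (iter K phiV w - w) by rewrite opprB addrC subrK.
  apply: (stB hIN2) => //; apply: hK => //.
  exact: (Isub_le (ipst K) FY (ipw K)).
have N2im x : N2 x -> exists y, x = ext_map i y.
  elim=> {x} [x /mapP[q _ ->]||x y _ [u ->] _ [u' ->]|y x _ _ [u ->]].
  - by exists (ext_pure inc 1 q.2); rewrite ext_map_pure.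
  - by exists 0; rewrite ext_mapZero.
  - by exists (u - u'); rewrite ext_mapB.
  - by exists (y *: u); rewrite ext_mapZ.
have Iim x : Isub Fs N2 x -> exists2 y, x = ext_map i y & ext_bc kE N y = 0.
  elim=> {x} [|x y _ [u -> e] _ [u' -> e']|f u /mapP[j _ ->] /N2im[y ->]].
  - by exists 0; rewrite ?ext_mapZero ?ext_bc0.
  - exists (u - u'); first by rewrite ext_mapB.
    by rewrite ext_bcB e e' subrr.
  - exists (F j *: y); first by rewrite ext_mapZ.
    rewrite ext_bcZ; have -> : p (F j) = 0; last by rewrite scale0r.
    apply/p_ker; exists (fun a => if a == j then 1 else 0).
    rewrite (bigD1 j) //= eqxx mul1r big1 ?addr0 // => a /negPf ->; exact: mul0r.
have [y ey e0] := Iim _ Isw.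
by rewrite -ez (flat_free ii ey).
Qed.
End Smooth.

(** * Étale algebras are flat *)

Section Presentation.
Variables (R : cring) (A B : calg R) (f : calg_hom A B) (n m : nat).
Variables (P : 'I_m -> polynomial A n) (b : 'I_n -> B).
Hypothesis hP : is_presentation f P b.
Notation tm := (tm (carrier A) (ix n)).
Notation S := (pcalg (@norel (carrier A) (ix n))).
Notation inc := (pinc (@norel (carrier A) (ix n))).
Notation gX i := (pgen (@norel (carrier A) (ix n)) (o2s i)).

(** Polynomials with coefficients in A, as terms of the presented algebras. *)
Definition tm_mon (e : 'I_n -> nat) : tm :=
  foldr (fun i t => iter (e i) (Mul (Gen (o2s i))) t) (Cst (1 : A)) (enum 'I_n).
Definition tm_poly (Q : polynomial A n) : tm :=
  foldr (fun q t => Add (Mul (Cst q.1) (tm_mon q.2)) t) (Cst (0 : A)) Q.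
Lemma tev_mon (C : calg R) (g : calg_hom A C) (c : ix n -> C) e :
  tev g c (tm_mon e) = \prod_(i < n) c (o2s i) ^+ e i.
Proof.
rewrite -big_enum /tm_mon /=; elim: (enum 'I_n) => [|i s ih]; first by rewrite big_nil /= rmorph1.
rewrite big_cons -ih /=; elim: (e i) => [|k ihk]; first by rewrite mul1r.
by rewrite /= ihk exprS mulrA.
Qed.
Lemma tev_poly (C : calg R) (g : calg_hom A C) (c : ix n -> C) Q :
  tev g c (tm_poly Q) = poly_eval g (fun i => c (o2s i)) Q.
Proof.
rewrite /poly_eval; elim: Q => [|q Q ih]; first by rewrite big_nil /= rmorph0.
by rewrite big_cons -ih /= tev_mon.
Qed.

Definition gen_b (i : ix n) : B := b (s2o i).
Definition pres_map : calg_hom S B :=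
  @pext _ _ _ (@norel _ _) B f gen_b (fun s t (h : norel s t) => match h with end).
Notation p := pres_map.
Lemma pres_map_ptm t : p (ptm _ t) = tev f gen_b t. Proof. exact: pext_ptm. Qed.
Lemma pres_map_inc a : p (inc a) = f a. Proof. exact: pext_inc. Qed.
Definition pres_F j : S := ptm _ (tm_poly (P j)).
Notation F := pres_F.
Lemma pres_mapF j : p (F j) = 0.
Proof.
rewrite pres_map_ptm tev_poly -(hP.1 j); congr (poly_eval _ _ _).
by apply/funext => i; rewrite /gen_b s2oK.
Qed.

Definition relB (s t : tm) := exists j, s = tm_poly (P j) /\ t = Cst (0 : A).
Notation Q := (pcalg relB).
Lemma relB_B s t : relB s t -> tev f gen_b s = tev f gen_b t.
Proof. by move=> [j [-> ->]]; rewrite -pres_map_ptm pres_mapF /= rmorph0. Qed.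

(** B and the algebra Q presented by the same relations have the same universal property. The
    last clause gives the injectivity of B -> Q, through a left inverse. *)
Lemma pres_inv : exists h : calg_hom B Q, (forall t, h (tev f gen_b t) = ptm relB t) /\
  forall x, x = pext relB_B (h x).
Proof.
have [|h [[hf hb] _]] := hP.2 Q (pinc relB) (fun i => pgen relB (o2s i)).
  move=> j; rewrite -tev_poly tev_ptm -[0](rmorph0 (pinc relB)) -ptmC.
  by apply/ptm_eq/teq_rel; exists j.
have ht t : h (tev f gen_b t) = ptm relB t.
  rewrite -tev_ptm; elim: t => [a|i|s hs t ht|s hs t ht] /=.
  - exact: (congr1 (fun u : calg_hom A Q => u a) hf).
  - by rewrite /gen_b hb o2sK.
  - by rewrite rmorphD hs ht.
  - by rewrite rmorphM hs ht.
exists h; split=> // x.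
have [u [_ hu]] := hP.2 B f b hP.1.
have e1 := hu (calg_id B) (conj (calg_comp1f f) (fun i => erefl)).
have e2 : u = calg_comp (pext relB_B) h.
  apply: hu; split; first by rewrite -calg_compA hf; apply: calg_hom_ext => a; exact: (pext_inc relB_B a).
  by move=> i; rewrite -[LHS]/(pext relB_B (h (b i))) hb pext_gen /gen_b s2oK.
by rewrite -[LHS]/(calg_id B x) -e1 e2.
Qed.

Lemma pres_surj x : exists s, p s = x.
Proof.
have [h [_ hx]] := pres_inv; rewrite (hx x); elim/ptm_ind: (h x) => t.
by exists (ptm _ t); rewrite pres_map_ptm pext_ptm.
Qed.

Lemma inI_idl : ideal (inI F).
Proof.
split; first by exists (fun=> 0); rewrite big1 // => j _; rewrite mul0r.
- move=> x y [c ->] [d ->]; exists (fun j => c j + d j).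
  by rewrite -big_split; apply: eq_bigr => j _; rewrite mulrDl.
- move=> a x [c ->]; exists (fun j => a * c j).
  by rewrite mulr_sumr; apply: eq_bigr => j _; rewrite mulrA.
Qed.
Lemma inI_F j : inI F (F j).
Proof.
exists (fun i => if i == j then 1 else 0); rewrite (bigD1 j) //= eqxx mul1r big1 ?addr0 //.
by move=> i /negPf ->; rewrite mul0r.
Qed.

(** An element of S which vanishes in B is zero in the presented algebra, hence a consequence of
    the relations: these hold modulo the ideal generated by the F j. *)
Lemma pres_ker s : p s = 0 <-> inI F s.
Proof.
split=> [|[c ->]]; last first.
  by rewrite rmorph_sum big1 // => j _; rewrite rmorphM pres_mapF mulr0.
elim/ptm_ind: s => t; rewrite pres_map_ptm => e.
have [h [ht _]] := pres_inv.
have /ptm_eq et : ptm relB t = ptm relB (Cst (0 : A)) by rewrite -!ht e /= !rmorph0.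
have := @tev_sound _ _ _ relB _ inc (pgen _) _ inI_idl _ _ _ et.
rewrite !tev_ptm ptmC rmorph0 subr0; apply=> s t' [j [-> ->]].
by rewrite !tev_ptm ptmC rmorph0 subr0; apply: inI_F.
Qed.

Definition inI2 (s : S) := exists h : 'I_m -> 'I_m -> S, s = \sum_a \sum_b h a b * (F a * F b).
Lemma inI2_idl : ideal inI2.
Proof.
split; first by exists (fun=> fun=> 0); rewrite big1 // => j _; rewrite big1 // => i _; rewrite mul0r.
- move=> x y [c ->] [d ->]; exists (fun i j => c i j + d i j).
  rewrite -big_split; apply: eq_bigr => i _ /=; rewrite -big_split; apply: eq_bigr => j _.
  by rewrite mulrDl.
- move=> a x [c ->]; exists (fun i j => a * c i j).
  rewrite mulr_sumr; apply: eq_bigr => i _; rewrite mulr_sumr; apply: eq_bigr => j _.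
  by rewrite mulrA.
Qed.
Lemma inI2_F j k : inI2 (F j * F k).
Proof.
exists (fun a b => if (a == j) && (b == k) then 1 else 0).
rewrite (bigD1 j) //= (bigD1 k) //= !eqxx mul1r big1 ?addr0; last first.
  by move=> i /negPf ->; rewrite andbF mul0r.
rewrite big1 ?addr0 // => i /negPf ->; rewrite big1 // => l _; exact: mul0r.
Qed.

(** C is S/I², where I is the kernel of S -> B. *)
Definition relC (s t : tm) :=
  exists j k, s = Mul (tm_poly (P j)) (tm_poly (P k)) /\ t = Cst (0 : A).
Notation C := (pcalg relC).
Lemma relC_B s t : relC s t -> tev f gen_b s = tev f gen_b t.
Proof. by move=> [j [k [-> ->]]] /=; rewrite -!pres_map_ptm pres_mapF mul0r rmorph0. Qed.
Definition resC : calg_hom C B := pext relC_B.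
Definition toC : calg_hom S C :=
  @pext _ _ _ (@norel _ _) C (pinc relC) (pgen relC) (fun s t (h : norel s t) => match h with end).
Lemma toC_ptm t : toC (ptm _ t) = ptm relC t. Proof. by rewrite [LHS]pext_ptm tev_ptm. Qed.
Lemma toC_surj x : exists s, toC s = x.
Proof. by elim/ptm_ind: x => t; exists (ptm _ t); rewrite toC_ptm. Qed.
Lemma resC_toC s : resC (toC s) = p s.
Proof. by elim/ptm_ind: s => t; rewrite toC_ptm [LHS]pext_ptm pres_map_ptm. Qed.
Lemma toC_ker s : toC s = 0 -> inI2 s.
Proof.
elim/ptm_ind: s => t; rewrite toC_ptm => e.
have /ptm_eq et : ptm relC t = ptm relC (Cst (0 : A)) by rewrite e ptmC rmorph0.
have := @tev_sound _ _ _ relC _ inc (pgen _) _ inI2_idl _ _ _ et.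
rewrite !tev_ptm ptmC rmorph0 subr0; apply=> s t' [j [k [-> ->]]].
by rewrite !tev_ptm ptmC rmorph0 subr0 ptmM; apply: inI2_F.
Qed.
Lemma toC_F j k : toC (F j) * toC (F k) = 0.
Proof.
rewrite !toC_ptm -ptmM -[0](rmorph0 (pinc relC)) -ptmC.
by apply/ptm_eq/teq_rel; exists j, k.
Qed.

(** Lift the identity of B to a section k of S/I² -> S/I = B, and k further to an endomorphism
    phi of S, by choosing the images of the variables. As k kills the image of I in B, phi maps
    I into I². *)
Lemma formally_etale_flat : formally_etale f -> flat f.
Proof.
move=> fe.
have [|||k [[hk kf] _]] := fe C B resC _ _ (pinc relC) (calg_id B) _.
- by move=> d; have [s <-] := pres_surj d; exists (toC s); rewrite resC_toC.
- move=> x y; have [s <-] := toC_surj x; have [t <-] := toC_surj y.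
  rewrite !resC_toC => /pres_ker[c ->] /pres_ker[d ->].
  rewrite !rmorph_sum mulr_suml big1 // => i _; rewrite mulr_sumr big1 // => j _.
  by rewrite !rmorphM mulrACA toC_F mulr0.
- by apply: calg_hom_ext => a; exact: (pext_inc relC_B a).
pose sg (i : ix n) := projT1 (boolp.cid (toC_surj (k (gen_b i)))).
have sgE i : toC (sg i) = k (gen_b i) by rewrite /sg; case: boolp.cid.
pose phi : calg_hom S S :=
  @pext _ _ _ (@norel _ _) S inc sg (fun s t (h : norel s t) => match h with end).
have phiC a : phi (inc a) = inc a by exact: pext_inc.
have phiG i : phi (pgen _ i) = sg i by exact: pext_gen.
have pG i : p (pgen _ i) = gen_b i by exact: pext_gen.
have hkE x : resC (k x) = x by exact: (congr1 (fun h : calg_hom B B => h x) hk).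
have kfE a : k (f a) = pinc relC a by exact: (congr1 (fun h : calg_hom A C => h a) kf).
have pphi s : p (phi s) = p s.
  move: s; apply: (@pcalg_hom_eq _ _ _ _ B (p \o phi) p) => [a|i].
    exact: congr1 (phiC a).
  by apply: etrans (congr1 p (phiG i)) _; rewrite -resC_toC sgE hkE pG.
have qphi s : toC (phi s) = k (p s).
  move: s; apply: (@pcalg_hom_eq _ _ _ _ C (toC \o phi) (k \o p)) => [a|i].
    apply: etrans (congr1 toC (phiC a)) _; apply: etrans (congr1 k (esym (pres_map_inc a))).
    by rewrite kfE [LHS]pext_inc.
  apply: etrans (congr1 toC (phiG i)) _; apply: etrans (congr1 k (esym (pG i))).
  exact: sgE.
apply: (@smooth_flat _ _ _ _ _ F p f phi) => //.
- by move=> a; rewrite pres_map_inc.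
- exact: pres_surj.
- exact: pres_ker.
- by move=> j; apply: toC_ker; rewrite qphi pres_mapF rmorph0.
- by move=> s; apply/pres_ker; rewrite rmorphB pphi subrr.
Qed.
End Presentation.

Lemma etale_flat (R : cring) (A B : calg R) (f : calg_hom A B) : etale f -> flat f.
Proof. by move=> [[n [m [P [b hP]]]] fe]; apply: (formally_etale_flat hP). Qed.

(** * Chevalley's theorem in one variable *)

(** Basic open sets of the constructible topology on the prime spectrum. *)
Definition sat (A : comPzRingType) (p : A -> Prop) (z : seq A) (s : A) : Prop :=
  (forall a, a \in z -> p a) /\ ~ p s.

(** f induces an open map of prime spectra for the constructible topology. *)
Definition constr_open (A B : comPzRingType) (f : {rmorphism A -> B}) : Prop :=
  forall q : B -> Prop, prime q -> forall z s, sat q z s ->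
  exists z' s', sat (fun a => q (f a)) z' s' /\
    forall p', prime p' -> sat p' z' s' ->
    exists q', [/\ prime q', sat q' z s & forall a, p' a <-> q' (f a)].

Lemma constr_open_comp (A B C : comPzRingType) (f : {rmorphism A -> B}) (g : {rmorphism B -> C})
    (k : {rmorphism A -> C}) : (forall a, k a = g (f a)) ->
  constr_open f -> constr_open g -> constr_open k.
Proof.
move=> kE hf hg q qp z s qzs.
have [z1 [s1 [sat1 h1]]] := hg q qp z s qzs.
have [z2 [s2 [sat2 h2]]] := hf _ (prime_pre g qp) z1 s1 sat1.
exists z2, s2; split.
  have -> // : (fun a => q (k a)) = (fun a => q (g (f a))) by apply/funext => a; rewrite kE.
move=> p' pp' psat; have [q' [qq' qsat e']] := h2 p' pp' psat.
have [q'' [qq'' qsat' e'']] := h1 q' qq' qsat.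
by exists q''; split=> // a; rewrite e' e'' kE.
Qed.

(** A closed immersion of finite presentation: the primes which contain F contain the kernel. *)
Lemma constr_open_surj (A B : comPzRingType) (f : {rmorphism A -> B}) (F : seq A) :
  (forall b, exists a, f a = b) ->
  (forall a, f a = 0 -> forall J, ideal J -> (forall x, x \in F -> J x) -> J a) ->
  (forall x, x \in F -> f x = 0) -> constr_open f.
Proof.
move=> fs fk fF q qp z s [qz qs].
pose l b := projT1 (boolp.cid (fs b)).
have lE b : f (l b) = b by rewrite /l; case: boolp.cid.
exists (F ++ map l z), (l s); split.
  split; last by rewrite lE.
  move=> a; rewrite mem_cat => /orP[/fF ->|/mapP[b /qz qb ->]]; last by rewrite lE.
  exact: ideal0 (prime_idl qp).
move=> p' pp' [pz ps].
have pk a a' : f a = f a' -> p' a -> p' a'.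
  move=> e pa; have -> : a' = a - (a - a') by rewrite opprB addrC subrK.
  apply: (idealB (prime_idl pp')) => //; apply: (fk _ _ _ (prime_idl pp')); first by rewrite rmorphB e subrr.
  by move=> x xF; apply: pz; rewrite mem_cat xF.
exists (fun b => p' (l b)); split.
- split.
  + split.
    * by apply: (pk 0); rewrite ?lE ?rmorph0 //; exact: ideal0 (prime_idl pp').
    * move=> x y hx hy; apply: (pk (l x + l y)); first by rewrite rmorphD !lE.
      exact: idealD (prime_idl pp') _ _ hx hy.
    * move=> a x hx; apply: (pk (l a * l x)); first by rewrite rmorphM !lE.
      exact: idealM (prime_idl pp') _ _ hx.
  + by move=> h; apply: (prime_n1 pp'); apply: pk h; rewrite lE rmorph1.
  + move=> x y h; apply: (prime_mul pp'); apply: pk h; by rewrite rmorphM !lE.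
- split=> // b bz; apply: pz; by rewrite mem_cat map_f ?orbT.
- by move=> a; split; apply: pk; rewrite lE.
Qed.

Section OneVariable.
Variable A : comNzRingType.
Implicit Types (p : A -> Prop) (f g h : {poly A}).

(** Vanishing modulo p, without forming the quotient ring. *)
Definition null p f := forall i, p f`_i.

Section ModPrime.
Variables (p : A -> Prop) (pp : prime p).
Let p_id := prime_idl pp.
Lemma p_sum (I : Type) (r : seq I) (P : pred I) (F : I -> A) :
  (forall i, P i -> p (F i)) -> p (\sum_(i <- r | P i) F i).
Proof. by move=> h; elim/big_ind: _ => //; [exact: ideal0|exact: idealD]. Qed.
Lemma null_ideal : ideal (null p).
Proof.
split=> [i|f g hf hg i|f g hg i]; first by rewrite coef0; exact: ideal0.
- by rewrite coefD; apply: idealD.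
- by rewrite coefM; apply: p_sum => j _; apply: idealM.
Qed.
Lemma null_C a : null p a%:P <-> p a.
Proof.
split=> [/(_ 0%N)|pa i]; first by rewrite coefC eqxx.
by rewrite coefC; case: eqP => // _; exact: ideal0.
Qed.

(** Drop the leading terms whose coefficients are in p. *)
Lemma null_trunc f : ~ null p f -> exists h, [/\ null p (f - h), ~ p (lead_coef h) & (size h <= size f)%N].
Proof.
have [n] := ubnP (size f); elim: n f => // n ih f sf nf.
have [pl|npl] := pselect (p (lead_coef f)); last first.
  by exists f; rewrite subrr; split=> //; exact: ideal0 null_ideal.
have f0 : (0 < size f)%N.
  by rewrite size_poly_gt0; apply: contra_notN nf => /eqP -> ; exact: ideal0 null_ideal.
pose g := take_poly (size f).-1 f.
have sg : (size g < size f)%N.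
  by apply: (leq_ltn_trans (size_take_poly _ _)); rewrite ltn_predL.
have fg : null p (f - g).
  move=> i; rewrite coefB coef_take_poly; case: ltnP => h; first by rewrite subrr; exact: ideal0.
  rewrite subr0; move: h; rewrite leq_eqVlt => /orP[/eqP <-|h]; first by rewrite -lead_coefE.
  by rewrite nth_default; [exact: ideal0|rewrite -(prednK f0)].
have [|ng|h [h1 h2 h3]] := ih g; first by rewrite -ltnS (leq_trans _ sf).
  by apply: nf; rewrite -[f](subrK g); exact: idealD null_ideal _ _ fg ng.
exists h; split=> //; last by apply: leq_trans h3 _; exact: ltnW.
by rewrite -[f](subrK g) -addrA; exact: idealD null_ideal _ _ fg h1.
Qed.

Lemma null_lead f : ~ p (lead_coef f) -> ~ null p f.
Proof. by move=> h n; apply: h; rewrite lead_coefE. Qed.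

(** Pseudo-division by g; a remainder in J vanishes mod p by the minimality of g. *)
Lemma null_div (J : {poly A} -> Prop) g : ideal J -> J g -> ~ p (lead_coef g) ->
  (forall h, J h -> ~ null p h -> (size g <= size h)%N) ->
  forall f, exists k u v, [/\ f * (lead_coef g ^+ k)%:P = u * g + v & J f -> null p v].
Proof.
move=> hJ Jg pg gmin f.
exists (Pdiv.Ring.rscalp f g), (Pdiv.Ring.rdivp f g), (Pdiv.Ring.rmodp f g); split.
  by apply: Pdiv.RingComRreg.rdivp_eq; apply: mulrC.
move=> Jf; apply: contrapT => nv.
have g0 : g != 0 by apply: contra_notN pg => /eqP ->; rewrite lead_coef0; exact: ideal0.
have := Pdiv.Ring.ltn_rmodp f g; rewrite g0 ltnNge => /negP; apply; apply: gmin => //.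
have -> : Pdiv.Ring.rmodp f g = f * (lead_coef g ^+ Pdiv.Ring.rscalp f g)%:P - Pdiv.Ring.rdivp f g * g.
  by rewrite (Pdiv.RingComRreg.rdivp_eq (mulrC _ _)) addrAC subrr add0r.
by apply: idealB => //; [rewrite mulrC|]; exact: (idealM hJ).
Qed.

Lemma null_min (J : {poly A} -> Prop) f : ideal J -> (forall h, null p h -> J h) ->
  J f -> ~ null p f -> exists g, [/\ J g, ~ p (lead_coef g) &
  forall h, J h -> ~ null p h -> (size g <= size h)%N].
Proof.
move=> hJ nJ Jf nf.
have [g [Jg ng gmin]] : exists g, [/\ J g, ~ null p g & forall h, J h -> ~ null p h -> (size g <= size h)%N].
  pose Q n := `[< exists g, [/\ J g, ~ null p g & size g = n] >].
  have eQ : exists n, Q n by exists (size f); apply/asboolP; exists f.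
  have [n /asboolP[g [Jg ng sg]] hn] := ex_minnP eQ.
  by exists g; split=> // h Jh nh; rewrite sg; apply: hn; apply/asboolP; exists h.
have [h [h1 h2 h3]] := null_trunc ng.
have Jh : J h by rewrite -[h](subKr g); apply: idealB => //; exact: nJ.
by exists h; split=> // u Ju nu; apply: leq_trans h3 (gmin _ Ju nu).
Qed.

(** p[X] is a prime ideal: look at the leading coefficients. *)
Lemma null_mul f g : null p (f * g) -> null p f \/ null p g.
Proof.
move=> h; apply: contrapT => /not_orP[nf ng].
have [f' [hf pf _]] := null_trunc nf; have [g' [hg pg _]] := null_trunc ng.
have hN := null_ideal.
have {}h : null p (f' * g').
  have -> : f' * g' = f * g - (g * (f - f') + f' * (g - g')).
    rewrite !mulrBr [g * f]mulrC [g * f']mulrC [f' * g]mulrC addrA subrK.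
    by rewrite opprB addrC subrK.
  by apply: (idealB hN) => //; apply: (idealD hN); exact: (idealM hN).
have := h (size f' + size g').-2; rewrite -mul_lead_coef.
by case/(prime_mul pp).
Qed.
Lemma null_prime : prime (null p).
Proof.
split; [exact: null_ideal| |exact: null_mul].
by move=> /(null_C 1); exact: prime_n1 pp.
Qed.
End ModPrime.

(** The one-variable case of Chevalley's theorem. Over p, the prime q of A[X] is either p[X] or
    generated modulo p, up to denominators, by a polynomial w; both survive in a constructible
    neighbourhood of p. *)
Lemma constr_open_poly : constr_open (polyC : {rmorphism A -> {poly A}}).
Proof.
move=> q qp z g [qz qg].
pose p (a : A) := q a%:P.
have pp : prime p := prime_pre (polyC : {rmorphism A -> {poly A}}) qp.
have q_id := prime_idl qp.
have nq f : null p f -> q f.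
  move=> nf; rewrite -[f]coefK poly_def; elim/big_ind: _ => [|x y|i _]; first exact: ideal0.
    exact: idealD.
  by rewrite -mul_polyC mulrC; apply: (idealM q_id); exact: nf.
have coefs_lit (l : seq {poly A}) (p' : A -> Prop) : ideal p' ->
    (forall a, a \in flatten (map (fun f : {poly A} => f : seq A) l) -> p' a) ->
    forall f, f \in l -> null p' f.
  move=> hp' h f fl i; have [si|si] := ltnP i (size f); last by rewrite nth_default //; exact: ideal0.
  by apply: h; apply/flatten_mapP; exists f => //; exact: mem_nth.
have lit_p (l : seq {poly A}) : (forall f, f \in l -> null p f) ->
    forall a, a \in flatten (map (fun f : {poly A} => f : seq A) l) -> p a.
  by move=> h a /flatten_mapP[f /h nf /(nthP 0)[i _ <-]]; exact: nf.
(* first case: q = p[X]; the neighbourhood consists of the p'[X] *)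
have [all0|/existsNP[f0 /not_implyP[qf0 nf0]]] := pselect (forall f, q f -> null p f).
  have /existsNP[i gi] : ~ null p g by move=> /nq.
  exists (flatten (map (fun f : {poly A} => f : seq A) z)), g`_i; split.
    by split=> //; apply: lit_p => f /qz /all0.
  move=> p' pp' [pz ps]; exists (null p'); split; first exact: null_prime.
  - by split; [exact: (coefs_lit _ _ (prime_idl pp') pz)|move=> /(_ i)].
  - by move=> a; split=> /(null_C pp').
(* second case: w has minimal degree among the members of q outside p[X] *)
have [w [qw pw wmin]] := null_min pp q_id nq qf0 nf0.
set s := lead_coef w in pw.
have sw : (1 < size w)%N.
  rewrite ltnNge; apply/negP => /size1_polyC ew; apply: pw.
  by rewrite /s ew lead_coefC /p -ew.
(* g and w generate the unit ideal over the residue field of p: J contains a constant t outside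
   p. The neighbourhood of p is defined by the coefficients of this relation and of the
   divisions by w *)
pose J h := exists u v n, null p n /\ h = u * g + v * w + n.
have hn := null_ideal pp.
have J_id : ideal J.
  split; first by exists 0, 0, 0; rewrite !mul0r !addr0; split=> //; exact: ideal0 hn.
  - move=> x y [u [v [n [h ->]]]] [u' [v' [n' [h' ->]]]]; exists (u + u'), (v + v'), (n + n').
    split; first exact: (idealD hn).
    by rewrite !mulrDl addrACA; congr (_ + _); rewrite addrACA.
  - move=> a x [u [v [n [h ->]]]]; exists (a * u), (a * v), (a * n).
    by rewrite !mulrDr !mulrA; split=> //; exact: (idealM hn).
have nJ h : null p h -> J h by move=> nh; exists 0, 0, h; rewrite !mul0r !add0r.
have Jg : J g by exists 1, 0, 0; rewrite mul1r mul0r !addr0; split=> //; exact: ideal0 hn.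
have Jw : J w by exists 0, 1, 0; rewrite mul1r mul0r add0r addr0; split=> //; exact: ideal0 hn.
have [e [Je pe emin]] := null_min pp J_id nJ Jw (null_lead pw).
set t := lead_coef e in pe.
have qC a : ~ p a -> forall k, ~ q (a ^+ k)%:P.
  move=> pa; elim=> [|k ih]; first by rewrite expr0; exact: prime_n1 qp.
  by rewrite exprS polyCM => /(prime_mul qp)[].
(* e has minimal degree in J outside p[X], and divides g and w modulo p[X] up to powers of t *)
have qe : ~ q e.
  move=> hqe; have [k [u [v [ev nv]]]] := null_div pp J_id Je pe emin g.
  have : q (g * (t ^+ k)%:P) by rewrite ev; apply: idealD => //; [exact: idealM|exact/nq/nv].
  by case/(prime_mul qp) => //; exact: qC.
have se : (size e <= 1)%N.
  have [k [u [v [ev /(_ Jw) nv]]]] := null_div pp J_id Je pe emin w.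
  have qu : q u.
    have : q (u * e) by have -> : u * e = w * (t ^+ k)%:P - v;
      [rewrite ev addrK|apply: idealB => //; [rewrite mulrC; exact: idealM|exact: nq]].
    by case/(prime_mul qp).
  have nu : ~ null p u.
    move=> nu; have : null p (w * (t ^+ k)%:P) by rewrite ev; apply: (idealD hn) => //; rewrite mulrC; exact: (idealM hn).
    case/(null_mul pp); first exact: null_lead.
    by move/(null_C pp); move: (qC _ pe k).
  have [u' [uu' pu' _]] := null_trunc pp nu.
  have qu' : q u' by rewrite -[u'](subKr u); apply: idealB => //; exact: nq.
  have su' := wmin _ qu' (null_lead pu').
  rewrite leqNgt; apply/negP => se.
  have hbig : ((size w).-1 < (size u' + size e).-2)%N.
    by case: (size e) se => [//|[//|d]] _; case: (size w) sw su' => [//|a] _; rewrite !addnS /= => /leq_trans; apply; rewrite leq_addr.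
  have : p ((u' * e)`_(size u' + size e).-2).
    have -> : u' * e = w * (t ^+ k)%:P - (v + e * (u - u')).
      by rewrite ev mulrBr [e * u]mulrC [e * u']mulrC opprD addrA addrK subKr.
    rewrite coefB; apply: (idealB (prime_idl pp)); last by apply: (idealD hn) => //; exact: (idealM hn).
    rewrite mulrC coefCM nth_default ?mulr0; first exact: ideal0 (prime_idl pp).
    by case: (size w) hbig.
  by rewrite -mul_lead_coef => /(prime_mul pp)[].
have [u [v [n [nn ee]]]] := Je.
have eC : e = t%:P by rewrite /t {1}(size1_polyC se) {2}(size1_polyC se) lead_coefC.
have hr f : exists k u v, [/\ f * (s ^+ k)%:P = u * w + v & q f -> null p v] := null_div pp q_id qw pw wmin f.
have [rl [rlp rlP]] : exists rl : seq {poly A}, (forall f, f \in rl -> null p f) /\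
    forall f, f \in z -> exists k u v, f * (s ^+ k)%:P = u * w + v /\ v \in rl.
  elim: z qz => [|f z ih] h; first by exists [::].
  have [|rl [h1 h2]] := ih; first by move=> x xz; apply: h; rewrite inE xz orbT.
  have [k [a [b [eb /(_ (h f _)) nb]]]] := hr f.
  exists (b :: rl); split=> x; rewrite inE => /orP[/eqP ->|]; rewrite ?inE ?eqxx //.
  - by apply: nb; rewrite inE eqxx.
  - exact: h1.
  - by exists k, a, b; rewrite inE eqxx.
  - by move=> /h2[k' [a' [b' [e' h']]]]; exists k', a', b'; rewrite inE h' orbT.
exists (flatten (map (fun f : {poly A} => f : seq A) (n :: rl))), (s * t); split.
  split; last by case/(prime_mul pp).
  by apply: lit_p => f; rewrite inE => /orP[/eqP ->|/rlp].
move=> p' pp' [pz ps].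
have hp' := prime_idl pp'.
have ps' : ~ p' s by move=> h; apply: ps; rewrite mulrC; exact: (idealM hp').
have pt' : ~ p' t by move=> h; apply: ps; exact: (idealM hp').
have hn' := null_ideal pp'.
have null' := coefs_lit _ _ hp' pz.
(* q' is a prime over p' which contains w *)
pose J' h := exists c j, null p' j /\ h = c * w + j.
have J'id : ideal J'.
  split; first by exists 0, 0; rewrite mul0r addr0; split=> //; exact: ideal0 hn'.
  - move=> x y [c [j [hj ->]]] [c' [j' [hj' ->]]]; exists (c + c'), (j + j').
    by rewrite mulrDl addrACA; split=> //; exact: (idealD hn').
  - move=> a x [c [j [hj ->]]]; exists (a * c), (a * j).
    by rewrite mulrDr mulrA; split=> //; exact: (idealM hn').
have [|x y [a [pa ->]] [b [pb ->]]|x [c [j [nj ->]]] [a [pa ea]]|q' [qp' J'q' q'A]] :=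
    @prime_exists _ J' (fun h => exists a, ~ p' a /\ h = a%:P) J'id.
- by exists 1; split=> //; exact: prime_n1 pp'.
- by exists (a * b); rewrite polyCM; split=> // /(prime_mul pp')[].
- apply: pa; apply/(null_C pp'); rewrite -ea; apply: (idealD hn') => //.
  have [//|nc] := pselect (null p' c); first by rewrite mulrC; exact: (idealM hn').
  have [c' [cc' pc' _]] := null_trunc pp' nc.
  exfalso; have : p' ((c' * w)`_(size c' + size w).-2).
    have -> : c' * w = a%:P - (j + w * (c - c')).
      by rewrite -ea mulrBr [w * c]mulrC [w * c']mulrC opprD addrA addrK subKr.
    rewrite coefB; apply: (idealB hp'); last by apply: (idealD hn') => //; exact: (idealM hn').
    rewrite coefC; case: eqP => // e0; last exact: ideal0.
    have c'0 : (0 < size c')%N by rewrite size_poly_gt0; apply: contra_notN pc' => /eqP ->; rewrite lead_coef0; exact: ideal0.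
    by move: e0; case: (size c') c'0 => [//|d] _; case: (size w) sw => [//|[//|d']] _; rewrite addSn !addnS.
  by rewrite -mul_lead_coef => /(prime_mul pp')[].
have q'w : q' w by apply: J'q'; exists 1, 0; rewrite mul1r addr0; split=> //; exact: ideal0 hn'.
have nq' f : null p' f -> q' f by move=> nf; apply: J'q'; exists 0, f; rewrite mul0r add0r.
have q'C a : p' a <-> q' a%:P.
  split=> [pa|qa]; first by apply/nq'/null_C.
  by apply: contrapT => pa; apply: (q'A _ qa); exists a.
have q'X a : ~ p' a -> forall k, ~ q' (a ^+ k)%:P.
  move=> pa; elim=> [|k ih]; first by rewrite expr0; exact: prime_n1 qp'.
  by rewrite exprS polyCM => /(prime_mul qp')[/q'C|].
have hq' := prime_idl qp'.
exists q'; split=> //; split.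
  move=> f /rlP [k [a [b [eb bl]]]].
  have : q' (f * (s ^+ k)%:P).
    rewrite eb; apply: (idealD hq'); first exact: (idealM hq').
    by apply/nq'/null'; rewrite inE bl orbT.
  by case/(prime_mul qp') => // /(q'X _ ps').
move=> q'g; apply: (q'X _ pt' 1%N); rewrite expr1 -eC ee.
apply: (idealD hq'); last by apply/nq'/null'; rewrite inE eqxx.
by apply: (idealD hq'); exact: (idealM hq').
Qed.
End OneVariable.

(** * Finite flat covers are pure *)

Section FreeConstructible.
Variables (R : cring).

Definition nz_of (A : comPzRingType) (h : (1 : A) != 0) : comNzRingType :=
  HB.pack_for comNzRingType (GRing.ComPzRing.sort A) (GRing.PzSemiRing_isNonZero.Build A h).

Definition norelF (E : comPzRingType) (T I : Type) (g : T -> E) (c : I -> E) (s t : tm T I)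
  (h : norel s t) : tev g c s = tev g c t := match h with end.

(** The algebra on one generator is A[X]; the case of the zero ring is separate, as it has no
    primes. *)
Lemma constr_open_free1 (A : calg R) : constr_open (pinc (@norel (carrier A) (ix 1))).
Proof.
set S := pcalg _; set inc := pinc _; move=> q qp.
have nzA : (1 : A) != 0.
  apply/eqP => e; apply: (prime_n1 qp); rewrite -(rmorph1 inc) e rmorph0.
  exact: ideal0 (prime_idl qp).
have nzS : (1 : S) != 0.
  by apply/eqP => e; apply: (prime_n1 qp); rewrite e; exact: ideal0 (prime_idl qp).
pose A' := nz_of nzA; pose S' := nz_of nzS.
pose i' : {rmorphism A' -> S'} := (inc : {rmorphism A -> S}).
pose X : S' := pgen (@norel (carrier A) (ix 1)) (o2s ord0).
pose cX : commr_rmorph i' X := fun x => mulrC _ _.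
pose chi0 : {rmorphism {poly A'} -> S'} := horner_morph cX.
pose chi : {rmorphism {poly A'} -> S} := chi0.
pose pC : {rmorphism A -> {poly A'}} := (polyC : {rmorphism A' -> {poly A'}}).
pose psi : {rmorphism S -> {poly A'}} :=
  @pmorR R A (ix 1) _ {poly A'} pC (fun=> 'X) (@norelF {poly A'} (carrier A) (ix 1) pC (fun=> 'X)).
have chiC (a : A) : chi (a : A')%:P = inc a by exact: (horner_morphC cX).
have chiX : chi 'X = X by exact: (horner_morphX cX).
have psiC (a : A) : psi (inc a) = (a : A')%:P by exact: pmorR_inc.
have psiX j : psi (pgen _ j) = 'X by exact: pmorR_gen.
have chi_psi x : chi (psi x) = x.
  move: x; apply: (@pcalg_hom_eq _ _ _ _ S (chi \o psi) idfun) => [a|j].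
    exact: etrans (congr1 chi (psiC a)) (chiC a).
  apply: etrans (congr1 chi (psiX j)) _; rewrite chiX /X.
  congr pgen; apply: sval_inj => /=; by case: j => [[|j] hj].
move=> z s [qz qs].
have satQ : sat (fun f => q (chi f)) (map psi z) (psi s).
  by split=> [f /mapP[x xz ->]|]; rewrite chi_psi //; exact: qz.
have [z' [s' [sat' h']]] := constr_open_poly (prime_pre chi qp) satQ.
exists z', s'; split.
  by move: sat'; congr sat; apply/funext => a; rewrite chiC.
move=> p' pp' psat; have [Q [Qp [Qz Qs] Qp']] := h' p' pp' psat.
exists (fun x => Q (psi x)); split; first exact: prime_pre.
- by split=> // x xz; apply: Qz; exact: map_f.
- by move=> a; rewrite psiC; exact: Qp'.
Qed.

Definition wid n (i : ix n) : ix n.+1 := exist _ (sval i) (ltnW (svalP i : (sval i).+1 < n.+1)%N).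
Definition lst n : ix n.+1 := exist _ n (ltnSn n).

(** Add the variables one at a time. *)
Lemma constr_open_free (A : calg R) n : constr_open (pinc (@norel (carrier A) (ix n))).
Proof.
elim: n => [|n ih].
  apply: (@constr_open_surj _ _ _ [::]) => // [x|a e J hJ _].
    elim/pcalg_ind: x => [a|[i hi]//|x y [a <-] [b <-]|x y [a <-] [b <-]]; first by exists a.
    - by exists (a + b); rewrite rmorphD.
    - by exists (a * b); rewrite rmorphM.
  pose h : calg_hom (pcalg (@norel (carrier A) (ix 0))) A :=
    pext (@norelF A _ _ (calg_id A) (fun i : ix 0 => 0)).
  have -> : a = h (pinc _ a) by rewrite [RHS]pext_inc.
  by rewrite e rmorph0; exact: ideal0.
pose S := pcalg (@norel (carrier A) (ix n)).
pose S' := pcalg (@norel (carrier A) (ix n.+1)).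
pose T := pcalg (@norel (carrier S) (ix 1)).
pose g : calg_hom S S' := pext (@norelF S' _ _ (pinc _) (fun i : ix n => pgen _ (wid i))).
pose th : calg_hom T S' := pext (@norelF S' _ _ g (fun _ : ix 1 => pgen _ (lst n))).
pose eg (i : ix n.+1) : T := match ltnP (sval i) n with
  | LtnNotGeq h => pinc _ (pgen _ (exist _ (sval i) h))
  | _ => pgen _ (o2s ord0) end.
pose et : calg_hom S' T := pext (@norelF T _ _ (calg_comp (pinc _) (pinc (@norel (carrier A) (ix n)))) eg).
have thC x : th (pinc _ x) = g x by exact: pext_inc.
have thG i : th (pgen _ i) = pgen _ (lst n) by exact: pext_gen.
have gC a : g (pinc _ a) = pinc _ a by exact: pext_inc.
have gG i : g (pgen _ i) = pgen _ (wid i) by exact: pext_gen.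
have etC a : et (pinc _ a) = pinc _ (pinc _ a) by exact: pext_inc.
have etG i : et (pgen _ i) = eg i by exact: pext_gen.
have etth x : et (th x) = x.
  move: x; apply: (@pcalg_hom_eq _ _ _ _ T (et \o th) idfun) => [x|i].
    apply: etrans (congr1 et (thC x)) _; move: x.
    apply: (@pcalg_hom_eq _ _ _ _ T (et \o g) (pinc (@norel (carrier S) (ix 1)))) => [a|i].
      exact: etrans (congr1 et (gC a)) (etC a).
    apply: etrans (congr1 et (gG i)) _; rewrite etG /eg.
    case: ltnP => h /=; first by congr (pinc _ (pgen _ _)); apply: sval_inj.
    by move: (svalP i); rewrite ltnNge h.
  apply: etrans (congr1 et (thG i)) _; rewrite etG /eg.
  case: ltnP => h /=; first by exfalso; move: (h : (n < n)%N); rewrite ltnn.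
  by congr pgen; apply: sval_inj => /=; case: i => [[|j] hj].
have thS x : exists y, th y = x.
  elim/pcalg_ind: x => [a|i|x y [a <-] [b <-]|x y [a <-] [b <-]].
  - by exists (pinc _ (pinc _ a)); rewrite thC gC.
  - have [h|h] := ltnP (sval i) n.
      exists (pinc _ (pgen _ (exist _ (sval i) h))); rewrite thC gG.
      by congr pgen; apply: sval_inj.
    exists (pgen _ (o2s ord0)); rewrite thG; congr pgen; apply: sval_inj => /=.
    by apply/eqP; rewrite eqn_leq h -ltnS (svalP i).
  - by exists (a + b); rewrite rmorphD.
  - by exists (a * b); rewrite rmorphM.
have h1 := constr_open_comp (k := pinc _ \o pinc _ : {rmorphism A -> T}) (fun a => erefl) ih (@constr_open_free1 S).
apply: (constr_open_comp (f := pinc _ \o pinc _ : {rmorphism A -> T}) (g := th) _ h1).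
  by move=> a; rewrite /= [RHS](etrans (thC _) (gC _)).
apply: (@constr_open_surj _ _ _ [::]) => // a e J hJ _.
by rewrite -(etth a) e rmorph0; exact: ideal0.
Qed.

Lemma constr_open_fin_pres (A B : calg R) (f : calg_hom A B) : fin_pres_alg f -> constr_open f.
Proof.
move=> [n [m [P [b hP]]]].
apply: (constr_open_comp (g := pres_map f b) _ (@constr_open_free A n)).
  by move=> a; rewrite pres_map_inc.
apply: (@constr_open_surj _ _ _ [seq pres_F P j | j : 'I_m]).
- exact: (pres_surj hP).
- move=> s /(pres_ker hP)[c ->] J hJ h; elim/big_ind: _ => [|x y|j _]; first exact: ideal0.
    exact: idealD.
  apply: idealM => //; apply: h; exact: (mem_imf (pres_F P)).
- by move=> s /mapP[j _ ->]; rewrite (pres_mapF hP).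
Qed.
End FreeConstructible.

Section FiniteSubfamily.
Local Open Scope classical_set_scope.
Variables (A : comPzRingType) (I : Type) (B : I -> comPzRingType)
  (f : forall i, {rmorphism A -> B i}).

Definition spec_covers (J : Type) (c : J -> I) :=
  forall p : A -> Prop, prime p -> exists j q, prime q /\ forall a, p a <-> q (f (c j) a).

(** The constructible topology of the prime spectrum is quasi-compact. If no finite subfamily
    covers, there is an ultrafilter of primes which contains the complement of every image. Its
    limit, the set of elements contained in almost all primes, is a prime; it lies in some
    image, and by openness so do almost all primes. *)
Lemma finite_spec_cover : (forall i, constr_open (f i)) -> spec_covers id ->
  exists n (c : 'I_n -> I), spec_covers c.
Proof.
move=> fo cov; apply: contrapT => nfin.
pose T := {p : A -> Prop | prime p}.
pose im i (t : T) := exists q, prime q /\ forall a, sval t a <-> q (f i a).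
pose F (X : set T) := exists l : seq I, forall t, (forall i, List.In i l -> ~ im i t) -> X t.
have FF : ProperFilter F.
  apply: Build_ProperFilter.
    move=> [l hX]; apply: nfin.
    exists (size l), (tnth (in_tuple l)) => p pp.
    apply: contrapT => np; apply: (hX (exist _ p pp)) => i il [q [qp hq]].
    apply: np; have [k [kl ek]] : exists k, (k < size l)%N /\ List.nth_error l k = Some i.
      elim: l il {hX} => [//|j l ih] /= [->|/ih[k [kl ek]]]; first by exists 0%N.
      by exists k.+1.
    have e : tnth (in_tuple l) (Ordinal kl) = i.
      rewrite (tnth_nth i) /=; elim: l k ek {hX kl il} => [|j l ih] [|k] //=; first by case.
      exact: ih.
    by exists (Ordinal kl); rewrite e; exists q.
  split.
  - by exists [::].
  - move=> X Y [l hX] [l' hY]; exists (l ++ l') => t h; split; [apply: hX|apply: hY] => i il;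
      apply: h; apply/List.in_or_app; [by left|by right].
  - by move=> X Y XY [l hX]; exists l => t /hX /XY.
have [G [UG FG]] := ultraFilterLemma FF.
have PG : ProperFilter G := ultra_proper.
pose ev a : set T := [set t | sval t a].
pose p a := G (ev a).
have GT (X : set T) : (forall t, X t) -> G X by move=> h; apply: filterS filterT => t _.
have pp : prime p.
  split; first split.
  - by apply: GT => -[t tp]; exact: ideal0 (prime_idl tp).
  - move=> x y hx hy; apply: (filterS _ (filterI hx hy)) => -[t tp] [/= h k].
    exact: idealD (prime_idl tp) _ _ h k.
  - by move=> a x; apply: filterS => -[t tp] /=; exact: idealM (prime_idl tp) _ _.
  - move=> h; apply: (@filter_not_empty _ G _); apply: filterS h => -[t tp] /=.
    exact: prime_n1 tp.
  - move=> x y hxy; have [h|hx] := in_ultra_setVsetC (ev x) UG; first by left.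
    right; apply: (filterS _ (filterI hxy hx)) => -[t tp] [/= h k].
    by case: (prime_mul tp h).
have [i [q [qp hq]]] := cov p pp.
have sat0 : sat q [::] 1 by split=> //; exact: prime_n1 qp.
have [z [s [[hz hs] hi]]] := fo i q qp [::] 1 sat0.
have Gz : G [set t : T | forall a, a \in z -> sval t a].
  elim: z hz {hi} => [|a z ih] h; first exact: GT.
  apply: (filterS _ (filterI (proj2 (hq a) (h a (mem_head _ _))) (ih (fun b bz => h b (mem_behead (s := a :: z) bz))))).
  by move=> t [/= h1 h2] b; rewrite inE => /orP[/eqP ->//|/h2].
have Gs : G (~` ev s).
  by have [h|//] := in_ultra_setVsetC (ev s) UG; case: hs; apply/hq.
have Gim : G [set t | im i t].
  apply: (filterS _ (filterI Gz Gs)) => -[t tp] [/= h1 h2].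
  by have [q' [qp' _ hq']] := hi t tp (conj h1 h2); exists q'.
have Gnim : G [set t | ~ im i t].
  by apply: FG; exists [:: i] => t; apply; left.
by apply: (@filter_not_empty _ G _); apply: (filterS _ (filterI Gim Gnim)) => t [].
Qed.
End FiniteSubfamily.

(** If q dies in every member of the family, its annihilator generates the unit ideal in every
    member, by flatness; so it is contained in no prime. *)
Lemma flat_cover_pure (A : comPzRingType) (I : Type) (B : I -> comPzRingType)
    (f : forall i, {rmorphism A -> B i}) :
  (forall i, flat (f i)) -> spec_covers f id -> pure f.
Proof.
move=> fl cov Q q hq; apply: contrapT => q0.
have ul : linear (fun a : A^o => (a : A) *: q) by move=> a x y; rewrite scalerDl scalerA.
pose u : {linear A^o -> Q} := mkL ul.
have annI : ideal (fun a : A => a *: q = 0).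
  split=> [|x y hx hy|a x hx]; first by rewrite scale0r.
  - by rewrite scalerDl hx hy addr0.
  - by rewrite -scalerA hx scaler0.
have [|p [pp annp]] := maximal_exists annI; first by rewrite scale1r.
have [i [r [rp hr]]] := cov p pp.
pose K := submodm (ker_submod u).
pose v : {linear K -> A^o} := @smval _ _ _ (ker_submod u).
have [||y ey] := @flat_exact _ _ (f i) K A^o Q v u (fl i) _ (ext_pure (f i) 1 (1 : A^o)) _.
- by move=> a ha; exact: smval_ex.
- by rewrite ext_map_pure mkLE scale1r; exact: hq.
have wl : linear_for (f i \; *:%R) (fun a : A^o => f i a : (B i)^o).
  by move=> a x z; rewrite rmorphD rmorphM.
pose w := ext_lift (mkL wl) : ext (f i) A^o -> (B i)^o.
apply: (prime_n1 rp); have : w (ext_pure (f i) 1 (1 : A^o)) = 1.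
  by rewrite /w ext_lift_pure mkLE rmorph1 scale1r.
rewrite -ey => <-; elim/ext_ind: y {ey} => [|b m|x y hx hy].
- by rewrite ext_mapZero /w ext_lift0; exact: ideal0 (prime_idl rp).
- rewrite ext_map_pure /w ext_lift_pure mkLE; apply: (idealM (prime_idl rp)).
  by apply/hr/annp; exact: (svalP m).
- by rewrite ext_mapD /w ext_liftD; exact: idealD (prime_idl rp) _ _ hx hy.
Qed.

(** * Residue fields and localizations *)

(** Identities between fractions after clearing denominators. *)
Section FractionIdentities.
Variables (T : Type) (zero one : T) (add mul sub : T -> T -> T) (opp : T -> T).
Hypothesis thT : ring_theory zero one add mul sub opp eq.
Add Ring Tring : thT.
Notation "x + y" := (add x y). Notation "x * y" := (mul x y). Notation "x - y" := (sub x y).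
Lemma frac_trans n1 d1 n2 d2 n3 d3 :
  d2 * (n1 * d3 - n3 * d1) = d3 * (n1 * d2 - n2 * d1) + d1 * (n2 * d3 - n3 * d2).
Proof. ring. Qed.
Lemma frac_add n1 d1 n2 d2 n1' d1' n2' d2' :
  (n1 * d2 + n2 * d1) * (d1' * d2') - (n1' * d2' + n2' * d1') * (d1 * d2) =
  (d2 * d2') * (n1 * d1' - n1' * d1) + (d1 * d1') * (n2 * d2' - n2' * d2).
Proof. ring. Qed.
Lemma frac_mul n1 d1 n2 d2 n1' d1' n2' d2' :
  (n1 * n2) * (d1' * d2') - (n1' * n2') * (d1 * d2) =
  (n2 * d2') * (n1 * d1' - n1' * d1) + (n1' * d1) * (n2 * d2' - n2' * d2).
Proof. ring. Qed.
Lemma frac_addA n1 d1 n2 d2 n3 d3 :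
  (n1 * (d2 * d3) + (n2 * d3 + n3 * d2) * d1) * ((d1 * d2) * d3) -
  ((n1 * d2 + n2 * d1) * d3 + n3 * (d1 * d2)) * (d1 * (d2 * d3)) = zero.
Proof. ring. Qed.
Lemma frac_addC n1 d1 n2 d2 :
  (n1 * d2 + n2 * d1) * (d2 * d1) - (n2 * d1 + n1 * d2) * (d1 * d2) = zero.
Proof. ring. Qed.
Lemma frac_add0 n d : (zero * d + n * one) * d - n * (one * d) = zero.
Proof. ring. Qed.
Lemma frac_mulA n1 d1 n2 d2 n3 d3 :
  (n1 * (n2 * n3)) * ((d1 * d2) * d3) - ((n1 * n2) * n3) * (d1 * (d2 * d3)) = zero.
Proof. ring. Qed.
Lemma frac_mulC n1 d1 n2 d2 : (n1 * n2) * (d2 * d1) - (n2 * n1) * (d1 * d2) = zero.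
Proof. ring. Qed.
Lemma frac_mul0 n d : (zero * n) * one - zero * (one * d) = zero.
Proof. ring. Qed.
Lemma frac_mul1 n d : (one * n) * d - n * (one * d) = zero.
Proof. ring. Qed.
Lemma frac_mulDl n1 d1 n2 d2 n3 d3 :
  ((n1 * d2 + n2 * d1) * n3) * ((d1 * d3) * (d2 * d3)) -
  ((n1 * n3) * (d2 * d3) + (n2 * n3) * (d1 * d3)) * ((d1 * d2) * d3) = zero.
Proof. ring. Qed.
Lemma frac_cD a b : (a + b) * (one * one) - (a * one + b * one) * one = zero.
Proof. ring. Qed.
Lemma frac_cM a b : (a * b) * (one * one) - (a * b) * one = zero.
Proof. ring. Qed.
End FractionIdentities.

Section ResidueField.
Variables (R : cring) (B : calg R) (q : B -> Prop).
Hypothesis qp : prime q.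
Let q_id := prime_idl qp.

Lemma comring_theory : ring_theory (0 : B) 1 +%R *%R (fun a b => a - b) -%R eq.
Proof.
by split=> *; rewrite ?add0r ?addrA ?mul1r ?mulrA ?mulrDl ?subrr //;
  first [exact: addrC|exact: mulrC].
Qed.
Let th := comring_theory.

Definition rden := {s : carrier B | ~ q s}.
Inductive relK : tm (carrier B) rden -> tm (carrier B) rden -> Prop :=
| relK_inv s : relK (Mul (Cst (sval s)) (Gen s)) (Cst (1 : B))
| relK_zero (b : B) : q b -> relK (Cst b) (Cst (0 : B)).

(** The residue field of B at q, generated by inverses of the elements outside q. *)
Definition resfield : calg R := pcalg relK.
Definition resmap : calg_hom B resfield := pinc relK.

(** Terms are evaluated to fractions (numerator, denominator) with denominators outside q. *)
Fixpoint fnum (t : tm (carrier B) rden) : B * B :=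
  match t with
  | Cst a => (a : B, 1) | Gen s => (1, sval s : B)
  | Add s t => ((fnum s).1 * (fnum t).2 + (fnum t).1 * (fnum s).2, (fnum s).2 * (fnum t).2)
  | Mul s t => ((fnum s).1 * (fnum t).1, (fnum s).2 * (fnum t).2) end.
Lemma fden t : ~ q (fnum t).2.
Proof.
elim: t => [a|[s hs]|s hs t ht|s hs t ht] //=; first exact: prime_n1 qp.
all: by case/(prime_mul qp).
Qed.
Lemma fnum_sound s t : teq relK s t -> q ((fnum s).1 * (fnum t).2 - (fnum t).1 * (fnum s).2).
Proof.
have z0 x : x = 0 -> q x by move->; exact: ideal0.
elim=> {s t} /=.
- by move=> s; apply: z0; rewrite subrr.
- by move=> s t _ h; rewrite -opprB; apply: idealN.
- move=> s t u _ h _ k.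
  have : q ((fnum t).2 * ((fnum s).1 * (fnum u).2 - (fnum u).1 * (fnum s).2)).
    rewrite [X in q X](frac_trans th _ _ (fnum t).1).
    by apply: (idealD q_id); exact: (idealM q_id).
  by case/(prime_mul qp) => // /fden.
- move=> s s' t t' _ h _ k; rewrite [X in q X](frac_add th).
  by apply: (idealD q_id); exact: (idealM q_id).
- move=> s s' t t' _ h _ k; rewrite [X in q X](frac_mul th).
  by apply: (idealD q_id); exact: (idealM q_id).
- by move=> s t u; apply: z0; exact: (frac_addA th).
- by move=> s t; apply: z0; exact: (frac_addC th).
- by move=> s; apply: z0; exact: (frac_add0 th).
- by move=> s t u; apply: z0; exact: (frac_mulA th).
- by move=> s t; apply: z0; exact: (frac_mulC th).
- by move=> s; apply: z0; exact: (frac_mul0 th).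
- by move=> s; apply: z0; exact: (frac_mul1 th).
- by move=> s t u; apply: z0; exact: (frac_mulDl th).
- by move=> a b; apply: z0; exact: (frac_cD th).
- by move=> a b; apply: z0; exact: (frac_cM th).
- move=> s t [d|b hb] /=; first by apply: z0; rewrite !mulr1 !mul1r subrr.
  by rewrite mulr1 mul0r subr0.
Qed.

Lemma resmap_ker b : resmap b = 0 <-> q b.
Proof.
split=> [|hb].
  rewrite -[0](rmorph0 resmap) -!(ptmC relK) => /ptm_eq/fnum_sound /=.
  by rewrite !mulr1 subr0.
by rewrite -[RHS](rmorph0 resmap) -!(ptmC relK); apply/ptm_eq/teq_rel/relK_zero.
Qed.

Lemma resfrac x : exists n d, ~ q d /\ resmap d * x = resmap n.
Proof.
elim/pcalg_ind: x => [a|s|x y [n [d [hd ex]]] [n' [d' [hd' ey]]]|x y [n [d [hd ex]]] [n' [d' [hd' ey]]]].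
- by exists a, 1; rewrite rmorph1 mul1r; split=> //; exact: prime_n1 qp.
- exists 1, (sval s); split; first exact: (svalP s).
  by rewrite -(ptmC relK) -(ptmG relK) -ptmM; apply/ptm_eq/teq_rel/relK_inv.
- exists (n * d' + n' * d), (d * d'); split; first by case/(prime_mul qp).
  rewrite !rmorphD !rmorphM mulrDr -ex -ey.
  by congr (_ + _); [rewrite mulrAC|rewrite -mulrA mulrC].
- exists (n * n'), (d * d'); split; first by case/(prime_mul qp).
  by rewrite !rmorphM -ex -ey mulrACA.
Qed.

Lemma resfield_field : is_field resfield.
Proof.
split; first by rewrite -(rmorph1 resmap) => /resmap_ker; exact: prime_n1 qp.
move=> x x0; have [n [d [hd e]]] := resfrac x.
have inv s : ~ q s -> exists y, y * resmap s = 1.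
  move=> hs; exists (pgen relK (exist _ s hs)); rewrite mulrC.
  by rewrite -(ptmC relK) -(ptmG relK) -ptmM; apply/ptm_eq/teq_rel/(relK_inv (exist _ s hs)).
have [yd hyd] := inv d hd.
have qn : ~ q n.
  by move=> /resmap_ker qn; apply: x0; rewrite -[x]mul1r -hyd -mulrA e qn mulr0.
have [yn hyn] := inv n qn.
by exists (yn * resmap d); rewrite -mulrA e.
Qed.
End ResidueField.

Section Localization.
Variables (R : cring) (B : calg R) (i : B).

Definition relL (s t : tm (carrier B) (ix 1)) := s = Mul (Cst i) (Gen (o2s ord0)) /\ t = Cst (1 : B).
Definition Loc : calg R := pcalg relL.
Definition loc : calg_hom B Loc := pinc relL.
Definition linv : Loc := pgen relL (o2s ord0).
Lemma linvE : loc i * linv = 1.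
Proof. by rewrite /linv -(ptmC relL) -(ptmG relL) -ptmM -[RHS](rmorph1 loc) -(ptmC relL); apply/ptm_eq/teq_rel. Qed.

Lemma unit_uniq (E : comPzRingType) (a x y : E) : a * x = 1 -> a * y = 1 -> x = y.
Proof. by move=> hx hy; rewrite -[x]mulr1 -hy mulrA [x * a]mulrC hx mul1r. Qed.

Lemma loc_ump (C : calg R) (g : calg_hom B C) c : g i * c = 1 ->
  exists! h : calg_hom Loc C, calg_comp h loc = g.
Proof.
move=> hc.
have hr s t : relL s t -> tev g (fun=> c) s = tev g (fun=> c) t.
  by move=> [-> ->] /=; rewrite hc rmorph1.
exists (pext hr); split; first by apply: calg_hom_ext => a; exact: (pext_inc hr a).
move=> h eh; apply: calg_hom_ext => x; apply/esym; move: x.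
apply: (@pcalg_hom_eq _ _ _ _ C h (pext hr)) => [a|j].
  by rewrite pext_inc -eh.
rewrite pext_gen; apply: (@unit_uniq _ (g i)) => //.
have -> : j = o2s ord0 by apply: sval_inj; case: j => [[|k] hk].
by rewrite -eh /= -rmorphM linvE rmorph1.
Qed.

(** B_i = B[X]/(iX - 1) is of finite presentation, and an element which is invertible modulo an
    ideal of square zero is invertible. *)
Lemma etale_loc : etale loc.
Proof.
split.
  pose P (_ : 'I_1) : polynomial B 1 := [:: (i, fun=> 1%N); (- 1, fun=> 0%N)].
  have ev (C : calg R) (g : calg_hom B C) (c : 'I_1 -> C) j :
      poly_eval g c (P j) = g i * c ord0 - 1.
    rewrite /poly_eval big_cons big_seq1 !big_ord_recl !big_ord0 /= expr1 expr0 !mulr1 rmorphN rmorph1.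
    by [].
  exists 1%N, 1%N, P, (fun=> linv); split; first by move=> j; rewrite ev linvE subrr.
  move=> C g c /(_ ord0); rewrite ev => /subr0_eq hc.
  have [h [h1 h2]] := loc_ump hc; exists h; split.
    split=> // j; have -> : j = ord0 by apply: val_inj; case: j => [[|k] hk].
    by apply: (@unit_uniq _ (g i)) => //; rewrite -h1 /= -rmorphM linvE rmorph1.
  by move=> k [k1 _]; apply: h2.
move=> C D s ss s0 g h e.
have [c hc] : exists c, g i * c = 1.
  have [c hc] := ss (h linv).
  pose n := g i * c - 1.
  have sn : s n = 0.
    rewrite rmorphB rmorphM rmorph1 hc.
    have -> : s (g i) = h (loc i) by exact: (congr1 (fun u : calg_hom B D => u i) e).
    by rewrite -rmorphM linvE rmorph1 subrr.
  exists (c * (1 - n)); rewrite mulrA -[g i * c](subrK 1) -/n mulrDl mul1r mulrBr mulr1.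
  by rewrite (s0 n n sn sn) subr0 addrC subrK.
have [k [k1 k2]] := loc_ump hc; exists k; split.
  split=> //; have hh : calg_comp s g i * h linv = 1.
    by rewrite e /= -rmorphM linvE rmorph1.
  have [u [_ hu]] := loc_ump hh.
  by rewrite -(hu (calg_comp s k)) ?(hu h) // -calg_compA k1.
by move=> k' [_ e']; apply: k2.
Qed.

Lemma loc_prime (q : B -> Prop) : prime q -> ~ q i ->
  exists r : Loc -> Prop, prime r /\ forall b, q b <-> r (loc b).
Proof.
move=> qp qi; have [n0 hf] := resfield_field qp.
have [c hc] : exists c, resmap q i * c = 1.
  have [|y hy] := hf (resmap q i); first by move/(resmap_ker qp).
  by exists y; rewrite mulrC.
have [h [hE _]] := loc_ump hc.
have zp : prime (fun x : resfield q => x = 0).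
  split; [exact: zero_ideal|by move=> e; apply: n0|].
  move=> x y xy; have [->|x0] := pselect (x = 0); [by left|right].
  by have [z hz] := hf x x0; rewrite -[y]mul1r -hz -mulrA xy mulr0.
exists (fun x => h x = 0); split; first exact: (prime_pre h zp).
move=> b; have -> : h (loc b) = resmap q b by exact: (congr1 (fun u : calg_hom B _ => u b) hE).
by split=> /(resmap_ker qp).
Qed.

End Localization.

(** * Charts of algebraic spaces *)

Section UnitIdeals.
Variables (R : cring).
Definition gen_unit (B C : calg R) (g : calg_hom B C) (I : set B) : Prop :=
  exists s : seq (C * B), (forall p, p \in s -> I p.2) /\ \sum_(p <- s) p.1 * g p.2 = 1.

(** An ideal which is contained in no prime is the unit ideal. *)
Lemma gen_unitP (B C : calg R) (g : calg_hom B C) (I : set B) :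
  gen_unit g I <-> forall r : C -> Prop, prime r -> exists i, I i /\ ~ r (g i).
Proof.
split=> [[s [sI s1]] r rp|h].
  apply: contrapT => /forallNP nr; apply: (prime_n1 rp); rewrite -s1 big_seq.
  elim/big_ind: _ => [|x y|p /sI Ip]; first exact: ideal0 (prime_idl rp).
    exact: idealD (prime_idl rp) _ _.
  apply: (idealM (prime_idl rp)); apply: contrapT => nrp; exact: (nr p.2).
pose J (c : C) := exists s : seq (C * B), (forall p, p \in s -> I p.2) /\ \sum_(p <- s) p.1 * g p.2 = c.
have hJ : ideal J.
  split; first by exists [::]; rewrite big_nil.
  - move=> x y [s [h1 <-]] [t [h2 <-]]; exists (s ++ t); rewrite big_cat; split=> // p.
    by rewrite mem_cat => /orP[/h1|/h2].
  - move=> a x [s [h1 <-]]; exists [seq (a * p.1, p.2) | p <- s]; split.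
      by move=> p /mapP[p' /h1 hp ->].
    by rewrite big_map mulr_sumr; apply: eq_bigr => p _; rewrite mulrA.
apply: contrapT => nJ1; have [r [rp Jr]] := maximal_exists hJ nJ1.
have [i [Ii ri]] := h r rp; apply: ri; apply: Jr; exists [:: (1, i)].
by rewrite big_seq1 mul1r; split=> // p; rewrite inE => /eqP ->.
Qed.

Lemma gen_unit1 (B C : calg R) (g : calg_hom B C) (I : set B) i c : I i -> c * g i = 1 -> gen_unit g I.
Proof.
by move=> Ii e; exists [:: (c, i)]; rewrite big_seq1; split=> // p; rewrite inE => /eqP ->.
Qed.

Lemma loc_gen_unit (B : calg R) (I : set B) i : I i -> gen_unit (loc i) I.
Proof. by move=> Ii; apply: (gen_unit1 (c := linv i) Ii); rewrite mulrC linvE. Qed.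

Lemma loc_frac (B : calg R) (i : B) (x : Loc i) : exists n b, loc i i ^+ n * x = loc i b.
Proof.
elim/pcalg_ind: x => [b|j|x y [n [b ex]] [m [c ey]]|x y [n [b ex]] [m [c ey]]].
- by exists 0%N, b; rewrite expr0 mul1r.
- exists 1%N, 1; rewrite expr1 rmorph1 -(linvE i); congr (_ * pgen _ _).
  by apply: sval_inj; case: j => [[|j] hj].
- exists (n + m)%N, (i ^+ m * b + i ^+ n * c); rewrite mulrDr rmorphD !rmorphM !rmorphXn -ex -ey.
  by rewrite exprD; congr (_ + _); rewrite mulrA // [X in X * _]mulrC.
- by exists (n + m)%N, (b * c); rewrite exprD mulrACA ex ey rmorphM.
Qed.

Lemma loc_map_ex (B C : calg R) (g : calg_hom B C) (i : B) c : g i * c = 1 ->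
  exists h : calg_hom (Loc i) C, calg_comp h (loc i) = g.
Proof. by move=> /loc_ump[h [eh _]]; exists h. Qed.
End UnitIdeals.

Section Opens.
Variable R : cring.
Implicit Types (P U : presheaf R).

(** The point of U with values in the residue field at q lies in an affine open. The inverse
    image of this open is defined by an ideal, some member i of which is invertible at q. *)
Lemma open_refine U (hU : scheme U) B (x : U B) (q : B -> Prop) : prime q ->
  exists i, ~ q i /\ exists D (w : U D) (h : calg_hom D (Loc i)),
    affine_open w /\ pres h w = pres (loc i) x.
Proof.
move=> qp; have [_ hK] := hU.
have [D [w [aw [f ef]]]] := hK (resfield q) (pres (resmap q) x) (resfield_field qp).
have [_ /(_ B x)[I hI]] := aw.
have /gen_unitP hu : gen_unit (resmap q) I by apply/hI; exists f.
have [n0 hf] := resfield_field qp.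
have zp : prime (fun x : resfield q => x = 0).
  split; [exact: zero_ideal|by move=> e; apply: n0|].
  move=> a b ab; have [->|a0] := pselect (a = 0); [by left|right].
  by have [z hz] := hf a a0; rewrite -[b]mul1r -hz -mulrA ab mulr0.
have [i [Ii ri]] := hu _ zp.
exists i; split; first by move/(resmap_ker qp).
have [h eh] := (hI _ (loc i)).2 (loc_gen_unit Ii).
by exists D, w, h.
Qed.

Section Charts.
Variables (P U : presheaf R) (a : psh_map U P).
Hypotheses (hdiag : forall T (x y : P T), scheme (equalizer x y)) (hU : scheme U)
  (hes : etale_surjective a).

(** Locally on the source every point of P lifts to an affine chart: take an affine open of the
    pullback of the atlas, which is étale over A, and localize it as in open_refine. *)
Lemma chart_cover A (p : P A) (r : A -> Prop) : prime r ->
  exists V (g : calg_hom A V), [/\ flat g, constr_open g,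
    exists s : V -> Prop, prime s /\ forall x, r x <-> s (g x)
  & exists D (w : U D) (h : calg_hom D V), affine_open w /\ pres h (a D w) = pres g p].
Proof.
move=> rp; have [het hsurj] := hes p.
have [|B [v [q [va qp hq]]]] := hsurj r; first exact/primeE.
move/primeE: qp => qp.
have [i [qi [D [w [h [wa ew]]]]]] := open_refine hU (pb_fst v) qp.
have ve := het _ _ va.
have hc x : calg_comp (loc i) (pb_snd v) x = loc i (pb_snd v x) by [].
exists (Loc i), (calg_comp (loc i) (pb_snd v)); split.
- exact: (flat_comp hc (etale_flat ve) (etale_flat (etale_loc i))).
- exact: (constr_open_comp hc (constr_open_fin_pres ve.1) (constr_open_fin_pres (etale_loc i).1)).
- have [s [sp hs]] := loc_prime qp qi.
  by exists s; split=> // x; rewrite hq hs.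
- exists D, w, h; split=> //.
  by rewrite -psh_nat ew psh_nat (pb_secP v) -pres_comp.
Qed.

(** The intersection of two affine charts over P: an affine open of the equalizer is an
    affine open of the pullback of the atlas to the first chart, hence étale over it. *)
Section Overlap.
Variables (D D' : calg R) (w : U D) (w' : U D').
Hypothesis aw' : affine_open w'.
Variables (T : calg R) (iL : calg_hom D T) (iR : calg_hom D' T).
Hypotheses (Tcopair : forall C (g : calg_hom D C) (g' : calg_hom D' C),
  exists h : calg_hom T C, calg_comp h iL = g /\ calg_comp h iR = g')
  (Teq : forall C (h k : calg_hom T C), calg_comp h iL = calg_comp k iL ->
    calg_comp h iR = calg_comp k iR -> h = k).
Notation E := (equalizer (pres iL (a D w)) (pres iR (a D' w'))).
Variables (V : calg R) (v : E V).
Hypothesis av : affine_open v.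
Let d := calg_comp (eq_val v) iL.
Let d' := calg_comp (eq_val v) iR.

Lemma overlap_eq : a V (pres d' w') = pres d (a D w).
Proof. by rewrite psh_nat /d /d' !pres_comp (eq_valP v). Qed.
Definition overlap_pb : pullback a (a D w) V := PbSec overlap_eq.

Lemma overlap_pt C (g : calg_hom D C) (g' : calg_hom D' C) :
  pres g (a D w) = pres g' (a D' w') ->
  exists e : E C, calg_comp (eq_val e) iL = g /\ calg_comp (eq_val e) iR = g'.
Proof.
move=> h; have [k [k1 k2]] := Tcopair g g'.
have e : pres k (pres iL (a D w)) = pres k (pres iR (a D' w')) by rewrite -!pres_comp k1 k2.
by exists (EqSec e).
Qed.

Lemma overlap_affine_open : affine_open overlap_pb.
Proof.
have [w'mono w'open] := aw'; have [vmono vopen] := av.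
split.
  move=> B f g e.
  have e1 : calg_comp f d' = calg_comp g d'.
    by apply: w'mono; rewrite (pres_comp f) (pres_comp g); exact: (congr1 (fun s => pb_fst s) e).
  have e2 : calg_comp f d = calg_comp g d by exact: (congr1 (fun s => pb_snd s) e).
  apply: vmono; apply: eq_sec_ext; apply: Teq; rewrite /= -!calg_compA; [exact: e2|exact: e1].
move=> B z; pose m := pb_fst z; pose de := pb_snd z.
have mz : a B m = pres de (a D w) := pb_secP z.
have [Im hIm] := w'open B m.
(* the open of Spec B over which z lifts to V, as the union of its affine opens Spec B_i *)
exists [set i | exists h : calg_hom V (Loc i), pres h overlap_pb = pres (loc i) z] => C g.
rewrite -/(gen_unit g _); split=> [[f ef]|].
  have f1 : pres (calg_comp f d') w' = pres g m.
    by rewrite pres_comp; exact: (congr1 (fun s => pb_fst s) ef).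
  have f2 : calg_comp f d = calg_comp g de by exact: (congr1 (fun s => pb_snd s) ef).
  apply/gen_unitP => r rp.
  have /gen_unitP/(_ r rp)[i1 [Ii1 ri1]] : gen_unit g Im by apply/hIm; exists (calg_comp f d').
  have [h1 eh1] := (hIm _ (loc i1)).2 (loc_gen_unit Ii1).
  have [|e1 [e1L e1R]] := @overlap_pt _ (calg_comp (loc i1) de) h1.
    by rewrite pres_comp -mz -!psh_nat eh1.
  have [J hJ] := vopen _ e1.
  have [|g1 eg1] := @loc_map_ex _ _ _ (calg_comp (loc (g i1)) g) i1 (linv (g i1)).
    exact: linvE.
  have /gen_unitP uJ : gen_unit g1 J.
    apply/hJ; exists (calg_comp (loc (g i1)) f); apply: eq_sec_ext; apply: Teq.
      by rewrite /= -!calg_compA e1L f2 !calg_compA eg1.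
    apply: w'mono; rewrite /= -!calg_compA e1R pres_comp f1.
    by rewrite pres_comp eh1 -!pres_comp eg1.
  have [r1 [r1p hr1]] := loc_prime rp ri1.
  have [j [Jj r1j]] := uJ r1 r1p.
  have [n [c hc]] := loc_frac j.
  have rc : ~ r (g c).
    rewrite hr1; have -> : loc (g i1) (g c) = g1 (loc i1 c) by rewrite -[LHS]/(calg_comp (loc (g i1)) g c) -eg1.
    rewrite -hc rmorphM => /(prime_mul r1p)[|//]; rewrite rmorphXn.
    have -> : g1 (loc i1 i1) = loc (g i1) (g i1) by rewrite -[RHS]/(calg_comp (loc (g i1)) g i1) -eg1.
    elim: n {hc} => [|n ih]; first by rewrite expr0; exact: prime_n1 r1p.
    by rewrite exprS => /(prime_mul r1p)[/hr1|].
  pose i := i1 * c.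
  exists i; split; last by rewrite rmorphM => /(prime_mul rp)[].
  have [|ro ero] := @loc_map_ex _ _ _ (loc i) i1 (loc i c * linv i).
    by rewrite mulrA -rmorphM linvE.
  have uc : loc i i1 * linv i * loc i c = 1 by rewrite mulrAC -rmorphM linvE.
  have [h eh] : exists h : calg_hom V (Loc i), pres h v = pres ro e1.
    apply/hJ; apply: (gen_unit1 (c := loc i i1 ^+ n * (loc i i1 * linv i)) Jj).
    rewrite mulrAC mulrC mulrA -[loc i i1 ^+ n]rmorphXn.
    have ej : loc i i1 ^+ n * ro j = loc i c.
      have er b : ro (loc i1 b) = loc i b by exact: (congr1 (fun u : calg_hom B _ => u b) ero).
      by rewrite -(er c) -hc rmorphM rmorphXn er.
    by rewrite rmorphXn -[X in X = 1]mulrA ej.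
  exists h; have eh' := congr1 (@eq_val _ _ _ _ _ _) eh.
  apply: pb_sec_ext => /=.
    rewrite -pres_comp; have -> : calg_comp h d' = calg_comp ro h1.
      by rewrite /d' calg_compA [X in calg_comp X iR]eh' -calg_compA e1R.
    by rewrite pres_comp eh1 -pres_comp ero.
  by rewrite /d calg_compA [X in calg_comp X iL]eh' -calg_compA e1L calg_compA ero.
move=> /gen_unitP hI.
have [h2 eh2] : exists h2 : calg_hom D' C, pres h2 w' = pres g m.
  apply/hIm/gen_unitP => r rp; have [i [[h eh] ri]] := hI r rp.
  have /gen_unitP hu : gen_unit (loc i) Im.
    apply/hIm; exists (calg_comp h d'); rewrite pres_comp.
    exact: (congr1 (fun s => pb_fst s) eh).
  have [r1 [r1p hr1]] := loc_prime (prime_pre g rp) ri.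
  by have [i' [Ii' ri']] := hu r1 r1p; exists i'; split=> // /hr1.
have [|e2 [e2L e2R]] := @overlap_pt _ (calg_comp g de) h2.
  by rewrite pres_comp -mz -!psh_nat eh2.
have [J hJ] := vopen _ e2.
have [f ef] : exists f : calg_hom V C, pres f v = pres (calg_id C) e2.
  apply/hJ/gen_unitP => r rp; have [i [[h eh] ri]] := hI r rp.
  have [|g1 eg1] := @loc_map_ex _ _ _ (calg_comp (loc (g i)) g) i (linv (g i)).
    exact: linvE.
  have /gen_unitP hu : gen_unit (loc (g i)) J.
    apply/hJ; exists (calg_comp g1 h); apply: eq_sec_ext; apply: Teq; rewrite /= -!calg_compA.
      rewrite e2L -/d [calg_comp h d](congr1 (fun s => pb_snd s) eh) /=.
      by rewrite !calg_compA eg1.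
    rewrite e2R -/d'; apply: w'mono; rewrite (pres_comp g1) (pres_comp h).
    rewrite [pres h (pres d' w')](congr1 (fun s => pb_fst s) eh) /= pres_comp eh2.
    by rewrite -!pres_comp eg1.
  have [r1 [r1p hr1]] := loc_prime rp ri.
  by have [j [Jj rj]] := hu r1 r1p; exists j; split=> // /hr1.
rewrite pres_id in ef; have ef' := congr1 (@eq_val _ _ _ _ _ _) ef.
exists f; apply: pb_sec_ext => /=.
  by rewrite -pres_comp /d' calg_compA [X in calg_comp X iR]ef' e2R.
by rewrite /d calg_compA [X in calg_comp X iL]ef' e2L.
Qed.

Lemma overlap_etale : etale d.
Proof. by have [het _] := hes (a D w); exact: (het _ _ overlap_affine_open). Qed.
End Overlap.

Definition base_calg : calg R := @CAlg R R idfun.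
Lemma base_homP (B : calg R) r : calg_str B (calg_str base_calg r) = calg_str B r.
Proof. by []. Qed.
Definition base_hom (B : calg R) : calg_hom base_calg B := CAlgHom (@base_homP B).

(** Two lifts of a point of P to affine charts w and w' agree, locally, through an affine open
    of the equalizer of w and w' over the product of the two charts. *)
Lemma chart_overlap D D' (w : U D) (w' : U D') A (h : calg_hom D A) (h' : calg_hom D' A)
    (r : A -> Prop) : affine_open w' -> pres h (a D w) = pres h' (a D' w') -> prime r ->
  exists i, ~ r i /\ exists V (d : calg_hom D V) (d' : calg_hom D' V) (k : calg_hom V (Loc i)),
  [/\ etale d, pres d (a D w) = pres d' (a D' w'), calg_comp k d = calg_comp (loc i) h
    & calg_comp k d' = calg_comp (loc i) h'].
Proof.
move=> aw' e rp.
pose T := push (base_hom D) (base_hom D').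
pose iL := poL (base_hom D) (base_hom D'); pose iR := poR (base_hom D) (base_hom D').
have Tcop C (g : calg_hom D C) (g' : calg_hom D' C) :
    exists h : calg_hom T C, calg_comp h iL = g /\ calg_comp h iR = g'.
  have hg t : g (base_hom D t) = g' (base_hom D' t) by rewrite /= !calg_funP.
  exists (copair hg); split; apply: calg_hom_ext => x; [exact: copairL|exact: copairR].
have Teq C (k l : calg_hom T C) : calg_comp k iL = calg_comp l iL ->
    calg_comp k iR = calg_comp l iR -> k = l.
  move=> e1 e2; apply: calg_hom_ext; apply: push_hom_eq => b.
    exact: (congr1 (fun u : calg_hom D C => u b) e1).
  exact: (congr1 (fun u : calg_hom D' C => u b) e2).
have [x [xL xR]] := @overlap_pt _ _ w w' T iL iR Tcop A h h' e.
have [i [ri [V [v [k [av ek]]]]]] := open_refine (hdiag _ _) x rp.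
exists i; split=> //.
exists V, (calg_comp (eq_val v) iL), (calg_comp (eq_val v) iR), k.
have ek' := congr1 (@eq_val _ _ _ _ _ _) ek; rewrite /= in ek'.
split.
- exact: overlap_etale.
- by rewrite !pres_comp (eq_valP v).
- by rewrite calg_compA ek' -calg_compA xL.
- by rewrite calg_compA ek' -calg_compA xR.
Qed.

End Charts.
End Opens.

(** * Modules over fibered categories and base change *)

Lemma bij_left (X Y Z : Type) (p : Y -> Z) (e : X -> Y) (q : X -> Z) :
  (forall x, p (e x) = q x) -> bijective e -> bijective q -> bijective p.
Proof.
move=> h [e' k1 k2] [q' k3 k4]; exists (e \o q') => z /=.
  by rewrite -{1}(k2 z) h k3 k2.
by rewrite h k4.
Qed.
Lemma bij_right (X Y Z : Type) (p : Y -> Z) (e : X -> Y) (q : X -> Z) :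
  (forall x, p (e x) = q x) -> bijective p -> bijective q -> bijective e.
Proof.
move=> h bp [q' k3 k4]; exists (q' \o p) => y /=; first by rewrite h k3.
by apply: (bij_inj bp); rewrite h k4.
Qed.
Lemma inj_surj_bij (X Y : Type) (f : X -> Y) :
  injective f -> (forall y, exists x, f x = y) -> bijective f.
Proof.
move=> fi fs; exists (fun y => projT1 (boolp.cid (fs y))) => y; last by case: boolp.cid.
by apply: fi; case: boolp.cid.
Qed.
Lemma bij_surj (X Y : Type) (f : X -> Y) : bijective f -> forall y, exists x, f x = y.
Proof. by case=> g _ k y; exists (g y). Qed.

Section IsBaseChange.

Lemma ext_map_bij (A B : comPzRingType) (f : {rmorphism A -> B}) (M N : lmodType A)
  (i : {linear M -> N}) : bijective i -> bijective (ext_map i : ext f M -> ext f N).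
Proof.
case=> j ij ji; have jl : linear j by move=> a x y; apply: (can_inj ij); rewrite linearP !ji.
exists (ext_map (mkL jl)) => x; rewrite ext_map_comp; apply: ext_map_id => m /=; rewrite ?mkLE //.
Qed.

Definition isbc (A B : comPzRingType) (f : {rmorphism A -> B}) (M : lmodType A) (N : lmodType B)
  (u : {linear M -> N | f \; *:%R}) : Prop := bijective (ext_lift u).

Section Composite.
Variables (A B C : comPzRingType) (f : {rmorphism A -> B}) (g : {rmorphism B -> C})
  (k : {rmorphism A -> C}) (H : forall a, k a = g (f a)).
Variables (M : lmodType A) (N : lmodType B) (P : lmodType C).
Variables (u : {linear M -> N | f \; *:%R}) (v : {linear N -> P | g \; *:%R})
  (w : {linear M -> P | k \; *:%R}) (hw : forall m, w m = v (u m)).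

Lemma isbc_square y : ext_lift w (ext_lift (ext_bc H M) y) =
  ext_lift v (ext_map (ext_lift u : {linear ext f M -> N}) y).
Proof.
elim/ext_ind: y => [|c m|x y hx hy].
- by rewrite !ext_lift0 ext_mapZero ext_lift0.
- rewrite ext_map_pure !ext_lift_pure ext_liftZ; congr (_ *: _).
  elim/ext_ind: m => [|b m|x y hx hy].
  + by rewrite ext_bc0 /= !ext_lift0 linear0.
  + by rewrite ext_bc_pure /= !ext_lift_pure linearZ_LR hw.
  + by rewrite ext_bcD /= !ext_liftD linearD hx hy.
- by rewrite !ext_liftD ext_mapD ext_liftD hx hy.
Qed.

Lemma isbc_comp : isbc u -> isbc v -> isbc w.
Proof.
move=> hu hv; apply: (bij_left isbc_square); first exact: ext_tower.
exact: bij_comp hv (ext_map_bij _ hu).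
Qed.
Lemma isbc_cancel : isbc u -> isbc w -> isbc v.
Proof.
move=> hu hw'; apply: (bij_left (fun y => esym (isbc_square y))); first exact: ext_map_bij.
exact: bij_comp hw' (ext_tower H M).
Qed.
Lemma isbc_ext_map : isbc v -> isbc w ->
  bijective (ext_map (ext_lift u : {linear ext f M -> N}) : ext g (ext f M) -> _).
Proof.
move=> hv hw'; apply: (bij_right (fun y => esym (isbc_square y))); first exact: hv.
exact: bij_comp hw' (ext_tower H M).
Qed.
End Composite.

(** Bijectivity of B ⊗ M -> N is tested after extension of scalars to the members of a pure
    family, where the map becomes the comparison of two extensions of M. *)
Lemma isbc_local (A B : comPzRingType) (f : {rmorphism A -> B}) (M : lmodType A) (N : lmodType B)
    (u : {linear M -> N | f \; *:%R}) (I : Type) (C : I -> comPzRingType)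
    (g : forall i, {rmorphism B -> C i}) (k : forall i, {rmorphism A -> C i})
    (P : forall i, lmodType (C i)) (v : forall i, {linear N -> P i | g i \; *:%R})
    (w : forall i, {linear M -> P i | k i \; *:%R}) :
  pure g -> (forall i a, k i a = g i (f a)) -> (forall i m, w i m = v i (u m)) ->
  (forall i, isbc (v i)) -> (forall i, isbc (w i)) -> isbc u.
Proof.
move=> gP H hw hv hw'.
have bi i := isbc_ext_map (H i) (hw i) (hv i) (hw' i).
apply: inj_surj_bij => [x y e|n].
  apply: (pure_eq gP) => i; apply: (bij_inj (bi i)).
  by rewrite !ext_map_pure; congr (ext_pure _ _ _).
apply: (pure_mem gP (u := ext_lift u)) => i; exact: (bij_surj (bi i)).
Qed.

Lemma isbc_idfun (A B : comPzRingType) (f : {rmorphism A -> B}) (M : lmodType A) :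
  isbc (ext_in f M).
Proof.
have e : ext_lift (ext_in f M) =1 id by apply: (@ext_eq _ _ _ _ _ (ext_lift _) idfun) => m; rewrite /= ext_lift_pure scale1r.
by exists id => x; rewrite e.
Qed.
End IsBaseChange.

(** * Covers and descent of sections *)

Section Covers.
Variable R : cring.

(** A class of maps covers Spec T if it contains a finite pure family. Covers in this sense are
    stable under coarsening. *)
Definition rcov (T : calg R) (S : forall B, calg_hom T B -> Prop) : Prop :=
  exists n (B : 'I_n -> calg R) (f : forall i, calg_hom T (B i)),
    (forall i, S _ (f i)) /\ pure (fun i => f i : {rmorphism T -> B i}).

Lemma rcov_sub (T : calg R) (S S' : forall B, calg_hom T B -> Prop) :
  rcov S -> (forall B (f : calg_hom T B), S B f -> S' B f) -> rcov S'.
Proof. by move=> [n [B [f [h p]]]] hs; exists n, B, f; split=> // i; apply: hs. Qed.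

Lemma rcov_trans (T : calg R) (S S' : forall B, calg_hom T B -> Prop) : rcov S ->
  (forall B (f : calg_hom T B), S B f -> rcov (fun C (g : calg_hom B C) => S' C (calg_comp g f))) ->
  rcov S'.
Proof.
move=> [n [B [f [h p]]]] hs.
have hs' i := hs _ _ (h i).
pose m i := projT1 (boolp.cid (hs' i)).
have m1 i : exists (C : 'I_(m i) -> calg R) (g : forall j, calg_hom (B i) (C j)),
    (forall j, S' _ (calg_comp (g j) (f i))) /\ pure (fun j => g j : {rmorphism B i -> C j}).
  exact: projT2 (boolp.cid (hs' i)).
pose C i := projT1 (boolp.cid (m1 i)).
have m2 i : exists (g : forall j, calg_hom (B i) (C i j)),
    (forall j, S' _ (calg_comp (g j) (f i))) /\ pure (fun j => g j : {rmorphism B i -> C i j}).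
  exact: projT2 (boolp.cid (m1 i)).
pose g i := projT1 (boolp.cid (m2 i)).
have gP i : (forall j, S' _ (calg_comp (g i j) (f i))) /\ pure (fun j => g i j : {rmorphism B i -> C i j}).
  exact: projT2 (boolp.cid (m2 i)).
pose K : finType := {i : 'I_n & 'I_(m i)}.
exists #|K|, (fun k => let s : K := enum_val k in C (tag s) (tagged s)),
  (fun k => let s : K := enum_val k in calg_comp (g (tag s) (tagged s)) (f (tag s))).
split=> [k|]; first by case: (gP (tag (enum_val k : K))) => h1 _; apply: h1.
apply: (pure_comp p (h := fun i j => g i j)) => [i|i j]; first by case: (gP i).
exists (enum_rank (Tagged (fun i => 'I_(m i)) j : K)); rewrite /= enum_rankK /=.
by exists idfun.
Qed.

Lemma rcov_push (T T' : calg R) (h : calg_hom T T') (S : forall B, calg_hom T B -> Prop) : rcov S ->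
  rcov (fun C (g : calg_hom T' C) => exists B (f : calg_hom T B) (k : calg_hom B C),
    S B f /\ calg_comp k f = calg_comp g h).
Proof.
move=> [n [B [f [hS p]]]].
exists n, (fun i => push (f i) h), (fun i => poR (f i) h); split=> [i|].
  by exists (B i), (f i), (poL (f i) h); split=> //; rewrite po_commE.
exact: pure_push.
Qed.

(** A cover by flat maps which are open for the constructible topology is checked at the points:
    finitely many maps suffice, by the quasi-compactness of the constructible topology. *)
Lemma rcov_point (T : calg R) (S : forall B, calg_hom T B -> Prop) :
  (forall r : T -> Prop, prime r -> exists V (g : calg_hom T V),
    [/\ S V g, flat g, constr_open g & exists s : V -> Prop, prime s /\ forall x, r x <-> s (g x)]) ->
  rcov S.
Proof.
move=> h; pose I := {r : T -> Prop | prime r}.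
have h' (i : I) := h _ (svalP i).
pose V i := projT1 (boolp.cid (h' i)).
have h1 i : exists g : calg_hom T (V i), [/\ S (V i) g, flat g, constr_open g
    & exists s : V i -> Prop, prime s /\ forall x, sval i x <-> s (g x)].
  exact: projT2 (boolp.cid (h' i)).
pose g i := projT1 (boolp.cid (h1 i)).
have gP i : [/\ S (V i) (g i), flat (g i), constr_open (g i)
    & exists s : V i -> Prop, prime s /\ forall x, sval i x <-> s (g i x)].
  exact: projT2 (boolp.cid (h1 i)).
have [||n [c cP]] := @finite_spec_cover T I V (fun i => g i : {rmorphism T -> V i}).
- by move=> i; case: (gP i).
- move=> p pp; have [_ _ _ [s [sp hs]]] := gP (exist _ p pp).
  by exists (exist _ p pp), s.
exists n, (fun j => V (c j)), (fun j => g (c j)); split=> [j|]; first by case: (gP (c j)).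
by apply: flat_cover_pure => // j; case: (gP (c j)).
Qed.

Section FiberedCovers.
Variable Y : fibcat R.

Definition fcov (T : calg R) (y : Y T) (S : forall B (z : Y B), fhom z y -> Prop) : Prop :=
  exists n (B : 'I_n -> calg R) (z : forall i, Y (B i)) (f : forall i, fhom (z i) y),
    (forall i, S _ _ (f i)) /\ pure (fun i => fover (f i) : {rmorphism T -> B i}).

Lemma fcov_of_rcov (T : calg R) (y : Y T) (S0 : forall B, calg_hom T B -> Prop)
    (S : forall B (z : Y B), fhom z y -> Prop) : rcov S0 ->
  (forall B (f : calg_hom T B), S0 B f -> exists (z : Y B) (g : fhom z y), fover g = f /\ S _ _ g) ->
  fcov S.
Proof.
move=> [n [B [f [hS p]]]] h; have h' i := h _ _ (hS i).
pose z i := projT1 (boolp.cid (h' i)).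
have h1 i : exists g : fhom (z i) y, fover g = f i /\ S _ _ g := projT2 (boolp.cid (h' i)).
pose g i := projT1 (boolp.cid (h1 i)).
have gP i : fover (g i) = f i /\ S _ _ (g i) := projT2 (boolp.cid (h1 i)).
exists n, B, z, g; split=> [i|]; first by case: (gP i).
have -> // : (fun i => fover (g i) : {rmorphism T -> B i}) = (fun i => f i : {rmorphism T -> B i}).
by apply/functional_extensionality_dep => i; case: (gP i) => ->.
Qed.
Lemma rcov_of_fcov (T : calg R) (y : Y T) (S : forall B (z : Y B), fhom z y -> Prop) : fcov S ->
  rcov (fun B f => exists (z : Y B) (g : fhom z y), fover g = f /\ S _ _ g).
Proof.
by move=> [n [B [z [g [hS p]]]]]; exists n, B, (fun i => fover (g i)); split=> // i; exists (z i), (g i).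
Qed.

Lemma fcov_sub (T : calg R) (y : Y T) (S S' : forall B (z : Y B), fhom z y -> Prop) :
  fcov S -> (forall B z (f : fhom z y), S B z f -> S' B z f) -> fcov S'.
Proof. by move=> [n [B [z [f [h p]]]]] hs; exists n, B, z, f; split=> // i; apply: hs. Qed.

Lemma fcov_trans (T : calg R) (y : Y T) (S S' : forall B (z : Y B), fhom z y -> Prop) : fcov S ->
  (forall B (z : Y B) (f : fhom z y), S B z f ->
    fcov (fun C (v : Y C) (g : fhom v z) => S' C v (fcomp f g))) ->
  fcov S'.
Proof.
move=> /rcov_of_fcov hS h.
apply: (@fcov_of_rcov _ _ (fun B f => exists (z : Y B) (g : fhom z y), fover g = f /\ S' _ _ g)) => //.
apply: (rcov_trans hS) => B f [z [g [<- /h hg]]].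
apply: (rcov_sub (rcov_of_fcov hg)) => C k [v [l [<- hl]]].
by exists v, (fcomp g l); rewrite fover_comp.
Qed.

Lemma fcov_pull (T T' : calg R) (y : Y T) (y' : Y T') (p : fhom y' y)
    (S : forall B (z : Y B), fhom z y -> Prop) : fcov S ->
  fcov (fun C (v : Y C) (g : fhom v y') => exists B (z : Y B) (f : fhom z y) (k : fhom v z),
    S B z f /\ fcomp f k = fcomp p g).
Proof.
move=> /rcov_of_fcov/(rcov_push (fover p)) h; apply: (fcov_of_rcov h) => C g.
move=> [B [f [k [[z [f' [<- hS]]] e]]]].
have [v [g' eg]] := flift y' g; exists v, g'; split=> //.
have [|k' [[ek _] _]] := @fcartesian _ _ _ _ _ _ _ _ f' (fcomp p g') k.
  by rewrite e fover_comp eg.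
by exists B, z, f', k'.
Qed.

(** All morphisms of a category fibered in groupoids are cartesian. *)
Lemma fmono (A B C : calg R) (x : Y A) (y : Y B) (z : Y C) (p : fhom x y) (f g : fhom z x) :
  fover f = fover g -> fcomp p f = fcomp p g -> f = g.
Proof.
move=> e1 e2; have [|k [_ u]] := @fcartesian _ _ _ _ _ _ _ _ p (fcomp p g) (fover g).
  by rewrite fover_comp.
by rewrite -(u g) // (u f).
Qed.

(** Fibre products over t, computed over the pushout of the rings. *)
Lemma fprod (T B B' : calg R) (t : Y T) (b : Y B) (b' : Y B') (d : fhom b t) (d' : fhom b' t) :
  exists (w : Y (push (fover d) (fover d'))) (p : fhom w b) (q : fhom w b'),
  [/\ fover p = poL (fover d) (fover d'), fover q = poR (fover d) (fover d'), fcomp d p = fcomp d' q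
    & forall A (a : Y A) (f : fhom a b) (g : fhom a b'), fcomp d f = fcomp d' g ->
      exists l : fhom a w, fcomp p l = f /\ fcomp q l = g].
Proof.
have [w [p ep]] := flift b (poL (fover d) (fover d')).
have [|q [[h1 h2] _]] := @fcartesian _ _ _ _ _ _ _ _ d' (fcomp d p) (poR (fover d) (fover d')).
  by rewrite fover_comp ep po_commE.
exists w, p, q; split=> // A a f g e.
have hg t0 : fover f (fover d t0) = fover g (fover d' t0).
  by have := congr1 (fun u => fover u t0) e; rewrite !fover_comp.
have [|l [[h3 h4] _]] := @fcartesian _ _ _ _ _ _ _ _ p f (copair hg).
  by rewrite ep; apply: calg_hom_ext => c; apply: copairL.
exists l; split=> //; apply: (fmono (p := d')).
  by rewrite fover_comp h2 h4; apply: calg_hom_ext => c; apply: copairR.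
by rewrite fcompA h1 -fcompA h3 e.
Qed.

Lemma qresD (N : qcoh Y) (A B : calg R) (x : Y A) (y : Y B) (f : fhom x y) (m n : N B y) :
  qres N f (m + n) = qres N f m + qres N f n.
Proof. exact: linearD. Qed.
Lemma qresZE (N : qcoh Y) (A B : calg R) (x : Y A) (y : Y B) (f : fhom x y) h (e : fover f = h) b
  (m : N B y) : qres N f (b *: m) = h b *: qres N f m.
Proof. by rewrite -e linearZ_LR. Qed.
Lemma qresZ (N : qcoh Y) (A B : calg R) (x : Y A) (y : Y B) (f : fhom x y) b (m : N B y) :
  qres N f (b *: m) = fover f b *: qres N f m.
Proof. exact: linearZ_LR. Qed.
Lemma qres0 (N : qcoh Y) (A B : calg R) (x : Y A) (y : Y B) (f : fhom x y) :
  qres N f 0 = 0.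
Proof. exact: linear0. Qed.

Section Sheaf.
Variables (N : qcoh Y) (T : calg R) (y : Y T).

(** Quasi-coherent sheaves are separated for pure covers. *)
Lemma qsep (S : forall B (z : Y B), fhom z y -> Prop) (n n' : N T y) : fcov S ->
  (forall B z (f : fhom z y), S B z f -> qres N f n = qres N f n') -> n = n'.
Proof.
move=> [k [B [z [f [hS p]]]]] h; apply: (pure_eq p) => i.
apply: (bij_inj (qres_iso N (f i))); rewrite !ext_lift_pure; congr (_ *: _); exact: h.
Qed.

End Sheaf.

Section Glue.
Variables (N : qcoh Y) (T : calg R) (y : Y T).

(** Quasi-coherent sheaves satisfy descent for pure covers: the restriction to the intersection
    of two members of the cover is the extension of scalars to the pushout, so that pure_glue
    applies. The sections to be glued form a relation, as they need not be chosen. *)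
Lemma qglue (Rl : forall B (z : Y B), fhom z y -> N B z -> Prop) :
  fcov (fun B z f => exists m, Rl B z f m) ->
  (forall B z (f : fhom z y) m B' z' (f' : fhom z' y) m' C (v : Y C) (g : fhom v z) (g' : fhom v z'),
    Rl B z f m -> Rl B' z' f' m' -> fcomp f g = fcomp f' g' -> qres N g m = qres N g' m') ->
  exists n, forall B z f m, Rl B z f m -> qres N f n = m.
Proof.
move=> cov cons; have [k [B [z [f [hS p]]]]] := cov.
pose m i := projT1 (boolp.cid (hS i)).
have mP i : Rl _ _ (f i) (m i) := projT2 (boolp.cid (hS i)).
have hx i := bij_surj (qres_iso N (f i)) (m i).
pose x i := projT1 (boolp.cid (hx i)).
have xP i : ext_lift (qres N (f i)) (x i) = m i := projT2 (boolp.cid (hx i)).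
pose v0 j (n : N T y) : rstmod (fover (f j)) (ext (fover (f j)) (N T y)) := ext_pure (fover (f j)) 1 n.
have vl j : linear (v0 j).
  by move=> a s t; rewrite /v0 rstE ext_pureDr ext_pureZ mul1r ext_scale_pure mulr1.
have [||n hn] := @pure_glue T k B _ p (N T y) (fun j => mkL (vl j)) x; first by [].
  move=> i j; set fi := fover (f i); set fj := fover (f j).
  apply: (bij_inj (po_fwd_bij fi fj (ext fj (N T y)))).
  have [w [q eq]] := flift (z i) (poL fi fj).
  have [|q' [[eq' eqo] _]] := @fcartesian _ _ _ _ _ _ _ _ (f j) (fcomp (f i) q) (poR fi fj).
    by rewrite fover_comp eq po_commE.
  pose r0 (c : ext fj (N T y)) : N _ w := qres N q' (ext_lift (qres N (f j)) c).
  have rl : linear_for (poR fi fj \; *:%R) r0.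
    by move=> a s t; rewrite /r0 ext_liftD ext_liftZ qresD (qresZE eqo).
  have rb : isbc (mkL rl).
    have rl' : linear_for (fover (f j) \; *:%R) (fun n : N T y => ext_pure fj 1 n).
      by move=> a s t; rewrite ext_pureDr ext_pureZ mul1r ext_pure1.
    have H a : fover (fcomp (f i) q) a = poR fi fj (fj a).
      by rewrite -eq' fover_comp eqo.
    apply: (isbc_cancel H (u := mkL rl') (w := qres N (fcomp (f i) q))).
    - by move=> c; rewrite /= /r0 ext_lift_pure scale1r -qres_comp eq'.
    - exact: isbc_idfun.
    - exact: qres_iso.
  have key s : ext_lift (mkL rl) (po_fwd fi fj (ext fj (N T y)) (ext_map (mkL (vl j)) s)) =
      qres N q (ext_lift (qres N (f i)) s).
    elim/ext_ind: s => [|b c|s t hs ht].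
    - apply: (@etrans _ _ 0); last by rewrite ext_lift0 qres0.
      by rewrite ext_mapZero (linear0 (po_fwd fi fj (ext fj (N T y)))); exact: ext_lift0.
    - rewrite ext_map_pure po_fwd_pure !ext_lift_pure (qresZE eq).
      by congr (_ *: _); rewrite mkLE /r0 mkLE /v0 ext_lift_pure scale1r -!qres_comp eq'.
    - by rewrite ext_mapD linearD ext_liftD hs ht ext_liftD qresD.
  apply: (bij_inj rb); apply: etrans (key (x i)) _.
  rewrite xP po_fwd_pure ext_lift_pure rmorph1 scale1r mkLE /r0 xP.
  by apply: (cons _ _ _ _ _ _ _ _ _ _ _ _ (mP i) (mP j)); rewrite eq'.
have hn' i : qres N (f i) n = m i by rewrite -xP hn ext_lift_pure scale1r.
exists n => B' z' f' m' hm'.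
apply: (qsep (fcov_pull f' (S := fun B z g => Rl B z g (qres N g n)) _)).
  by exists k, B, z, f; split=> // i; rewrite hn'.
move=> C v g [B0 [z0 [f0 [k0 [h0 e0]]]]].
by rewrite -qres_comp -e0 qres_comp; apply: (cons _ _ _ _ _ _ _ _ _ _ _ _ h0 hm' e0).
Qed.
End Glue.
End FiberedCovers.
End Covers.

(** * Objects over the atlas *)

Local Notation ob s := (projT1 s).
Local Notation st s := (projT2 s).

Section Slices.
Variables (R : cring) (X : fibcat R) (C : calg R) (x : X C).

Definition sob (A : calg R) := {a : X A & fhom a x}.

Section Slice.
Definition shom (A B : calg R) (s : sob A) (t : sob B) :=
  {f : fhom (ob s) (ob t) | fcomp (st t) f = st s}.
Definition slob (A : calg R) (a : X A) (g : fhom a x) : sob A := existT (fun b : X A => fhom b x) a g.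
Definition slhom A B (s : sob A) (t : sob B) (f : fhom (ob s) (ob t))
  (h : fcomp (st t) f = st s) : shom s t := exist _ f h.
Lemma sid_subproof A (s : sob A) : fcomp (st s) (fid (ob s)) = st s.
Proof. exact: fcompf1. Qed.
Lemma scomp_subproof A B D (s : sob A) (t : sob B) (v : sob D) (g : shom t v) (f : shom s t) :
  fcomp (st v) (fcomp (sval g) (sval f)) = st s.
Proof. by rewrite fcompA (svalP g) (svalP f). Qed.
Definition sid A (s : sob A) : shom s s := exist _ _ (sid_subproof s).
Definition scomp A B D (s : sob A) (t : sob B) (v : sob D) (g : shom t v) (f : shom s t) : shom s v :=
  exist _ _ (scomp_subproof g f).

(** Objects with a map to x, and morphisms over x. *)
Definition slice : fibcat R.
Proof.
apply: (@FibCat R sob shom (fun A B s t f => fover (sval f)) sid scomp).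
- by move=> *; apply: sval_inj; apply: fcomp1f.
- by move=> *; apply: sval_inj; apply: fcompf1.
- by move=> *; apply: sval_inj; apply: fcompA.
- by move=> *; apply: fover_id.
- by move=> *; apply: fover_comp.
- move=> A B y f; have [z [p e]] := flift (ob y) f.
  by exists (slob (fcomp (st y) p)), (@slhom _ _ (slob (fcomp (st y) p)) y p erefl).
- move=> A B D y z v p q h e.
  have [k [[k1 k2] ku]] := @fcartesian _ _ _ _ _ _ _ _ (sval p) (sval q) h e.
  have kP : fcomp (st y) k = st v by rewrite -(svalP p) -fcompA k1 (svalP q).
  exists (exist _ k kP); split; first by split=> //; apply: sval_inj.
  by move=> k' [h1 h2]; apply: sval_inj; apply: ku; split=> //; rewrite -h1.
Defined.
End Slice.

(** Objects with a map to x, and all morphisms of X between them: up to equivalence, the full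
    subcategory of the objects which admit a map to x. *)
Definition over : fibcat R.
Proof.
apply: (@FibCat R sob (fun A B s t => fhom (ob s) (ob t)) (fun A B s t f => fover f)
  (fun A s => fid (ob s)) (fun A B D s t v g f => fcomp g f)).
- by move=> *; apply: fcomp1f.
- by move=> *; apply: fcompf1.
- by move=> *; apply: fcompA.
- by move=> *; apply: fover_id.
- by move=> *; apply: fover_comp.
- move=> A B y f; have [z [p e]] := flift (ob y) f.
  by exists (slob (fcomp (st y) p)), p.
- by move=> A B D y z v p q h e; apply: (@fcartesian _ X _ _ _ (ob y) (ob z) (ob v) p q h e).
Defined.

(** Composition with the structure map of s lifts the members of a cover to the slice. *)
Lemma fcov_slice (A : calg R) (s : slice A) (S : forall B (z : X B), fhom z (ob s) -> Prop) :
  @fcov R X A (ob s) S ->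
  fcov (fun B (z : slice B) (f : fhom z s) => S B (ob z) (sval f)).
Proof.
move=> [n [B [z [f [hS p]]]]].
by exists n, B, (fun i => slob (fcomp (st s) (f i))), (fun i => @slhom _ _ (slob (fcomp (st s) (f i))) s (f i) erefl).
Qed.

Section Charts.
Hypothesis Cx : fpqc_atlas x.

(** Any two maps to x are covered by pairs which factor through a chart of the fibre product of
    x with itself; on a chart the second projection is flat, and two factorizations through
    charts are, locally, joined by a third object. *)
Record chart_data := ChartData {
  is_chart : forall W (w : X W), fhom w x -> fhom w x -> Prop;
  chart_flat : forall W (w : X W) (al be : fhom w x), is_chart al be -> flat (fover be);
  chart_lift : forall A (a : X A) (al be : fhom a x),
    fcov (fun B (z : X B) (f : fhom z a) => flat (fover f) /\
      exists W (w : X W) (al' be' : fhom w x) (e : fhom z w),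
      [/\ is_chart al' be', fcomp al' e = fcomp al f & fcomp be' e = fcomp be f]);
  chart_agree : forall A (a : X A) W (w : X W) (al be : fhom w x) W' (w' : X W') (al' be' : fhom w' x)
    (e : fhom a w) (e' : fhom a w'), is_chart al be -> is_chart al' be' ->
    fcomp al e = fcomp al' e' -> fcomp be e = fcomp be' e' ->
    fcov (fun B (z : X B) (f : fhom z a) =>
      exists V (v : X V) (d : fhom v w) (d' : fhom v w') (k : fhom z v),
      [/\ flat (fover d), fcomp al d = fcomp al' d' /\ fcomp be d = fcomp be' d', fcomp d k = fcomp e f
        & fcomp d' k = fcomp e' f]) }.

Lemma chart_data_exists : inhabited chart_data.
Proof.
have [P [cl [q [[cl_surj cl_eq cl_res] qcl [_ hdiag _] [U [a [[hU hes] hfl _]]]]]]] := Cx x.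
(* charts are the affine opens of an étale atlas of the algebraic space P *)
pose ischart W (w : X W) (al be : fhom w x) :=
  exists u : U W, affine_open u /\ cl W (Span al be) = a W u.
have lift A (b : X A) (al be : fhom b x) B (g : calg_hom A B) : exists (z : X B) (f : fhom z b),
    fover f = g /\ cl B (Span (fcomp al f) (fcomp be f)) = pres g (cl A (Span al be)).
  have [z [f e]] := flift b g; exists z, f; split=> //; apply: cl_res.
  by exists f; split.
constructor; apply: (@ChartData ischart).
- by move=> W w al be [u [au e]]; have := hfl _ u au; rewrite -e qcl.
- move=> A b al be; apply: (@fcov_of_rcov _ _ _ _ (fun V g => flat g /\
      exists D (w : U D) (h : calg_hom D V), affine_open w /\ pres h (a D w) = pres g (cl A (Span al be)))).
    apply: rcov_point => r rp; have [V [g [gf go gs ge]]] := chart_cover hU hes (cl A (Span al be)) rp.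
    by exists V, g; split.
  move=> V g [gf [D [u [h [au eh]]]]].
  have [s es] := cl_surj D (a D u).
  have [z [f [ef clz]]] := lift A b al be V g.
  have [z' [f' [ef' clz']]] := lift D (apex s) (span_fst s) (span_snd s) V h.
  have e : cl V (Span (fcomp al f) (fcomp be f)) = cl V (Span (fcomp (span_fst s) f') (fcomp (span_snd s) f')).
    by rewrite clz clz' -eh -es; case: (s).
  move/cl_eq: e => [k [/= k1 k2 k3]].
  exists z, f; split=> //; split; first by rewrite ef.
  exists D, (apex s), (span_fst s), (span_snd s), (fcomp f' k); split.
  + by exists u; split=> //; rewrite -es; case: (s).
  + by rewrite fcompA.
  + by rewrite fcompA.
- move=> A b W w al be W' w' al' be' e e' [u [au eu]] [u' [au' eu']] eal ebe.
  have clb : pres (fover e) (a W u) = pres (fover e') (a W' u').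
    rewrite -eu -eu'; rewrite -(cl_res _ _ _ (Span (fcomp al e) (fcomp be e))); last by exists e.
    by rewrite -(cl_res _ _ (fover e') (Span (fcomp al e) (fcomp be e))) //; exists e'.
  apply: (@fcov_of_rcov _ _ _ _ (fun B g => exists V (d : calg_hom W V) (d' : calg_hom W' V) (k : calg_hom V B),
     [/\ etale d, pres d (a W u) = pres d' (a W' u'), calg_comp k d = calg_comp g (fover e)
    & calg_comp k d' = calg_comp g (fover e')])).
    apply: rcov_point => r rp.
    have [i [ri [V [d [d' [k [h1 h2 h3 h4]]]]]]] := chart_overlap hdiag hes au' clb rp.
    exists (Loc i), (loc i); split; [|exact: (etale_flat (etale_loc i))
      |exact: (constr_open_fin_pres (etale_loc i).1)|].
      by exists V, d, d', k.
    by have [s [sp hs]] := loc_prime rp ri; exists s.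
  move=> B g [V [d [d' [k [h1 h2 h3 h4]]]]].
  have [v [f [ef clv]]] := lift _ _ al be V d.
  have [v' [f' [ef' clv']]] := lift _ _ al' be' V d'.
  have /cl_eq[j [/= j1 j2 j3]] : cl V (Span (fcomp al f) (fcomp be f)) = cl V (Span (fcomp al' f') (fcomp be' f')).
    by rewrite clv clv' eu eu' h2.
  have [z [p ep]] := flift b g.
  have [|m [[m1 m2] _]] := @fcartesian _ _ _ _ _ _ _ _ f (fcomp e p) k.
    by rewrite ef h3 fover_comp ep.
  exists z, p; split=> //; exists V, v, f, (fcomp f' j), m; split.
  + by rewrite ef; apply: etale_flat.
  + by rewrite !fcompA j2 j3.
  + by [].
  + apply: (fmono (p := al')).
      by rewrite !fover_comp m2 j1 calg_comp1f ef' ep.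
    by rewrite !fcompA j2 -fcompA m1 fcompA eal.
Qed.
End Charts.
End Slices.

(** * The descent datum of a kernel *)

Section KernelDescent.
Variables (R : cring) (X : fibcat R) (C : calg R) (x : X C) (cd : chart_data x).
Variables (F G : qcoh X) (h : qhom F G).
Notation Y := (slice x).

Definition K0 : lmodType C := submodm (ker_submod (h C x)).
Definition K0val (k : K0) : F C x := @smval _ _ _ (ker_submod (h C x)) k.
Lemma K0val_ker k : h C x (K0val k) = 0. Proof. exact: (@smvalP _ _ _ (ker_submod (h C x)) k). Qed.
Lemma K0valP c k k' : K0val (c *: k + k') = c *: K0val k + K0val k'. Proof. by []. Qed.

Lemma slice_fover A B (s : Y A) (t : Y B) (E : fhom s t) c :
  fover (st s) c = fover E (fover (st t) c).
Proof. by rewrite -(svalP E) fover_comp. Qed.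

(** The extension of scalars of the kernel at x along all maps to x. It is a sheaf on the slice,
    since it depends on the map to x and not only on the object. *)
Definition N0 : qcoh Y.
Proof.
apply: (@QCoh R Y (fun A (s : Y A) => ext (fover (st s)) K0)
  (fun A B (s : Y A) (t : Y B) E => ext_bc (slice_fover E) K0)).
- move=> A s m; elim/ext_ind: m => [|b m|m n hm hn]; first exact: ext_bc0.
    by rewrite ext_bc_pure /= fover_id.
  by rewrite ext_bcD hm hn.
- move=> A B D s t v g f m; elim/ext_ind: m => [|b m|m n hm hn].
  + by rewrite !ext_bc0.
  + by rewrite !ext_bc_pure /= fover_comp.
  + by rewrite !ext_bcD hm hn.
- by move=> A B s t E; exact: ext_tower.
Defined.

Lemma N0_pure A B (s : Y A) (t : Y B) (E : fhom s t) b k :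
  qres N0 E (ext_pure (fover (st t)) b k) = ext_pure (fover (st s)) (fover E b) k.
Proof. exact: ext_bc_pure. Qed.

Lemma kap_linear A (s : Y A) : linear_for (fover (st s) \; *:%R) (fun k : K0 => qres F (st s) (K0val k)).
Proof. by move=> c k k'; rewrite K0valP qresD qresZ. Qed.
Definition kap A (s : Y A) : {linear N0 A s -> F A (ob s)} := ext_lift (mkL (kap_linear s)).
Lemma kap_pure A (s : Y A) b k : kap s (ext_pure (fover (st s)) b k) = b *: qres F (st s) (K0val k).
Proof. exact: ext_lift_pure. Qed.
Lemma kap0 A (s : Y A) : kap s 0 = 0. Proof. exact: linear0. Qed.
Lemma kapD A (s : Y A) m n : kap s (m + n) = kap s m + kap s n. Proof. exact: linearD. Qed.
Lemma kapZ A (s : Y A) c m : kap s (c *: m) = c *: kap s m. Proof. exact: linearZ. Qed.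

Lemma kap_res A B (s : Y A) (t : Y B) (E : fhom s t) n : kap s (qres N0 E n) = qres F (sval E) (kap t n).
Proof.
elim/ext_ind: n => [|b k|m n hm hn].
- by rewrite qres0 !kap0 qres0.
- by rewrite N0_pure !kap_pure qresZ -qres_comp (svalP E).
- by rewrite qresD !kapD qresD hm hn.
Qed.

Lemma kap_h A (s : Y A) n : h A (ob s) (kap s n) = 0.
Proof.
elim/ext_ind: n => [|b k|m n hm hn].
- by rewrite kap0 linear0.
- by rewrite kap_pure linearZ /= qfun_nat K0val_ker qres0 scaler0.
- by rewrite kapD linearD hm hn addr0.
Qed.

Let i0 : {linear K0 -> F C x} := @smval _ _ _ (ker_submod (h C x)).
Lemma kapE A (s : Y A) n : kap s n = ext_lift (qres F (st s)) (ext_map i0 n).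
Proof. by symmetry; apply: ext_lift_map. Qed.

(** Over a flat map to x the extension of scalars of the kernel is again the kernel. *)
Lemma kap_inj A (s : Y A) : flat (fover (st s)) -> injective (kap s).
Proof.
move=> fl m n; rewrite !kapE => /(bij_inj (qres_iso F (st s))).
by apply: fl; apply: smval_inj.
Qed.
Lemma kap_surj A (s : Y A) f : flat (fover (st s)) -> h A (ob s) f = 0 -> exists n, kap s n = f.
Proof.
move=> fl; have [y <-] := bij_surj (qres_iso F (st s)) f => e.
have hu m : h C x m = 0 -> exists k, i0 k = m.
  by move=> hm; exact: (smval_ex (ker_submod (h C x)) hm).
have [|n en] := @flat_exact _ _ (fover (st s)) _ _ _ i0 (h C x) fl hu y; last by exists n; rewrite kapE en.
apply: (bij_inj (qres_iso G (st s))); rewrite ext_lift0 -e.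
elim/ext_ind: y {e} => [|b m|m n hm hn].
- by rewrite ext_mapZero !ext_lift0 linear0.
- by rewrite ext_map_pure !ext_lift_pure linearZ /= qfun_nat.
- by rewrite ext_mapD !ext_liftD linearD hm hn.
Qed.

(** The pullbacks along al and be of the kernel to w are compared inside F: if be is flat, the
    pullback along be is the kernel at w, which contains the pullback of k along al. *)
Definition sol (k : K0) W (w : X W) (al be : fhom w x) (m : N0 W (slob be)) : Prop :=
  kap (slob be) m = qres F al (K0val k).

Lemma sol_ex k W (w : X W) (al be : fhom w x) : flat (fover be) -> exists m, sol k al (be := be) m.
Proof. by move=> fl; apply: kap_surj => //; rewrite qfun_nat K0val_ker qres0. Qed.

Lemma sol_chart k W (w : X W) (al be : fhom w x) (m : N0 W (slob be)) A (s : Y A)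
    (E : fhom s (slob be : Y W)) : flat (fover be) -> sol k al m ->
  fcov (fun B (t : Y B) (g : fhom t s) => exists V (v : X V) (al' be' : fhom v x)
    (e : fhom t (slob be' : Y V)), [/\ is_chart cd al' be',
     fcomp al' (sval e) = fcomp al (fcomp (sval E) (sval g))
   & forall m', sol k al' m' -> qres N0 (fcomp E g) m = qres N0 e m']).
Proof.
move=> fl hm.
apply: (fcov_sub (fcov_slice (fcov_pull (sval E) (chart_lift cd al be)))) => B t g.
move=> [D [v [f [l [[ff [V [c [al' [be' [e [hc e1 e2]]]]]]] efl]]]]].
pose sv : Y D := slob (fcomp be f).
pose Ev : fhom sv (slob be : Y W) := @slhom _ _ _ _ _ _ sv (slob be) f erefl.
have lP : fcomp (fcomp be f) l = st t by rewrite -fcompA efl fcompA (svalP E) (svalP g).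
pose le : fhom t sv := @slhom _ _ _ _ _ _ t sv l lP.
pose ec : fhom sv (slob be' : Y V) := @slhom _ _ _ _ _ _ sv (slob be') e e2.
exists V, c, al', be', (fcomp ec le); split=> //.
  by rewrite /= fcompA e1 -fcompA efl.
move=> m' hm'.
have -> : fcomp E g = fcomp Ev le by apply: sval_inj; rewrite /= -efl.
rewrite !qres_comp; congr (qres _ _ _).
apply: kap_inj.
  apply: (flat_comp (k := fover (fcomp be f)) _ fl ff) => a; by rewrite fover_comp.
by rewrite !kap_res hm hm' /= -!qres_comp e1.
Qed.

(** Locally the two pairs factor through charts, by sol_chart, and these are joined by an object
    which is flat over x; there both elements are determined by their common image in F. *)
Lemma sol_agree k W (w : X W) (al be : fhom w x) (m : N0 W (slob be))
    W' (w' : X W') (al' be' : fhom w' x) (m' : N0 W' (slob be')) A (s : Y A)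
    (E : fhom s (slob be : Y W)) (E' : fhom s (slob be' : Y W')) :
  flat (fover be) -> flat (fover be') -> sol k al m -> sol k al' m' ->
  fcomp al (sval E) = fcomp al' (sval E') -> qres N0 E m = qres N0 E' m'.
Proof.
move=> fl fl' hm hm' eal.
apply: (qsep (S := fun B t g => qres N0 g (qres N0 E m) = qres N0 g (qres N0 E' m'))) => //.
apply: (fcov_trans (sol_chart E fl hm)) => B t g [V [c [al1 [be1 [e1 [c1 a1 h1]]]]]].
apply: (fcov_trans (sol_chart (fcomp E' g) fl' hm')) => B2 t2 g2 [V' [c' [al2 [be2 [e2 [c2 a2 h2]]]]]].
have ea : fcomp al1 (sval (fcomp e1 g2)) = fcomp al2 (sval e2).
  by rewrite a2 /= fcompA a1 !fcompA eal.
have eb : fcomp be1 (sval (fcomp e1 g2)) = fcomp be2 (sval e2).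
  by rewrite (svalP (fcomp e1 g2)) (svalP e2).
apply: (fcov_sub (fcov_slice (chart_agree c1 c2 ea eb))) => B3 t3 g3.
move=> [D [v [d [d' [l [fd [ha hb] k1 k2]]]]]].
pose sv : Y D := slob (fcomp be1 d).
pose d1 : fhom sv (slob be1 : Y V) := @slhom _ _ _ _ _ _ sv (slob be1) d erefl.
pose d2 : fhom sv (slob be2 : Y V') := @slhom _ _ _ _ _ _ sv (slob be2) d' (esym hb).
have lP : fcomp (fcomp be1 d) l = st t3.
  by rewrite -fcompA k1 fcompA (svalP (fcomp e1 g2)) (svalP g3).
pose le : fhom t3 sv := @slhom _ _ _ _ _ _ t3 sv l lP.
have [m1 hm1] := sol_ex k al1 (chart_flat c1).
have [m2 hm2] := sol_ex k al2 (chart_flat c2).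
have := h1 _ hm1; have := h2 _ hm2; rewrite !qres_comp => -> ->.
have e12 : qres N0 d1 m1 = qres N0 d2 m2.
  apply: kap_inj; last by rewrite !kap_res hm1 hm2 /= -!qres_comp ha.
  by apply: (flat_comp (k := fover (fcomp be1 d)) _ (chart_flat c1) fd) => a; rewrite fover_comp.
have q1 : fcomp e1 (fcomp g2 g3) = fcomp d1 le by apply: sval_inj; rewrite /= k1 fcompA.
have q2 : fcomp e2 g3 = fcomp d2 le by apply: sval_inj; rewrite /= k2.
by rewrite -!qres_comp q1 q2 !qres_comp e12.
Qed.

(** n is the image of k under the descent datum at the pair of al and the structure map of s.
    This pair need not be flat, so that n is only tested on the objects over s where it factors
    through a flat one. *)
Definition Th (k : K0) A (s : Y A) (al : fhom (ob s) x) (n : N0 A s) : Prop :=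
  forall B (t : Y B) (p : fhom t s) W (w : X W) (al' be' : fhom w x) (E : fhom t (slob be' : Y W))
    (m : N0 W (slob be')), flat (fover be') -> fcomp al' (sval E) = fcomp al (sval p) ->
    sol k al' m -> qres N0 p n = qres N0 E m.

Lemma lift_cover A (s : Y A) (al : fhom (ob s) x) :
  fcov (fun B (t : Y B) (p : fhom t s) => exists W (w : X W) (al' be' : fhom w x) (E : fhom t (slob be' : Y W)),
    flat (fover be') /\ fcomp al' (sval E) = fcomp al (sval p)).
Proof.
apply: (fcov_sub (fcov_slice (chart_lift cd al (st s)))) => B t p.
move=> [_ [W [w [al' [be' [e [c1 e1 e2]]]]]]].
have eP : fcomp be' e = st t by rewrite e2 (svalP p).
exists W, w, al', be', (@slhom _ _ _ _ _ _ t (slob be') e eP); split=> //; exact: chart_flat c1.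
Qed.

Lemma Th_uniq k A (s : Y A) (al : fhom (ob s) x) n n' : Th k al n -> Th k al n' -> n = n'.
Proof.
move=> hn hn'; apply: (qsep (lift_cover al)) => B t p [W [w [al' [be' [E [fl e]]]]]].
have [m hm] := sol_ex k al' fl.
by rewrite (hn _ _ _ _ _ _ _ _ _ fl e hm) (hn' _ _ _ _ _ _ _ _ _ fl e hm).
Qed.

(** Glue the local solutions, which agree by sol_agree. *)
Lemma Th_ex k A (s : Y A) (al : fhom (ob s) x) : exists n : N0 A s, Th k al n.
Proof.
pose Rl B (t : Y B) (p : fhom t s) (n : N0 B t) := exists W (w : X W) (al' be' : fhom w x)
  (E : fhom t (slob be' : Y W)) m, [/\ flat (fover be'), fcomp al' (sval E) = fcomp al (sval p), sol k al' m
    & n = qres N0 E m].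
have [||n hn] := @qglue R Y N0 A s Rl.
- apply: (fcov_sub (lift_cover al)) => B t p [W [w [al' [be' [E [fl e]]]]]].
  have [m hm] := sol_ex k al' fl.
  by exists (qres N0 E m), W, w, al', be', E, m.
- move=> B z f _ B' z' f' _ D v g g' [W [w [al1 [be1 [E [m [fl e hm ->]]]]]]]
    [W' [w' [al2 [be2 [E' [m' [fl' e' hm' ->]]]]]]] egg.
  rewrite -!qres_comp; apply: (sol_agree fl fl' hm hm').
  rewrite /= !fcompA e e' -!fcompA; congr (fcomp _ _); exact: (congr1 sval egg).
by exists n => B t p W w al' be' E m fl e hm; apply: hn; exists W, w, al', be', E, m.
Qed.

Lemma ThP k k' c A (s : Y A) (al : fhom (ob s) x) n n' : Th k al n -> Th k' al n' ->
  Th (c *: k + k') al (fover al c *: n + n').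
Proof.
move=> hn hn' B t p W w al' be' E m fl e hm.
have [m1 hm1] := sol_ex k al' fl; have [m2 hm2] := sol_ex k' al' fl.
have -> : m = fover al' c *: m1 + m2.
  by apply: (kap_inj (s := slob be' : Y W) fl); rewrite kapD kapZ hm1 hm2 hm K0valP qresD qresZ.
rewrite !qresD !qresZ (hn _ _ _ _ _ _ _ _ _ fl e hm1) (hn' _ _ _ _ _ _ _ _ _ fl e hm2).
congr (_ *: _ + _); have := congr1 (fun u => fover u c) e.
by rewrite !fover_comp.
Qed.

Lemma Th_res k A (s : Y A) (al : fhom (ob s) x) n B (t : Y B) (p : fhom t s) :
  Th k al n -> Th k (fcomp al (sval p)) (qres N0 p n).
Proof.
move=> hn D v q W w al' be' E m fl e hm; rewrite -qres_comp; apply: hn fl _ hm.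
by rewrite e fcompA.
Qed.

Definition th1 A (s : Y A) (al : fhom (ob s) x) (k : K0) : N0 A s := projT1 (boolp.cid (Th_ex k al)).
Lemma th1P A (s : Y A) (al : fhom (ob s) x) k : Th k al (th1 al k : N0 A s).
Proof. exact: projT2 (boolp.cid _). Qed.
Arguments th1P {A s} al k {B t} p {W w al' be'} E {m} _ _ _.
Lemma th1_linear A (s : Y A) (al : fhom (ob s) x) : linear_for (fover al \; *:%R) (@th1 A s al).
Proof. by move=> c k k'; apply: (@Th_uniq (c *: k + k') _ _ al); [|apply: ThP]; apply: th1P. Qed.

(** The descent datum: an isomorphism between the extensions of the kernel along two maps from
    the same object to x, by theta_refl and theta_comp. *)
Definition theta A (s : Y A) (al : fhom (ob s) x) : {linear N0 A (slob al) -> N0 A s} :=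
  ext_lift (mkL (th1_linear al)).
Lemma theta_pure A (s : Y A) (al : fhom (ob s) x) b k :
  theta al (ext_pure (fover al) b k) = b *: th1 al k.
Proof. exact: ext_lift_pure. Qed.
Lemma theta0 A (s : Y A) (al : fhom (ob s) x) : @theta A s al 0 = 0. Proof. exact: linear0. Qed.
Lemma thetaD A (s : Y A) (al : fhom (ob s) x) m n : @theta A s al (m + n) = theta al m + theta al n.
Proof. exact: linearD. Qed.
Lemma thetaZ A (s : Y A) (al : fhom (ob s) x) c n : @theta A s al (c *: n) = c *: theta al n.
Proof. exact: linearZ. Qed.

Lemma theta_res A B (s : Y A) (t : Y B) (p : fhom t s) (al : fhom (ob s) x) (al' : fhom (ob t) x)
    (q : fhom (slob al' : Y B) (slob al : Y A)) n : sval q = sval p ->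
  theta al' (qres N0 q n) = qres N0 p (theta al n).
Proof.
move=> e; have e' : fcomp al (sval p) = al' by rewrite -e; exact: (svalP q).
elim/ext_ind: n => [|b k|m n hm hn].
- by rewrite qres0 !theta0 qres0.
- rewrite N0_pure !theta_pure qresZ /= e; congr (_ *: _).
  by apply: (@Th_uniq k _ _ al'); [exact: th1P|rewrite -e'; apply: Th_res; apply: th1P].
- by rewrite qresD !thetaD qresD hm hn.
Qed.

Lemma id_flat : flat (fover (fid x)).
Proof.
rewrite fover_id => M N i ii m n e.
have l (P : lmodType C) : linear_for (calg_id C \; *:%R) (@id P) by [].
have k (P : lmodType C) : bijective (ext_lift (mkL (l P)) : ext (calg_id C) P -> P).
  exists (ext_pure (calg_id C) 1) => y; last by rewrite ext_lift_pure scale1r.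
  elim/ext_ind: y => [|b y|y z hy hz]; first by rewrite ext_lift0 ext_pure0r.
    by rewrite ext_lift_pure mkLE ext_pureZ mul1r.
  by rewrite ext_liftD ext_pureDr hy hz.
have s (y : ext (calg_id C) M) : ext_lift (mkL (l N)) (ext_map i y) = i (ext_lift (mkL (l M)) y).
  elim/ext_ind: y => [|b y|y z hy hz]; first by rewrite ext_mapZero !ext_lift0 linear0.
    by rewrite ext_map_pure !ext_lift_pure !mkLE linearZ.
  by rewrite ext_mapD !ext_liftD linearD hy hz.
by apply: (bij_inj (k M)); apply: ii; rewrite -!s e.
Qed.

(** The pair of two identities of x is flat, with solution k itself. *)
Lemma theta_refl A (s : Y A) n : theta (st s) n = n :> N0 A s.
Proof.
elim/ext_ind: n => [|b k|m n hm hn]; last by rewrite thetaD hm hn.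
  exact: theta0.
rewrite theta_pure [RHS]ext_pure1; congr (_ *: _).
apply: (@Th_uniq k _ _ (st s)); first exact: th1P.
move=> B t p W w al' be' E m fl e hm; rewrite N0_pure rmorph1.
have tP : fcomp (fid x) (st t) = st t by rewrite fcomp1f.
pose E0 : fhom t (slob (fid x) : Y C) := @slhom _ _ _ _ _ _ t (slob (fid x)) (st t) tP.
have h0 : sol k (fid x) (ext_pure (fover (fid x)) 1 k : N0 C (slob (fid x))).
  by rewrite /sol kap_pure scale1r.
rewrite -(sol_agree (E := E0) id_flat fl h0 hm) ?N0_pure ?rmorph1 //.
by rewrite e /= (svalP p) fcomp1f.
Qed.

(** Two composable pairs give a pair on their fibre product; flatness of the second leg is
    preserved since it is stable under base change. *)
Lemma pair_comp W1 (w1 : X W1) (al1 be1 : fhom w1 x) W2 (w2 : X W2) (al2 be2 : fhom w2 x)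
    A (a : X A) (e1 : fhom a w1) (e2 : fhom a w2) : flat (fover be1) -> flat (fover be2) ->
  fcomp be1 e1 = fcomp al2 e2 ->
  exists V (v : X V) (p1 : fhom v w1) (p2 : fhom v w2) (e : fhom a v),
    [/\ fcomp be1 p1 = fcomp al2 p2, flat (fover (fcomp be2 p2)), fcomp p1 e = e1 & fcomp p2 e = e2].
Proof.
move=> f1 f2 e12.
have [v [p1 [p2 [_ h2 h1 /(_ _ _ _ _ e12)[e [h3 h4]]]]]] := fprod be1 al2.
exists _, v, p1, p2, e; split=> //.
apply: (flat_comp (k := fover (fcomp be2 p2)) _ f2 (g := fover p2)) => [b|]; first by rewrite fover_comp.
by rewrite h2; apply: flat_push.
Qed.

(** The cocycle condition. Locally both factors are computed by flat pairs, and their composite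
    is a flat pair which computes the right hand side. *)
Lemma theta_comp A (s : Y A) (al be : fhom (ob s) x) n :
  theta be (theta (s := slob be : Y A) al n) = theta al n :> N0 A s.
Proof.
elim/ext_ind: n => [|b k|m n hm hn]; last by rewrite !thetaD hm hn.
  by rewrite !theta0.
rewrite !theta_pure thetaZ; congr (_ *: _).
apply: (@Th_uniq k _ _ al); last exact: th1P.
set n1 := th1 (s := slob be : Y A) al k.
have hn1 : Th (s := slob be : Y A) k al n1 := @th1P _ (slob be : Y A) al k.
move=> B t p W w al' be' E m fl e hm.
have tmp : fcomp be (sval p) = fcomp be (sval p) by [].
pose q : fhom (slob (fcomp be (sval p)) : Y B) (slob be : Y A) :=
  @slhom _ _ _ _ _ _ (slob (fcomp be (sval p))) (slob be) (sval p) tmp.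
rewrite -(theta_res (p := p) (q := q)) //.
set be_t := fcomp be (sval p).
apply: (qsep (S := fun B2 t2 g => qres N0 g (theta be_t (qres N0 q n1) : N0 B t) = qres N0 g (qres N0 E m))) => //.
apply: (fcov_trans (lift_cover (s := t) be_t)) => B2 t2 g2 [W2 [w2 [al2 [be2 [E2 [fl2 a2]]]]]].
pose s2 : Y B2 := slob (fcomp be_t (sval g2)).
have := fcov_slice (s := t2) (chart_lift cd (fcomp al (fcomp (sval p) (sval g2))) (st s2)).
move=> /fcov_sub; apply => B3 t3 g3 [_ [W1 [w1 [al1 [be1 [e1 [c1 a1 b1]]]]]]].
have fl1 := chart_flat c1.
have [|V [v [p1 [p2 [ev [hp flv ev1 ev2]]]]]] := @pair_comp _ w1 al1 be1 _ w2 al2 be2 _ _ e1 (sval (fcomp E2 g3)) fl1 fl2.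
  by rewrite /= b1 fcompA a2.
pose s3 : Y B3 := slob (fcomp (fcomp be_t (sval g2)) (sval g3)).
have g3P : fcomp (st s2) (sval g3) = st s3 by [].
pose E1 : fhom s3 (slob be1 : Y W1) := @slhom _ _ _ _ _ _ s3 (slob be1) e1 b1.
have evP : fcomp (fcomp be2 p2) ev = st t3 by rewrite -fcompA ev2 (svalP (fcomp E2 g3)).
pose Ev : fhom t3 (slob (fcomp be2 p2) : Y V) := @slhom _ _ _ _ _ _ t3 (slob (fcomp be2 p2)) ev evP.
(* on the composite of the flat pairs, theta is determined by the images in F *)
have key m0 : exists mv : N0 V (slob (fcomp be2 p2)),
    kap (slob (fcomp be2 p2)) mv = qres F p1 (kap (slob be1) m0) /\
    theta (s := t3) (st s3) (qres N0 E1 m0) = qres N0 Ev mv.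
  elim/ext_ind: m0 => [|b' k'|m0 n0 [mv [hmv1 hmv2]] [nv [hnv1 hnv2]]].
  - by exists 0; rewrite !kap0 !qres0 theta0.
  - have [m2 hm2] := sol_ex k' al2 fl2.
    pose P2 : fhom (slob (fcomp be2 p2) : Y V) (slob be2 : Y W2) :=
      @slhom _ _ _ _ _ _ (slob (fcomp be2 p2)) (slob be2) p2 erefl.
    exists (fover p1 b' *: qres N0 P2 m2); split.
      by rewrite kapZ kap_res hm2 kap_pure qresZ -!qres_comp hp.
    rewrite N0_pure theta_pure qresZ -qres_comp; congr (_ *: _).
      by rewrite -[LHS]/(fover e1 b') -ev1 fover_comp.
    have := @th1P _ t3 (st s3) k' _ _ (fid t3) _ _ _ _ (fcomp P2 Ev) _ fl2 _ hm2.
    rewrite qres_id; apply; rewrite /= ev2 fcompf1 /= fcompA a2.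
    by [].
  - by exists (mv + nv); rewrite !kapD !qresD thetaD hmv1 hmv2 hnv1 hnv2.
have [m1 hm1] := sol_ex k al1 fl1.
have [mv [hmv1 hmv2]] := key m1.
have hmv : sol k (fcomp al1 p1) mv by rewrite /sol hmv1 hm1 qres_comp.
pose q3 : fhom s3 (slob be_t : Y B) :=
  @slhom _ _ _ _ _ _ s3 (slob be_t) (fcomp (sval g2) (sval g3)) (fcompA _ _ _).
rewrite -(theta_res (p := fcomp g2 g3) (q := q3)) // -!qres_comp.
have -> : qres N0 (fcomp q q3) n1 = qres N0 E1 m1.
  apply: (hn1 _ _ _ _ _ _ _ _ _ fl1 _ hm1); rewrite /= a1.
  by rewrite -!fcompA.
rewrite hmv2; apply: (sol_agree flv fl hmv hm).
rewrite /= -fcompA ev1 a1 !fcompA e -!fcompA.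
by [].
Qed.

(** The descent datum is compatible with the maps to F, by construction. *)
Lemma kap_theta A (s : Y A) (al : fhom (ob s) x) n : kap s (theta al n) = kap (slob al) n.
Proof.
elim/ext_ind: n => [|b k|m n hm hn]; last by rewrite thetaD !kapD hm hn.
  by rewrite theta0 !kap0.
rewrite theta_pure kapZ kap_pure; congr (_ *: _).
have := rcov_of_fcov (lift_cover al).
move=> /(fcov_of_rcov (y := ob s) (S := fun B z g => qres F g (kap s (th1 al k)) = qres F g (qres F al (K0val k)))) cov.
apply: (qsep (cov _)) => // B f [t [p [<- [W [w [al' [be' [E [fl e]]]]]]]]].
exists (ob t), (sval p); split=> //.
have [m hm] := sol_ex k al' fl.
by rewrite -kap_res (th1P al k p E fl e hm) kap_res hm /= -!qres_comp e.
Qed.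

End KernelDescent.

(** * The kernel on the objects which map to the atlas *)

Section AtlasCover.
Variables (R : cring) (X : fibcat R) (C : calg R) (x : X C).

(** An fpqc covering is a cover by flat maps; the affine opens of the atlas of the fibre product
    with x have a map to x. *)
Lemma atlas_cover (Cx : fpqc_atlas x) T (t : X T) :
  fcov (fun B (z : X B) (f : fhom z t) => flat (fover f) /\ exists g : fhom z x, True).
Proof.
have [P [cl [q [[cl_surj _ _] qcl _ [U [a [[hU hes] hfl [n [B [u [au us]]]]]]]]]]] := Cx T t.
have hs i := cl_surj (B i) (a (B i) (u i)).
pose s i := projT1 (boolp.cid (hs i)).
have sP i : cl _ (s i) = a _ (u i) := projT2 (boolp.cid (hs i)).
have fE i : fover (span_snd (s i)) = q (B i) (a (B i) (u i)) by rewrite -qcl sP.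
have fl i : flat (fover (span_snd (s i))) by rewrite fE; apply: hfl.
exists n, B, (fun i => apex (s i)), (fun i => span_snd (s i)); split=> [i|].
  by split=> //; exists (span_fst (s i)).
apply: flat_cover_pure => // p /primeE pp; have [i [r [rp hr]]] := us p pp.
by exists i, r; split=> [|b]; [exact/primeE|rewrite fE].
Qed.

Lemma fcov_over (A : calg R) (s : over x A) (S : forall B (z : X B), fhom z (ob s) -> Prop) :
  @fcov R X A (ob s) S ->
  fcov (Y := over x) (fun B (z : over x B) (f : fhom z s) => S B (ob z) f).
Proof.
move=> [n [B [z [f [hS p]]]]].
by exists n, B, (fun i => slob (fcomp (st s) (f i))), (fun i => f i).
Qed.
End AtlasCover.

Section KernelOver.
Variables (R : cring) (X : fibcat R) (C : calg R) (x : X C) (cd : chart_data x).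
Variables (F G : qcoh X) (h : qhom F G).
Notation Y := (slice x).
Notation N0 := (N0 x h).
Notation theta := (theta cd h).

Definition slq A B (t : Y A) (s : Y B) (f : fhom (ob t) (ob s)) : fhom (slob (fcomp (st s) f) : Y A) s :=
  @slhom _ _ _ _ _ _ (slob (fcomp (st s) f)) s f erefl.

(** Restrict to the object t with the structure map induced by f, and pass to the given
    structure map of t by the descent datum. *)
Definition n1res_fun A B (t : over x A) (s : over x B) (f : fhom t s) (n : N0 B s) : N0 A t :=
  theta (s := t) (fcomp (st s) f) (qres N0 (slq f) n).
Lemma n1res_linear A B (t : over x A) (s : over x B) (f : fhom t s) :
  linear_for (fover f \; *:%R) (n1res_fun f).
Proof. by move=> b m n; rewrite /n1res_fun qresD qresZ thetaD thetaZ. Qed.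

Lemma theta_bij A (s : Y A) (al : fhom (ob s) x) : bijective (theta al : N0 A (slob al) -> N0 A s).
Proof.
case: s al => a g al; set s : Y A := existT _ a g.
exists (theta (s := slob al : Y A) (st s)) => n.
  exact: etrans (theta_comp cd (s := slob al : Y A) (al := al) (be := st s) n) (theta_refl cd (s := slob al : Y A) n).
exact: etrans (theta_comp cd (s := s) (al := st s) (be := al) n) (theta_refl cd n).
Qed.

Lemma n1res_id A (s : over x A) m : n1res_fun (fid s) m = m.
Proof.
transitivity (qres N0 (fid (s : Y A)) (theta (st s) m)).
  exact: (@theta_res _ _ _ _ cd _ _ h _ _ (s : Y A) (s : Y A) (fid (s : Y A)) (st s)).
by rewrite qres_id theta_refl.
Qed.

Lemma n1res_comp A B D (v : over x A) (t : over x B) (s : over x D) (g : fhom t s) (f : fhom v t) n :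
  n1res_fun (fcomp g f) n = n1res_fun f (n1res_fun g n).
Proof.
pose v1 : Y A := slob (fcomp (st t) f).
pose al' := fcomp (st s) (fcomp g f).
have qP : fcomp (fcomp (st s) g) f = al' by rewrite -fcompA.
pose q : fhom (slob al' : Y A) (slob (fcomp (st s) g) : Y B) :=
  @slhom _ _ _ _ _ _ (slob al') (slob (fcomp (st s) g)) f qP.
have e : n1res_fun f (n1res_fun g n) =
    theta (s := v) (fcomp (st t) f) (theta (s := v1) al' (qres N0 q (qres N0 (slq g) n))).
  congr (theta _ _); symmetry.
  exact: (theta_res cd (h := h) (s := t : Y B) (t := v1) (p := slq f) (q := q)).
rewrite e (theta_comp cd (s := v) (al := al') (be := fcomp (st t) f)) -qres_comp.
by congr (theta _ (qres N0 _ n)); apply: sval_inj.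
Qed.

Lemma n1res_iso A B (t : over x A) (s : over x B) (f : fhom t s) :
  bijective (ext_lift (mkL (n1res_linear f))).
Proof.
apply: (eq_bij (f := theta (s := t) (fcomp (st s) f) \o ext_lift (qres N0 (slq f)))).
  exact: bij_comp (theta_bij _) (qres_iso N0 (slq f)).
apply: (@ext_eq _ _ _ _ _ (theta (s := t) (fcomp (st s) f) \o ext_lift (qres N0 (slq f))) (ext_lift _)) => m /=.
by rewrite !ext_lift_pure thetaZ.
Qed.

Definition N1 : qcoh (over x) := @QCoh R (over x) (fun A (s : over x A) => N0 A s)
  (fun A B (t : over x A) (s : over x B) f => mkL (n1res_linear f)) n1res_id n1res_comp n1res_iso.

Lemma kap_n1 A B (t : over x A) (s : over x B) (f : fhom t s) (n : N1 B s) :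
  kap h t (qres N1 f n) = qres F f (kap h s n).
Proof. by rewrite [LHS]kap_theta (kap_res (slq f)). Qed.

End KernelOver.

(** * Extension of sheaves from the objects over the atlas *)

Lemma ext_dprod_ex (T : comPzRingType) (n : nat) (N : 'I_n -> lmodType T) (B : comPzRingType)
    (g : {rmorphism T -> B}) (y : forall j, ext g (N j)) :
  exists z : ext g (dprodmod N), forall j, ext_map (dpr j : {linear dprodmod N -> N j}) z = y j.
Proof.
exists (\sum_(j < n) ext_map (@dinj T n N j) (y j)) => j.
rewrite (linear_sum (ext_map (dpr j))) (bigD1 j) //= big1 ?addr0 => [|i ne].
  by rewrite ext_map_comp; apply: ext_map_id => m; exact: dinj_funE.
by rewrite ext_map_comp; apply: ext_map0 => m; exact: dinj_fun0.
Qed.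

Section Extension.
Variables (R : cring) (X : fibcat R) (C : calg R) (x : X C).
Variable N : qcoh (over x).

Section PushRes.
Variables (T B B' : calg R) (t : X T) (b : over x B) (b' : over x B').
Variables (d : fhom (ob b) t) (d' : fhom (ob b') t).
Variables (w : over x (push (fover d) (fover d'))) (p : fhom w b) (q : fhom w b').
Hypotheses (ep : fover p = poL (fover d) (fover d')) (eq : fover q = poR (fover d) (fover d')).

Lemma pres_linear : linear_for (fover d \; *:%R)
  (fun n : rstmod (fover d') (N B' b') => qres N q n : rstmod (poL (fover d) (fover d')) (N _ w)).
Proof.
move=> a m n.
change (qres N q (fover d' a *: (m : N B' b') + n) =
  poL (fover d) (fover d') (fover d a) *: (qres N q m : N _ w) + qres N q n).
by rewrite qresD (qresZE eq) po_comm.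
Qed.
Definition pushres : {linear ext (fover d) (rstmod (fover d') (N B' b')) ->
    rstmod (poL (fover d) (fover d')) (N _ w)} := ext_lift (mkL pres_linear).
Lemma pushres_pure c n : pushres (ext_pure (fover d) c n) = fover p c *: (qres N q n : N _ w).
Proof. by rewrite [LHS]ext_lift_pure mkLE rstE ep. Qed.

(** The restriction from b' to the fibre product w is the base change of the map of rings T ->
    B. *)
Lemma pushres_bij : bijective pushres.
Proof.
have rl : linear_for (poR (fover d) (fover d') \; *:%R) (fun n : N B' b' => qres N q n).
  by move=> a m n; rewrite qresD (qresZE eq).
have bl : bijective (ext_lift (mkL rl)).
  have := qres_iso N q; case: _ / eq rl => rl.
  move=> hb; apply: (eq_bij hb); apply: (@ext_eq _ _ _ _ _ (ext_lift _) (ext_lift _)) => m; by rewrite /= !ext_lift_pure.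
have e y : pushres y = ext_lift (mkL rl) (po_fwd (fover d) (fover d') (N B' b') y : ext _ _).
  elim/ext_ind: y => [|c m|m n hm hn].
  - apply: (@etrans _ _ 0); first exact: linear0.
    by rewrite (linear0 (po_fwd (fover d) (fover d') (N B' b'))); exact/esym/(ext_lift0 (mkL rl)).
  - by rewrite pushres_pure po_fwd_pure ext_lift_pure mkLE ep.
  - rewrite (linearD (po_fwd (fover d) (fover d') (N B' b'))) ext_liftD -hm -hn.
    exact: linearD.
apply: (eq_bij (f := fun y => ext_lift (mkL rl) (po_fwd (fover d) (fover d') (N B' b') y : ext _ _))) => //.
exact: bij_comp bl (po_fwd_bij _ _ _).
Qed.
End PushRes.
End Extension.

Lemma sub_linear (A : comPzRingType) (U U' V : lmodType A) (u : {linear U -> V}) (v : {linear U' -> V})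
  a m n m' n' : u (a *: m + n) - v (a *: m' + n') = a *: (u m - v m') + (u n - v n').
Proof. by rewrite (linearP u) (linearP v) opprD addrACA scalerBr. Qed.

Lemma ext_map_sub (A B : comPzRingType) (f : {rmorphism A -> B}) (M P : lmodType A)
  (w u v : {linear M -> P}) : (forall m, w m = u m - v m) ->
  forall y : ext f M, ext_map w y = ext_map u y - ext_map v y.
Proof.
move=> h; elim/ext_ind => [|c n|y z hy hz].
- by rewrite !ext_mapZero subr0.
- by rewrite !ext_map_pure h -[X in _ = _ - X]scale1r -scaleNr ext_scale_pure ext_pureDr mulN1r -[in RHS](mulN1r c)
    -[in RHS](rmorph1 f) -rmorphN [in RHS]mulrC -ext_pureZ scaleN1r.
- by rewrite !ext_mapD hy hz opprD addrACA.
Qed.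

Section ExtendedSheaf.
Variables (R : cring) (X : fibcat R) (C : calg R) (x : X C).
Hypothesis cov : forall T (t : X T),
  fcov (fun B (z : X B) (f : fhom z t) => flat (fover f) /\ exists g : fhom z x, True).
Variable N : qcoh (over x).

Section OneObject.
Variables (T : calg R) (t : X T).

(** Fibre products over t, with the pushout as ring. *)
Record meet B B' (b : over x B) (b' : over x B') (d : fhom (ob b) t) (d' : fhom (ob b') t) := Meet {
  mt_ob : over x (push (fover d) (fover d'));
  mt_p : fhom mt_ob b;
  mt_q : fhom mt_ob b';
  mt_ep : fover mt_p = poL (fover d) (fover d');
  mt_eq : fover mt_q = poR (fover d) (fover d');
  mt_comm : fcomp d mt_p = fcomp d' mt_q;
  mt_univ : forall A (a : over x A) (f : fhom a b) (g : fhom a b'), fcomp d f = fcomp d' g ->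
      exists l : fhom a mt_ob, fcomp mt_p l = f /\ fcomp mt_q l = g }.
Lemma meet_ex B B' (b : over x B) (b' : over x B') (d : fhom (ob b) t) (d' : fhom (ob b') t) :
  inhabited (meet d d').
Proof.
have [w [p [q [h1 h2 h3 h4]]]] := fprod d d'; constructor.
by apply: (@Meet _ _ b b' d d' (slob (fcomp (st b) p)) p q h1 h2 h3) => A a; apply: h4.
Qed.
Definition meet_of B B' (b : over x B) (b' : over x B') (d : fhom (ob b) t) (d' : fhom (ob b') t) :
  meet d d' := projT1 (boolp.cid (match meet_ex d d' with inhabits m => ex_intro (fun=> True) m I end)).

Lemma leg_linear A B (s : over x A) (s' : over x B) (e : fhom (ob s) t) (e' : fhom (ob s') t) (f : fhom s' s) :
  fcomp e f = e' ->
  linear (fun n : rstmod (fover e) (N A s) => qres N f n : rstmod (fover e') (N B s')).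
Proof.
move=> <- a m n.
change (qres N f (fover e a *: (m : N A s) + n) =
  fover (fcomp e f) a *: (qres N f m : N B s') + qres N f n).
by rewrite qresD qresZ fover_comp.
Qed.

(** The value at t of the extension of N is the limit of N over all maps to t from objects with
    a map to x. *)
Record leg := Leg { leg_ring : calg R; leg_ob : over x leg_ring; leg_map : fhom (ob leg_ob) t }.
Definition legs : lmodType T := dprodmod (fun l : leg => rstmod (fover (leg_map l)) (N _ (leg_ob l))).
Definition lcomp (m : legs) : Prop :=
  forall A B (s : over x A) (d : fhom (ob s) t) (s' : over x B) (d' : fhom (ob s') t)
    (f : fhom s' s), fcomp d f = d' -> qres N f (m (Leg d)) = m (Leg d').
Lemma lcomp_submod : submod lcomp.
Proof.
split.
- by move=> A B s d s' d' f e; apply: qres0.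
- by move=> m n hm hn A B s d s' d' f e; rewrite [LHS]qresD (hm _ _ _ _ _ _ _ e) (hn _ _ _ _ _ _ _ e).
- move=> a m hm A B s d s' d' f e; rewrite [LHS]qresZ (hm _ _ _ _ _ _ _ e).
  by rewrite -[fover f _]/(calg_comp (@fover R X _ _ _ _ f) (fover d) a) -(@fover_comp R X) e.
Qed.
Definition Kt : lmodType T := submodm lcomp_submod.
Lemma proj_linear A (s : over x A) (d : fhom (ob s) t) :
  linear_for (fover d \; *:%R) (fun m : Kt => (smval m : legs) (Leg d) : N A s).
Proof. by []. Qed.
Definition proj A (s : over x A) (d : fhom (ob s) t) : {linear Kt -> N A s | fover d \; *:%R} :=
  mkL (proj_linear d).
Lemma proj_comp A B (s : over x A) (d : fhom (ob s) t) (s' : over x B) (d' : fhom (ob s') t)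
  (f : fhom s' s) m : fcomp d f = d' -> qres N f (proj d m) = proj d' m.
Proof. by move=> e; apply: (@smvalP _ _ _ lcomp_submod m). Qed.
Lemma Kt_eq (m n : Kt) : (forall A (s : over x A) (d : fhom (ob s) t), proj d m = proj d n) -> m = n.
Proof.
move=> h; apply: (@smval_inj _ _ _ lcomp_submod); apply: dprod_eq => -[A s d]; exact: h.
Qed.
Lemma Kt_ex (n : forall A (s : over x A) (d : fhom (ob s) t), N A s) :
  (forall A B (s : over x A) (d : fhom (ob s) t) (s' : over x B) (f : fhom s' s),
    qres N f (n A s d) = n B s' (fcomp d f)) ->
  exists m : Kt, forall A (s : over x A) (d : fhom (ob s) t), proj d m = n A s d.
Proof.
move=> h.
pose m0 : legs := fun l => n _ _ (leg_map l).
have hm : lcomp m0 by move=> A B s d s' d' f <-; apply: h.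
by have [m em] := smval_ex lcomp_submod hm; exists m => A s d; rewrite /proj mkLE em.
Qed.

Definition legres A B (s : over x A) (s' : over x B) (e : fhom (ob s) t) (e' : fhom (ob s') t) (f : fhom s' s)
    (h : fcomp e f = e') : {linear rstmod (fover e) (N A s) -> rstmod (fover e') (N B s')} :=
  mkL (leg_linear h).
Definition legproj A (s : over x A) (d : fhom (ob s) t) : {linear Kt -> rstmod (fover d) (N A s)} :=
  mkL (proj_linear d : linear (fun m : Kt => proj d m : rstmod (fover d) (N A s))).

Section Meet.
Variables (A B : calg R) (s : over x A) (b : over x B) (e : fhom (ob s) t) (d : fhom (ob b) t) (m : meet e d).
Definition mres := pushres N (mt_eq m).
Lemma mres_pure c n : mres (ext_pure (fover e) c n) = fover (mt_p m) c *: (qres N (mt_q m) n : N _ (mt_ob m)).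
Proof. exact: pushres_pure (mt_ep m) (mt_eq m) c n. Qed.
Lemma mres_bij : bijective mres. Proof. exact: pushres_bij (mt_ep m) (mt_eq m). Qed.
Lemma mres0 : mres 0 = 0 :> N _ (mt_ob m). Proof. exact: (linear0 mres). Qed.
Lemma mresD y z : mres (y + z) = (mres y : N _ (mt_ob m)) + mres z. Proof. exact: (linearD mres). Qed.
Lemma mresB y z : mres (y - z) = (mres y : N _ (mt_ob m)) - mres z. Proof. exact: (linearB mres). Qed.
Lemma mres_proj y : mres (ext_map (legproj d) y) = qres N (mt_p m) (ext_lift (proj e) y) :> N _ (mt_ob m).
Proof.
elim/ext_ind: y => [|c n|y z hy hz].
- by rewrite ext_mapZero mres0 ext_lift0 qres0.
- rewrite ext_map_pure mres_pure ext_lift_pure qresZ; congr (_ *: _).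
  by rewrite mkLE (proj_comp (f := mt_p m) n erefl); apply: proj_comp; rewrite (mt_comm m).
- by rewrite ext_mapD mresD hy hz ext_liftD qresD.
Qed.
End Meet.

Lemma mres_nat A B B' (s : over x A) (b : over x B) (b' : over x B') (e : fhom (ob s) t) (d : fhom (ob b) t)
    (d' : fhom (ob b') t) (m : meet e d) (m' : meet e d') (f : fhom b' b) (h : fcomp d f = d')
    (l : fhom (mt_ob m') (mt_ob m)) y : fcomp (mt_p m) l = mt_p m' -> fcomp (mt_q m) l = fcomp f (mt_q m') ->
  mres m' (ext_map (legres h) y) = qres N l (mres m y : N _ (mt_ob m)) :> N _ (mt_ob m').
Proof.
move=> h1 h2; elim/ext_ind: y => [|c n|y z hy hz].
- by rewrite ext_mapZero !mres0 qres0.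
- rewrite ext_map_pure !mres_pure qresZ ?mkLE -!qres_comp -h2 -h1; congr (_ *: _).
  by rewrite fover_comp.
- by rewrite ext_mapD !mresD hy hz qresD.
Qed.

Section Cover.
Variables (k : nat) (B : 'I_k -> calg R) (b : forall j, over x (B j)) (d : forall j, fhom (ob (b j)) t).
Hypothesis dp : pure (fun j => fover (d j) : {rmorphism T -> B j}).

Lemma leg_cover A (s : over x A) (e : fhom (ob s) t) :
  fcov (Y := over x) (fun D (z : over x D) (f : fhom z s) => exists j (g : fhom z (b j)),
    fcomp (d j) g = fcomp e f).
Proof.
have c : fcov (fun D (z : X D) (f : fhom z t) => exists j (g : fhom z (ob (b j))), fcomp (d j) g = f).
  by exists k, B, (fun j => ob (b j)), d; split=> // j; exists j, (fid _); rewrite fcompf1.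
apply: (fcov_sub (fcov_over (fcov_pull e c))) => D z f [E [v [g [l [[j [g' <-]] e']]]]].
by exists j, (fcomp g' l); rewrite -e' fcompA.
Qed.

Lemma proj_inj (m n : Kt) : (forall j, proj (d j) m = proj (d j) n) -> m = n.
Proof.
move=> h; apply: Kt_eq => A s e.
apply: (qsep (leg_cover e)) => D z f [j [g eg]].
by rewrite (proj_comp (f := f) _ erefl) (proj_comp (f := f) _ erefl) -eg
  -(proj_comp (f := g) _ erefl) h -(proj_comp (f := g) _ erefl).
Qed.

(** The limit is already determined by a cover: a matching family on its members determines a
    section at every leg by descent. With proj_inj, this presents the extension as an equalizer
    of two finite products. *)
Lemma proj_glue (n : forall j, N _ (b j)) :
  (forall i j D (z : over x D) (f : fhom z (b i)) (g : fhom z (b j)),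
     fcomp (d i) f = fcomp (d j) g -> qres N f (n i) = qres N g (n j)) ->
  exists m : Kt, forall j, proj (d j) m = n j.
Proof.
move=> hn.
have ex A (s : over x A) (e : fhom (ob s) t) : exists m : N A s, forall D (z : over x D) (f : fhom z s) j
    (g : fhom z (b j)), fcomp (d j) g = fcomp e f -> qres N f m = qres N g (n j).
  have [||m hm] := @qglue R (over x) N A s (fun D z f m => exists j (g : fhom z (b j)),
      fcomp (d j) g = fcomp e f /\ m = qres N g (n j)).
  - apply: (fcov_sub (leg_cover e)) => D z f [j [g eg]].
    by exists (qres N g (n j)), j, g.
  - move=> D z f _ D' z' f' _ E v g g' [j [l [el ->]]] [j' [l' [el' ->]]] egg.
    rewrite -!qres_comp; apply: hn.
    by rewrite (@fcompA _ X) el (@fcompA _ X) el' -!(@fcompA _ X); congr fcomp.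
  by exists m => D z f j g eg; apply: hm; exists j, g.
pose m A s e := projT1 (boolp.cid (@ex A s e)).
have mP A (s : over x A) (e : fhom (ob s) t) : forall D (z : over x D) (f : fhom z s) j
    (g : fhom z (b j)), fcomp (d j) g = fcomp e f -> qres N f (m A s e) = qres N g (n j).
  exact: projT2 (boolp.cid (@ex A s e)).
have [|K hK] := @Kt_ex m.
  move=> A A' s e s' f; apply: (qsep (leg_cover (fcomp e f))) => D z g [j [l el]].
  rewrite -qres_comp (mP _ _ _ _ _ _ _ _ el); apply: mP.
  by rewrite el -(@fcompA _ X).
exists K => j; rewrite hK -[LHS](@qres_id _ _ N) (mP _ _ (d j) _ _ (fid (b j)) j (fid (b j)) erefl).
exact: qres_id.
Qed.
End Cover.

(** The extension is the kernel of a map v between two finite products, over a cover and its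
    pairwise intersections. Along a flat leg e this kernel commutes with extension of scalars,
    and the matching families on the members of the cover pulled back to s are the sections over
    s. *)
Lemma proj_flat A (s : over x A) (e : fhom (ob s) t) : flat (fover e) -> isbc (proj e).
Proof.
move=> fl; have [k [B [z [d [hd dp]]]]] := cov t.
pose b j : over x (B j) := slob (projT1 (boolp.cid (hd j).2)).
pose dm j : fhom (ob (b j)) t := d j.
pose E0 := dprodmod (fun j => rstmod (fover (dm j)) (N _ (b j))).
pose u0 (m : Kt) : E0 := fun j => proj (dm j) m.
have ul : linear u0 by move=> a m n; apply: dprod_eq => j; exact: (proj_linear (dm j)).
pose u : {linear Kt -> E0} := mkL ul.
have ui : injective u.
  move=> m n emn; apply: (proj_inj (d := dm) dp) => j; exact: (congr1 (fun f : E0 => f j) emn).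
pose mt i j := meet_of (dm i) (dm j).
pose E1 := dprodmod (fun i => dprodmod (fun j => rstmod (fover (fcomp (dm i) (mt_p (mt i j)))) (N _ (mt_ob (mt i j))))).
pose lp i j := legres (erefl (fcomp (dm i) (mt_p (mt i j)))).
pose lq i j := legres (esym (mt_comm (mt i j))).
(* the difference of the two restrictions to the intersection of the members i and j *)
pose v0 (n : E0) : E1 := fun i j => lp i j (n i) - lq i j (n j).
have vl : linear v0.
  move=> a m n; apply: dprod_eq => i; apply: dprod_eq => j.
  have e1 : lp i j (a *: m i + n i) - lq i j (a *: m j + n j) =
      a *: (lp i j (m i) - lq i j (m j)) + (lp i j (n i) - lq i j (n j)).
    exact: sub_linear.
  exact: e1.
pose v : {linear E0 -> E1} := mkL vl.
have uv (n : E0) : v n = 0 -> exists m, u m = n.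
  move=> vn; have [|m hm] := @proj_glue k B b dm dp n; last by exists m; apply: dprod_eq => j; exact: hm.
  move=> i j D a f g efg; have [l [<- <-]] := mt_univ (mt i j) efg.
  rewrite !qres_comp; congr (qres N l _); apply/subr0_eq.
  exact: (congr1 (fun y : E1 => y i j) vn).
pose nt j := meet_of e (dm j).
have ccomp j y : mres (nt j) (ext_map (dpr j) (ext_map u y)) =
    qres N (mt_p (nt j)) (ext_lift (proj e) y) :> N _ (mt_ob (nt j)).
  by rewrite -mres_proj ext_map_comp (ext_map_eq (j := legproj (dm j))).
apply: inj_surj_bij => [y y' eyy'|n].
  apply: (fl _ _ u ui); apply/subr0_eq; rewrite -ext_mapB; apply: ext_dprod_eq0 => j.
  apply: (bij_inj (mres_bij (nt j))); rewrite ccomp ext_liftB eyy' subrr qres0.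
  by rewrite [RHS]mres0.
have hy j := bij_surj (mres_bij (nt j)) (qres N (mt_p (nt j)) n).
pose y j := projT1 (boolp.cid (hy j)).
have yP j : mres (nt j) (y j) = qres N (mt_p (nt j)) n := projT2 (boolp.cid (hy j)).
have [z0 hz0] := ext_dprod_ex y.
have vz : ext_map v z0 = 0.
  apply: ext_dprod_eq0 => i; apply: ext_dprod_eq0 => j.
  have -> : ext_map (dpr j) (ext_map (dpr i) (ext_map v z0)) = ext_map (lp i j) (y i) - ext_map (lq i j) (y j).
    rewrite -(hz0 i) -(hz0 j) !ext_map_comp.
    by apply: (ext_map_sub (w := dpr j \o (dpr i \o v)) (u := lp i j \o dpr i) (v := lq i j \o dpr j)).
  (* the matching condition may be tested on the pullback of the intersection to s *)
  pose m3 := meet_of e (fcomp (dm i) (mt_p (mt i j))).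
  have [|l1 [l1p l1q]] := @mt_univ _ _ _ _ _ _ (nt i) _ (mt_ob m3) (mt_p m3) (fcomp (mt_p (mt i j)) (mt_q m3)).
    by rewrite (mt_comm m3) (@fcompA _ X).
  have [|l2 [l2p l2q]] := @mt_univ _ _ _ _ _ _ (nt j) _ (mt_ob m3) (mt_p m3) (fcomp (mt_q (mt i j)) (mt_q m3)).
    by rewrite (mt_comm m3) (@fcompA _ X) -(mt_comm (mt i j)).
  apply: (bij_inj (mres_bij m3)); rewrite [LHS]mresB [RHS]mres0.
  by rewrite (mres_nat _ _ l1p l1q) (mres_nat _ _ l2p l2q) !yP -!qres_comp l1p l2p subrr.
have [y0 hy0] := flat_exact fl uv vz.
exists y0; apply: (qsep (leg_cover (b := b) (d := dm) dp e)) => D z' f [j [g eg]].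
have [l [<- _]] := mt_univ (nt j) (esym eg).
by rewrite !qres_comp; congr (qres N l _); rewrite -ccomp hy0 hz0 yP.
Qed.
End OneObject.
End ExtendedSheaf.

(** * Kernels of morphisms of quasi-coherent sheaves *)

Section ExtensionSheaf.
Variables (R : cring) (X : fibcat R) (C : calg R) (x : X C).
Hypothesis cov : forall T (t : X T),
  fcov (fun B (z : X B) (f : fhom z t) => flat (fover f) /\ exists g : fhom z x, True).
Variable N : qcoh (over x).
Notation Kt := (Kt N).
Notation proj := (proj N).

(** Locally on s, every leg factors through a flat leg, where proj_flat applies. *)
Lemma proj_isbc T (t : X T) A (s : over x A) (e : fhom (ob s) t) : isbc (proj e).
Proof.
have c : fcov (Y := over x) (fun D (z : over x D) (f : fhom z s) => exists B (b : over x B)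
    (d : fhom (ob b) t) (g : fhom z b), flat (fover d) /\ fcomp d g = fcomp e f).
  apply: (fcov_sub (fcov_over (fcov_pull e (cov t)))) => D z f [B [b [d [g [[fd [ga _]] h]]]]].
  by exists B, (slob ga), d, g.
have [k [D [z [f [hS p]]]]] := c.
apply: (isbc_local p (P := fun i => N _ (z i)) (v := fun i => qres N (f i))
  (w := fun i => proj (t := t) (s := z i) (fcomp e (f i)))).
- by move=> i a; rewrite (@fover_comp _ X).
- by move=> i m; rewrite (proj_comp (f := f i) _ erefl).
- by move=> i; apply: qres_iso.
- move=> i; have [B [b [d [g [fd h]]]]] := hS i.
  apply: (isbc_comp _ (u := proj (t := t) (s := b) d) (v := qres N g)).
  + by move=> a; rewrite -h (@fover_comp _ X).
  + by move=> m; rewrite (proj_comp (f := g) m h).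
  + exact: (proj_flat cov N).
  + exact: qres_iso.
Qed.

Section Restriction.
Variables (T T' : calg R) (t' : X T') (t : X T) (f : fhom t' t).
Lemma kres_comp (m : Kt t) :
  lcomp (fun l : leg x t' => proj (t := t) (s := leg_ob l) (fcomp f (leg_map l)) m).
Proof. by move=> A B s d s' d' g <- /=; apply: proj_comp; rewrite fcompA. Qed.
Definition kres_fun (m : Kt t) : Kt t' := exist _ _ (kres_comp m).
Lemma kres_proj (m : Kt t) A (s : over x A) (d : fhom (ob s) t') :
  proj d (kres_fun m) = proj (fcomp f d) m.
Proof. by []. Qed.
Lemma kres_linear : linear_for (fover f \; *:%R) kres_fun.
Proof.
move=> a m n; apply: Kt_eq => A s d; rewrite kres_proj.
rewrite (linearD (proj d)) (linearZ_LR (proj d)) !kres_proj linearD linearZ_LR /=.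
by rewrite fover_comp.
Qed.

(** Bijectivity is tested on a cover of t' by legs, along which the values of the extension at t
    and at t' both become values of N. *)
Lemma kres_iso : isbc (mkL kres_linear).
Proof.
have [k [B [z [d [hd dp]]]]] := cov t'.
pose b j : over x (B j) := slob (projT1 (boolp.cid (hd j).2)).
apply: (isbc_local dp (P := fun j => N _ (b j)) (v := fun j => proj (s := b j) (d j))
  (w := fun j => proj (s := b j) (fcomp f (d j)))) => [i a|i m|i|i].
- by rewrite fover_comp.
- by [].
- exact: proj_isbc.
- exact: proj_isbc.
Qed.
End Restriction.

(** The extension of N along the forgetful functor from objects over x. *)
Definition Kq : qcoh X.
Proof.
apply: (@QCoh R X (fun T t => Kt t) (fun A B x y f => mkL (kres_linear f))).
- move=> A t m; apply: Kt_eq => B s d; change (proj (fcomp (fid t) d) m = proj d m).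
  by rewrite (fcomp1f d).
- move=> A B D t u v g f m; apply: Kt_eq => E s d.
  change (proj (fcomp (fcomp g f) d) m = proj (fcomp g (fcomp f d)) m).
  by rewrite (fcompA g f d).
- by move=> A B t u f; exact: kres_iso.
Defined.

Variables (F : qcoh X) (ka : forall A (s : over x A), {linear N A s -> F A (ob s)}).
Hypothesis ka_res : forall A B (t : over x A) (s : over x B) (f : fhom t s) n,
  ka t (qres N f n) = qres F f (ka s n).

(** A morphism from N to F on the objects over x extends to all objects, by descent for F. *)
Lemma to_ex T (t : X T) (m : Kt t) : exists f : F T t, forall A (s : over x A) (d : fhom (ob s) t),
  qres F d f = ka s (proj d m).
Proof.
have [||f hf] := @qglue R X F T t (fun B z d n => exists g : fhom z x, n = ka (slob g) (proj (s := slob g) d m)).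
- apply: (fcov_sub (cov t)) => B z d [_ [g _]]; by exists (ka (slob g) (proj (s := slob g) d m)), g.
- move=> B z d _ B' z' d' _ D v l l' [g ->] [g' ->] e.
  pose sv : over x D := slob (fcomp g l).
  have e1 := ka_res (t := sv) (s := slob g) l (proj (s := slob g) d m).
  have e2 := ka_res (t := sv) (s := slob g') l' (proj (s := slob g') d' m).
  apply: etrans (esym e1) (etrans _ e2); apply: (congr1 (ka sv)).
  rewrite (proj_comp (s := slob g) (s' := sv) (f := l) _ erefl).
  by rewrite (proj_comp (s := slob g') (s' := sv) (f := l') _ (esym e)).
by exists f => A [z g] d; apply: hf; exists g.
Qed.
Definition to_fun T (t : X T) (m : Kt t) : F T t := projT1 (boolp.cid (to_ex m)).
Lemma to_funP T (t : X T) (m : Kt t) A (s : over x A) (d : fhom (ob s) t) :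
  qres F d (to_fun m) = ka s (proj d m).
Proof. exact: (projT2 (boolp.cid (to_ex m))). Qed.
Lemma to_sep T (t : X T) (G : qcoh X) (f f' : G T t) :
  (forall A (s : over x A) (d : fhom (ob s) t), qres G d f = qres G d f') -> f = f'.
Proof. by move=> h; apply: (qsep (cov t)) => B z d [_ [g _]]; apply: (h _ (slob g)). Qed.
Lemma to_linear T (t : X T) : linear (@to_fun T t).
Proof.
move=> a m n; apply: to_sep => A s d.
rewrite to_funP (linearD (proj d)) (linearZ_LR (proj d)) (linearD (ka s)) (linearZ_LR (ka s)) /=.
by rewrite qresD qresZ !to_funP.
Qed.
Lemma to_nat A B (t : X A) (u : X B) (f : fhom t u) (m : Kq B u) :
  mkL (@to_linear A t) (qres Kq f m) = qres F f (mkL (@to_linear B u) m).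
Proof. by apply: to_sep => D s d; rewrite !mkLE to_funP -qres_comp to_funP. Qed.
Definition to_hom : qhom Kq F := QHom to_nat.
End ExtensionSheaf.

(** N is the kernel of h, and its value at the atlas x is the kernel of h at x; the statement
    keeps of this only that N maps to F with h g = 0 and hits z. *)
Theorem kernel_sheaf (R : cring) (X : fibcat R) (C : calg R) (x : X C) (Cx : fpqc_atlas x)
    (F G : qcoh X) (h : qhom F G) (z : F C x) : h C x z = 0 ->
  exists (N : qcoh X) (g : qhom N F), (forall B (y : X B) m, h B y (g B y m) = 0) /\
    exists n, g C x n = z.
Proof.
move=> hz; have [cd] := chart_data_exists Cx; have cov := atlas_cover Cx.
pose N := N1 cd h.
pose ka A (s : over x A) : {linear N A s -> F A (ob s)} := kap h s.
have kaP := @kap_n1 _ _ _ _ cd _ _ h.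
pose g := to_hom cov (N := N) (ka := ka) kaP.
exists (Kq cov N), g; split.
  move=> B y m; apply: (to_sep cov (G := G)) => A s d.
  by rewrite -qfun_nat (to_funP cov kaP) qres0 [LHS]kap_h.
have [k ek] := smval_ex (ker_submod (h C x)) hz.
pose s0 : over x C := slob (fid x).
pose n0 : N C s0 := ext_pure (fover (fid x)) 1 k.
have [|m hm] := @Kt_ex _ _ _ x N C x (fun A s (d : fhom (ob s) x) => qres N (x := s) (y := s0) d n0).
  by move=> A B s d s' f; rewrite -qres_comp.
exists m; rewrite -[LHS](@qres_id _ _ F) (to_funP cov kaP m (s := s0) (fid x)) hm.
rewrite (_ : qres N _ n0 = n0); last exact: (@qres_id _ _ N _ s0).
by rewrite [LHS]kap_pure scale1r qres_id.
Qed.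

(** * Sheaves of finite presentation *)

Section Rows.
Variables (B : comPzRingType) (n : nat) (M : lmodType B).
Definition rows_fun (c : 'I_n -> M) (v : 'rV[B]_n) : M := \sum_i v 0 i *: c i.
Lemma rows_linear c : linear (rows_fun c).
Proof.
move=> a v w; rewrite /rows_fun scaler_sumr -big_split /=; apply: eq_bigr => i _.
by rewrite !mxE scalerDl scalerA.
Qed.
Definition rows c : {linear 'rV[B]_n -> M} := mkL (rows_linear c).
Lemma rowsE c v : rows c v = \sum_i v 0 i *: c i. Proof. by []. Qed.
Lemma rows_delta c i : rows c (delta_mx 0 i) = c i.
Proof.
rewrite rowsE (bigD1 i) //= big1 ?addr0 => [|j ne]; first by rewrite mxE !eqxx scale1r.
by rewrite mxE (negPf ne) andbF scale0r.
Qed.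
Lemma rows_eq (p : {linear 'rV[B]_n -> M}) v : p v = \sum_i v 0 i *: p (delta_mx 0 i).
Proof. by rewrite {1}(row_sum_delta v) linear_sum; apply: eq_bigr => i _; rewrite linearZ. Qed.
Lemma rows_ext (p q : {linear 'rV[B]_n -> M}) : (forall i, p (delta_mx 0 i) = q (delta_mx 0 i)) -> p =1 q.
Proof. by move=> h v; rewrite rows_eq (rows_eq q); apply: eq_bigr => i _; rewrite h. Qed.
End Rows.

Definition fin_gen (B : comPzRingType) (M : lmodType B) : Prop :=
  exists n (p : {linear 'rV[B]_n -> M}), forall m, exists v, p v = m.

Lemma fin_pres_gen (B : comPzRingType) (M : lmodType B) : fin_pres_mod M -> fin_gen M.
Proof. by move=> [m [n [q [p [h _]]]]]; exists n, p. Qed.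

(** The presentation of N lifts along u; the kernel is generated by the lifted relations and by
    the differences of the generators of M and their lifts. *)
Lemma fin_gen_ker (B : comPzRingType) (M N : lmodType B) (u : {linear M -> N}) :
  fin_gen M -> fin_pres_mod N -> (forall y, exists z, u z = y) ->
  exists k (c : 'I_k -> M), (forall i, u (c i) = 0) /\ forall z, u z = 0 -> exists v, rows c v = z.
Proof.
move=> [l [p ps]] [m [n [q [r [rs rk]]]]] us.
pose li i := projT1 (boolp.cid (us (r (delta_mx 0 i)))).
have liP i : u (li i) = r (delta_mx 0 i) := projT2 (boolp.cid (us _)).
pose f := rows li.
have uf v : u (f v) = r v by apply: (rows_ext (p := u \o f)) => i; exact: etrans (congr1 u (rows_delta li i)) (liP i).
pose ba j := projT1 (boolp.cid (rs (u (p (delta_mx 0 j))))).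
have baP j : r (ba j) = u (p (delta_mx 0 j)) := projT2 (boolp.cid (rs _)).
pose g := rows ba.
have rg v : r (g v) = u (p v) by apply: (rows_ext (p := r \o g) (q := u \o p)) => i; exact: etrans (congr1 r (rows_delta ba i)) (baP i).
pose c (i : 'I_(m + l)) : M := match fintype.split i with
  | inl a => f (q (delta_mx 0 a)) | inr b => p (delta_mx 0 b) - f (g (delta_mx 0 b)) end.
have cv v : rows c v = f (q (lsubmx v)) + (p (rsubmx v) - f (g (rsubmx v))).
  rewrite rowsE big_split_ord /=; congr (_ + _).
    apply: etrans _ (esym (rows_eq (f \o q) _)); apply: eq_bigr => i _ /=.
    by rewrite /c (unsplitK (inl i : 'I_m + 'I_l)) mxE.
  apply: etrans _ (esym (rows_eq (p \- (f \o g)) _)); apply: eq_bigr => i _ /=.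
  by rewrite /c (unsplitK (inr i : 'I_m + 'I_l)) mxE.
exists (m + l)%N, c; split=> [i|z uz].
  rewrite /c; case: fintype.split => a; first by rewrite uf; apply/rk; exists (delta_mx 0 a).
  by rewrite linearB uf rg subrr.
have [v ev] := ps z.
have [w ew] : exists w, q w = g v by apply/rk; rewrite rg ev.
exists (row_mx w v); rewrite cv row_mxKl row_mxKr ew ev.
by rewrite addrC subrK.
Qed.

Section Local.
Variables (R : cring) (X : fibcat R).

(** Purity of the cover, applied to the cokernel of u at t. *)
Lemma local_image (F G : qcoh X) (u : qhom F G) T (t : X T) (n : G T t)
    (S : forall B (z : X B), fhom z t -> Prop) : fcov S ->
  (forall B (z : X B) (f : fhom z t), S B z f -> exists m, u B z m = qres G f n) ->
  exists m, u T t m = n.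
Proof.
move=> [k [B [z [f [hS p]]]]] h; apply: (pure_mem p) => i.
have [m hm] := h _ _ _ (hS i); have [y ey] := bij_surj (qres_iso F (f i)) m.
exists y; apply: (bij_inj (qres_iso G (f i))); rewrite ext_lift_pure scale1r -hm -ey.
elim/ext_ind: y {ey} => [|b c|s s' hs hs'].
- by rewrite ext_mapZero !ext_lift0 linear0.
- by rewrite ext_map_pure !ext_lift_pure linearZ /= qfun_nat.
- by rewrite ext_mapD !ext_liftD linearD hs hs'.
Qed.

Variables (C : calg R) (x : X C).
Hypothesis cov : forall T (t : X T),
  fcov (fun B (z : X B) (f : fhom z t) => flat (fover f) /\ exists g : fhom z x, True).

Lemma lift_ext_map (F G : qcoh X) (u : qhom F G) A B (y : X A) (z : X B) (f : fhom y z) m :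
  ext_lift (qres G f) (ext_map (u B z) m) = u A y (ext_lift (qres F f) m).
Proof.
elim/ext_ind: m => [|b c|s s' hs hs'].
- by rewrite ext_mapZero !ext_lift0 linear0.
- by rewrite ext_map_pure !ext_lift_pure linearZ /= qfun_nat.
- by rewrite ext_mapD !ext_liftD linearD hs hs'.
Qed.

(** Surjectivity is stable under extension of scalars and local, so it is tested at the atlas.
    *)
Lemma surj_at (F G : qcoh X) (u : qhom F G) : (forall n, exists m, u C x m = n) ->
  forall T (t : X T) n, exists m, u T t m = n.
Proof.
move=> us T t n; apply: (local_image (cov t)) => B z f [_ [g _]].
have [y <-] := bij_surj (qres_iso G g) (qres G f n).
have [y' <-] := ext_map_surj (f := fover g) us y.
by exists (ext_lift (qres F g) y'); rewrite lift_ext_map.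
Qed.

(** Right exactness is also stable under extension of scalars and local. *)
Lemma exact_at (F G H : qcoh X) (v : qhom F G) (u : qhom G H) : (forall n, exists m, u C x m = n) ->
  (forall m, u C x m = 0 -> exists l, v C x l = m) ->
  forall T (t : X T) m, u T t m = 0 -> exists l, v T t l = m.
Proof.
move=> us ex T t m um; apply: (local_image (cov t)) => B z f [_ [g _]].
have [y ey] := bij_surj (qres_iso G g) (qres G f m).
have [|y' ey'] := @ext_rexact _ _ (fover g) _ _ _ (v C x) (u C x) us ex y.
  by apply: (bij_inj (qres_iso H g)); rewrite lift_ext_map ey qfun_nat um qres0 ext_lift0.
by exists (ext_lift (qres F g) y'); rewrite -lift_ext_map ey'.
Qed.

Lemma zero_at (F G : qcoh X) (u : qhom F G) : (forall m, u C x m = 0) ->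
  forall T (t : X T) m, u T t m = 0.
Proof.
move=> us T t m; apply: (qsep (cov t)) => B z f [_ [g _]].
rewrite -qfun_nat qres0; have [y <-] := bij_surj (qres_iso F g) (qres F f m).
by rewrite -lift_ext_map (ext_map0 us) ext_lift0.
Qed.

Lemma inj_bij_at (F G : qcoh X) (u : qhom F G) : bijective (u C x) ->
  forall T (t : X T), bijective (u T t).
Proof.
move=> ub T t; apply: inj_surj_bij => [m m' e|]; last exact: (surj_at (bij_surj ub)).
apply: (qsep (cov t)) => B z f [_ [g _]].
have [y ey] := bij_surj (qres_iso F g) (qres F f m).
have [y' ey'] := bij_surj (qres_iso F g) (qres F f m').
rewrite -ey -ey'; congr ext_lift.
apply: (bij_inj (ext_map_bij (fover g) (i := u C x) ub)).
by apply: (bij_inj (qres_iso G g)); rewrite !lift_ext_map ey ey' !qfun_nat e.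
Qed.
End Local.

Section FpSheaves.
Variables (R : cring) (X : fibcat R).
Notation fp := (sub_qcoh (is_fp X)).

Lemma zres_linear (A B : calg R) (f : {rmorphism B -> A}) : linear_for (f \; *:%R) (fun _ : 'rV[B]_0 => 0 : 'rV[A]_0).
Proof. by move=> a v w; rewrite addr0 /= scaler0. Qed.
Lemma zero_iso (A B : calg R) (f : {rmorphism B -> A}) : bijective (ext_lift (mkL (zres_linear f))).
Proof.
exists (fun=> 0) => y; last by rewrite [LHS]thinmx0 [RHS]thinmx0.
elim/ext_ind: y => [//|b m|y z <- <-]; last by rewrite addr0.
by rewrite [m]thinmx0 ext_pure0r.
Qed.
Definition zeroq : qcoh X.
Proof.
apply: (@QCoh R X (fun B _ => 'rV[B]_0) (fun A B y z f => mkL (zres_linear (fover f)))).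
- by move=> A y m; rewrite [LHS]thinmx0 [RHS]thinmx0.
- by [].
- by move=> A B y z f; apply: zero_iso.
Defined.
Lemma zeroq_fp : is_fp X zeroq.
Proof.
move=> B y; exists 0%N, 0%N, idfun, idfun; split=> [v|v]; first by exists v.
by split=> _; [exists v|rewrite [LHS]thinmx0].
Qed.
Definition zeroS : fp := SubQCoh zeroq_fp.

Section Sum.
Variables F G : qcoh X.
Definition sres_fun A B (y : X A) (z : X B) (f : fhom y z) (m : F B z * G B z) : F A y * G A y :=
  (qres F f m.1, qres G f m.2).
Lemma sres_linear A B (y : X A) (z : X B) (f : fhom y z) :
  linear_for (fover f \; *:%R) (sres_fun f : (F B z * G B z)%type -> (F A y * G A y)%type).
Proof. by move=> a [m m'] [n n']; rewrite /sres_fun /= !qresD !qresZ. Qed.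
Lemma inl_linear (B : comPzRingType) (M N : lmodType B) : linear (fun m : M => (m, 0) : (M * N)%type).
Proof. by move=> a m n; congr pair; rewrite /= scaler0 addr0. Qed.
Lemma inr_linear (B : comPzRingType) (M N : lmodType B) : linear (fun n : N => (0, n) : (M * N)%type).
Proof. by move=> a m n; congr pair; rewrite /= scaler0 addr0. Qed.
Lemma sum_iso A B (y : X A) (z : X B) (f : fhom y z) : bijective (ext_lift (mkL (sres_linear f))).
Proof.
have [gF kF kF'] := qres_iso F f; have [gG kG kG'] := qres_iso G f.
pose i1 := mkL (@inl_linear B (F B z) (G B z)); pose i2 := mkL (@inr_linear B (F B z) (G B z)).
have p1 m : ext_lift (mkL (sres_linear f)) (ext_map i1 m) = (ext_lift (qres F f) m, 0).
  elim/ext_ind: m => [|b m|m n hm hn]; first by rewrite ext_mapZero !ext_lift0.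
    rewrite ext_map_pure !ext_lift_pure !mkLE /sres_fun /= qres0.
    by congr pair; rewrite /= scaler0.
  by rewrite ext_mapD !ext_liftD hm hn; congr pair; rewrite /= addr0.
have p2 m : ext_lift (mkL (sres_linear f)) (ext_map i2 m) = (0, ext_lift (qres G f) m).
  elim/ext_ind: m => [|b m|m n hm hn]; first by rewrite ext_mapZero !ext_lift0.
    rewrite ext_map_pure !ext_lift_pure !mkLE /sres_fun /= qres0.
    by congr pair; rewrite /= scaler0.
  by rewrite ext_mapD !ext_liftD hm hn; congr pair; rewrite /= addr0.
have dec (m : ext (fover f) (F B z * G B z)%type) : exists m1 m2, m = ext_map i1 m1 + ext_map i2 m2.
  elim/ext_ind: m => [|b [m n]|m n [m1 [m2 ->]] [n1 [n2 ->]]].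
  - by exists 0, 0; rewrite !ext_mapZero addr0.
  - exists (ext_pure _ b m), (ext_pure _ b n); rewrite !ext_map_pure -ext_pureDr !mkLE.
    by congr (ext_pure _ b _); congr pair; rewrite /= ?addr0 ?add0r.
  - by exists (m1 + n1), (m2 + n2); rewrite !ext_mapD addrACA.
exists (fun n => ext_map i1 (gF n.1) + ext_map i2 (gG n.2)) => m.
  have [m1 [m2 ->]] := dec m; rewrite ext_liftD p1 p2 /=.
  by rewrite addr0 add0r kF kG.
by rewrite ext_liftD p1 p2 kF' kG'; case: m => m n; congr pair; rewrite /= ?addr0 ?add0r.
Qed.
Definition sumq : qcoh X.
Proof.
apply: (@QCoh R X (fun B z => (F B z * G B z)%type) (fun A B y z f => mkL (sres_linear f))).
- by move=> A y [m n]; rewrite mkLE /sres_fun /= !qres_id.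
- by move=> A B D y z w g f [m n]; rewrite !mkLE /sres_fun /= !qres_comp.
- by move=> A B y z f; apply: sum_iso.
Defined.
End Sum.

Lemma fin_pres_pair (B : comPzRingType) (M N : lmodType B) :
  fin_pres_mod M -> fin_pres_mod N -> fin_pres_mod (M * N)%type.
Proof.
move=> [m [n [q [p [ps pk]]]]] [m' [n' [q' [p' [ps' pk']]]]].
have ql : linear (fun v : 'rV[B]_(m + m') => row_mx (q (lsubmx v)) (q' (rsubmx v))).
  by move=> a v w; rewrite !linearP scale_row_mx add_row_mx.
have pl : linear (fun v : 'rV[B]_(n + n') => (p (lsubmx v), p' (rsubmx v)) : (M * N)%type).
  by move=> a v w; rewrite !linearP.
exists (m + m')%N, (n + n')%N, (mkL ql), (mkL pl); split=> [[y y']|v].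
  by have [v <-] := ps y; have [v' <-] := ps' y'; exists (row_mx v v'); rewrite mkLE row_mxKl row_mxKr.
rewrite mkLE; split=> [[/pk[w e] /pk'[w' e']]|[w <-]].
  by exists (row_mx w w'); rewrite mkLE row_mxKl row_mxKr e e' hsubmxK.
have e : p (q (lsubmx w)) = 0 by rewrite pk; exists (lsubmx w).
have e' : p' (q' (rsubmx w)) = 0 by rewrite pk'; exists (rsubmx w).
by rewrite mkLE row_mxKl row_mxKr e e'.
Qed.

Lemma sum_fp (E E' : fp) : is_fp X (sumq E E').
Proof. move=> B z; exact: (fin_pres_pair (sub_valP E B z) (sub_valP E' B z)). Qed.
Definition sumS (E E' : fp) : fp := SubQCoh (sum_fp E E').

Lemma in1_nat (F G : qcoh X) A B (y : X A) (z : X B) (f : fhom y z) (m : F B z) :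
  mkL (@inl_linear A (F A y) (G A y)) (qres F f m) = qres (sumq F G) f (mkL (@inl_linear B (F B z) (G B z)) m).
Proof. by rewrite !mkLE /sres_fun /= qres0. Qed.
Definition in1 (F G : qcoh X) : qhom F (sumq F G) := @QHom R X F (sumq F G) _ (@in1_nat F G).
Lemma in2_nat (F G : qcoh X) A B (y : X A) (z : X B) (f : fhom y z) (m : G B z) :
  mkL (@inr_linear A (F A y) (G A y)) (qres G f m) = qres (sumq F G) f (mkL (@inr_linear B (F B z) (G B z)) m).
Proof. by rewrite !mkLE /sres_fun /= qres0. Qed.
Definition in2 (F G : qcoh X) : qhom G (sumq F G) := @QHom R X G (sumq F G) _ (@in2_nat F G).

Section Cotuple.
Variables (F G H : qcoh X) (u : qhom F H) (v : qhom G H).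
Lemma cot_linear B (z : X B) : linear (fun m : sumq F G B z => u B z m.1 + v B z m.2).
Proof. by move=> a [m m'] [n n'] /=; rewrite !linearP addrACA scalerDr. Qed.
Lemma cot_nat A B (y : X A) (z : X B) (f : fhom y z) (m : sumq F G B z) :
  mkL (@cot_linear A y) (qres (sumq F G) f m) = qres H f (mkL (@cot_linear B z) m).
Proof. by rewrite !mkLE /sres_fun /= !qfun_nat qresD. Qed.
Definition cot : qhom (sumq F G) H := QHom cot_nat.
Lemma cotE B (z : X B) m : cot B z m = u B z m.1 + v B z m.2. Proof. by []. Qed.
Lemma cot1 : qcomp cot (in1 F G) = u.
Proof. by apply: qhom_ext => B z m; rewrite /= linear0 addr0. Qed.
Lemma cot2 : qcomp cot (in2 F G) = v.
Proof. by apply: qhom_ext => B z m; rewrite /= linear0 add0r. Qed.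
End Cotuple.

Section Cokernel.
Variables (F G : qcoh X) (u : qhom F G).
Definition ckmod B (z : X B) : lmodType B := quomod (im_submod (u B z)).
Definition ckproj B (z : X B) : {linear G B z -> ckmod z} := qproj (im_submod (u B z)).
Lemma ckproj0 B (z : X B) m : ckproj z m = 0 <-> exists l, u B z l = m.
Proof. exact: (qproj0 (im_submod (u B z))). Qed.
Lemma ckproj_surj B (z : X B) n : exists m, ckproj z m = n.
Proof. exact: qproj_surj. Qed.
Lemma ckres0_linear A B (y : X A) (z : X B) (f : fhom y z) :
  linear_for (fover f \; *:%R) (fun m : G B z => ckproj y (qres G f m)).
Proof. by move=> a m n; rewrite qresD qresZ linearP. Qed.
Lemma ckres0_im A B (y : X A) (z : X B) (f : fhom y z) m : (exists l, u B z l = m) ->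
  mkL (ckres0_linear f) m = 0.
Proof. by move=> [l <-]; apply/ckproj0; exists (qres F f l); rewrite qfun_nat. Qed.
Definition ckres A B (y : X A) (z : X B) (f : fhom y z) : {linear ckmod z -> ckmod y | fover f \; *:%R} :=
  qliftL (im_submod (u B z)) (@ckres0_im A B y z f).
Lemma ckresE A B (y : X A) (z : X B) (f : fhom y z) m : ckres f (ckproj z m) = ckproj y (qres G f m).
Proof. exact: (qlift_proj (im_submod (u B z)) (@ckres0_im A B y z f)). Qed.
Lemma ck_iso A B (y : X A) (z : X B) (f : fhom y z) : bijective (ext_lift (ckres f)).
Proof.
have sq m : ext_lift (ckres f) (ext_map (ckproj z) m) = ckproj y (ext_lift (qres G f) m).
  elim/ext_ind: m => [|b c|s s' hs hs'].
  - by rewrite ext_mapZero !ext_lift0 linear0.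
  - by rewrite ext_map_pure !ext_lift_pure ckresE (linearZ_LR (ckproj y)).
  - by rewrite ext_mapD !ext_liftD linearD hs hs'.
apply: inj_surj_bij => [m n e|n]; last first.
  have [m <-] := ckproj_surj n; have [w <-] := bij_surj (qres_iso G f) m.
  by exists (ext_map (ckproj z) w); rewrite sq.
apply/subr0_eq; have : ext_lift (ckres f) (m - n) = 0 by rewrite ext_liftB e subrr.
have [w <-] := ext_map_surj (f := fover f) (@ckproj_surj _ z) (m - n).
rewrite sq => /ckproj0[l el].
have [l' el'] := bij_surj (qres_iso F f) l.
have <- : ext_map (u B z) l' = w by apply: (bij_inj (qres_iso G f)); rewrite lift_ext_map el' el.
by rewrite ext_map_comp; apply: ext_map0 => a; apply/ckproj0; exists a.
Qed.
Definition ckq : qcoh X.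
Proof.
apply: (@QCoh R X ckmod ckres).
- by move=> A y m; have [n <-] := ckproj_surj m; rewrite ckresE qres_id.
- by move=> A B D y z w g f m; have [n <-] := ckproj_surj m; rewrite !ckresE qres_comp.
- by move=> A B y z f; apply: ck_iso.
Defined.
Definition ckp : qhom G ckq := @QHom R X G ckq ckproj (fun A B y z f m => esym (ckresE f m)).
Lemma ckp0 B (z : X B) m : ckp B z m = 0 <-> exists l, u B z l = m.
Proof. exact: ckproj0. Qed.
Lemma ck_exact : right_exact u ckp.
Proof. by move=> B z; split; [exact: ckproj_surj|exact: ckproj0]. Qed.
End Cokernel.

(** The relations of P are those of N and the images of the generators of M. *)
Lemma fin_pres_coker (B : comPzRingType) (M N P : lmodType B) (u : {linear M -> N}) (v : {linear N -> P}) :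
  fin_gen M -> fin_pres_mod N -> (forall y, exists z, v z = y) ->
  (forall z, v z = 0 <-> exists w, u w = z) -> fin_pres_mod P.
Proof.
move=> [l [p ps]] [m [n [q [r [rs rk]]]]] vs vk.
pose ba j := projT1 (boolp.cid (rs (u (p (delta_mx 0 j))))).
have baP j : r (ba j) = u (p (delta_mx 0 j)) := projT2 (boolp.cid (rs _)).
have rg w : r (rows ba w) = u (p w).
  by apply: (rows_ext (p := r \o rows ba) (q := u \o p)) => i; exact: etrans (congr1 r (rows_delta ba i)) (baP i).
have tl : linear (fun w : 'rV[B]_(m + l) => q (lsubmx w) + rows ba (rsubmx w)).
  by move=> a w w'; rewrite (linearP (@lsubmx B 1 m l)) (linearP (@rsubmx B 1 m l)) (linearP q)
    (linearP (rows ba)) addrACA scalerDr.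
exists (m + l)%N, n, (mkL tl), (v \o r); split=> [y|w] /=.
  by have [z <-] := vs y; have [w <-] := rs z; exists w.
split=> [/vk[a ea]|[w' <-]].
  have [b eb] := ps a.
  have [c ec] : exists c, q c = w - rows ba b by apply/rk; rewrite linearB rg eb ea subrr.
  by exists (row_mx c b); rewrite row_mxKl row_mxKr ec subrK.
apply/vk; rewrite linearD rg.
have -> : r (q (lsubmx w')) = 0 by rewrite rk; exists (lsubmx w').
by exists (p (rsubmx w')); rewrite add0r.
Qed.
Lemma ck_fp (E E' : fp) (u : qhom E E') : is_fp X (ckq u).
Proof.
move=> B z; apply: (@fin_pres_coker _ _ _ (ckq u B z) (u B z) (ckp u B z)).
- exact: (fin_pres_gen (sub_valP E B z)).
- exact: (sub_valP E' B z).
- exact: ckproj_surj.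
- exact: ckp0.
Qed.
Definition ckS (E E' : fp) (u : qhom E E') : fp := SubQCoh (ck_fp u).
End FpSheaves.

(** * Sheaves of finite presentation hitting given elements *)

Section Hitting.
Variables (R : cring) (X : fibcat R) (C : calg R) (x : X C).
Hypotheses (Cx : fpqc_atlas x) (Xgen : generates (is_fp X)).
Notation fp := (sub_qcoh (is_fp X)).

(** An element of a direct sum is contained in a finite subsum. *)
Lemma gen_hit (F : qcoh X) (z : F C x) : exists (E : fp) (g : qhom E F) e, g C x e = z.
Proof.
have [J [E [u h]]] := Xgen F; have [w [_ ->]] := h C x z.
elim/big_ind: _ => [|y y' [E1 [g1 [e1 <-]]] [E2 [g2 [e2 <-]]]|j _].
- by exists (zeroS X), 0, 0.
- by exists (sumS E1 E2), (cot g1 g2), (e1, e2).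
- by exists (E j), (u j), (w j).
Qed.

(** Generation is applied to the kernel sheaf of h. *)
Lemma ker_hit (F G : qcoh X) (h : qhom F G) (z : F C x) : h C x z = 0 ->
  exists (E : fp) (g : qhom E F), qcomp h g = 0 /\ exists e, g C x e = z.
Proof.
move=> /(kernel_sheaf Cx)[N [g [hg [n <-]]]].
have [E [k [e <-]]] := gen_hit n.
exists E, (qcomp g k); split; last by exists e.
by apply: qhom_ext => B y m; exact: hg.
Qed.

Lemma ker_hit_seq (F G : qcoh X) (h : qhom F G) (s : seq (F C x)) : (forall z, z \in s -> h C x z = 0) ->
  exists (E : fp) (g : qhom E F), qcomp h g = 0 /\ forall z, z \in s -> exists e, g C x e = z.
Proof.
elim: s => [|z s ih] hs.
  by exists (zeroS X), 0; split=> //; apply: qhom_ext => B y m /=; rewrite linear0.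
have [|E1 [g1 [h1 H1]]] := ih; first by move=> w ws; apply: hs; rewrite inE ws orbT.
have [|E2 [g2 [h2 [e2 H2]]]] := @ker_hit F G h z; first by apply: hs; rewrite inE eqxx.
exists (sumS E1 E2), (cot g1 g2); split.
  apply: qhom_ext => B y [m n] /=; rewrite linearD.
  have := congr1 (fun k : qhom E1 G => k B y m) h1; have := congr1 (fun k : qhom E2 G => k B y n) h2.
  by rewrite /= => -> ->; rewrite addr0.
move=> w; rewrite inE => /orP[/eqP ->|/H1[e1 <-]].
  by exists (0, e2); rewrite cotE /= linear0 add0r.
by exists (e1, 0); rewrite cotE /= linear0 addr0.
Qed.
End Hitting.

(** * A small skeleton of the sheaves of finite presentation *)

(** The sheaves of finite presentation form a type which is too large to index a module. Up to
    isomorphism they form a set: such a sheaf can be recovered from the relations between formal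
    combinations of chosen generators of its values, and from the restrictions of these
    generators. *)
Section Codes.
Variables (R : cring) (X : fibcat R).
Notation fp := (sub_qcoh (is_fp X)).

Lemma gens_ex (E : fp) B (y : X B) : exists e : nat -> E B y,
  forall m, exists l : seq (B * nat), m = \sum_(p <- l) p.1 *: e p.2.
Proof.
have [n [p ps]] := fin_pres_gen (sub_valP E B y).
exists (fun k => if insub k is Some i then p (delta_mx 0 i) else 0) => m.
have [v <-] := ps m; exists [seq (v 0 i, val i) | i <- enum 'I_n].
rewrite big_map big_enum /= rows_eq; apply: eq_bigr => i _.
by rewrite (insubT (fun k => (k < n)%N) (ltn_ord i)) /=; congr (_ *: p (delta_mx 0 _)); apply: val_inj.
Qed.
Definition gens (E : fp) B (y : X B) : nat -> E B y := projT1 (boolp.cid (gens_ex E y)).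
Definition ev (E : fp) B (y : X B) (l : seq (B * nat)) : E B y := \sum_(p <- l) p.1 *: gens E y p.2.
Lemma ev_ex (E : fp) B (y : X B) m : exists l, ev E y l = m.
Proof. by have [l ->] := projT2 (boolp.cid (gens_ex E y)) m; exists l. Qed.
Lemma ev_cat (E : fp) B (y : X B) l l' : ev E y (l ++ l') = ev E y l + ev E y l'.
Proof. exact: big_cat. Qed.
Lemma ev_scale (E : fp) B (y : X B) b l : ev E y [seq (b * p.1, p.2) | p <- l] = b *: ev E y l.
Proof. by rewrite /ev big_map scaler_sumr; apply: eq_bigr => p _; rewrite scalerA. Qed.

Definition code_type := forall A B (y : X A) (z : X B), fhom y z -> seq (A * nat) -> seq (B * nat) -> Prop.
Definition code (E : fp) : code_type := fun A B y z f l l' => ev E y l = qres E f (ev E z l').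

Section SameCode.
Variables (E E' : fp) (h : code E = code E').
Lemma code_eq A B (y : X A) (z : X B) (f : fhom y z) l l' :
  ev E y l = qres E f (ev E z l') -> ev E' y l = qres E' f (ev E' z l').
Proof. by move=> e; have : code E f l l' by []; rewrite h. Qed.
Definition code_fun B (y : X B) (m : E B y) : E' B y := ev E' y (projT1 (boolp.cid (ev_ex m))).
Lemma code_funE B (y : X B) l : code_fun (ev E y l) = ev E' y l.
Proof.
rewrite /code_fun; case: boolp.cid => l' /= e.
by have := @code_eq _ _ _ _ (fid y) l' l; rewrite !qres_id; apply.
Qed.
Lemma code_linear B (y : X B) : linear (@code_fun B y).
Proof.
move=> b m n; have [l <-] := ev_ex m; have [l' <-] := ev_ex n.
by rewrite -ev_scale -ev_cat !code_funE ev_cat ev_scale.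
Qed.
Lemma code_nat A B (y : X A) (z : X B) (f : fhom y z) m :
  mkL (@code_linear A y) (qres E f m) = qres E' f (mkL (@code_linear B z) m).
Proof.
have [l' <-] := ev_ex m; have [l el] := ev_ex (qres E f (ev E z l')).
by rewrite !mkLE code_funE -el code_funE; apply: code_eq.
Qed.
Definition code_hom : qhom E E' := QHom code_nat.
End SameCode.

Lemma code_homK (E E' : fp) (h : code E = code E') (h' : code E' = code E) :
  qcomp (code_hom h') (code_hom h) = qid E.
Proof.
apply: qhom_ext => B y m; have [l <-] := ev_ex m.
by rewrite /= !code_funE.
Qed.

Definition Sk := {c : code_type | exists E : fp, code E = c}.
Definition rep (i : Sk) : fp := projT1 (boolp.cid (svalP i)).
Lemma rep_code i : code (rep i) = sval i. Proof. exact: projT2 (boolp.cid (svalP i)). Qed.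
Definition skel (E : fp) : Sk := exist _ (code E) (ex_intro _ E erefl).
Definition to_rep (E : fp) : qhom E (rep (skel E)) := code_hom (esym (rep_code (skel E))).
Definition of_rep (E : fp) : qhom (rep (skel E)) E := code_hom (rep_code (skel E)).
Lemma of_repK E : qcomp (of_rep E) (to_rep E) = qid E. Proof. exact: code_homK. Qed.
End Codes.

(** * Coends *)

(** Modules presented by generators on which the scalars act, and relations between formal sums.
    The generators of the coend are the symbols c ⊗ e, so that it need not be written as a
    quotient of a direct sum of tensor products. *)
Section PresentedModules.
Variables (B : comPzRingType) (S : Type) (act : B -> S -> S) (rel : seq S -> seq S -> Prop).

Inductive pcong : seq S -> seq S -> Prop :=
| pc_refl s : pcong s s
| pc_sym s t : pcong s t -> pcong t s
| pc_trans s t v : pcong s t -> pcong t v -> pcong s v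
| pc_cat s s' t t' : pcong s s' -> pcong t t' -> pcong (s ++ t) (s' ++ t')
| pc_catC s t : pcong (s ++ t) (t ++ s)
| pc_rel s t : rel s t -> pcong s t.

Hypotheses (act_rel : forall b s t, rel s t -> pcong (map (act b) s) (map (act b) t))
  (act1 : forall g, act 1 g = g) (actM : forall b c g, act b (act c g) = act (b * c) g)
  (actD : forall b c g, pcong [:: act (b + c) g] [:: act b g; act c g])
  (act0 : forall g, pcong [:: act 0 g] [::]).

Lemma pc_act b s t : pcong s t -> pcong (map (act b) s) (map (act b) t).
Proof.
elim=> {s t} [s|s t _ h|s t v _ h _ k|s s' t t' _ h _ k|s t|s t h].
- exact: pc_refl.
- exact: pc_sym.
- exact: pc_trans h k.
- by rewrite !map_cat; apply: pc_cat.
- by rewrite !map_cat; apply: pc_catC.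
- exact: act_rel.
Qed.

Definition pmod := {c : seq S -> Prop | exists s, c = pcong s}.
Definition mcl (s : seq S) : pmod := exist _ (pcong s) (ex_intro _ s erefl).
Lemma mcl_eq s t : mcl s = mcl t <-> pcong s t.
Proof.
split=> [/(congr1 sval)/(congr1 (fun c => c t))/= e|h]; first by rewrite e; apply: pc_refl.
apply: sval_inj => /=; apply/funext => v; apply/propext; split=> k.
  exact: pc_trans (pc_sym h) k.
exact: pc_trans h k.
Qed.
Definition mrep (x : pmod) : seq S := projT1 (boolp.cid (svalP x)).
Lemma mrepK x : mcl (mrep x) = x.
Proof. by apply: sval_inj; rewrite /= /mrep; case: boolp.cid. Qed.
Lemma mrep_cl s : pcong (mrep (mcl s)) s. Proof. by apply/mcl_eq; rewrite mrepK. Qed.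

HB.instance Definition _ := gen_eqMixin pmod.
HB.instance Definition _ := gen_choiceMixin pmod.
Definition madd x y := mcl (mrep x ++ mrep y).
Definition mscale b x := mcl (map (act b) (mrep x)).
Lemma maddE s t : madd (mcl s) (mcl t) = mcl (s ++ t).
Proof. by apply/mcl_eq/pc_cat; apply: mrep_cl. Qed.
Lemma mscaleE b s : mscale b (mcl s) = mcl (map (act b) s).
Proof. exact/mcl_eq/pc_act/mrep_cl. Qed.
Lemma maddA : associative madd.
Proof. by move=> x y z; rewrite -(mrepK x) -(mrepK y) -(mrepK z) !maddE catA. Qed.
Lemma maddC : commutative madd.
Proof. by move=> x y; rewrite -(mrepK x) -(mrepK y) !maddE; apply/mcl_eq/pc_catC. Qed.
Lemma madd0 : left_id (mcl [::]) madd. Proof. by move=> x; rewrite -(mrepK x) maddE. Qed.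
Lemma mscaleDl x b c : mscale (b + c) x = madd (mscale b x) (mscale c x).
Proof.
rewrite -(mrepK x) !mscaleE maddE; apply/mcl_eq; elim: (mrep x) => [|g s ih]; first exact: pc_refl.
apply: pc_trans (pc_cat (actD b c g) ih) _ => /=.
apply: (@pc_cat [:: _] [:: _]); first exact: pc_refl.
rewrite -cat1s catA -[X in pcong _ (_ ++ X)]cat1s catA.
by apply: pc_cat; [apply: pc_catC|apply: pc_refl].
Qed.
Lemma mscale0 x : mscale 0 x = mcl [::].
Proof.
rewrite -(mrepK x) mscaleE; apply/mcl_eq; elim: (mrep x) => [|g s ih]; first exact: pc_refl.
exact: (pc_cat (act0 g) ih).
Qed.
Lemma mscale1 : left_id 1 mscale.
Proof. by move=> x; rewrite -(mrepK x) mscaleE (eq_map act1) map_id. Qed.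
Lemma maddN : left_inverse (mcl [::]) (mscale (-1)) madd.
Proof. by move=> x; rewrite -[X in madd _ X]mscale1 -mscaleDl addNr mscale0. Qed.
HB.instance Definition _ := GRing.isZmodule.Build pmod maddA maddC madd0 maddN.
Lemma mscaleA b c x : mscale b (mscale c x) = mscale (b * c) x.
Proof. by rewrite -(mrepK x) !mscaleE -map_comp (eq_map (actM b c)). Qed.
Lemma mscaleDr : right_distributive mscale +%R.
Proof. by move=> b x y; rewrite -(mrepK x) -(mrepK y) [X in mscale b X]maddE !mscaleE map_cat [RHS]maddE. Qed.
HB.instance Definition _ := GRing.Zmodule_isLmodule.Build B pmod mscaleA mscale1 mscaleDr mscaleDl.
Definition pmodule : lmodType B := pmod.

Definition pg (g : S) : pmodule := mcl [:: g].
Lemma mcl_cons g s : mcl (g :: s) = pg g + (mcl s : pmodule). Proof. by rewrite [RHS]maddE. Qed.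
Lemma mcl_nil : mcl [::] = 0 :> pmodule. Proof. by []. Qed.
Lemma mscale_pg b g : b *: pg g = pg (act b g). Proof. exact: mscaleE. Qed.
Lemma pmod_ind (P : pmodule -> Prop) : P 0 -> (forall g, P (pg g)) -> (forall y z, P y -> P z -> P (y + z)) ->
  forall y, P y.
Proof.
move=> h0 hg hD y; rewrite -(mrepK y); elim: (mrep y) => [//|g s ih].
by rewrite mcl_cons; apply: hD.
Qed.

Section Lift.
Variables (G : zmodType) (f : S -> G).
Hypothesis hf : forall s t, rel s t -> \sum_(g <- s) f g = \sum_(g <- t) f g.
Lemma plift_cong s t : pcong s t -> \sum_(g <- s) f g = \sum_(g <- t) f g.
Proof.
elim=> {s t} [//|s t _ -> //|s t v _ -> _ -> //|s s' t t' _ h _ k|s t|s t /hf //].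
- by rewrite !big_cat h k.
- by rewrite !big_cat /= addrC.
Qed.
Definition plift (y : pmodule) : G := \sum_(g <- mrep y) f g.
Lemma plift_pcl s : plift (mcl s) = \sum_(g <- s) f g. Proof. exact/plift_cong/mrep_cl. Qed.
Lemma plift_pg g : plift (pg g) = f g. Proof. by rewrite plift_pcl big_seq1. Qed.
Lemma pliftD y z : plift (y + z) = plift y + plift z.
Proof. by rewrite -(mrepK y) -(mrepK z) [X in plift X]maddE !plift_pcl big_cat. Qed.
Lemma plift0 : plift 0 = 0. Proof. by rewrite -mcl_nil plift_pcl big_nil. Qed.
End Lift.
End PresentedModules.

Section Coend.
Variables (R : cring) (A : calg R) (X : fibcat R).
Notation fp := (sub_qcoh (is_fp X)).
Notation lfun := (lfun A (is_fp X)).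

Section OneFunctor.
Variable Ga : lfun.

Section OneObject.
Variables (B : calg R) (y : X B).
Definition cgen := {i : Sk X & (Ga (rep i) * rep i B y)%type}.
Definition cg (i : Sk X) (c : Ga (rep i)) (e : rep i B y) : cgen := existT _ i (c, e).
Definition cact (b : B) (g : cgen) : cgen := cg (projT2 g).1 (b *: (projT2 g).2).

(** The last relation is the one of the coend. For the multiples of the identity by scalars in R
    it says that the tensor products are over R. *)
Inductive crel : seq cgen -> seq cgen -> Prop :=
| crel0 i c : crel [:: @cg i c 0] [::]
| crelDr i c e e' : crel [:: @cg i c (e + e')] [:: cg c e; cg c e']
| crelDl i c c' e : crel [:: @cg i (c + c') e] [:: cg c e; cg c' e]
| crelN i j (u : qhom (rep i) (rep j)) c e : crel [:: cg (lmap Ga u c) e] [:: cg c (u B y e)].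

Lemma cact_rel b s t : crel s t -> pcong crel (map (cact b) s) (map (cact b) t).
Proof.
case=> *; apply: pc_rel; rewrite /= /cact /=.
- by rewrite scaler0; constructor.
- by rewrite scalerDr; constructor.
- by constructor.
- by rewrite -linearZ; constructor.
Qed.
Lemma cact1 g : cact 1 g = g. Proof. by case: g => i [c e]; rewrite /cact scale1r. Qed.
Lemma cactM b b' g : cact b (cact b' g) = cact (b * b') g.
Proof. by rewrite /cact /= scalerA. Qed.
Lemma cactD b b' g : pcong crel [:: cact (b + b') g] [:: cact b g; cact b' g].
Proof. by rewrite /cact scalerDl; apply/pc_rel; constructor. Qed.
Lemma cact0 g : pcong crel [:: cact 0 g] [::].
Proof. by rewrite /cact scale0r; apply/pc_rel; constructor. Qed.

(** The coend of Ga and the evaluation at y. *)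
Definition Lmod : lmodType B := pmodule cact_rel cact1 cactM cactD cact0.
Definition br (i : Sk X) (c : Ga (rep i)) (e : rep i B y) : Lmod := pg cact_rel cact1 cactM cactD cact0 (cg c e).
Lemma br_rel s t : crel s t -> mcl crel s = mcl crel t. Proof. by move=> h; apply/mcl_eq/pc_rel. Qed.
Lemma br_add g h : pg cact_rel cact1 cactM cactD cact0 g + pg cact_rel cact1 cactM cactD cact0 h =
  mcl crel [:: g; h] :> Lmod.
Proof. exact: (esym (mcl_cons _ _ _ _ _ g [:: h])). Qed.
Lemma brDr i c e e' : @br i c (e + e') = br c e + br c e'.
Proof. by rewrite br_add; apply: br_rel; constructor. Qed.
Lemma brDl i c c' e : @br i (c + c') e = br c e + br c' e.
Proof. by rewrite br_add; apply: br_rel; constructor. Qed.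
Lemma br_nat i j (u : qhom (rep i) (rep j)) c e : br (lmap Ga u c) e = br c (u B y e).
Proof. by apply: br_rel; constructor. Qed.
Lemma brZ i b c e : @br i c (b *: e) = b *: br c e.
Proof. by rewrite /br mscale_pg. Qed.
Lemma br0r i c : @br i c 0 = 0. Proof. by rewrite -(scale0r 0) brZ scale0r. Qed.
Lemma Lmod_ind (P : Lmod -> Prop) : P 0 -> (forall i c e, P (@br i c e)) ->
  (forall m n, P m -> P n -> P (m + n)) -> forall m, P m.
Proof. by move=> h0 hb hD; apply: pmod_ind => // -[i [c e]]; apply: hb. Qed.

Section Lift.
Variables (G : zmodType) (f : forall i, Ga (rep i) -> rep i B y -> G).
Hypotheses (fDr : forall i c e e', @f i c (e + e') = f c e + f c e')
  (fDl : forall i c c' e, @f i (c + c') e = f c e + f c' e)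
  (fN : forall i j (u : qhom (rep i) (rep j)) c e, f (lmap Ga u c) e = f c (u B y e)).
Definition lift_gen (g : cgen) : G := f (projT2 g).1 (projT2 g).2.
Lemma lift_rel s t : crel s t -> \sum_(g <- s) lift_gen g = \sum_(g <- t) lift_gen g.
Proof.
case=> [i c|i c e e'|i c c' e|i j u c e]; rewrite !big_cons !big_nil ?addr0 /lift_gen /= //.
by apply: (@addrI _ (f c 0)); rewrite -fDr !addr0.
Qed.
Definition Llift (m : Lmod) : G := plift lift_gen m.
Lemma Llift_br i c e : Llift (@br i c e) = f c e. Proof. exact: (plift_pg _ _ _ _ _ lift_rel). Qed.
Lemma LliftD m n : Llift (m + n) = Llift m + Llift n. Proof. by apply: pliftD => s t; exact: lift_rel. Qed.
Lemma Llift0 : Llift 0 = 0. Proof. by apply: (@plift0 _ _ _ _ cact_rel cact1 cactM cactD cact0) => s t; exact: lift_rel. Qed.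
End Lift.
End OneObject.
End OneFunctor.
End Coend.

(** * The coend as a quasi-coherent sheaf *)

Section LeftAdjoint.
Variables (R : cring) (A : calg R) (X : fibcat R).
Notation fp := (sub_qcoh (is_fp X)).
Notation lfun := (lfun A (is_fp X)).

Section Sheaf.
Variable Ga : lfun.
Notation br := (@br R A X Ga _ _ _).

Lemma br_sumr B (y : X B) (i : Sk X) (c : Ga (rep i)) : linear (fun e : rep i B y => br c e).
Proof. by move=> b m n; rewrite brDr brZ. Qed.
Definition brl B (y : X B) (i : Sk X) (c : Ga (rep i)) : {linear rep i B y -> Lmod Ga y} := mkL (br_sumr c).

Section Res.
Variables (B D : calg R) (y : X B) (z : X D) (f : fhom y z).
Definition lres_fun : Lmod Ga z -> Lmod Ga y := Llift (fun i c e => br c (qres (rep i) f e)).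
Lemma lres_br i (c : Ga (rep i)) e : lres_fun (br c e) = br c (qres (rep i) f e).
Proof.
apply: (Llift_br (f := fun i c e => br c (qres (rep i) f e))) => [j d e1 e2|j d d' e1|j k u d e1].
- by rewrite qresD brDr.
- by rewrite brDl.
- by rewrite br_nat qfun_nat.
Qed.
Lemma lresD m n : lres_fun (m + n) = lres_fun m + lres_fun n.
Proof.
apply: LliftD => [j d e1 e2|j d d' e1|j k u d e1].
- by rewrite qresD brDr.
- by rewrite brDl.
- by rewrite br_nat qfun_nat.
Qed.
Lemma lres0 : lres_fun 0 = 0.
Proof. by apply: (@addIr _ (lres_fun 0)); rewrite -lresD !add0r. Qed.
Lemma lres_linear : linear_for (fover f \; *:%R) lres_fun.
Proof.
move=> b m n; rewrite lresD; congr (_ + _) => /=; elim/Lmod_ind: m => [|i c e|m1 m2 h1 h2].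
- by rewrite scaler0 lres0 scaler0.
- by rewrite -brZ !lres_br qresZ brZ.
- by rewrite scalerDr !lresD h1 h2 scalerDr.
Qed.

Lemma res_inv_ex i : exists g, cancel (ext_lift (qres (rep i) f)) g /\ cancel g (ext_lift (qres (rep i) f)).
Proof. by case: (qres_iso (rep i) f) => g h1 h2; exists g. Qed.
Definition res_inv i := projT1 (boolp.cid (res_inv_ex i)).
Arguments res_inv i : clear implicits.
Lemma res_invK i : cancel (ext_lift (qres (rep i) f)) (res_inv i).
Proof. by case: (projT2 (boolp.cid (res_inv_ex i))). Qed.
Lemma res_invK' i : cancel (res_inv i) (ext_lift (qres (rep i) f)).
Proof. by case: (projT2 (boolp.cid (res_inv_ex i))). Qed.

(** Extension of scalars commutes with the coend: in every member rep i, the element e comes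
    from the extension of scalars of the value at z. *)
Definition linv_gen i (c : Ga (rep i)) (e : rep i B y) : ext (fover f) (Lmod Ga z) :=
  ext_map (brl z c) (res_inv i e).
Lemma linv_genE i (c : Ga (rep i)) w : linv_gen c (ext_lift (qres (rep i) f) w) = ext_map (brl z c) w.
Proof. by rewrite /linv_gen res_invK. Qed.
Lemma linv_Dr i (c : Ga (rep i)) e e' : linv_gen c (e + e') = linv_gen c e + linv_gen c e'.
Proof. by rewrite -(res_invK' e) -(res_invK' e') -ext_liftD !linv_genE ext_mapD. Qed.
Lemma linv_Dl i (c c' : Ga (rep i)) e : linv_gen (c + c') e = linv_gen c e + linv_gen c' e.
Proof.
rewrite /linv_gen; elim/ext_ind: (res_inv i e) => [|b m|m n hm hn].
- by rewrite !ext_mapZero addr0.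
- by rewrite !ext_map_pure -ext_pureDr !mkLE brDl.
- by rewrite !ext_mapD hm hn addrACA.
Qed.
Lemma linv_N i j (u : qhom (rep i) (rep j)) c e : linv_gen (lmap Ga u c) e = linv_gen c (u B y e).
Proof.
rewrite -(res_invK' e) -lift_ext_map !linv_genE ext_map_comp.
by apply: ext_map_eq => m; rewrite /= br_nat.
Qed.
Definition linv_fun : Lmod Ga y -> ext (fover f) (Lmod Ga z) := Llift linv_gen.
Lemma linv_br i (c : Ga (rep i)) e : linv_fun (br c e) = linv_gen c e.
Proof. exact: (Llift_br linv_Dr linv_Dl linv_N). Qed.
Lemma linvD m n : linv_fun (m + n) = linv_fun m + linv_fun n.
Proof. exact: (LliftD linv_Dr linv_Dl linv_N). Qed.
Lemma linv0 : linv_fun 0 = 0.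
Proof. exact: (Llift0 linv_Dr linv_Dl linv_N). Qed.

Lemma lres_iso : bijective (ext_lift (mkL lres_linear)).
Proof.
exists linv_fun => w.
  elim/ext_ind: w => [|b m|m n hm hn]; first by rewrite ext_lift0 linv0.
    rewrite ext_lift_pure mkLE; elim/Lmod_ind: m => [|i c e|m n hm hn].
    + by rewrite lres0 scaler0 linv0 ext_pure0r.
    + by rewrite lres_br -brZ linv_br -(ext_lift_pure (qres (rep i) f)) linv_genE ext_map_pure.
    + by rewrite lresD scalerDr linvD hm hn ext_pureDr.
  by rewrite ext_liftD linvD hm hn.
elim/Lmod_ind: w => [|i c e|m n hm hn]; first by rewrite linv0 ext_lift0.
  rewrite linv_br -(res_invK' e) linv_genE.
  elim/ext_ind: (res_inv i e) => [|b m|m n hm hn].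
  + by rewrite ext_mapZero !ext_lift0 br0r.
  + by rewrite ext_map_pure !ext_lift_pure !mkLE lres_br brZ.
  + by rewrite ext_mapD !ext_liftD hm hn brDr.
by rewrite linvD ext_liftD hm hn.
Qed.
End Res.

Definition Lq : qcoh X.
Proof.
apply: (@QCoh R X (fun B y => Lmod Ga y) (fun B D y z f => mkL (lres_linear f))).
- move=> B y m; rewrite mkLE; elim/Lmod_ind: m => [|i c e|m n hm hn]; first exact: lres0.
    by rewrite lres_br qres_id.
  by rewrite lresD hm hn.
- move=> B D T y z w g f m; rewrite !mkLE; elim/Lmod_ind: m => [|i c e|m n hm hn]; first by rewrite !lres0.
    by rewrite !lres_br qres_comp.
  by rewrite !lresD hm hn.
- by move=> B D y z f; apply: lres_iso.
Defined.

(** A morphism from the coend to G amounts to a family of additive maps, natural in i, from Ga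
    (rep i) to the morphisms rep i -> G. *)
Section MapOut.
Variables (G : qcoh X) (h : forall i, Ga (rep i) -> qhom (rep i) G).
Hypotheses (hD : forall i c c', @h i (c + c') = h c + h c')
  (hN : forall i j (u : qhom (rep i) (rep j)) c, h (lmap Ga u c) = qcomp (h c) u).
Definition lout_gen B (y : X B) i (c : Ga (rep i)) (e : rep i B y) : G B y := h c B y e.
Lemma lout_Dr B (y : X B) i (c : Ga (rep i)) (e e' : rep i B y) :
  lout_gen c (e + e') = lout_gen c e + lout_gen c e'.
Proof. exact: linearD. Qed.
Lemma lout_Dl B (y : X B) i (c c' : Ga (rep i)) (e : rep i B y) :
  lout_gen (c + c') e = lout_gen c e + lout_gen c' e.
Proof. by rewrite /lout_gen hD. Qed.
Lemma lout_N B (y : X B) i j (u : qhom (rep i) (rep j)) c (e : rep i B y) :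
  lout_gen (lmap Ga u c) e = lout_gen c (u B y e).
Proof. by rewrite /lout_gen hN. Qed.
Definition lout_fun B (y : X B) : Lmod Ga y -> G B y := Llift (@lout_gen B y).
Lemma lout_br B (y : X B) i (c : Ga (rep i)) (e : rep i B y) : lout_fun (br c e) = h c B y e.
Proof. exact: (Llift_br (@lout_Dr B y) (@lout_Dl B y) (@lout_N B y)). Qed.
Lemma loutD B (y : X B) m n : @lout_fun B y (m + n) = lout_fun m + lout_fun n.
Proof. exact: (LliftD (@lout_Dr B y) (@lout_Dl B y) (@lout_N B y)). Qed.
Lemma lout0 B (y : X B) : @lout_fun B y 0 = 0.
Proof. exact: (Llift0 (@lout_Dr B y) (@lout_Dl B y) (@lout_N B y)). Qed.
Lemma lout_linear B (y : X B) : linear (@lout_fun B y).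
Proof.
move=> b m n; rewrite loutD; congr (_ + _); elim/Lmod_ind: m => [|i c e|m1 m2 h1 h2].
- by rewrite scaler0 lout0 scaler0.
- by rewrite -brZ !lout_br linearZ.
- by rewrite scalerDr !loutD h1 h2 scalerDr.
Qed.
Lemma lout_nat B D (y : X B) (z : X D) (f : fhom y z) (m : Lq D z) :
  mkL (@lout_linear B y) (qres Lq f m) = qres G f (mkL (@lout_linear D z) m).
Proof.
rewrite !mkLE; elim/Lmod_ind: m => [|i c e|m n hm hn]; first by rewrite lres0 !lout0 qres0.
  by rewrite lres_br !lout_br qfun_nat.
by rewrite lresD !loutD qresD hm hn.
Qed.
Definition lout : qhom Lq G := QHom lout_nat.
Lemma loutE B (y : X B) i (c : Ga (rep i)) (e : rep i B y) : lout B y (br c e) = h c B y e.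
Proof. exact: lout_br. Qed.
End MapOut.

Lemma lhom_eq (G : qcoh X) (u v : qhom Lq G) :
  (forall B (y : X B) i (c : Ga (rep i)) (e : rep i B y), u B y (br c e) = v B y (br c e)) -> u = v.
Proof.
move=> h; apply: qhom_ext => B y; apply: Lmod_ind => [|i c e|m n hm hn]; first by rewrite !linear0.
  exact: h.
by rewrite !linearD hm hn.
Qed.

Lemma br_nat_q B D (y : X B) (z : X D) (f : fhom y z) i (c : Ga (rep i)) m :
  brl y c (qres (rep i) f m) = qres Lq f (brl z c m).
Proof. by rewrite !mkLE lres_br. Qed.
Definition brq i (c : Ga (rep i)) : qhom (rep i) Lq := @QHom R X (rep i) Lq (fun B y => brl y c) (fun B D y z f m => br_nat_q f c m).
Lemma brqE B (y : X B) i (c : Ga (rep i)) e : brq c B y e = br c e. Proof. by []. Qed.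
Lemma brqD i (c c' : Ga (rep i)) : brq (c + c') = brq c + brq c'.
Proof. by apply: qhom_ext => B y e; rewrite brqE brDl. Qed.
Lemma brqN i j (u : qhom (rep i) (rep j)) c : brq (lmap Ga u c) = qcomp (brq c) u.
Proof. by apply: qhom_ext => B y e; rewrite brqE br_nat. Qed.

Definition Lact (a : A) : qhom Lq Lq := @lout Lq (fun i c => brq (a *: c))
  (fun i c c' => etrans (congr1 (@brq i) (scalerDr a c c')) (brqD (a *: c) (a *: c')))
  (fun i j u c => etrans (congr1 (@brq i) (esym (linearZ_LR (lmap Ga u) a c))) (brqN u (a *: c))).
Lemma LactE a B (y : X B) i (c : Ga (rep i)) e : Lact a B y (br c e) = br (a *: c) e.
Proof. exact: loutE. Qed.
Definition Lob : qcohA A X.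
Proof.
apply: (@QCohA R A X Lq Lact) => [a b|a b||r]; apply: lhom_eq => B y i c e.
- change (Lact (a + b) B y (br c e) = Lact a B y (br c e) + Lact b B y (br c e)).
  by rewrite !LactE scalerDl brDl.
- change (Lact (a * b) B y (br c e) = Lact a B y (Lact b B y (br c e))).
  by rewrite !LactE scalerA.
- change (Lact 1 B y (br c e) = br c e); by rewrite LactE scale1r.
- change (Lact (calg_str A r) B y (br c e) = calg_str B r *: br c e).
  rewrite LactE -brZ; have := br_nat (r *: qid (rep i)) c e; rewrite lmapZ lmap_id.
  exact.
Defined.
End Sheaf.
End LeftAdjoint.

(** * The left adjoint of Omega *)

Section Adjunction.
Variables (R : cring) (A : calg R) (X : fibcat R).
Notation fp := (sub_qcoh (is_fp X)).
Notation lfun := (lfun A (is_fp X)).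
Notation br := (@br R A X _ _ _ _).

Section Bracket.
Variable Ga : lfun.

Lemma lmap0 (E E' : fp) (c : Ga E') : lmap Ga (0 : qhom E E') c = 0.
Proof. by apply: (@addIr _ (lmap Ga (0 : qhom E E') c)); rewrite -lmapD !add0r. Qed.
Lemma lmapN (E E' : fp) (u : qhom E E') (c : Ga E') : lmap Ga (- u) c = - lmap Ga u c.
Proof. by apply: (@addIr _ (lmap Ga u c)); rewrite -lmapD !addNr lmap0. Qed.
Lemma lmapB (E E' : fp) (u v : qhom E E') (c : Ga E') : lmap Ga (u - v) c = lmap Ga u c - lmap Ga v c.
Proof. by rewrite lmapD lmapN. Qed.

(** The symbol c ⊗ e for an arbitrary sheaf E, by transport to its representative. *)
Definition bkq (E : fp) (c : Ga E) : qhom E (Lq Ga) := qcomp (brq (lmap Ga (of_rep E) c)) (to_rep E).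
Definition bk (E : fp) (c : Ga E) B (y : X B) (e : E B y) : Lq Ga B y := bkq c B y e.
Lemma bkE (E : fp) (c : Ga E) B (y : X B) (e : E B y) : bk c e = br (lmap Ga (of_rep E) c) (to_rep E B y e).
Proof. by []. Qed.
Lemma bkDr (E : fp) (c : Ga E) B (y : X B) (e e' : E B y) : bk c (e + e') = bk c e + bk c e'.
Proof. exact: linearD. Qed.
Lemma bk0r (E : fp) (c : Ga E) B (y : X B) : bk c (0 : E B y) = 0.
Proof. exact: linear0. Qed.
Lemma bkDl (E : fp) (c c' : Ga E) B (y : X B) (e : E B y) : bk (c + c') e = bk c e + bk c' e.
Proof. by rewrite !bkE linearD brDl. Qed.
Lemma bk0l (E : fp) B (y : X B) (e : E B y) : bk (0 : Ga E) e = 0.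
Proof. by apply: (@addIr _ (bk 0 e)); rewrite -bkDl !add0r. Qed.
Lemma bkNl (E : fp) (c : Ga E) B (y : X B) (e : E B y) : bk (- c) e = - bk c e.
Proof. by apply: (@addIr _ (bk c e)); rewrite -bkDl !addNr bk0l. Qed.
Lemma bkBl (E : fp) (c c' : Ga E) B (y : X B) (e : E B y) : bk (c - c') e = bk c e - bk c' e.
Proof. by rewrite bkDl bkNl. Qed.
Lemma bk_rep i (c : Ga (rep i)) B (y : X B) (e : rep i B y) : bk c e = br c e.
Proof.
rewrite bkE br_nat; congr (br _ _).
exact: (congr1 (fun u : qhom (rep i) (rep i) => u B y e) (of_repK (rep i))).
Qed.

(** The relation of the coend extends from the representatives to all sheaves, because of_rep is
    a left inverse of to_rep. *)
Lemma bk_nat (E E' : fp) (u : qhom E E') (c : Ga E') B (y : X B) (e : E B y) :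
  bk (lmap Ga u c) e = bk c (u B y e).
Proof.
have ub : qcomp (qcomp (of_rep E') (qcomp (to_rep E') u)) (of_rep E) = qcomp u (of_rep E).
  by rewrite qcompA of_repK; apply: qhom_ext.
rewrite !bkE -lmap_comp -ub -qcompA lmap_comp br_nat; congr (br _ (to_rep E' B y (u B y _))).
exact: (congr1 (fun u : qhom E E => u B y e) (of_repK E)).
Qed.
Lemma bkqE (E : fp) (c : Ga E) B (y : X B) (e : E B y) : bkq c B y e = bk c e. Proof. by []. Qed.
Lemma bk_act (a : A) (E : fp) (c : Ga E) B (y : X B) (e : E B y) : Lact Ga a B y (bk c e) = bk (a *: c) e.
Proof. by rewrite !bkE LactE linearZ. Qed.

Lemma unit_linear (E : fp) : linear (fun c : Ga E => bkq c : homA E (Lob Ga)).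
Proof.
move=> a c c'; apply: qhom_ext => B y e.
change (bk (a *: c + c') e = Lact Ga a B y (bk c e) + bk c' e).
by rewrite bk_act bkDl.
Qed.
Definition eta : lfun_hom Ga (omega (is_fp X) (Lob Ga)).
Proof.
apply: (@LFunHom R A X (is_fp X) Ga (omega (is_fp X) (Lob Ga)) (fun E => mkL (@unit_linear E))).
by move=> E E' u c; apply: qhom_ext => B y e; exact: bk_nat.
Defined.
End Bracket.

Section Functoriality.
Variables (Ga Gb : lfun) (t : lfun_hom Ga Gb).
Definition Lhom_q : qhom (Lq Ga) (Lq Gb) := @lout R A X Ga (Lq Gb) (fun i c => brq (t (rep i) c))
  (fun i c c' => etrans (congr1 (@brq R A X Gb i) (linearD (t (rep i)) c c')) (brqD _ _))
  (fun i j u c => etrans (congr1 (@brq R A X Gb i) (lf_nat t u c)) (brqN u _)).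
Lemma Lhom_qE B (y : X B) i (c : Ga (rep i)) (e : rep i B y) : Lhom_q B y (br c e) = br (t (rep i) c) e.
Proof. exact: loutE. Qed.
Lemma Lhom_act a : qcomp Lhom_q (Lact Ga a) = qcomp (Lact Gb a) Lhom_q.
Proof.
apply: lhom_eq => B y i c e.
change (Lhom_q B y (Lact Ga a B y (br c e)) = Lact Gb a B y (Lhom_q B y (br c e))).
by rewrite LactE !Lhom_qE LactE linearZ.
Qed.
Definition Lhom : qAhom (Lob Ga) (Lob Gb) := @QAHom R A X (Lob Ga) (Lob Gb) Lhom_q Lhom_act.
Lemma Lhom_bk (E : fp) (c : Ga E) B (y : X B) (e : E B y) : Lhom_q B y (bk c e) = bk (t E c) e.
Proof. by rewrite !bkE Lhom_qE lf_nat. Qed.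
End Functoriality.

Lemma Lhom_id (Ga : lfun) : Lhom (lfun_id Ga) = qAid (Lob Ga).
Proof.
have e : Lhom_q (lfun_id Ga) = qid (Lq Ga) by apply: lhom_eq => B y i c e; rewrite Lhom_qE.
by apply: qAhom_ext => B y m; exact: (congr1 (fun u : qhom (Lq Ga) (Lq Ga) => u B y m) e).
Qed.
Lemma Lhom_comp (Ga Gb Gc : lfun) (s : lfun_hom Gb Gc) (t : lfun_hom Ga Gb) :
  Lhom (lfun_comp s t) = qAcomp (Lhom s) (Lhom t).
Proof.
have e : Lhom_q (lfun_comp s t) = qcomp (Lhom_q s) (Lhom_q t).
  apply: lhom_eq => B y i c e; rewrite Lhom_qE.
  change (br (s _ (t _ c)) e = Lhom_q s B y (Lhom_q t B y (br c e))).
  by rewrite !Lhom_qE.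
by apply: qAhom_ext => B y m; exact: (congr1 (fun u : qhom (Lq Ga) (Lq Gc) => u B y m) e).
Qed.
Definition Lfunctor : functor (L_R A (is_fp X)) (QCoh_A A X) :=
  @Functor (L_R A (is_fp X)) (QCoh_A A X) (@Lob R A X) (fun Ga Gb t => Lhom t) Lhom_id Lhom_comp.

Section Counit.
Variable F : qcohA A X.
Notation OF := (omega (is_fp X) F).
Definition counit_q : qhom (Lq OF) F := @lout R A X OF F (fun i c => c)
  (fun i c c' => erefl) (fun i j u c => erefl).
Lemma counit_br B (y : X B) i (c : OF (rep i)) (e : rep i B y) : counit_q B y (br c e) = (c : qhom _ _) B y e.
Proof. exact: loutE. Qed.
Lemma counit_bk (E : fp) (c : OF E) B (y : X B) (e : E B y) : counit_q B y (bk c e) = (c : qhom E F) B y e.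
Proof.
rewrite bkE counit_br.
exact: (congr1 ((c : qhom E F) B y) (congr1 (fun u : qhom E E => u B y e) (of_repK E))).
Qed.
Lemma counit_act a : qcomp counit_q (Lact OF a) = qcomp (qA_act F a) counit_q.
Proof.
apply: lhom_eq => B y i c e.
change (counit_q B y (Lact OF a B y (br c e)) = qA_act F a B y (counit_q B y (br c e))).
by rewrite LactE !counit_br.
Qed.
Definition counit : qAhom (Lob OF) F := @QAHom R A X (Lob OF) F counit_q counit_act.
End Counit.

Lemma eta_nat (Ga Gb : lfun) (t : lfun_hom Ga Gb) :
  lfun_comp (eta Gb) t = lfun_comp (omega_hom (is_fp X) (Lhom t)) (eta Ga).
Proof.
apply: lfun_hom_ext => E c; apply: qhom_ext => B y e.
change (bk (t E c) e = Lhom_q t B y (bk c e)).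
by rewrite Lhom_bk.
Qed.
Lemma counit_nat (F G : qcohA A X) (s : qAhom F G) :
  qAcomp (counit G) (Lhom (omega_hom (is_fp X) s)) = qAcomp s (counit F).
Proof.
have e : qcomp (counit_q G) (Lhom_q (omega_hom (is_fp X) s)) = qcomp s (counit_q F).
  apply: lhom_eq => B y i c e.
  change (counit_q G B y (Lhom_q (omega_hom (is_fp X) s) B y (br c e)) = s B y (counit_q F B y (br c e))).
  by rewrite Lhom_qE !counit_br.
by apply: qAhom_ext => B y m; exact: (congr1 (fun u : qhom _ _ => u B y m) e).
Qed.
Lemma triangle1 (Ga : lfun) : qAcomp (counit (Lob Ga)) (Lhom (eta Ga)) = qAid (Lob Ga).
Proof.
have e : qcomp (counit_q (Lob Ga)) (Lhom_q (eta Ga)) = qid (Lq Ga).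
  apply: lhom_eq => B y i c e.
  change (counit_q (Lob Ga) B y (Lhom_q (eta Ga) B y (br c e)) = br c e).
  by rewrite Lhom_qE counit_br -bk_rep.
by apply: qAhom_ext => B y m; exact: (congr1 (fun u : qhom _ _ => u B y m) e).
Qed.
Lemma triangle2 (F : qcohA A X) :
  lfun_comp (omega_hom (is_fp X) (counit F)) (eta (omega (is_fp X) F)) = lfun_id (omega (is_fp X) F).
Proof.
apply: lfun_hom_ext => E c; apply: qhom_ext => B y e.
change (counit_q F B y (bk c e) = (c : qhom E F) B y e).
exact: counit_bk.
Qed.

Definition coend_adjoint : left_adjoint (Omega A (is_fp X)).
Proof.
apply: (@LeftAdjoint (QCoh_A A X) (L_R A (is_fp X)) (Omega A (is_fp X)) Lfunctor
  (@NatTrans _ _ (functor_id (L_R A (is_fp X))) (functor_comp (Omega A (is_fp X)) Lfunctor) eta eta_nat)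
  (@NatTrans _ _ (functor_comp Lfunctor (Omega A (is_fp X))) (functor_id (QCoh_A A X)) counit counit_nat)).
- exact: triangle1.
- exact: triangle2.
Defined.
End Adjunction.

(** * Unit and counit are invertible *)

Section UnitCounit.
Variables (R : cring) (A : calg R) (X : fibcat R).
Variables (C : calg R) (x : X C) (Cx : fpqc_atlas x) (Xgen : generates (is_fp X)).
Notation fp := (sub_qcoh (is_fp X)).
Notation lfun := (lfun A (is_fp X)).
Let cov := atlas_cover Cx.

Lemma qcompE (F G H : qcoh X) (v : qhom G H) (u : qhom F G) B (y : X B) m : qcomp v u B y m = v B y (u B y m).
Proof. by []. Qed.

Section OneFunctor.
Variable Ga : lfun.

(** An additive functor commutes with finite direct sums. *)
Lemma pair_ex (E E' : fp) (c : Ga E) (c' : Ga E') :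
  exists d : Ga (sumS E E'), lmap Ga (in1 E E' : qhom E (sumS E E')) d = c /\ lmap Ga (in2 E E' : qhom E' (sumS E E')) d = c'.
Proof.
pose p1 : qhom (sumS E E') E := cot (qid E) 0; pose p2 : qhom (sumS E E') E' := cot 0 (qid E').
exists (lmap Ga p1 c + lmap Ga p2 c'); rewrite !linearD -!lmap_comp.
rewrite [qcomp p1 (in1 _ _)]cot1 [qcomp p2 (in1 _ _)]cot1 [qcomp p1 (in2 _ _)]cot2 [qcomp p2 (in2 _ _)]cot2.
by rewrite !lmap_id !lmap0 addr0 add0r.
Qed.

(** By pair_ex two symbols can be written with the same element of Ga at a direct sum. *)
Lemma bk_ex B (y : X B) (m : Lq Ga B y) : exists (E : fp) (c : Ga E) (e : E B y), m = bk c e.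
Proof.
elim/Lmod_ind: m => [|i c e|m n [E [c [e ->]]] [E' [c' [e' ->]]]].
- by exists (zeroS X), 0, 0; rewrite bk0r.
- by exists (rep i), c, e; rewrite bk_rep.
have [d [<- <-]] := pair_ex c c'.
exists (sumS E E'), d, (in1 E E' B y e + in2 E E' B y e').
by rewrite bkDr (bk_nat (in1 E E' : qhom E (sumS E E'))) (bk_nat (in2 E E' : qhom E' (sumS E E'))).
Qed.

Section Values.
Variables (B : calg R) (y : X B).

(** A witness, with one element c for all members of s, for the equality of the class of s and c
    ⊗ w. *)
Fixpoint val (E : fp) (c : Ga E) (s : seq (cgen Ga y)) (w : E B y) : Prop :=
  if s is g :: s' then exists (u : qhom (rep (projT1 g)) E) w',
    [/\ lmap Ga u c = (projT2 g).1, val c s' w' & w = u B y (projT2 g).2 + w']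
  else w = 0.

Lemma val_cat (E : fp) (c : Ga E) s t w v : val c s w -> val c t v -> val c (s ++ t) (w + v).
Proof.
elim: s w => [|g s ih] w /=; first by move=> ->; rewrite add0r.
move=> [u [w' [h1 h2 ->]]] hv; exists u, (w' + v); rewrite addrA; split=> //; exact: ih.
Qed.
Lemma val_map (E E' : fp) (c : Ga E) (c' : Ga E') (q : qhom E E') s w :
  lmap Ga q c' = c -> val c s w -> val c' s (q B y w).
Proof.
move=> e; elim: s w => [|g s ih] w /=; first by move=> ->; rewrite linear0.
move=> [u [w' [h1 h2 ->]]]; exists (qcomp q u), (q B y w'); rewrite linearD; split=> //; last exact: ih.
by rewrite lmap_comp e.
Qed.
Lemma val_ex s : exists (E : fp) (c : Ga E) w, val c s w.
Proof.
elim: s => [|g s [E [c [w h]]]]; first by exists (zeroS X), 0, 0.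
have [d [h1 h2]] := pair_ex (projT2 g).1 c.
exists (sumS (rep (projT1 g)) E), d, (in1 _ _ B y (projT2 g).2 + in2 (rep (projT1 g)) E B y w).
exists (in1 _ _), (in2 (rep (projT1 g)) E B y w); split=> //.
exact: (@val_map E (sumS (rep (projT1 g)) E) c d (in2 (rep (projT1 g)) E)).
Qed.

Hypothesis lex : left_exact Ga.

(** Left exactness at the cokernel of u - v. Together with pair_ex this makes the pairs (E, c) a
    filtered category, of which the coend is a filtered colimit: the following lemmas deduce
    that equality in the coend is witnessed at one such pair. *)
Lemma coeq_ex (E E' : fp) (c : Ga E') (u v : qhom E E') : lmap Ga u c = lmap Ga v c ->
  exists (E'' : fp) (c' : Ga E'') (q : qhom E' E''), lmap Ga q c' = c /\ forall D (z : X D) e, q D z (u D z e) = q D z (v D z e).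
Proof.
move=> e; pose q : qhom E' (ckS (u - v)) := ckp (u - v).
have [_ h] := lex (E'' := E) (E' := E') (E := ckS (u - v)) (v := u - v) (u := q) (@ck_exact _ _ _ _ (u - v)).
have [|c' ec] := (h c).1; first by rewrite lmapB e subrr.
exists (ckS (u - v)), c', q; split=> // D z a; apply/subr0_eq; rewrite -linearB.
by apply/ckp0; exists a.
Qed.

(** Two witnesses for the same c differ in the choice of morphisms u with the same value at c,
    which can be coequalized. *)
Lemma val_uniq (E : fp) (c : Ga E) s w w' : val c s w -> val c s w' ->
  exists (E' : fp) (c' : Ga E') (q : qhom E E'), lmap Ga q c' = c /\ q B y w = q B y w'.
Proof.
elim: s w w' => [|g s ih] w w' /=; first by move=> -> ->; exists E, c, (qid E); rewrite lmap_id.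
move=> [u [v [h1 h2 ->]]] [u' [v' [h1' h2' ->]]].
have [E1 [c1 [q1 [hq1 e1]]]] := ih _ _ h2 h2'.
have [|E2 [c2 [q2 [hq2 e2]]]] := @coeq_ex _ _ c1 (qcomp q1 u) (qcomp q1 u').
  by rewrite !lmap_comp hq1 h1 h1'.
exists E2, c2, (qcomp q2 q1); split; first by rewrite lmap_comp hq2.
by rewrite !linearD !qcompE e1; congr (_ + _); exact: e2.
Qed.

Definition veq s t := exists (E : fp) (c : Ga E) w, val c s w /\ val c t w.

(** Having a common value is transitive by val_uniq, and it is compatible with sums because any
    two elements of Ga come from one by pair_ex. *)
Lemma pcong_veq s t : pcong (@crel R A X Ga B y) s t -> veq s t.
Proof.
have both s1 s2 t1 t2 (E1 : fp) (c1 : Ga E1) w1 (E2 : fp) (c2 : Ga E2) w2 :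
    val c1 s1 w1 -> val c1 s2 w1 -> val c2 t1 w2 -> val c2 t2 w2 ->
    exists (E : fp) (c : Ga E) v1 v2, [/\ val c s1 v1, val c s2 v1, val c t1 v2 & val c t2 v2].
  move=> h1 h2 h3 h4; have [d [d1 d2]] := pair_ex c1 c2.
  exists (sumS E1 E2), d, (in1 E1 E2 B y w1), (in2 E1 E2 B y w2); split.
  - exact: (val_map (E' := sumS E1 E2) d1 h1).
  - exact: (val_map (E' := sumS E1 E2) d1 h2).
  - exact: (val_map (E' := sumS E1 E2) d2 h3).
  - exact: (val_map (E' := sumS E1 E2) d2 h4).
elim=> {s t} [s|s t _ [E [c [w [h1 h2]]]]|s t v _ [E1 [c1 [w1 [h1 h2]]]] _ [E2 [c2 [w2 [h3 h4]]]]
  |s s' t t' _ [E1 [c1 [w1 [h1 h2]]]] _ [E2 [c2 [w2 [h3 h4]]]]|s t|s t].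
- by have [E [c [w h]]] := val_ex s; exists E, c, w.
- by exists E, c, w.
- have [E [c [v1 [v2 [k1 k2 k3 k4]]]]] := both _ _ _ _ _ _ _ _ _ _ h1 h2 h3 h4.
  have [E' [c' [q [hq eq]]]] := val_uniq k2 k3.
  exists E', c', (q B y v1); split; first exact: val_map hq k1.
  by rewrite eq; apply: val_map hq k4.
- have [E [c [v1 [v2 [k1 k2 k3 k4]]]]] := both _ _ _ _ _ _ _ _ _ _ h1 h2 h3 h4.
  by exists E, c, (v1 + v2); split; apply: val_cat.
- have [E1 [c1 [w1 h1]]] := val_ex s; have [E2 [c2 [w2 h2]]] := val_ex t.
  have [E [c [v1 [v2 [k1 _ k3 _]]]]] := both _ _ _ _ _ _ _ _ _ _ h1 h1 h2 h2.
  by exists E, c, (v1 + v2); split; [|rewrite addrC]; apply: val_cat.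
case=> [i c|i c e e'|i c c' e|i j u c e].
- exists (rep i), c, 0; split=> //=; exists (qid _), 0; rewrite lmap_id; split=> //.
  by rewrite /= addr0.
- exists (rep i), c, (e + e'); split; first by exists (qid _), 0; rewrite lmap_id addr0; split.
  exists (qid _), e'; rewrite lmap_id; split=> //.
  by exists (qid _), 0; rewrite lmap_id addr0; split.
- have [d [d1 d2]] := pair_ex c c'; pose E := sumS (rep i) (rep i).
  pose j1 : qhom (rep i) E := in1 _ _; pose j2 : qhom (rep i) E := in2 _ _.
  exists E, d, (j1 B y e + j2 B y e); split.
    exists (j1 + j2), 0; split=> //=; last by rewrite addr0.
    by rewrite lmapD d1 d2.
  exists j1, (j2 B y e); split=> //; exists j2, 0; split=> //.
  by rewrite addr0.
- exists (rep j), c, (u B y e); split; first by exists u, 0; rewrite addr0; split.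
  by exists (qid _), 0; rewrite lmap_id addr0; split.
Qed.

(** In the filtered colimit, c ⊗ e vanishes only if e dies along a morphism of the index
    category. *)
Lemma bk_zero (E : fp) (c : Ga E) (e : E B y) : bk c e = 0 ->
  exists (E' : fp) (c' : Ga E') (u : qhom E E'), lmap Ga u c' = c /\ u B y e = 0.
Proof.
move=> h; have /pcong_veq : pcong (@crel R A X Ga B y) [:: cg (lmap Ga (of_rep E) c) (to_rep E B y e)] [::].
  by apply/mcl_eq.
move=> [E' [c' [w [[u [w' [h1 h2 h3]]] h4]]]]; move: h1 h2 h3 h4 => /= h1 -> -> h4.
exists E', c', (qcomp u (to_rep E)); rewrite lmap_comp h1 -lmap_comp of_repK lmap_id; split=> //.
by move: h4; rewrite addr0.
Qed.
End Values.

Hypothesis lex : left_exact Ga.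

Lemma bk_zero_seq (E : fp) (s : seq (E C x)) (c : Ga E) : (forall e, e \in s -> bk c e = 0) ->
  exists (E' : fp) (c' : Ga E') (u : qhom E E'), lmap Ga u c' = c /\ forall e, e \in s -> u C x e = 0.
Proof.
elim: s => [|e s ih] hs; first by exists E, c, (qid E); rewrite lmap_id.
have [|E1 [c1 [u1 [h1 k1]]]] := ih; first by move=> e' h; apply: hs; rewrite inE h orbT.
have [|E2 [c2 [u2 [h2 k2]]]] := @bk_zero _ _ lex _ c1 (u1 C x e).
  by rewrite -bk_nat h1; apply: hs; rewrite inE eqxx.
exists E2, c2, (qcomp u2 u1); split; first by rewrite lmap_comp h2.
move=> e'; rewrite inE qcompE => /orP[/eqP -> //|/k1 ->]; exact: linear0.
Qed.

(** Since E C x is finitely generated, bk_zero provides a single u which kills it and such that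
    c comes from the target of u. Then u is zero, and so is c. *)
Lemma eta_inj (E : fp) (c : Ga E) : (forall e : E C x, bk c e = 0) -> c = 0.
Proof.
move=> h; have [n [p ps]] := fin_pres_gen (sub_valP E C x).
have [|E' [c' [u [<- hu]]]] := @bk_zero_seq E [seq p (delta_mx 0 i) | i <- enum 'I_n] c; first by [].
suff -> : u = 0 by rewrite lmap0.
apply: qhom_ext => B y; apply: (zero_at cov) => m.
have [v <-] := ps m; rewrite rows_eq linear_sum big1 // => i _.
by rewrite linearZ /= hu ?scaler0 //; apply/mapP; exists i; rewrite ?mem_enum.
Qed.

(** The images under h of finitely many generators at the atlas are symbols with a common c0 at
    a sheaf E0. The sheaf E2 maps to E and E0 so that h becomes c0, and covers E; E3 covers the
    kernel of E2 -> E, which is finitely generated at the atlas. By injectivity of the unit the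
    pullback of c0 to E2 vanishes on E3, so it comes from Ga E by left exactness. *)
Lemma eta_surj (E : fp) (h : qhom E (Lq Ga)) : exists c : Ga E, bkq c = h.
Proof.
have [n [p ps]] := fin_pres_gen (sub_valP E C x).
pose gen i := p (delta_mx 0 i).
have common (s : seq (E C x)) : exists (E0 : fp) (c0 : Ga E0), forall e, e \in s -> exists d, h C x e = bk c0 d.
  elim: s => [|e s [E1 [c1 ih]]]; first by exists (zeroS X), 0.
  have [E2 [c2 [d2 h2]]] := bk_ex (h C x e).
  have [d [e1 e2]] := pair_ex c1 c2; exists (sumS E1 E2), d => a; rewrite inE => /orP[/eqP ->|/ih[d1 h1]].
    exists (in2 E1 E2 C x d2); rewrite h2 -e2; exact: bk_nat.
  by exists (in1 E1 E2 C x d1); rewrite h1 -e1; apply: bk_nat.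
have [E0 [c0 h0]] := common [seq gen i | i <- enum 'I_n].
have h0' i : exists d, h C x (gen i) = bk c0 d by apply: h0; apply/mapP; exists i; rewrite ?mem_enum.
pose d i := projT1 (boolp.cid (h0' i)).
have dP i : h C x (gen i) = bk c0 (d i) := projT2 (boolp.cid (h0' i)).
(* the kernel of H is the fibre product of h and c0, and contains the pairs (gen i, d i) *)
pose H : qhom (sumS E E0) (Lq Ga) := cot h (- bkq c0).
have [|E2 [g [hg gP]]] := @ker_hit_seq _ _ _ _ Cx Xgen (sumS E E0) (Lq Ga) H [seq (gen i, d i) | i <- enum 'I_n].
  by move=> z /mapP[i _ ->]; rewrite /H cotE /= dP -/(bk c0 (d i)) subrr.
pose w1 : qhom E2 E := qcomp (cot (qid E) 0) g; pose w2 : qhom E2 E0 := qcomp (cot 0 (qid E0)) g.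
have hw B (y : X B) m : h B y (w1 B y m) = bk c0 (w2 B y m).
  have := congr1 (fun k : qhom E2 (Lq Ga) => k B y m) hg; rewrite qcompE /H cotE => /= /subr0_eq.
  by rewrite /= addr0 add0r.
have w1s e : exists m, w1 C x m = e.
  have [v <-] := ps e; rewrite rows_eq.
  elim/big_ind: _ => [|a b [m <-] [m' <-]|i _]; first by exists 0; rewrite linear0.
    by exists (m + m'); rewrite linearD.
  have [|m em] := gP (gen i, d i); first by apply/mapP; exists i; rewrite ?mem_enum.
  by exists (v 0 i *: m); rewrite linearZ /= em /= addr0.
have [k [ke [ke0 keP]]] := fin_gen_ker (fin_pres_gen (sub_valP E2 C x)) (sub_valP E C x) w1s.
have [|E3 [v [hv vP]]] := @ker_hit_seq _ _ _ _ Cx Xgen E2 E w1 [seq ke i | i <- enum 'I_k].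
  by move=> z /mapP[i _ ->].
have vk m : w1 C x m = 0 -> exists l, v C x l = m.
  move=> /keP[r <-]; rewrite rowsE.
  elim/big_ind: _ => [|a b [l <-] [l' <-]|i _]; first by exists 0; rewrite linear0.
    by exists (l + l'); rewrite linearD.
  have [|l el] := vP (ke i); first by apply/mapP; exists i; rewrite ?mem_enum.
  by exists (r 0 i *: l); rewrite linearZ /= el.
have rex : right_exact v w1.
  move=> B y; split; first exact: (surj_at cov w1s).
  move=> m; split=> [|[l <-]]; first exact: (exact_at cov w1s vk).
  exact: (congr1 (fun k : qhom E3 E => k B y l) hv).
have [_ hc] := lex rex.
have [|c ec] := (hc (lmap Ga w2 c0)).1.
  apply: eta_inj => e; rewrite !bk_nat -hw.
  have := congr1 (fun k : qhom E3 E => k C x e) hv; rewrite qcompE => ->; exact: linear0.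
exists c; apply: qhom_ext => B y e.
have [m <-] := surj_at cov w1s e.
by rewrite hw -bk_nat -ec bk_nat.
Qed.

Lemma eta_bij (E : fp) : bijective (eta Ga E).
Proof.
apply: inj_surj_bij => [c c' e|h]; last exact: eta_surj.
apply/subr0_eq/eta_inj => m; rewrite bkBl.
by have := congr1 (fun k : qhom E (Lq Ga) => k C x m) e; rewrite -!bkqE /= => ->; rewrite subrr.
Qed.
End OneFunctor.

(** Surjectivity is generation. Every element is one symbol g ⊗ a, and if g(a) = 0 then a is hit
    by a sheaf on which g vanishes. *)
Lemma counit_bij (F : qcohA A X) B (y : X B) : bijective (counit_q F B y).
Proof.
apply: (inj_bij_at cov); apply: inj_surj_bij => [m n e|z].
  apply/subr0_eq; have : counit_q F C x (m - n) = 0 by rewrite linearB e subrr.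
  have [E [c [a ->]]] := bk_ex (m - n); rewrite counit_bk => h.
  have [E' [g [hg [a' <-]]]] := ker_hit Cx Xgen h.
  by rewrite -bk_nat [lmap _ g c]hg bk0l.
have [E [g [e <-]]] := gen_hit Xgen z.
by exists (bk (g : omega (is_fp X) F E) e); rewrite counit_bk.
Qed.
End UnitCounit.

(** * Hom functors are exact on test sequences *)

Lemma fsumE (T : choiceType) (V : zmodType) (D : set T) (f : T -> V) : finite_set D ->
  (forall j, ~ D j -> f j = 0) -> \sum_(j \in [set: T]) f j = \sum_(j <- finmap.enum_fset (fset_set D)) f j.
Proof.
move=> fD h; apply: fsbigTE => j; rewrite in_fset_set // => /negP nD; apply: h => Dj; apply: nD.
by rewrite inE.
Qed.

Section FiniteFamilies.
Variables (B : comPzRingType) (J : choiceType) (M : J -> lmodType B).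

Definition supp (z : forall j, M j) : set J := [set j | z j != 0].
Lemma suppP (z : forall j, M j) j : ~ supp z j -> z j = 0.
Proof. by move=> h; apply/eqP/negP => /negP; apply: h. Qed.

Lemma fs_lin (z z' : forall j, M j) b : finitely_supported z -> finitely_supported z' ->
  finitely_supported (fun j => b *: z j + z' j).
Proof.
move=> h h'; apply: (@sub_finite_set _ _ (supp z `|` supp z')); last by rewrite finite_setU.
move=> j /= nz; apply: contrapT => /not_orP[/suppP e /suppP e'].
by move: nz; rewrite e e' scaler0 addr0 eqxx.
Qed.

Lemma fsum_lin (V : lmodType B) (g : forall j, {linear M j -> V}) (z z' : forall j, M j) b :
  finitely_supported z -> finitely_supported z' ->
  \sum_(j \in [set: J]) g j (b *: z j + z' j) =
  b *: (\sum_(j \in [set: J]) g j (z j)) + \sum_(j \in [set: J]) g j (z' j).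
Proof.
move=> h h'; pose D := supp z `|` supp z'; have fD : finite_set D by rewrite finite_setU.
have s1 j : ~ D j -> z j = 0 by move=> /not_orP[/suppP].
have s2 j : ~ D j -> z' j = 0 by move=> /not_orP[_ /suppP].
rewrite !(fsumE fD); try by move=> j Dj; rewrite ?(s1 _ Dj) ?(s2 _ Dj) ?scaler0 ?addr0 linear0.
by rewrite scaler_sumr -big_split /=; apply: eq_bigr => j _; rewrite linearP.
Qed.

Definition fdelta (j : J) (a : M j) : forall i, M i :=
  fun i => match eqVneq j i with EqNotNeq e => eq_rect j M a i e | NeqNotEq _ => 0 end.
Lemma fdeltaE j a : @fdelta j a j = a.
Proof. by rewrite /fdelta; case: eqVneq => [e|/eqP//]; rewrite (Prop_irrelevance e erefl). Qed.
Lemma fdelta0 j a i : ~ [set j] i -> @fdelta j a i = 0.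
Proof. by rewrite /fdelta; case: eqVneq => // e h; case: h; rewrite /= e. Qed.
Lemma fdelta_fs j a : finitely_supported (@fdelta j a).
Proof.
apply: (@sub_finite_set _ _ [set j]); last exact: finite_set1.
by move=> i /= nz; apply: contrapT => h; move: nz; rewrite fdelta0 // eqxx.
Qed.
Lemma fdelta_sum (V : zmodType) (g : forall i, M i -> V) j a : (forall i, g i 0 = 0) ->
  \sum_(i \in [set: J]) g i (@fdelta j a i) = g j a.
Proof.
move=> g0; rewrite (fsumE (finite_set1 j)) => [|i h]; last by rewrite fdelta0.
by rewrite fset_set1 finmap.big_seq_fset1 fdeltaE.
Qed.
End FiniteFamilies.

Section OmegaLex.
Variables (R : cring) (A : calg R) (X : fibcat R).
Notation fp := (sub_qcoh (is_fp X)).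
Variables (F : qcohA A X) (S : test_sequence (is_fp X)).
Notation OF := (omega (is_fp X) F).

Lemma qsumE (G H : qcoh X) (T : choiceType) (D : set T) (f : T -> qhom G H) B (y : X B) (m : G B y) :
  finite_set D -> (forall j, ~ D j -> f j = 0) ->
  (\sum_(j \in [set: T]) f j) B y m = \sum_(j <- finmap.enum_fset (fset_set D)) f j B y m.
Proof.
move=> fD h; rewrite (fsumE fD h).
by apply: (big_morph (fun u : qhom G H => u B y m)).
Qed.

Lemma omega_sep (u : qhom (ts_E S) F) : (forall j : ts_J S, qcomp u (ts_u j) = 0) -> u = 0.
Proof.
move=> h; apply: qhom_ext => B y e; have [z [_ ->]] := ts_surj e.
rewrite linear_sum big1 // => j _.
exact: (congr1 (fun v : qhom (ts_EJ j) F => v B y (z j)) (h j)).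
Qed.

Section Glue.
Variable x : forall j : ts_J S, qhom (ts_EJ j) F.
Hypothesis hx : forall k : ts_K S, \sum_(j \in [set: ts_J S]) qcomp (x j) (ts_v k j) = 0.

Section At.
Variables (B : calg R) (y : X B).
Notation tot z := (\sum_(j \in [set: ts_J S]) x j B y (z j)).

(** z is the image of a finitely supported w, and only finitely many components of the morphisms
    from the members of its support are nonzero; so the two sums can be exchanged. *)
Lemma glue_wd (z : forall j : ts_J S, ts_EJ j B y) : finitely_supported z ->
  \sum_(j \in [set: ts_J S]) ts_u j B y (z j) = 0 -> tot z = 0.
Proof.
move=> fz /(ts_exact fz)[w [fw ez]].
pose DK := supp w; pose DJ := \bigcup_(k in DK) [set j | ts_v k j != 0].
have fJ : finite_set DJ by apply: bigcup_finite => // k _; exact: ts_fin.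
have vJ (k : ts_K S) (j : ts_J S) : DK k -> ~ DJ j -> ts_v k j = 0.
  move=> Dk Dj; apply/eqP/negP => /negP nv; apply: Dj; by exists k.
have zE (j : ts_J S) : z j = \sum_(k <- finmap.enum_fset (fset_set DK)) ts_v k j B y (w k).
  rewrite ez (fsumE (D := DK)) // => k Dk; have -> : w k = 0 by exact: suppP Dk.
  by rewrite linear0.
rewrite (fsumE fJ) => [|j Dj]; last first.
  rewrite zE linear_sum big_seq big1 // => k; rewrite in_fset_set // inE => Dk.
  by rewrite (vJ k j Dk Dj) /= linear0.
under eq_bigr => j _ do rewrite zE linear_sum.
rewrite exchange_big /= big_seq big1 // => k; rewrite in_fset_set // inE => Dk.
have <- := qsumE (w k) fJ (f := fun j => qcomp (x j) (ts_v k j)); first by rewrite hx.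
by move=> j Dj; rewrite (vJ k j Dk Dj); apply: qhom_ext => D t m /=; rewrite linear0.
Qed.

Lemma glue_eq (z z' : forall j : ts_J S, ts_EJ j B y) : finitely_supported z -> finitely_supported z' ->
  \sum_(j \in [set: ts_J S]) ts_u j B y (z j) = \sum_(j \in [set: ts_J S]) ts_u j B y (z' j) ->
  tot z = tot z'.
Proof.
move=> h h' e; apply/subr0_eq; rewrite addrC -scaleN1r.
have f1 := fsum_lin (fun j : ts_J S => x j B y) (-1) h' h; rewrite -f1.
apply: glue_wd; first exact: fs_lin.
by rewrite (fsum_lin (fun j : ts_J S => ts_u j B y)) // scaleN1r e addNr.
Qed.

Definition glue_fun (e : ts_E S B y) : F B y := tot (projT1 (boolp.cid (ts_surj e))).
Lemma glue_funE (z : forall j : ts_J S, ts_EJ j B y) : finitely_supported z ->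
  glue_fun (\sum_(j \in [set: ts_J S]) ts_u j B y (z j)) = tot z.
Proof. by move=> fz; rewrite /glue_fun; case: boolp.cid => z' [fz' e] /=; apply: glue_eq. Qed.
Lemma glue_linear : linear glue_fun.
Proof.
move=> b e e'; have [z [fz ->]] := ts_surj e; have [z' [fz' ->]] := ts_surj e'.
rewrite -(fsum_lin (fun j : ts_J S => ts_u j B y)) // !glue_funE //; last exact: fs_lin.
exact: (fsum_lin (fun j : ts_J S => x j B y)).
Qed.
End At.

Lemma glue_nat B D (y : X B) (t : X D) (f : fhom y t) e :
  mkL (@glue_linear B y) (qres (ts_E S) f e) = qres F f (mkL (@glue_linear D t) e).
Proof.
rewrite !mkLE; have [z [fz ->]] := ts_surj e.
have z0 j : ~ supp z j -> z j = 0 by exact: suppP.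
have fz' : finitely_supported (fun j : ts_J S => qres (ts_EJ j) f (z j)).
  apply: (sub_finite_set _ fz) => j /= nz; apply: contrapT => /z0 e0.
  by move: nz; rewrite e0 qres0 eqxx.
have push (H : qcoh X) (v : forall j : ts_J S, qhom (ts_EJ j) H) :
    qres H f (\sum_(j \in [set: ts_J S]) v j D t (z j)) =
    \sum_(j \in [set: ts_J S]) v j B y (qres (ts_EJ j) f (z j)).
  have e1 : \sum_(j \in [set: ts_J S]) v j D t (z j) = \sum_(j <- finmap.enum_fset (fset_set (supp z))) v j D t (z j).
    by apply: fsumE => // j /z0 ->; rewrite linear0.
  have e2 : \sum_(j \in [set: ts_J S]) v j B y (qres (ts_EJ j) f (z j)) =
      \sum_(j <- finmap.enum_fset (fset_set (supp z))) v j B y (qres (ts_EJ j) f (z j)).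
    by apply: fsumE => // j /z0 ->; rewrite qres0 linear0.
  rewrite e1 e2 (big_morph (qres H f) (@qresD _ _ H _ _ _ _ f) (@qres0 _ _ H _ _ _ _ f)).
  by apply: eq_bigr => j _; rewrite qfun_nat.
by rewrite push !glue_funE // push.
Qed.
Definition glue : qhom (ts_E S) F := QHom glue_nat.
Lemma glueE (j : ts_J S) : qcomp glue (ts_u j) = x j.
Proof.
apply: qhom_ext => B y a.
have e := fdelta_sum (M := fun j : ts_J S => ts_EJ j B y) (g := fun i => ts_u i B y) a (fun i => linear0 _).
change (glue_fun (ts_u j B y a) = x j B y a).
rewrite -e glue_funE; last exact: fdelta_fs.
exact: (fdelta_sum (M := fun j : ts_J S => ts_EJ j B y) (g := fun i => x i B y) a (fun i => linear0 _)).
Qed.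
End Glue.

(** Exactness at the family concentrated in k. *)
Lemma test_comp0 (k : ts_K S) B (y : X B) (m : ts_EK k B y) :
  \sum_(j \in [set: ts_J S]) ts_u j B y (ts_v k j B y m) = 0.
Proof.
apply/ts_exact.
  apply: (sub_finite_set _ (ts_fin (t := S) k)) => j /= nz; apply/eqP => e0.
  by move: nz; rewrite e0 eqxx.
exists (fdelta (M := fun k : ts_K S => ts_EK k B y) m); split; first exact: fdelta_fs.
move=> j; symmetry.
exact: (fdelta_sum (M := fun k : ts_K S => ts_EK k B y) (g := fun i => ts_v i j B y) m (fun i => linear0 _)).
Qed.

Lemma omega_exact : exact_on_test OF S.
Proof.
split; first exact: omega_sep.
move=> x; split=> [hx|[u hu] k]; first by exists (glue hx) => j; exact: glueE.
apply: qhom_ext => B y m.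
rewrite (qsumE m (ts_fin (t := S) k)) => [|j /= /negP]; last first.
  rewrite negbK => /eqP ->; apply: qhom_ext => D t a /=; exact: linear0.
have := congr1 (u B y) (test_comp0 m); rewrite (fsumE (ts_fin (t := S) k)) => [|j /= /negP]; last first.
  by rewrite negbK => /eqP ->; rewrite linear0.
rewrite linear_sum linear0 => e0; rewrite [RHS](_ : _ = 0) // -[RHS]e0; apply: eq_bigr => j _.
by rewrite -(hu j).
Qed.
End OmegaLex.

(** * The equivalence of categories *)

Lemma sum_unit (V : zmodType) (f : unit -> V) : \sum_(j \in [set: unit]) f j = f tt.
Proof.
rewrite (fsumE (finite_set1 tt)) => [|[] h]; last by case: h.
by rewrite fset_set1 finmap.big_seq_fset1.
Qed.

Section LexLeftExact.
Variables (R : cring) (A : calg R) (X : fibcat R).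
Notation fp := (sub_qcoh (is_fp X)).
Notation lfun := (lfun A (is_fp X)).

Section TestOfRightExact.
Variables (E'' E' E : fp) (v : qhom E'' E') (u : qhom E' E) (h : right_exact v u).
Lemma unit_fin : forall k : unit, finite_set [set j : unit | v != 0].
Proof. by move=> k; apply: finite_finset. Qed.
Lemma unit_surj (B : calg R) (y : X B) (e : E B y) : exists z : unit -> E' B y,
  @finitely_supported B (unit : choiceType) (fun _ => E' B y) z /\ e = \sum_(j \in [set: unit]) u B y (z j).
Proof.
have [z <-] := (h y).1 e; exists (fun _ => z); split; first exact: finite_finset.
by rewrite sum_unit.
Qed.
Lemma unit_exact (B : calg R) (y : X B) (z : unit -> E' B y) :
  @finitely_supported B (unit : choiceType) (fun _ => E' B y) z ->
  (\sum_(j \in [set: unit]) u B y (z j) = 0 <->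
   exists w : unit -> E'' B y, @finitely_supported B (unit : choiceType) (fun _ => E'' B y) w /\
     forall j, z j = \sum_(k \in [set: unit]) v B y (w k)).
Proof.
move=> _; rewrite sum_unit; split=> [/((h y).2 _).1[w e]|[w [_ e]]].
  exists (fun _ => w); split; first exact: finite_finset.
  by move=> [] ; rewrite sum_unit.
by apply/((h y).2 _); exists (w tt); rewrite e sum_unit.
Qed.

(** A right exact sequence is a test sequence with index sets of one element. *)
Definition right_exact_test : test_sequence (is_fp X) :=
  @TestSequence R X (is_fp X) (unit : choiceType) (unit : choiceType) E (fun _ => E') (fun _ => E'')
    (fun _ => u) (fun _ _ => v) unit_fin unit_surj unit_exact.
End TestOfRightExact.

Lemma lex_left_exact (G : lfun) : is_lex (is_fp X) G -> left_exact G.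
Proof.
move=> hG E'' E' E v u h; have [h1 h2] := hG (right_exact_test h); split=> [c e|c].
  by apply: h1.
have := h2 (fun _ => c); rewrite /= => {}h2; split=> [e|[d e]].
  have [|d hd] := h2.1; first by move=> k; rewrite sum_unit.
  by exists d; exact: (hd tt).
have := h2.2 (ex_intro _ d (fun _ => e)) tt; by rewrite sum_unit.
Qed.

Section Transport.
Variables (G H : lfun) (t : lfun_hom G H) (tb : forall E, bijective (t E)).
Lemma lex_transport : is_lex (is_fp X) H -> is_lex (is_fp X) G.
Proof.
move=> hH S; have [h1 h2] := hH S; split=> [c hc|c].
  apply: (bij_inj (tb _)); rewrite linear0; apply: h1 => j.
  by rewrite -lf_nat hc linear0.
have sum0 (k : ts_K S) : (\sum_(j \in [set: ts_J S]) lmap G (ts_v k j) (c j) = 0) <->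
    (\sum_(j \in [set: ts_J S]) lmap H (ts_v k j) (t _ (c j)) = 0).
  have fD := ts_fin (t := S) k.
  have e1 : \sum_(j \in [set: ts_J S]) lmap G (ts_v k j) (c j) =
     \sum_(j <- finmap.enum_fset (fset_set [set j | ts_v k j != 0])) lmap G (ts_v k j) (c j).
    by apply: fsumE => // j /= /negP; rewrite negbK => /eqP ->; rewrite lmap0.
  have e2 : \sum_(j \in [set: ts_J S]) lmap H (ts_v k j) (t _ (c j)) =
     \sum_(j <- finmap.enum_fset (fset_set [set j | ts_v k j != 0])) lmap H (ts_v k j) (t _ (c j)).
    by apply: fsumE => // j /= /negP; rewrite negbK => /eqP ->; rewrite lmap0.
  have e3 : t _ (\sum_(j \in [set: ts_J S]) lmap G (ts_v k j) (c j)) =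
      \sum_(j \in [set: ts_J S]) lmap H (ts_v k j) (t _ (c j)).
    by rewrite e1 e2 linear_sum; apply: eq_bigr => j _; rewrite lf_nat.
  rewrite -e3; split=> [->|e]; first by rewrite linear0.
  by apply: (bij_inj (tb _)); rewrite e linear0.
split=> [hc|[d hd] k].
  have [|d hd] := (h2 (fun j => t _ (c j))).1; first by move=> k; apply/sum0.
  have [d' ed'] := bij_surj (tb _) d; exists d' => j.
  by apply: (bij_inj (tb _)); rewrite lf_nat ed' hd.
apply/sum0; apply: (h2 (fun j => t _ (c j))).2; exists (t _ d) => j.
by rewrite -lf_nat hd.
Qed.
End Transport.

Lemma lfun_iso (G H : lfun) (t : lfun_hom G H) : (forall E, bijective (t E)) ->
  @is_iso (L_R A (is_fp X)) G H t.
Proof.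
move=> tb; pose s E d := projT1 (boolp.cid (bij_surj (tb E) d)).
have sK E d : t E (s E d) = d := projT2 (boolp.cid (bij_surj (tb E) d)).
have sl E : linear (s E).
  by move=> a c d; apply: (bij_inj (tb E)); rewrite linearP !sK.
have sn (E E' : fp) (u : qhom E E') (d : H E') : mkL (sl E) (lmap H u d) = lmap G u (mkL (sl E') d).
  by apply: (bij_inj (tb E)); rewrite lf_nat !mkLE !sK.
exists (@LFunHom R A X (is_fp X) H G (fun E => mkL (sl E)) sn); split; apply: lfun_hom_ext => E d.
  by apply: (bij_inj (tb E)); exact: sK.
exact: sK.
Qed.

Lemma qA_iso (F G : qcohA A X) (u : qAhom F G) : (forall B (y : X B), bijective (u B y)) ->
  @is_iso (QCoh_A A X) F G u.
Proof.
move=> ub; pose s B (y : X B) d := projT1 (boolp.cid (bij_surj (ub B y) d)).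
have sK B (y : X B) d : u B y (s B y d) = d := projT2 (boolp.cid (bij_surj (ub B y) d)).
have sl B (y : X B) : linear (s B y).
  by move=> a c d; apply: (bij_inj (ub B y)); rewrite linearP !sK.
have sn B D (y : X B) (z : X D) (f : fhom y z) d : mkL (sl B y) (qres G f d) = qres F f (mkL (sl D z) d).
  by apply: (bij_inj (ub B y)); rewrite qfun_nat !mkLE !sK.
pose v : qhom G F := QHom sn.
have va a : qcomp v (qA_act G a) = qcomp (qA_act F a) v.
  apply: qhom_ext => B y m; apply: (bij_inj (ub B y)).
  have := congr1 (fun k : qhom F G => k B y (v B y m)) (qAh_act u a).
  rewrite !qcompE => ->; rewrite [LHS]sK; congr (qA_act G a B y _); by rewrite [RHS]sK.
exists (QAHom va); split; apply: qAhom_ext => B y m.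
  by apply: (bij_inj (ub B y)); exact: sK.
exact: sK.
Qed.
End LexLeftExact.

(** Suppose that the values of G satisfy P, that the counit of some adjunction is invertible,
    and that its unit is invertible at the objects which satisfy P. Then G is an equivalence
    onto these objects, with any left adjoint as quasi-inverse, as left adjoints are unique. *)
Section AdjointEquivalence.
Variables (C D : category) (G : functor C D) (L0 : left_adjoint G).
Variables (P : D -> Prop) (hG : forall c, P (G c)).
Hypotheses (counit_iso : forall c, is_iso (la_counit L0 c))
  (unit_iso : forall d, P d -> is_iso (la_unit L0 d)).
Variable L : left_adjoint G.

Lemma adj_eq (M : left_adjoint G) d c (f g : chom (la_fun M d) c) :
  ccomp (fun_hom G f) (la_unit M d) = ccomp (fun_hom G g) (la_unit M d) -> f = g.
Proof.
have k (h : chom (la_fun M d) c) :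
    ccomp (la_counit M c) (fun_hom (la_fun M) (ccomp (fun_hom G h) (la_unit M d))) = h.
  rewrite fun_comp ccompA.
  have := nt_nat (la_counit M) h; rewrite /= => ->.
  by rewrite -ccompA (la_triangle1 M) ccompf1.
by move=> e; rewrite -(k f) -(k g) e.
Qed.

(** The canonical comparison of two left adjoints. *)
Definition adj_cmp (M N : left_adjoint G) d : chom (la_fun M d) (la_fun N d) :=
  ccomp (la_counit M (la_fun N d)) (fun_hom (la_fun M) (la_unit N d)).
Lemma adj_cmp_unit (M N : left_adjoint G) d :
  ccomp (fun_hom G (adj_cmp M N d)) (la_unit M d) = la_unit N d.
Proof.
rewrite /adj_cmp fun_comp -ccompA.
have := nt_nat (la_unit M) (la_unit N d); rewrite /= => <-.
by rewrite ccompA (la_triangle2 M) ccomp1f.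
Qed.
Lemma adj_cmpK (M N : left_adjoint G) d : ccomp (adj_cmp N M d) (adj_cmp M N d) = cid (la_fun M d).
Proof.
apply: adj_eq; rewrite fun_comp -ccompA !adj_cmp_unit.
by rewrite fun_id ccomp1f.
Qed.

Lemma any_counit_iso c : is_iso (la_counit L c).
Proof.
have [g [g1 g2]] := counit_iso c.
have e : la_counit L c = ccomp (la_counit L0 c) (adj_cmp L L0 (G c)).
  apply: adj_eq; rewrite fun_comp -ccompA adj_cmp_unit.
  by rewrite (la_triangle2 L) (la_triangle2 L0).
exists (ccomp (adj_cmp L0 L (G c)) g); rewrite e; split.
  by rewrite -ccompA (ccompA g) g1 ccomp1f adj_cmpK.
by rewrite -ccompA (ccompA (adj_cmp L L0 _)) adj_cmpK ccomp1f g2.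
Qed.
Lemma any_unit_iso d : P d -> is_iso (la_unit L d).
Proof.
move=> /unit_iso[g [g1 g2]].
exists (ccomp g (fun_hom G (adj_cmp L L0 d))); split.
  by rewrite -ccompA adj_cmp_unit g1.
rewrite -(adj_cmp_unit L0 L) -ccompA (ccompA (la_unit L0 d)) g2 ccomp1f.
by rewrite -[LHS](fun_comp G) adj_cmpK fun_id.
Qed.

Lemma adjoint_quasi_inverses :
  quasi_inverses (functor_corestrict hG) (functor_restrict P (la_fun L)).
Proof.
split.
  unshelve eexists.
    exact: (@NatTrans _ _ (functor_comp (functor_restrict P (la_fun L)) (functor_corestrict hG)) (functor_id C)
      (fun c => la_counit L c) (fun a b f => nt_nat (la_counit L) f)).
  exact: any_counit_iso.
have hu (d : full_subcategory P) := any_unit_iso (full_valP d).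
pose g d := projT1 (boolp.cid (hu d)).
have gP (d : full_subcategory P) : ccomp (g d) (la_unit L (full_val d)) = cid (full_val d) /\
   ccomp (la_unit L (full_val d)) (g d) = cid _ := projT2 (boolp.cid (hu d)).
have gn (a b : full_subcategory P) (f : chom a b) :
    ccomp (g b) (fun_hom G (fun_hom (la_fun L) f)) = ccomp (f : @chom D _ _) (g a).
  rewrite -[LHS]ccompf1 -(gP a).2 -ccompA (ccompA (fun_hom G _)).
  have := nt_nat (la_unit L) (f : @chom D (full_val a) (full_val b)); rewrite /= => <-.
  by rewrite !ccompA (gP b).1 ccomp1f.
unshelve eexists.
  exact: (@NatTrans _ _ (functor_comp (functor_corestrict hG) (functor_restrict P (la_fun L)))
    (functor_id (full_subcategory P)) g gn).
by move=> d; exists (la_unit L (full_val d)); case: (gP d).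
Qed.
End AdjointEquivalence.

Theorem theorem6p3 (R : cring) (A : calg R) (X : fibcat R)
    (Xqc : quasi_compact X) (Xgen : generates (is_fp X)) :
  (forall G : lfun A (is_fp X), is_lex (is_fp X) G <-> left_exact G) /\
  exists hO : forall F : qcohA A X, is_lex (is_fp X) (Omega A (is_fp X) F),
    inhabited (left_adjoint (Omega A (is_fp X))) /\
    forall L : left_adjoint (Omega A (is_fp X)),
      quasi_inverses (Omega_Lex hO) (Lex_restrict L).
Proof.
have [C [x Cx]] := Xqc.
have hO (F : qcohA A X) : is_lex (is_fp X) (Omega A (is_fp X) F) by move=> S; apply: omega_exact.
split.
  move=> G; split; first exact: lex_left_exact.
  move=> hG; apply: (lex_transport (t := eta G)); last exact: hO.
  exact: (eta_bij Cx Xgen hG).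
exists hO; split; first by constructor; exact: coend_adjoint.
move=> L; apply: (adjoint_quasi_inverses (L0 := coend_adjoint A X)) => [F|G hG].
  apply: qA_iso => B y; exact: (counit_bij Cx Xgen).
apply: lfun_iso; apply: (eta_bij Cx Xgen); exact: lex_left_exact.
Qed.
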